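(* Let $M^n$ be a closed $\kappa$-orientable topological manifold of dimension $n$ and $f\colon M\to\mathbb S^1$ a tame map. Then for every $r$ and every $\langle a,b\rangle\in\mathbb T\setminus\Delta_{\mathbb T}$, $$C^m_r(f)(\langle a,b\rangle)=C^m_{n-1-r}(f)(\langle b,a\rangle).$$ Equivalently, $C^m_r(f)(z)=C^m_{n-1-r}(f)(\tau(z))$ for $z\in\mathbb C\setminus(0\sqcup\mathbb S^1)$, where $\tau(z):=1/\bar z=z/|z|^2$.
   Context: Fix a field $\kappa$; vector spaces and singular homology are over $\kappa$. If $\kappa$ has characteristic $2$ every manifold is $\kappa$-orientable; otherwise $\kappa$-orientable means orientable. $\mathbb S^1=\mathbb R/2\pi\mathbb Z$ (as a target of maps). A tame map is a proper continuous map $f\colon X\to\mathbb R$ or $f\colon X\to\mathbb S^1$ on a locally compact ANR $X$ such that (i) each fiber of $f$ is a neighborhood deformation retract, and (ii) for some discrete set $\Sigma$ in the target, the restriction of $f$ to $X\setminus f^{-1}(\Sigma)$ is a fibration. Elements of $\Sigma$ are called critical values (critical angles). $G_{2m}$-representations. A $G_{2m}$-representation ($m\ge1$) consists of finite dimensional vector spaces $V_1,\dots,V_{2m}$ and linear maps $\alpha_i\colon V_{2i-1}\to V_{2i}$, $\beta_i\colon V_{2i+1}\to V_{2i}$, $1\le i\le m$, with $V_{2m+1}:=V_1$. Each is a finite direct sum, unique up to isomorphism and order, of indecomposables, which are the following. (I) Bar codes $\rho^G(I)$, where $I$ is $[i,j]$ (integers $i\le j$) or $(i,j)$, $[i,j)$,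 $(i,j]$ (integers $i<j$), with $1\le i\le m$. Put $\mathrm{supp}(I)=\{2i,\dots,2j\}$, $\{2i+1,\dots,2j-1\}$, $\{2i,\dots,2j-1\}$, $\{2i+1,\dots,2j\}$ respectively. $V_r$ has basis $\{e_s: s\in\mathrm{supp}(I),\ s\equiv r \bmod 2m\}$; the maps $\alpha$ send $e_s$ ($s$ odd) to $e_{s+1}$ and the maps $\beta$ send $e_s$ ($s$ odd) to $e_{s-1}$, if the target index lies in $\mathrm{supp}(I)$, and to $0$ otherwise. (II) Jordan blocks $\rho^G(J)$, $J=(V,T)$ an isomorphism class of indecomposable pairs with $T$ a linear automorphism of a finite dimensional space $V$: all $V_r=V$, $\alpha_1=T$, all other $\alpha_i$ and all $\beta_i$ are the identity. Bar codes of a tame map $f\colon X\to\mathbb S^1$. Let $0<\theta_1<\dots<\theta_m\le2\pi$ be the critical angles, and choose $t_1<\dots<t_m$ with $0<t_1<\theta_1$, $\theta_{i-1}<t_i<\theta_i$. Put $X_i=f^{-1}(\theta_i)$, $R_i=f^{-1}(t_i)$. Moving a regular fiber along the fibration over the open arc between consecutive critical angles until it is close to a critical fiber and then retracting to the critical fiber gives maps, unique up to homotopy, $a_i\colon R_i\to X_i$ ($1\le i\le m$), $b_i\colon R_{i+1}\to X_i$ ($i\le m-1$), $b_m\colon R_1\to X_m$ (crossing from $t_1+2\pi$ back to $\theta_m$). Then $V_{2i}=H_r(X_i)$, $V_{2i-1}=H_r(R_i)$, with $\alpha_i,\beta_i$ induced by $a_i,b_i$, is a $G_{2m}$-representation $\rho_r(f)$.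 The multisets $\mathcal B^{co}_r(f)$, $\mathcal B^{oc}_r(f)$ consist of the closed-open $[\cdot,\cdot)$, respectively open-closed $(\cdot,\cdot]$, bar codes of $\rho_r(f)$, with ends $i$ and $j+km$ ($1\le i,j\le m$) replaced by $\theta_i$ and $\theta_j+2\pi k$. They are empty for $r<0$. Configurations. $\mathbb T=\mathbb R^2/\mathbb Z$ for the action $(n,(a,b))\mapsto(a+2\pi n,b+2\pi n)$; $\langle a,b\rangle$ is the class of $(a,b)$; $\Delta_{\mathbb T}$ is the image of the diagonal $\{a=b\}$. $\mathbb T$ is identified with $\mathbb C\setminus0$ by $\langle a,b\rangle\mapsto e^{(a-b)/2+i(a+b)/2}$, and $\Delta_{\mathbb T}$ corresponds to the unit circle $\mathbb S^1\subset\mathbb C$. $C^m_r(f)\colon\mathbb T\setminus\Delta_{\mathbb T}\to\mathbb Z_{\ge0}$ is the finitely supported multiplicity function of the configuration obtained by recording each $[a,b)\in\mathcal B^{co}_r(f)$ as the point $\langle a,b\rangle$ and each $(\alpha,\beta]\in\mathcal B^{oc}_r(f)$ as the point $\langle\beta,\alpha\rangle$. *)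

(* Defs.v *)
From HB Require Import structures.
From mathcomp Require Import all_boot all_order all_algebra.
From mathcomp Require Import generic_quotient ring_quotient.
From mathcomp Require Import all_classical all_reals all_analysis.
From mathcomp.real_closed Require Import complex.
From mathcomp.multinomials Require Import freeg.

Set Implicit Arguments.
Unset Strict Implicit.
Unset Printing Implicit Defensive.

Import Order.TTheory GRing.Theory Num.Theory.
Import numFieldNormedType.Exports.

Local Open Scope classical_set_scope.
Local Open Scope ring_scope.
Local Open Scope quotient_scope.

(* The quotient of a module by a submodule. *)
Section LinearQuotient.
Variables (K : nzRingType) (V : lmodType K) (I : {pred V}).
Hypothesis clI : submod_closed I.

Definition lquot_pred : {pred V} := [pred x | x \in I].
Let lquot_zmod_closed : zmod_closed lquot_pred.
Proof. exact: GRing.submod_closedB clI. Qed.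
HB.instance Definition _ :=
  GRing.isZmodClosed.Build V lquot_pred lquot_zmod_closed.

Definition lquot : Type := Quotient.quot lquot_pred.
HB.instance Definition _ := GRing.Zmodule.on lquot.

Definition lquot_pi (x : V) : lquot := \pi_(Quotient.quot lquot_pred) x.
Definition lquot_repr (x : lquot) : V := repr (x : Quotient.quot lquot_pred).

Lemma lquot_reprK : cancel lquot_repr lquot_pi.
Proof. by move=> x; exact: (@reprK _ (Quotient.quot lquot_pred)). Qed.

Lemma lquot_eqP x y : lquot_pi x = lquot_pi y <-> x - y \in I.
Proof.
have <- : (x - y \in lquot_pred) = (x - y \in I) by [].
by rewrite Quotient.idealrBE; split => [/eqP|/eqP].
Qed.

Lemma lquot_piD : {morph lquot_pi : x y / x + y}.
Proof. by move=> x y; exact: (@Quotient.pi_add _ lquot_pred). Qed.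

Definition lquot_scale (a : K) (x : lquot) : lquot :=
  lquot_pi (a *: lquot_repr x).

Lemma lquot_piZ a x : lquot_pi (a *: x) = lquot_scale a (lquot_pi x).
Proof.
apply/lquot_eqP; rewrite -scalerBr -[_ *: _]addr0.
apply: clI.2; last exact: clI.1.
by apply/lquot_eqP; rewrite lquot_reprK.
Qed.

Let scaleA a b x : lquot_scale a (lquot_scale b x) = lquot_scale (a * b) x.
Proof. by rewrite -[x]lquot_reprK -!lquot_piZ scalerA. Qed.
Let scale1 : left_id 1 lquot_scale.
Proof. by move=> x; rewrite -[x]lquot_reprK -lquot_piZ scale1r. Qed.
Let scaleDr : right_distributive lquot_scale +%R.
Proof.
move=> a x y; rewrite -[x]lquot_reprK -[y]lquot_reprK.
by rewrite -lquot_piD -!lquot_piZ scalerDr lquot_piD.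
Qed.
Let scaleDl x : {morph lquot_scale^~ x : a b / a + b}.
Proof.
by move=> a b; rewrite -[x]lquot_reprK -!lquot_piZ -lquot_piD scalerDl.
Qed.
HB.instance Definition _ :=
  GRing.Zmodule_isLmodule.Build K lquot scaleA scale1 scaleDr scaleDl.

Lemma lquot_pi_linear : linear lquot_pi.
Proof. by move=> a x y; rewrite lquot_piD lquot_piZ. Qed.
HB.instance Definition _ :=
  GRing.isLinear.Build K V lquot *:%R lquot_pi lquot_pi_linear.

End LinearQuotient.

Section FreeModule.
Variables (K : comNzRingType) (S : choiceType).

Lemma fglift_linear (V : lmodType K) (g : S -> V) : linear (fglift g).
Proof.
move=> a x y.
have subL u v : fglift g (u - v) = fglift g u - fglift g v.
  exact: lift_is_additive.
have lift0 : fglift g 0 = 0 by rewrite -[in LHS](subrr 0) subL subrr.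
have addL u v : fglift g (u + v) = fglift g u + fglift g v.
  by rewrite -{1}[v]opprK subL -[- v]sub0r subL lift0 sub0r opprK.
rewrite addL; congr (_ + _).
have sumL r (F : S -> {freeg S / K}) :
    fglift g (\sum_(z <- r) F z) = \sum_(z <- r) fglift g (F z).
  elim: r => [|z r IH]; last by rewrite !big_cons addL IH.
  by rewrite !big_nil.
rewrite (_ : a *: x = fgscale a x) // -[in RHS](freeg_sumE x) /fgscale !sumL.
rewrite scaler_sumr; apply: eq_bigr => z _.
by rewrite !liftU scalerA.
Qed.

Definition free_lift (V : lmodType K) (g : S -> V) : {freeg S / K} -> V :=
  fglift g.
HB.instance Definition _ (V : lmodType K) (g : S -> V) :=
  GRing.isLinear.Build K {freeg S / K} V *:%R (free_lift g)
    (@fglift_linear V g).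

Lemma free_liftU (V : lmodType K) (g : S -> V) s : free_lift g << s >> = g s.
Proof. by rewrite /free_lift liftU scale1r. Qed.

Lemma free_lift_ext (V : lmodType K) (u v : {linear {freeg S / K} -> V}) :
  (forall s, u << s >> = v << s >>) -> u =1 v.
Proof.
move=> uv x; rewrite -[x]freeg_sumE !linear_sum; apply: eq_bigr => s _.
have -> : << coeff s x *g s >> = coeff s x *: << s >> :> {freeg S / K}.
  by apply/eqP/freeg_eqP => z; rewrite coeffZ !coeffU mul1r.
by rewrite !linearZ /= uv.
Qed.
End FreeModule.

Section StandardSimplex.
Variable R : realType.

Definition simplex (n : nat) : set 'rV[R]_n.+1 :=
  [set v | (forall i, 0 <= v 0 i) /\ \sum_i v 0 i = 1].
Arguments simplex : clear implicits.

Definition coface (n : nat) (i : 'I_n.+2) (v : 'rV[R]_n.+1) : 'rV[R]_n.+2 :=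
  \row_j (if unlift i j is Some k then v 0 k else 0).

Lemma coface_simplex n (i : 'I_n.+2) (v : simplex n) :
  coface i (set_val v) \in simplex n.+1.
Proof.
have [v0 v1] := set_valP v; apply/mem_set; split => [j|].
  by rewrite mxE; case: unliftP.
rewrite (bigD1_ord i) //= mxE unlift_none add0r -[RHS]v1.
by apply: eq_bigr => k _; rewrite mxE liftK.
Qed.

Definition face_fun n (i : 'I_n.+2) (v : simplex n) : simplex n.+1 :=
  exist _ (coface i (set_val v)) (coface_simplex i v).

Lemma continuous_coface n (i : 'I_n.+2) : continuous (@coface n i).
Proof.
move=> /= v A /= /(nbhs_ballP (coface i v)) [e e0 eA].
apply/nbhs_ballP; exists e => //= w [_ vw]; apply: eA; split => // k j.
rewrite !mxE; case: unliftP => [l _|_]; first exact: vw.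
exact: ballxx.
Qed.

Lemma continuous_face n (i : 'I_n.+2) : continuous (@face_fun n i).
Proof.
apply: continuous_comp_initial => v /=.
apply: (@continuous_comp _ _ _ set_val (@coface n i)).
  exact: initial_continuous.
exact: continuous_coface.
Qed.

Definition face n (i : 'I_n.+2) : continuousType (simplex n) (simplex n.+1) :=
  mkcts (@continuous_face n i).

End StandardSimplex.
Arguments simplex : clear implicits.

Section SingularHomology.
Variables (R : realType) (K : comNzRingType).
Implicit Types X Y : topologicalType.

Definition sing (n : nat) X := continuousType (simplex R n) X.
HB.instance Definition _ n X := Choice.on (sing n X).

Definition chain (n : nat) X := {freeg (sing n X) / K}.
HB.instance Definition _ n X := GRing.Lmodule.on (chain n X).

Definition sing_comp n X Y (phi : continuousType X Y) (s : sing n X) :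
    sing n Y := phi \o s.

Definition sing_face n X (i : 'I_n.+2) (s : sing n.+1 X) : sing n X :=
  s \o @face R n i.

Definition bdry n X : {linear chain n.+1 X -> chain n X} :=
  free_lift (fun s => \sum_(i < n.+2) (-1) ^+ i *: << sing_face i s >>).

Definition push n X Y (phi : continuousType X Y) :
    {linear chain n X -> chain n Y} :=
  free_lift (fun s => << sing_comp phi s >>).

Lemma bdry_push n X Y (phi : continuousType X Y) (c : chain n.+1 X) :
  bdry n Y (push n.+1 phi c) = push n phi (bdry n X c).
Proof.
apply: (@free_lift_ext _ _ _ (bdry n Y \o push n.+1 phi)
                             (push n phi \o bdry n X)).
move=> s /=; rewrite !free_liftU linear_sum; apply: eq_bigr => i _.
rewrite linearZ /= free_liftU; congr (_ *: << _ >>).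
exact/continuousEP.
Qed.

(* chains of A, as a submodule of the chains of X *)
Definition chain_in n X (A : set X) : {pred chain n X} :=
  fun c => all (fun s : sing n X => `[< range s `<=` A >]) (dom c).

Lemma chain_in_closed n X (A : set X) : submod_closed (@chain_in n X A).
Proof.
split=> [|a c d /allP cA /allP dA]; first by rewrite unfold_in dom0.
apply/allP => s /domD_subset; rewrite mem_cat => /orP[/domZ_subset|].
  exact: cA.
exact: dA.
Qed.
HB.instance Definition _ n X (A : set X) :=
  GRing.isSubmodClosed.Build K (chain n X) (@chain_in n X A)
    (@chain_in_closed n X A).

(* Relative cycles of the pair (X, A); [homology] is H_n(X, A). *)
Definition is_cycle n X (A : set X) : {pred chain n X} :=
  match n with
  | 0 => predT
  | m.+1 => fun c => bdry m X c \in chain_in A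
  end.

Lemma is_cycle_closed n X (A : set X) : submod_closed (@is_cycle n X A).
Proof.
case: n => [|n]; first by [].
split=> [|a c d]; rewrite ![_ \in is_cycle A]unfold_in.
  by rewrite linear0 rpred0.
by move=> cA dA; rewrite linearP rpredD ?rpredZ.
Qed.
HB.instance Definition _ n X (A : set X) :=
  GRing.isSubmodClosed.Build K (chain n X) (@is_cycle n X A)
    (@is_cycle_closed n X A).

Record rel_cycle n X (A : set X) := RelCycle {
  rel_cycle_val : chain n X;
  rel_cycleP : rel_cycle_val \in is_cycle A
}.
HB.instance Definition _ n X (A : set X) := [isSub for @rel_cycle_val n X A].
HB.instance Definition _ n X (A : set X) := [Choice of rel_cycle n A by <:].
HB.instance Definition _ n X (A : set X) :=
  [SubChoice_isSubLmodule of rel_cycle n A by <:].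

Definition is_bdry n X (A : set X) : {pred rel_cycle n A} :=
  fun z => `[< exists d : chain n.+1 X,
                 rel_cycle_val z - bdry n X d \in chain_in A >].

Lemma is_bdry_closed n X (A : set X) : submod_closed (@is_bdry n X A).
Proof.
split=> [|a c d]; rewrite ![_ \in @is_bdry n X A]unfold_in.
  by apply/asboolP; exists 0; rewrite linear0 subr0 rpred0.
move=> /asboolP[u cu] /asboolP[v dv]; apply/asboolP; exists (a *: u + v).
by rewrite linearP opprD addrACA -scalerBr rpredD ?rpredZ.
Qed.

Definition homology n X (A : set X) := lquot (@is_bdry_closed n X A).
HB.instance Definition _ n X (A : set X) := GRing.Lmodule.on (homology n A).

Section InducedMap.
Variables (n : nat) (X Y : topologicalType) (A : set X) (B : set Y).
Variables (phi : continuousType X Y) (phiAB : forall x, A x -> B (phi x)).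

Lemma push_chain_in m (c : chain m X) :
  c \in chain_in A -> push m phi c \in chain_in B.
Proof.
move=> /allP cA; rewrite -[c]freeg_sumE linear_sum big_seq.
apply: rpred_sum => s sc.
have -> : << coeff s c *g s >> = coeff s c *: << s >> :> chain m X.
  by apply/eqP/freeg_eqP => z; rewrite coeffZ !coeffU mul1r.
rewrite linearZ rpredZ //= free_liftU; apply/allP => t.
rewrite domU1 mem_seq1 => /eqP ->.
have /asboolP sA := cA _ sc.
by apply/asboolP => _ [x _ <-]; apply: phiAB; apply: sA; exists x.
Qed.

Lemma push_is_cycle (z : rel_cycle n A) :
  push n phi (rel_cycle_val z) \in is_cycle B.
Proof.
case: z => c /=; case: n c => [|m] c; first by [].
by rewrite !unfold_in bdry_push => /push_chain_in.
Qed.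

Definition push_cycle (z : rel_cycle n A) : rel_cycle n B :=
  RelCycle (push_is_cycle z).

Lemma push_cycle_linear : linear push_cycle.
Proof. by move=> a u v; apply/val_inj; rewrite /= !linearP. Qed.

Definition induced_fun (x : homology n A) : homology n B :=
  lquot_pi (@is_bdry_closed n Y B) (push_cycle (lquot_repr x)).

Lemma induced_pi z :
  induced_fun (lquot_pi _ z : homology n A) =
  lquot_pi _ (push_cycle z) :> homology n B.
Proof.
apply/lquot_eqP.
have /lquot_eqP := lquot_reprK (lquot_pi (@is_bdry_closed n X A) z).
rewrite ![_ \in @is_bdry _ _ _]unfold_in => /asboolP[d dA].
apply/asboolP; exists (push n.+1 phi d).
by rewrite bdry_push /= -!linearB; exact: push_chain_in.
Qed.

Lemma induced_linear : linear induced_fun.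
Proof.
move=> a x y; rewrite -[x]lquot_reprK -[y]lquot_reprK -linearP /=.
by rewrite !induced_pi push_cycle_linear linearP.
Qed.
HB.instance Definition _ := GRing.isLinear.Build K (homology n A) (homology n B)
  *:%R induced_fun induced_linear.
Definition induced : {linear homology n A -> homology n B} := induced_fun.
End InducedMap.

End SingularHomology.
Arguments homology R K n {X} A.
Arguments induced R K n {X Y} A B phi phiAB.

Section Representations.
Variables (K : fieldType) (m : nat).

(* i : 'I_m counts from 0: the odd and even spaces at i are V_(2i+1), V_(2i+2).
   Finite dimensionality is not built in; it is a consequence of the existence
   of a [decomposition]. *)
Record grep := GRep {
  odd_space : 'I_m -> lmodType K;
  even_space : 'I_m -> lmodType K;
  alpha : forall i, {linear odd_space i -> even_space i};
  beta : forall i, {linear odd_space (ordS i) -> even_space i}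
}.

Definition grep_iso (V W : grep) : Prop :=
  exists (p : forall i, {linear odd_space V i -> odd_space W i})
         (q : forall i, {linear even_space V i -> even_space W i}),
    [/\ forall i, bijective (p i), forall i, bijective (q i),
        forall i x, q i (alpha V i x) = alpha W i (p i x) &
        forall i x, q i (beta V i x) = beta W i (p (ordS i) x)].

Definition grep0 : grep :=
  @GRep (fun=> 'rV[K]_0) (fun=> 'rV[K]_0) (fun=> idfun) (fun=> idfun).

Section PairMap.
Variables (U1 U2 W1 W2 : lmodType K).
Variables (u : {linear U1 -> W1}) (w : {linear U2 -> W2}).
Definition pair_map (x : U1 * U2) : W1 * W2 := (u x.1, w x.2).
Lemma pair_map_linear : linear pair_map.
Proof. by move=> a x y; rewrite /pair_map /= !linearP. Qed.
HB.instance Definition _ :=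
  GRing.isLinear.Build K (U1 * U2)%type (W1 * W2)%type *:%R
    pair_map pair_map_linear.
End PairMap.

Definition grep_sum (V W : grep) : grep :=
  @GRep (fun i => (odd_space V i * odd_space W i)%type)
        (fun i => (even_space V i * even_space W i)%type)
        (fun i => pair_map (alpha V i) (alpha W i))
        (fun i => pair_map (beta V i) (beta W i)).

(* [Bar a i b j] is the interval with ends i and j, containing i iff a and
   containing j iff b. *)
Record barcode := Bar
  { lclosed : bool; lend : nat; rclosed : bool; rend : nat }.

Definition barcode_tuple (I : barcode) :=
  (lclosed I, lend I, (rclosed I, rend I)).
Definition barcode_of_tuple (t : bool * nat * (bool * nat)) :=
  Bar t.1.1 t.1.2 t.2.1 t.2.2.
Lemma barcode_tupleK : cancel barcode_tuple barcode_of_tuple.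
Proof. by case. Qed.
HB.instance Definition _ := Choice.copy barcode (can_type barcode_tupleK).

Definition valid_barcode (I : barcode) : bool :=
  (0 < lend I <= m)%N &&
  (if lclosed I && rclosed I then lend I <= rend I else lend I < rend I)%N.

Definition bar_supp (I : barcode) (s : nat) : bool :=
  ((lend I).*2 + ~~ lclosed I <= s)%N && (s + ~~ rclosed I <= (rend I).*2)%N.

Definition bar_index (I : barcode) (r : nat) : Type :=
  {s : nat | bar_supp I s && (s == r %[mod m.*2])%N}.
HB.instance Definition _ I r := Choice.on (bar_index I r).
HB.instance Definition _ I r := SubType.on (bar_index I r).

Definition bar_space (I : barcode) (r : nat) : lmodType K :=
  {freeg (bar_index I r) / K}.

(* The linear map e_s |-> e_(g s), with e_(g s) read as 0 when g s is not an
   index of the target space. *)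
Definition bar_map (I : barcode) (g : nat -> nat) (r r' : nat) :
    {linear bar_space I r -> bar_space I r'} :=
  free_lift (fun s : bar_index I r =>
    if insub (g (val s)) is Some s' then << s' >> else 0 : bar_space I r').

Definition bar_grep (I : barcode) : grep :=
  @GRep (fun i : 'I_m => bar_space I i.*2.+1) (fun i => bar_space I i.*2.+2)
        (fun i => bar_map I succn _ _) (fun i => bar_map I predn _ _).

Definition indecomposable_pair (V : vectType K) (T : 'End(V)) : Prop :=
  fullv != 0%VS :> {vspace V} /\
  forall U W : {vspace V}, (T @: U <= U)%VS -> (T @: W <= W)%VS ->
    (U + W)%VS = fullv -> (U :&: W)%VS = 0%VS -> U = 0%VS \/ W = 0%VS.

Record jordan := Jordan {
  jspace : vectType K;
  jmap : 'End(jspace);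
  jmap_auto : bijective jmap;
  jmap_indec : indecomposable_pair jmap
}.

Definition jordan_grep (J : jordan) : grep :=
  @GRep (fun=> jspace J) (fun=> jspace J)
        (fun i : 'I_m => if val i == 0 then jmap J else \1%VF)
        (fun=> idfun).

Definition decomposition (V : grep) (bars : seq barcode) : Prop :=
  all valid_barcode bars /\
  exists jordans : seq jordan,
    grep_iso V (foldr grep_sum grep0
                  (map bar_grep bars ++ map jordan_grep jordans)).

(* Existence and uniqueness up to order hold for pointwise finite dimensional V
   (Krull-Schmidt). *)
Definition barcodes (V : grep) : seq barcode := xget [::] (decomposition V).

End Representations.

Section Topology.
Variable R : realType.

Definition homeomorphic (X Y : topologicalType) : Prop :=
  exists (f : X -> Y) (g : Y -> X),
    [/\ continuous f, continuous g, cancel f g & cancel g f].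

Definition metrizable (X : topologicalType) : Prop :=
  exists Y : metricType R, homeomorphic X Y.

Definition absolute_nbhd_retract (X : topologicalType) : Prop :=
  metrizable X /\
  forall (Y : metricType R) (F : set Y), closed F -> homeomorphic X F ->
    exists (U : set Y) (r : Y -> Y),
      [/\ open U, F `<=` U, {within U, continuous r},
          forall y, U y -> F (r y) & forall y, F y -> r y = y].

(* U is an open neighborhood of A, and h is a homotopy of U in X, relative to A,
   from the inclusion to a retraction of U onto A. *)
Definition nbhd_retraction (X : topologicalType) (A U : set X)
    (h : X * R -> X) : Prop :=
  [/\ open U /\ A `<=` U, {within U `*` `[0, 1], continuous h},
      forall x, U x -> h (x, 0) = x, forall x, U x -> A (h (x, 1)) &
      forall x t, A x -> 0 <= t <= 1 -> h (x, t) = x].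

Definition nbhd_deformation_retract (X : topologicalType) (A : set X) : Prop :=
  exists U h, @nbhd_retraction X A U h.

Definition proper_map (X Y : topologicalType) (f : X -> Y) : Prop :=
  forall C : set Y, compact C -> compact (f @^-1` C).

(* The restriction of f to the preimage of B is a fibration over B. *)
Definition fibration_over (X Y : topologicalType) (f : X -> Y) (B : set Y) :
    Prop :=
  forall (Z : topologicalType) (g : Z -> X) (k : Z * R -> Y),
    continuous g -> {within setT `*` `[0, 1], continuous k} ->
    (forall z t, 0 <= t <= 1 -> B (k (z, t))) ->
    (forall z, f (g z) = k (z, 0)) ->
    exists2 G : Z * R -> X,
      {within setT `*` `[0, 1], continuous G} &
      (forall z, G (z, 0) = g z) /\
      (forall z t, 0 <= t <= 1 -> f (G (z, t)) = k (z, t)).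

(* A discrete set of critical values is locally finite: no limit point in Y. *)
Definition tame (X Y : topologicalType) (f : X -> Y) : Prop :=
  [/\ continuous f /\ proper_map f,
      locally_compact [set: X] /\ absolute_nbhd_retract X,
      forall y, nbhd_deformation_retract (f @^-1` [set y]) &
      exists2 Sigma : set Y, limit_point Sigma = set0 &
        fibration_over f (~` Sigma)].

Definition closed_manifold (n : nat) (M : topologicalType) : Prop :=
  [/\ compact [set: M], hausdorff_space M, @second_countable M &
      forall x : M, exists2 U : set M, open U /\ U x &
        homeomorphic U 'rV[R]_n].

Lemma subsetC_point (M : Type) (N : set M) y (Ny : N y) :
  forall x, (~` N) x -> (~` [set y]) (@idfun M x).
Proof. by move=> x Nx /= xy; apply: Nx; rewrite xy. Qed.

(* H_n(M, M \ N; Z) -> H_n(M, M \ {y}; Z) *)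
Definition localize n (M : topologicalType) (N : set M) y (Ny : N y) :
    homology R int n (~` N) -> homology R int n (~` [set y]) :=
  induced R int n _ _ (idfun : continuousType M M) (subsetC_point Ny).

(* a locally consistent choice of generators of the groups H_n(M, M \ {x}; Z) *)
Definition orientable (n : nat) (M : topologicalType) : Prop :=
  exists mu : forall x : M, homology R int n (~` [set x]),
    (forall x y, exists k : int, y = k *: mu x) /\
    (forall x : M, exists2 N : set M, nbhs x N &
       exists nu : homology R int n (~` N),
         forall y (Ny : N y), localize Ny nu = mu y).

Definition field_orientable (K : fieldType) (n : nat) (M : topologicalType) :
    Prop :=
  2%N \in [pchar K] \/ orientable n M.

End Topology.

Section CircleAndPlane.
Variable R : realType.

Definition period : {pred R} :=
  fun x => `[< exists k : int, x = pi *+ 2 *~ k >].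
Lemma period_closed : zmod_closed period.
Proof.
split; first by apply/asboolP; exists 0; rewrite mulr0z.
move=> x y /asboolP[k ->] /asboolP[l ->]; apply/asboolP; exists (k - l).
by rewrite mulrzBr.
Qed.
HB.instance Definition _ := GRing.isZmodClosed.Build R period period_closed.

Definition circle := quotient_topology (Quotient.quot period).
HB.instance Definition _ := Topological.on circle.
Definition angle (x : R) : circle := \pi_(Quotient.quot period) x.

Definition diag_period : {pred R * R} :=
  fun p => `[< exists k : int, p = (pi *+ 2 *~ k, pi *+ 2 *~ k) >].
Lemma diag_period_closed : zmod_closed diag_period.
Proof.
split; first by apply/asboolP; exists 0; rewrite mulr0z.
move=> x y /asboolP[k ->] /asboolP[l ->]; apply/asboolP; exists (k - l).
by rewrite mulrzBr.
Qed.
HB.instance Definition _ :=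
  GRing.isZmodClosed.Build (R * R)%type diag_period diag_period_closed.

(* the quotient of R^2 by the diagonal translations by multiples of 2 pi *)
Definition torus := Quotient.quot diag_period.
Definition tpoint (a b : R) : torus := \pi_torus (a, b).

Definition torus_diagonal : set torus := [set tpoint a a | a in [set: R]].

(* independent of the chosen representative (a, b) *)
Definition to_plane (p : torus) : R[i] :=
  let: (a, b) := repr p in
  let modulus := expR ((a - b) / 2) in
  let arg := (a + b) / 2 in
  Complex (modulus * cos arg) (modulus * sin arg).

Definition inversion (z : R[i]) : R[i] := (z^*)^-1.

End CircleAndPlane.

Section Configurations.
Variables (R : realType) (X : topologicalType) (f : X -> circle R).

Definition fiber (x : R) : set X := f @^-1` [set angle x].

(* phi is obtained by moving the fiber at u (= p modulo 2 pi) along lifts of the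
   segment from u to u + c (v - u), then retracting to the fiber at v. *)
Definition transition (p u v : R) (phi : fiber p -> fiber v) : Prop :=
  exists (c : R) (H : X * R -> X) (U : set X) (h : X * R -> X),
    [/\ 0 < c < 1,
        {within fiber p `*` `[0, c], continuous H} /\
          (forall x, fiber p x -> H (x, 0) = x /\
             forall t, 0 <= t <= c -> fiber (u + t * (v - u)) (H (x, t))),
        nbhd_retraction (fiber v) U h,
        forall t, c <= t <= 1 -> fiber (u + t * (v - u)) `<=` U &
        forall x : fiber p, set_val (phi x) = h (H (set_val x, c), 1)].

(* k-th angle (k >= 1) of the 2pi-periodic extension of s = [:: s_1; ..; s_m] *)
Definition periodic_nth (s : seq R) (k : nat) : R :=
  s`_(k.-1 %% size s)%N + pi *+ 2 * (k.-1 %/ size s)%:R.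

(* The critical angles theta_1 < .. < theta_m together with the choices entering
   the construction of the representations: the t_i, a_i and b_i.  Entry i of a
   sequence is the angle of index i+1; the map b_i starts from
   t_(i+1), or from t_1 + 2 pi when i = m. *)
Record critical_data := CriticalData {
  crit_angles : seq R;
  reg_angles : seq R;
  crit_sorted : path <%R 0 crit_angles;
  crit_le : all (fun x => x <= pi *+ 2) crit_angles;
  size_reg : size reg_angles = size crit_angles;
  reg_crit : forall i, (i < size crit_angles)%N ->
    (0 :: crit_angles)`_i < reg_angles`_i < crit_angles`_i;
  crit_fibration :
    fibration_over R f (~` [set angle x | x in [set` crit_angles]]);
  amap : forall i : 'I_(size crit_angles),
    continuousType (fiber reg_angles`_i) (fiber crit_angles`_i);
  bmap : forall i : 'I_(size crit_angles),
    continuousType (fiber reg_angles`_(ordS i)) (fiber crit_angles`_i);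
  amapP : forall i : 'I_(size crit_angles), transition reg_angles`_i (amap i);
  bmapP : forall i : 'I_(size crit_angles),
    transition (periodic_nth reg_angles i.+2) (bmap i)
}.

Variables (K : fieldType) (D : critical_data).

Definition abs_homology (r : nat) (A : set X) : lmodType K :=
  homology R K r (set0 : set A).

Definition abs_induced (r : nat) (A B : set X) (phi : continuousType A B) :
    {linear abs_homology r A -> abs_homology r B} :=
  induced R K r set0 set0 phi (fun _ => id).

Definition fiber_grep (r : nat) : grep K (size (crit_angles D)) :=
  @GRep K _ (fun i => abs_homology r (fiber (reg_angles D)`_i))
    (fun i => abs_homology r (fiber (crit_angles D)`_i))
    (fun i => abs_induced r (@amap D i)) (fun i => abs_induced r (@bmap D i)).

Definition barcodes_of (r : int) : seq barcode :=
  if r is Posz r' then barcodes (fiber_grep r') else [::].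

Definition bar_point (I : barcode) : torus R :=
  let a := periodic_nth (crit_angles D) (lend I) in
  let b := periodic_nth (crit_angles D) (rend I) in
  if lclosed I then tpoint a b else tpoint b a.

Definition mixed_points (r : int) : seq (torus R) :=
  [seq bar_point J | J <- barcodes_of r & lclosed J != rclosed J].

Definition Cm (r : int) (p : torus R) : nat := count_mem p (mixed_points r).

Definition Cm_plane (r : int) (z : R[i]) : nat :=
  count_mem z (map (@to_plane R) (mixed_points r)).

End Configurations.

(* Main.v *)
(* For a regular value p of f let F p be its fiber.  A class y of F p suspends to a class of
   dimension one more in M relative to the complement of F p, and Poincare duality represents the
   suspension by a cocycle near F p; evaluating it on the cycles of F p of the complementary degree
   gives a perfect pairing of H_r (F p) and H_(n-1-r) (F p).  Across a critical level the relation
   alpha x = beta y says that x and y are homologous in the preimage of an interval, and with respect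
   to the pairings of the two regular fibers the relations in degrees r and n-1-r are each other's
   annihilators.  The numbers of bars [a, b) and (a, b] with given ends are dimensions of subquotients
   of the regular fibers that are defined by walks along these relations; the pairings exchange the two
   kinds.  Finite dimensionality of the homology of the fibers makes the bar code decomposition exist. *)
Require Import Defs.
From HB Require Import structures.
From mathcomp Require Import all_boot all_order all_algebra.
From mathcomp Require Import generic_quotient.
From mathcomp Require Import all_classical all_reals all_analysis.
From mathcomp.real_closed Require Import complex.
From mathcomp.multinomials Require Import freeg.
From mathcomp Require Import ring lra zify.

Set Implicit Arguments.
Unset Strict Implicit.
Unset Printing Implicit Defensive.

Import Order.TTheory GRing.Theory Num.Theory.
Import numFieldNormedType.Exports.

Local Open Scope classical_set_scope.
Local Open Scope ring_scope.
Local Notation lift := fintype.lift.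

(** The fibers need not be manifolds, so duality is applied in the ambient M only: for a closed set
    A, between germs of cochains along A and chains of M modulo the complement of A. A germ is a
    cocycle on small simplices only; capping therefore uses iterated subdivisions of the fundamental
    cycle, for all large numbers of subdivisions. Critical fibers enter only through the relation
    [alpha x = beta y]: a chain over the arc between two regular fibers, prolonged a little beyond
    both, is a relative cycle that restricts to the suspensions of its two traces. A bar [a, b) is a
    walk that starts with [beta x] outside the image of [alpha] and dies after b - a steps; a bar
    (a, b] starts in the kernel of [beta] and gets stuck at its end. Annihilators exchange image
    with kernel and domain with kernel, hence these two types. Finite dimension comes from the same
    duality, as a subdivided fundamental cycle has finitely many simplices and a cocycle is tested
    on their faces. *)

(** * Identities in abelian groups *)

Inductive zexp := ZVar of nat | ZAdd of zexp & zexp | ZOpp of zexp | ZZero.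

Fixpoint zeval (V : zmodType) (env : seq V) e : V :=
  match e with
  | ZVar i => env`_i
  | ZAdd a b => zeval env a + zeval env b
  | ZOpp a => - zeval env a
  | ZZero => 0
  end.

Fixpoint zcoef (i : nat) e : int :=
  match e with
  | ZVar j => (j == i)%:Z
  | ZAdd a b => zcoef i a + zcoef i b
  | ZOpp a => - zcoef i a
  | ZZero => 0
  end.

Lemma zevalE (V : zmodType) (env : seq V) e :
  zeval env e = \sum_(i < size env) env`_i *~ zcoef i e.
Proof.
elim: e => [j|a IHa b IHb|a IH|] /=.
- have [lej|ltj] := leqP (size env) j.
    rewrite nth_default // big1 // => i _.
    by case: eqP => [ji|_]; [move: (ltn_ord i); rewrite -ji ltnNge lej | rewrite mulr0z].
  rewrite (bigD1 (Ordinal ltj)) //= eqxx mulr1z big1 ?addr0 // => i ni.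
  by case: eqP => [ji|_]; [case/eqP: ni; apply/val_inj | rewrite mulr0z].
- by rewrite IHa IHb -big_split; apply: eq_bigr => i _; rewrite mulrzDr.
- by rewrite IH -sumrN; apply: eq_bigr => i _; rewrite mulrNz.
by rewrite big1 // => i _; rewrite mulr0z.
Qed.

Lemma zeval_eq (V : zmodType) (env : seq V) a b :
  all (fun i => zcoef i a == zcoef i b) (iota 0 (size env)) ->
  zeval env a = zeval env b.
Proof.
move/allP => h; rewrite !zevalE; apply: eq_bigr => i _.
by rewrite (eqP (h i _)) // mem_iota /=.
Qed.

Ltac zindex x l :=
  lazymatch l with
  | ?y :: ?l' => match constr:(tt) with
      | _ => let _ := match constr:(tt) with _ => first [constr_eq x y | unify x y] end in constr:(0%N)
      | _ => let n := zindex x l' in constr:(n.+1)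
      end
  end.
Ltac zinsert x l :=
  match constr:(tt) with
  | _ => let n := zindex x l in l
  | _ => lazymatch l with
      | ?y :: ?l' => let l'' := zinsert x l' in constr:(y :: l'')
      | _ => constr:(x :: l)
      end
  end.
Ltac zatoms e l :=
  lazymatch e with
  | (?a + ?b)%R => let l' := zatoms a l in zatoms b l'
  | (- ?a)%R => zatoms a l
  | 0%R => l
  | _ => zinsert e l
  end.
Ltac zreify e l :=
  lazymatch e with
  | (?a + ?b)%R => let a' := zreify a l in let b' := zreify b l in constr:(ZAdd a' b')
  | (- ?a)%R => let a' := zreify a l in constr:(ZOpp a')
  | 0%R => constr:(ZZero)
  | _ => let n := zindex e l in constr:(ZVar n)
  end.
(** Both sides are integer combinations of atoms, compared coefficientwise. Scalar multiples and
    values of maps count as atoms. *)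
Ltac zmod :=
  lazymatch goal with
  | |- @eq ?T ?a ?b =>
    let l0 := constr:(@nil T) in
    let l1 := zatoms a l0 in
    let l := zatoms b l1 in
    let a' := zreify a l in
    let b' := zreify b l in
    exact: (@zeval_eq _ l a' b' isT)
  end.

(** * Extension of linear functionals in arbitrary dimension *)

Section LinearFactorization.
Variable K : fieldType.

(** A set is judged together with [G0], the graph forced by [l], so that the empty union is
    admissible in Zorn's lemma. *)
Let partial_graph (W : lmodType K) (G0 A : set (W * K)) : Prop :=
  (forall a w k w' k', (A `|` G0) (w, k) -> (A `|` G0) (w', k') ->
     (A `|` G0) (a *: w + w', a * k + k')) /\
  (forall k, (A `|` G0) (0, k) -> k = 0).

(** The functional that [l] induces on the image of [u] extends to [W] by Zorn's lemma. Chain spaces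
    are infinite dimensional; this is how cochains with prescribed values on some chains and on
    boundaries are obtained below. *)
Lemma functional_factor (V W : lmodType K) (u : {linear V -> W})
    (l : {linear V -> K^o}) :
  (forall v, u v = 0 -> l v = 0) ->
  exists m : {linear W -> K^o}, forall v, m (u v) = l v.
Proof.
move=> ul; pose G0 : set (W * K) := [set p | exists v, p = (u v, l v)].
have [F FP Ftot|A [[Alin A0] Amax]] := @Zorn_bigcup _ (partial_graph G0).
  (* The sets of [F] are nested, so two points of the union lie in one member or both in [G0]. *)
  have dec p q : (\bigcup_(X in F) X `|` G0) p -> (\bigcup_(X in F) X `|` G0) q ->
      (G0 p /\ G0 q) \/ exists2 X, F X & (X `|` G0) p /\ (X `|` G0) q.
    move=> [[X FX Xp]|p0] [[Y FY Yq]|q0].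
    - have [XY|YX] := Ftot _ _ FX FY; right.
        by exists Y => //; split; left=> //; apply: XY.
      by exists X => //; split; left=> //; apply: YX.
    - by right; exists X => //; split; [left|right].
    - by right; exists Y => //; split; [right|left].
    - by left.
  split=> [a w k w' k' wk wk'|k wk].
    have [[[v [-> ->]] [v' [-> ->]]]|[X FX [Xp Xq]]] := dec _ _ wk wk'.
      by right; exists (a *: v + v'); rewrite !linearP.
    have [XP _] := FP _ FX; have [Xr|r0] := XP a _ _ _ _ Xp Xq; last by right.
    by left; exists X.
  have [[[v [uv ->]] _]|[X FX [Xp _]]] := dec _ _ wk wk.
    by apply: ul; rewrite -uv.
  by have [_ X0] := FP _ FX; apply: X0.
pose G := A `|` G0.
have G00 : G (0, 0) by right; exists 0; rewrite !linear0.
have Gfun w k k' : G (w, k) -> G (w, k') -> k = k'.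
  move=> wk wk'; apply/eqP; rewrite -subr_eq0 -opprB oppr_eq0 -mulN1r addrC.
  by apply/eqP/A0; have := Alin (-1) _ _ _ _ wk wk'; rewrite scaleN1r addNr addrC mulN1r.
have Gtot w0 : exists k, G (w0, k).
  apply: contrapT => nw0.
  (* If [w0] has no value, giving it the value 0 enlarges the graph. *)
  pose B : set (W * K) := [set p | exists c, G (p.1 - c *: w0, p.2)].
  have GB : G `<=` B by move=> [w k] wk; exists 0; rewrite scale0r subr0.
  have BG0 : B `|` G0 = B.
    by apply/seteqP; split=> [p [//|p0]|p Bp]; [apply: GB; right|left].
  apply: (Amax B); last first.
    rewrite /partial_graph BG0; split=> [a w k w' k' [c wk] [c' wk']|k [c] /=].
      exists (a * c + c'); rewrite /=.
      have := Alin a _ _ _ _ wk wk'; rewrite /= scalerBr scalerA.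
      have -> // : a *: w - (a * c) *: w0 + (w' - c' *: w0) =
                   a *: w + w' - (a * c + c') *: w0.
      by rewrite scalerDl; zmod.
    have [->|c0] := eqVneq c 0; first by rewrite scale0r subr0 => /A0.
    rewrite sub0r => wk; case: nw0; exists (- c^-1 * k + 0).
    have := Alin (- c^-1) _ _ _ _ wk G00.
    by rewrite scalerN scaleNr opprK scalerA mulVf // scale1r addr0.
  split=> [p Ap|BA]; first by apply: GB; left.
  apply: nw0; exists 0; left; apply: BA; exists 1.
  by rewrite /= scale1r subrr.
pose m w := xget 0 [set k | G (w, k)].
have mP w : G (w, m w) by have := xgetPex 0 (Gtot w).
have mlin : linear (m : W -> K^o).
  by move=> a w w'; apply: (Gfun _ _ _ (mP _)); apply: Alin; exact: mP.
pose HBm := GRing.isLinear.Build K W K^o *:%R m mlin.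
pose M : {linear W -> K^o} := HB.pack (m : W -> K^o) HBm.
by exists M => v; apply: (Gfun _ _ _ (mP _)); right; exists v.
Qed.

End LinearFactorization.

Lemma freeg_supp_ind (K : comNzRingType) (S : choiceType) (Q : pred S)
    (P : {freeg S / K} -> Prop) :
  P 0 -> (forall a c d, P c -> P d -> P (a *: c + d)) ->
  (forall s, Q s -> P << s >>) ->
  forall c : {freeg S / K}, all Q (dom c) -> P c.
Proof.
move=> P0 PD P1 c /allP cQ; rewrite -[c]freeg_sumE.
have : {subset dom c <= Q} by move=> s; exact: cQ.
elim: (dom c) => [|s r IH] rQ; first by rewrite big_nil.
rewrite big_cons; have -> : << coeff s c *g s >> = coeff s c *: << s >> :> {freeg S / K}.
  by apply/eqP/freeg_eqP => z; rewrite coeffZ !coeffU mul1r.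
apply: PD; first by apply: P1; apply: rQ; rewrite mem_head.
by apply: IH => t tr; apply: rQ; rewrite inE tr orbT.
Qed.

(** * Chains supported on a set of generators *)

Section Support.
Variables (K : comNzRingType) (S : choiceType).

(** [chain_in A] is convertible to an instance, so the lemmas on [fsupp] apply to it directly. *)
Definition fsupp (Q : set S) : {pred {freeg S / K}} :=
  fun c => all (fun s => `[< Q s >]) (dom c).

Lemma fsupp_closed Q : submod_closed (fsupp Q).
Proof.
split=> [|a c d /allP cQ /allP dQ]; first by rewrite unfold_in dom0.
apply/allP => s /domD_subset; rewrite mem_cat => /orP[/domZ_subset|].
  exact: cQ.
exact: dQ.
Qed.
HB.instance Definition _ Q :=
  GRing.isSubmodClosed.Build K {freeg S / K} (fsupp Q) (fsupp_closed Q).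

Lemma fsuppU Q s : (<< s >> \in fsupp Q) = `[< Q s >].
Proof. by rewrite unfold_in domU1 /= andbT. Qed.

Lemma fsupp_ind (Q : set S) (P : {freeg S / K} -> Prop) :
  P 0 -> (forall a c d, P c -> P d -> P (a *: c + d)) ->
  (forall s, Q s -> P << s >>) -> forall c, c \in fsupp Q -> P c.
Proof.
move=> P0 PD P1 c cQ; apply: (freeg_supp_ind P0 PD _ cQ) => s /asboolP; exact: P1.
Qed.

Lemma fsupp_lift (V : lmodType K) (F : {linear {freeg S / K} -> V}) Q
    (N : submodClosed V) c :
  (forall s, Q s -> F << s >> \in N) -> c \in fsupp Q -> F c \in N.
Proof.
move=> FN; apply: (fsupp_ind (P := fun c => F c \in N)) => [|a x y Fx Fy|//]; first by rewrite linear0 rpred0.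
by rewrite linearP rpredD ?rpredZ.
Qed.

Lemma eq_on_fsupp (V : lmodType K) (F G : {linear {freeg S / K} -> V}) Q c :
  (forall s, Q s -> F << s >> = G << s >>) -> c \in fsupp Q -> F c = G c.
Proof.
move=> FG; apply: (fsupp_ind (P := fun c => F c = G c)) => [|a x y Fx Fy|//]; first by rewrite !linear0.
by rewrite !linearP Fx Fy.
Qed.

Lemma fsuppS (P Q : set S) c : P `<=` Q -> c \in fsupp P -> c \in fsupp Q.
Proof. by move=> PQ /allP cP; apply/allP => s /cP /asboolP /PQ ?; apply/asboolP. Qed.

Lemma fsuppT c : c \in fsupp setT.
Proof. by apply/allP => s _; apply/asboolP. Qed.

Lemma fsuppI (P Q : set S) c : c \in fsupp P -> c \in fsupp Q -> c \in fsupp (P `&` Q).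
Proof.
by move=> /allP cP /allP cQ; apply/allP => s sc; apply/asboolP; split;
   apply/asboolP; [apply: cP | apply: cQ].
Qed.

Lemma fsupp_split (P Q : set S) c : c \in fsupp (P `|` Q) ->
  exists c1 c2, [/\ c = c1 + c2, c1 \in fsupp P & c2 \in fsupp Q].
Proof.
apply: (fsupp_ind (P := fun c => exists c1 c2,
  [/\ c = c1 + c2, c1 \in fsupp P & c2 \in fsupp Q])) => [|a x y [x1 [x2 [-> x1P x2Q]]] [y1 [y2 [-> y1P y2Q]]]|s].
- by exists 0, 0; rewrite addr0 !rpred0.
- exists (a *: x1 + y1), (a *: x2 + y2).
  by split; rewrite ?rpredD ?rpredZ //; rewrite scalerDr; zmod.
case=> sPQ; [exists << s >>, 0 | exists 0, << s >>];
  by rewrite ?addr0 ?add0r rpred0 fsuppU; split=> //; apply/asboolP.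
Qed.

End Support.
Arguments fsupp {K S} Q.

(** Locked, so that unification does not unfold operators on chains into the free module. *)
HB.lock Definition flift (K : comNzRingType) (S : choiceType) (V : lmodType K) (g : S -> V) :
  {linear {freeg S / K} -> V} := free_lift g.

Lemma fliftU (K : comNzRingType) (S : choiceType) (V : lmodType K) (g : S -> V) s :
  flift g << s >> = g s.
Proof. rewrite flift.unlock; exact: free_liftU. Qed.

(** * Affine chains *)

Section AffineChains.
Variables (R : realType) (K : comNzRingType).
Local Notation ach k d := {freeg 'M[R]_(k, d) / K}.

(* A matrix lists the vertices of an affine simplex; the empty matrix generates
   degree -1, so [abd] is the augmented boundary. *)
Definition abd k d : {linear ach k.+1 d -> ach k d} :=
  flift (fun P : 'M[R]_(k.+1, d) =>
    \sum_(i < k.+1) (-1) ^+ i *: << row' i P >>).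

Definition cone k d (b : 'rV[R]_d) : {linear ach k d -> ach k.+1 d} :=
  flift (fun P : 'M[R]_(k, d) => << (col_mx b P : 'M[R]_(k.+1, d)) >>).

Definition avmap k d d' (f : 'rV[R]_d -> 'rV[R]_d') : {linear ach k d -> ach k d'} :=
  flift (fun P : 'M[R]_(k, d) => << \matrix_(i < k) f (row i P) >>).

Lemma abdU k d (P : 'M[R]_(k.+1, d)) :
  abd k d << P >> = \sum_(i < k.+1) (-1) ^+ i *: << row' i P >>.
Proof. exact: fliftU. Qed.

Lemma coneU k d (b : 'rV[R]_d) (P : 'M[R]_(k, d)) :
  cone k b << P >> = << (col_mx b P : 'M[R]_(k.+1, d)) >>.
Proof. exact: fliftU. Qed.

Lemma avmapU k d d' (f : 'rV[R]_d -> 'rV[R]_d') (P : 'M[R]_(k, d)) :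
  avmap k f << P >> = << \matrix_(i < k) f (row i P) >>.
Proof. exact: fliftU. Qed.

Lemma abd_avmap k d d' (f : 'rV[R]_d -> 'rV[R]_d') c :
  abd k d' (avmap k.+1 f c) = avmap k f (abd k d c).
Proof.
apply: (@free_lift_ext _ _ _ (abd k d' \o avmap k.+1 f) (avmap k f \o abd k d)).
move=> P /=; rewrite avmapU !abdU linear_sum; apply: eq_bigr => i _.
rewrite linearZ /= avmapU; congr (_ *: << _ >>); apply/matrixP => j l.
by rewrite !mxE; congr (f _ 0 l); apply/rowP => m; rewrite !mxE.
Qed.

Lemma row0_col_mx k d (b : 'rV[R]_d) (P : 'M[R]_(k, d)) :
  row ord0 (col_mx b P : 'M[R]_(k.+1, d)) = b.
Proof.
have -> : ord0 = lshift k ord0 :> 'I_(1 + k) by apply/val_inj.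
by rewrite (@rowKu _ 1 k d ord0 b P) row_id.
Qed.

Lemma rowS_col_mx k d (b : 'rV[R]_d) (P : 'M[R]_(k, d)) i :
  row (lift ord0 i) (col_mx b P : 'M[R]_(k.+1, d)) = row i P.
Proof.
have -> : lift ord0 i = rshift 1 i :> 'I_(1 + k) by apply/val_inj.
exact: (@rowKd _ 1 k d i b P).
Qed.

Lemma row_row' k d (P : 'M[R]_(k.+1, d)) i (j : 'I_k) :
  row j (row' i P) = row (lift i j) P.
Proof. by apply/rowP => l; rewrite !mxE. Qed.

Lemma row'0_col_mx k d (b : 'rV[R]_d) (P : 'M[R]_(k, d)) :
  row' ord0 (col_mx b P : 'M[R]_(k.+1, d)) = P.
Proof. by apply/row_matrixP => i; rewrite row_row' rowS_col_mx. Qed.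

Lemma row'S_col_mx k d (b : 'rV[R]_d) (P : 'M[R]_(k.+1, d)) i :
  row' (lift ord0 i) (col_mx b P : 'M[R]_(k.+2, d)) = col_mx b (row' i P).
Proof.
apply/row_matrixP => j; rewrite row_row'.
case: (unliftP (ord0 : 'I_k.+1) j) => [m|] ->.
  have -> : lift (lift ord0 i) (lift ord0 m) = lift ord0 (lift i m).
    by apply/val_inj; rewrite /= /bump !leq0n /= !add1n ltnS; case: leqP.
  by rewrite !rowS_col_mx row_row'.
have -> : lift (lift ord0 i) ord0 = ord0 :> 'I_k.+2 by apply/val_inj.
by rewrite !row0_col_mx.
Qed.

(** The face opposite the apex is [c], the other faces are cones over the faces of [c]. Hence cones
    contract the augmented complex. *)
Lemma abd_cone k d (b : 'rV[R]_d) c :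
  abd k.+1 d (cone k.+1 b c) = c - cone k b (abd k d c).
Proof.
apply: (@free_lift_ext _ _ _ (abd k.+1 d \o cone k.+1 b)
  (idfun \- (cone k b \o abd k d))) => P /=.
rewrite coneU !abdU big_ord_recl row'0_col_mx scale1r linear_sum -sumrN /=.
congr (_ + _); apply: eq_bigr => i _.
by rewrite row'S_col_mx linearZ /= coneU exprS mulN1r scaleNr.
Qed.

Lemma abd_cone0 d (b : 'rV[R]_d) c : abd 0 d (cone 0 b c) = c.
Proof.
apply: (@free_lift_ext _ _ _ (abd 0 d \o cone 0 b) idfun) => P /=.
by rewrite coneU abdU big_ord1 row'0_col_mx scale1r.
Qed.

(** Degree -1 is [k = 0], where the augmented complex ends and every chain is a cycle. *)
Definition acycle k d : ach k d -> Prop :=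
  if k is l.+1 then fun c => abd l d c = 0 else fun=> True.

Lemma abd_cone_cycle k d (b : 'rV[R]_d) c : acycle c -> abd k d (cone k b c) = c.
Proof.
case: k c => [|k] c /=; first by rewrite abd_cone0.
by move=> c0; rewrite abd_cone c0 linear0 subr0.
Qed.

(** A nonempty list of vertices is the cone from its first vertex over the others. *)
Lemma ach_ind k d (P : ach k.+1 d -> Prop) :
  P 0 -> (forall a x y, P x -> P y -> P (a *: x + y)) ->
  (forall b c, P (cone k b c)) -> forall c, P c.
Proof.
move=> P0 PD Pc c; apply: (fsupp_ind P0 PD _ (fsuppT c)) => Q _.
by rewrite -[Q](@vsubmxK _ 1) -coneU.
Qed.

Lemma acycle_abd k d c : @acycle k d (abd k d c).
Proof.
elim: k c => [//|k IH].
apply: ach_ind => [|a x y /= hx hy|b c]; first by rewrite /= !linear0.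
  by rewrite !linearP /= hx hy scaler0 addr0.
by rewrite /= abd_cone linearB /= (abd_cone_cycle _ (IH _)) subrr.
Qed.

Section Homotopy.
Variables (d d' : nat) (F G : forall k, {linear ach k d -> ach k d'}).
Variable b : forall k, 'M[R]_(k, d) -> 'rV[R]_d'.

(* The acyclic carrier construction with cones from [b] as contractions. *)
Fixpoint ahom k : {linear ach k d -> ach k.+1 d'} :=
  match k with
  | 0 => \0
  | k.+1 => flift (fun P : 'M[R]_(k.+1, d) =>
      cone k.+1 (b P) (F k.+1 << P >> - G k.+1 << P >> - ahom k (abd k d << P >>)))
  end.

Lemma ahomU k (P : 'M[R]_(k.+1, d)) : ahom k.+1 << P >> =
  cone k.+1 (b P) (F k.+1 << P >> - G k.+1 << P >> - ahom k (abd k d << P >>)).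
Proof. exact: fliftU. Qed.

Hypothesis FG0 : F 0%N =1 G 0%N.
Hypothesis Fb : forall k c, abd k d' (F k.+1 c) = F k (abd k d c).
Hypothesis Gb : forall k c, abd k d' (G k.+1 c) = G k (abd k d c).

(** The chain that is coned off is a cycle by the same formula one degree lower, whatever the apexes
    [b]. *)
Lemma abd_ahom k c :
  abd k.+1 d' (ahom k.+1 c) = F k.+1 c - G k.+1 c - ahom k (abd k d c).
Proof.
have cyc (f : forall k, {linear ach k d -> ach k d'}) l (x : ach l d) :
    (forall k c, abd k d' (f k.+1 c) = f k (abd k d c)) -> acycle x -> acycle (f l x).
  by move=> fb; case: l x => [//|l] x /= x0; rewrite fb x0 linear0.
elim: k c => [|k IH] c.
  apply: (@free_lift_ext _ _ _ (abd 1 d' \o ahom 1)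
    ((F 1 \- G 1) \- (ahom 0 \o abd 0 d))) => P.
  rewrite [LHS]/= ahomU /= subr0 abd_cone_cycle //=.
  by rewrite linearB /= Fb Gb FG0 subrr.
apply: (@free_lift_ext _ _ _ (abd k.+2 d' \o ahom k.+2)
    ((F k.+2 \- G k.+2) \- (ahom k.+1 \o abd k.+1 d))) => P.
rewrite [LHS]/= ahomU abd_cone_cycle //.
rewrite /acycle !linearB /= Fb Gb IH (acycle_abd << P >>) linear0 subr0.
by rewrite subrr.
Qed.
End Homotopy.

Definition bary k d (P : 'M[R]_(k, d)) : 'rV[R]_d := const_mx k%:R^-1 *m P.

Fixpoint asub k d : {linear ach k d -> ach k d} :=
  match k with
  | 0 => idfun
  | k.+1 => flift (fun P : 'M[R]_(k.+1, d) =>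
      cone k (bary P) (asub k d (abd k d << P >>)))
  end.

Lemma asubU k d (P : 'M[R]_(k.+1, d)) :
  asub k.+1 d << P >> = cone k (bary P) (asub k d (abd k d << P >>)).
Proof. exact: fliftU. Qed.

Lemma abd_asub k d c : abd k d (asub k.+1 d c) = asub k d (abd k d c).
Proof.
elim: k c => [|k IH] c.
  apply: (@free_lift_ext _ _ _ (abd 0 d \o asub 1 d) (asub 0 d \o abd 0 d)) => P /=.
  by rewrite fliftU abd_cone_cycle.
apply: (@free_lift_ext _ _ _ (abd k.+1 d \o asub k.+2 d) (asub k.+1 d \o abd k.+1 d)).
move=> P; rewrite [LHS]/= asubU abd_cone_cycle //.
by rewrite /acycle IH (acycle_abd << P >>) linear0.
Qed.

Lemma avmap_cone k d d' (f : 'rV[R]_d -> 'rV[R]_d') b c :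
  avmap k.+1 f (cone k b c) = cone k (f b) (avmap k f c).
Proof.
apply: (@free_lift_ext _ _ _ (avmap k.+1 f \o cone k b) (cone k (f b) \o avmap k f)).
move=> P /=; rewrite coneU !avmapU coneU; congr (<< _ >>); apply/row_matrixP => i.
rewrite rowK; case: (unliftP ord0 i) => [j|] ->; last by rewrite !row0_col_mx.
by rewrite !rowS_col_mx rowK.
Qed.

Section Natural.
Variables (d d' e e' : nat) (f : 'rV[R]_d -> 'rV[R]_d') (g : 'rV[R]_e -> 'rV[R]_e').

(** A map that respects the apexes commutes with each coning. Needed for the inclusions of faces of
    the model simplex. *)
Lemma avmap_ahom (F G : forall k, {linear ach k d -> ach k e})
    (F' G' : forall k, {linear ach k d' -> ach k e'}) b b' :
  (forall k P, g (b k P) = b' k (\matrix_(i < k) f (row i P))) ->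
  (forall k c, avmap k g (F k c) = F' k (avmap k f c)) ->
  (forall k c, avmap k g (G k c) = G' k (avmap k f c)) ->
  forall k c, avmap k.+1 g (ahom F G b k c) = ahom F' G' b' k (avmap k f c).
Proof.
move=> gb gF gG; elim=> [|k IH] c; first by rewrite /= linear0.
apply: (@free_lift_ext _ _ _ (avmap k.+2 g \o ahom F G b k.+1)
  (ahom F' G' b' k.+1 \o avmap k.+1 f)) => P.
rewrite [RHS]/= avmapU [LHS]/= !ahomU avmap_cone gb !linearB /= IH gF gG.
by rewrite -(avmapU f) abd_avmap.
Qed.
End Natural.

Lemma bary_mulmx k d d' (D : 'M[R]_(d, d')) (P : 'M[R]_(k, d)) :
  mulmxr D (bary P) = bary (\matrix_(i < k) mulmxr D (row i P)).
Proof.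
rewrite /bary /= -mulmxA; congr (_ *m _).
by apply/row_matrixP => i; rewrite rowK row_mul.
Qed.

Lemma avmap_asub k d d' (D : 'M[R]_(d, d')) c :
  avmap k (mulmxr D) (asub k d c) = asub k d' (avmap k (mulmxr D) c).
Proof.
elim: k c => [//|k IH] c.
apply: (@free_lift_ext _ _ _ (avmap k.+1 (mulmxr D) \o asub k.+1 d)
  (asub k.+1 d' \o avmap k.+1 (mulmxr D))) => P.
rewrite [RHS]/= avmapU [LHS]/= !asubU avmap_cone IH bary_mulmx.
by rewrite -(avmapU (mulmxr D)) abd_avmap.
Qed.

Definition rows_in d (C : set 'rV[R]_d) k : set 'M[R]_(k, d) :=
  [set P | forall i, C (row i P)].

Definition cvx d (C : set 'rV[R]_d) : Prop :=
  forall k (w : 'rV[R]_k.+1) (P : 'M[R]_(k.+1, d)), simplex R k w ->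
    rows_in C P -> C (w *m P).

Section Carrier.
Variables (d : nat) (C : set 'rV[R]_d).

Lemma abd_in k c : c \in fsupp (@rows_in d C k.+1) -> abd k d c \in fsupp (@rows_in d C k).
Proof.
apply: fsupp_lift => P PC; rewrite abdU; apply: rpred_sum => i _; apply: rpredZ.
by rewrite fsuppU; apply/asboolP => j /=; rewrite row_row'.
Qed.

Lemma cone_in k b c : C b -> c \in fsupp (@rows_in d C k) ->
  cone k b c \in fsupp (@rows_in d C k.+1).
Proof.
move=> Cb; apply: fsupp_lift => P PC; rewrite coneU fsuppU; apply/asboolP => i.
by case: (unliftP ord0 i) => [j|] ->; rewrite ?rowS_col_mx ?row0_col_mx.
Qed.

Hypothesis cvxC : cvx C.

Lemma bary_in k (P : 'M[R]_(k.+1, d)) : rows_in C P -> C (bary P).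
Proof.
apply: cvxC; split=> [i|]; first by rewrite mxE invr_ge0.
under eq_bigr do rewrite mxE.
by rewrite sumr_const card_ord -[LHS]mulr_natr mulVf // pnatr_eq0.
Qed.

Lemma asub_in k c : c \in fsupp (@rows_in d C k) -> asub k d c \in fsupp (@rows_in d C k).
Proof.
elim: k c => [//|k IH] c; apply: fsupp_lift => P PC.
rewrite asubU; apply: cone_in; first exact: bary_in.
by apply/IH/abd_in; rewrite fsuppU; apply/asboolP.
Qed.

End Carrier.

Lemma ahom_in d d' (C : set 'rV[R]_d) (C' : set 'rV[R]_d')
    (F G : forall k, {linear ach k d -> ach k d'}) b k (c : ach k d) :
  (forall k P, rows_in C P -> C' (b k.+1 P)) ->
  (forall k c, c \in fsupp (@rows_in _ C k) -> F k c \in fsupp (@rows_in _ C' k)) ->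
  (forall k c, c \in fsupp (@rows_in _ C k) -> G k c \in fsupp (@rows_in _ C' k)) ->
  c \in fsupp (@rows_in _ C k) -> ahom F G b k c \in fsupp (@rows_in _ C' k.+1).
Proof.
move=> Cb CF CG; elim: k c => [|k IH] c; first by rewrite /= rpred0.
apply: fsupp_lift => P PC; rewrite ahomU; apply: cone_in; first exact: Cb.
have sP : (<< P >> : ach k.+1 d) \in fsupp (@rows_in _ C k.+1) by rewrite fsuppU; apply/asboolP.
by rewrite !rpredB ?CF ?CG //; apply/IH/abd_in.
Qed.

Lemma simplex_cvx n : cvx (simplex R n).
Proof.
move=> k w P [w0 w1] PC; split=> [j|].
  rewrite mxE sumr_ge0 // => i _; rewrite mulr_ge0 //.
  by have [/(_ j)] := PC i; rewrite mxE.
under eq_bigr do rewrite mxE.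
rewrite exchange_big /= -[RHS]w1; apply: eq_bigr => i _.
rewrite -mulr_sumr -[RHS]mulr1; congr (_ * _); have [_ <-] := PC i.
by apply: eq_bigr => j _; rewrite mxE.
Qed.

Lemma ball_cvx d (x : 'rV[R]_d) e : cvx [set y | `|x - y| <= e].
Proof.
move=> k w P [w0 w1] PC /=; rewrite mulmx_sum_row.
have -> : x - \sum_i w 0 i *: row i P = \sum_i w 0 i *: (x - row i P).
  rewrite -{1}[x]scale1r -w1 scaler_suml -sumrB.
  by apply: eq_bigr => i _; rewrite scalerBr.
apply: le_trans (ler_norm_sum _ _ _) _; rewrite -[e]mul1r -w1 mulr_suml.
by apply: ler_sum => i _; rewrite normrZ ger0_norm // ler_wpM2l //; exact: PC.
Qed.

Definition adiam d e k : set 'M[R]_(k, d) :=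
  [set P | forall i j, `|row i P - row j P| <= e].

(** The difference is the mean of k + 1 vectors, of which one is 0 and the others have norm at most
    e. *)
Lemma bary_dist k d e (P : 'M[R]_(k.+1, d)) i : adiam e P ->
  `|bary P - row i P| <= k%:R / k.+1%:R * e.
Proof.
move=> Pe; have k0 : (k.+1%:R : R) != 0 by rewrite pnatr_eq0.
have -> : bary P - row i P = k.+1%:R^-1 *: \sum_j (row j P - row i P).
  rewrite /bary mulmx_sum_row sumrB sumr_const card_ord scalerBr scaler_sumr.
  rewrite -[row i P *+ _]scaler_nat scalerA mulVf // scale1r; congr (_ - _).
  by apply: eq_bigr => j _; rewrite mxE.
rewrite normrZ ger0_norm ?invr_ge0 // -mulrA mulrCA ler_wpM2l ?invr_ge0 //.
rewrite (bigD1 i) //= subrr add0r; apply: le_trans (ler_norm_sum _ _ _) _.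
apply: (@le_trans _ _ (\sum_(j < k.+1 | j != i) e)); first by apply: ler_sum.
by rewrite sumr_const cardC1 card_ord /= mulr_natl.
Qed.

(** The edges at the new apex are bounded by [bary_dist] and the convexity of balls, the other edges
    by induction on the faces. *)
Lemma asub_diam k d e c : 0 <= e -> c \in fsupp (@adiam d e k.+1) ->
  asub k.+1 d c \in fsupp (@adiam d (k%:R / k.+1%:R * e) k.+1).
Proof.
move=> e0; elim: k c => [|k IH] c; apply: fsupp_lift => P Pe.
  rewrite asubU abdU big_ord1 /= scale1r coneU fsuppU; apply/asboolP => i j.
  by rewrite !ord1 subrr normr0 !mul0r.
set e' := k.+1%:R / _ * e; have e'0 : 0 <= e' by rewrite !mulr_ge0 ?invr_ge0.
rewrite asubU.
have ee' : k%:R / k.+1%:R * e <= e'.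
  rewrite ler_wpM2r // ler_pdivrMr ?ltr0n // mulrAC ler_pdivlMr ?ltr0n //.
  by rewrite -!natrM ler_nat; nia.
have Pin : (<< P >> : ach k.+2 d) \in fsupp (@rows_in _ [set y | `|bary P - y| <= e'] k.+2).
  by rewrite fsuppU; apply/asboolP => i; apply: bary_dist.
have P1 : asub k.+1 d (abd k.+1 d << P >>) \in fsupp (@adiam d e' k.+1).
  apply: fsuppS (IH _ _) => [Q Qe i j|]; first exact: le_trans (Qe i j) ee'.
  rewrite abdU; apply: rpred_sum => i _; apply: rpredZ; rewrite fsuppU.
  by apply/asboolP => j l; rewrite !row_row'.
have P2 := asub_in (@ball_cvx _ _ _) (abd_in Pin).
move: (fsuppI P1 P2); apply: fsupp_lift => Q [Q1 Q2].
rewrite coneU fsuppU; apply/asboolP => i j.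
case: (unliftP ord0 i) => [i'|] ->; case: (unliftP ord0 j) => [j'|] ->;
  rewrite ?rowS_col_mx ?row0_col_mx.
- exact: Q1.
- by rewrite distrC; exact: Q2.
- exact: Q2.
- by rewrite subrr normr0.
Qed.

End AffineChains.

(** * Continuous retractions onto simplices and intervals *)

Lemma within_comp (T X Y : topologicalType) (A : set X) (f : T -> X) (h : X -> Y) :
  continuous f -> (forall x, A (f x)) -> {within A, continuous h} -> continuous (h \o f).
Proof.
move=> cf fA /subspace_sigL_continuousP ch.
pose f' x : A := exist _ (f x) (mem_set (fA x)).
have cf' : continuous f' by apply: continuous_comp_initial.
by move=> x; apply: (@continuous_comp _ _ _ f' (sigL A h)); [exact: cf' | exact: ch].
Qed.

Section Continuity.
Variable R : realType.

Lemma continuous_row (T : topologicalType) n (f : T -> 'rV[R]_n) :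
  (forall j, continuous (fun x => f x 0 j)) -> continuous f.
Proof.
move=> cf x; apply/cvg_ballP => e e0; rewrite near_map.
have : \forall y \near x, forall j, ball (f x 0 j) e (f y 0 j).
  by apply: filter_forall => j; have /cvg_ballP/(_ _ e0) := cf j x; rewrite near_map.
by apply: filterS => y fy; split=> // i j; rewrite ord1.
Qed.

Lemma continuous_coord (T : topologicalType) n (f : T -> 'rV[R]_n) j :
  continuous f -> continuous (fun x => f x 0 j).
Proof.
move=> cf x; apply: (@continuous_comp _ _ _ f (fun M : 'rV_n => M 0 j)).
  exact: cf.
exact: coord_continuous.
Qed.

Lemma continuous_bigsum (T : topologicalType) (I : Type) (r : seq I) (F : I -> T -> R) :
  (forall i, continuous (F i)) -> continuous (fun x => \sum_(i <- r) F i x).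
Proof.
move=> cF x; elim: r => [|i r IH].
  have -> : (fun y => \sum_(i <- [::]) F i y) = fun=> 0.
    by apply/funext => y; rewrite big_nil.
  exact: cvg_cst.
have -> : (fun y => \sum_(j <- i :: r) F j y) = fun y => F i y + \sum_(j <- r) F j y.
  by apply/funext => y; rewrite big_cons.
by apply: cvgD; [exact: cF | exact: IH].
Qed.

Lemma continuous_mulmx (T : topologicalType) n m (f : T -> 'rV[R]_n) (P : 'M[R]_(n, m)) :
  continuous f -> continuous (fun x => f x *m P).
Proof.
move=> cf; apply: continuous_row => j.
under eq_fun do rewrite mxE.
apply: continuous_bigsum => i x; apply: cvgM; last exact: cvg_cst.
exact: continuous_coord.
Qed.

(** A retraction of the coordinate space onto the simplex; through it singular simplices extend to
    the whole space and can be evaluated on affine chains. The defect [1 - s] is spread evenly over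
    the coordinates, which keeps the denominator at least 1. *)
Definition ret_fun n (v : 'rV[R]_n.+1) : 'rV[R]_n.+1 :=
  let s := \sum_i `|v 0 i| in
  \row_i ((`|v 0 i| + `|1 - s| / n.+1%:R) / (s + `|1 - s|)).

Lemma ret_simplex n (v : 'rV[R]_n.+1) : ret_fun v \in simplex R n.
Proof.
set s := \sum_i `|v 0 i|.
have s0 : 0 < s + `|1 - s|.
  by apply: (@lt_le_trans _ _ 1); [exact: ltr01 | rewrite -lerBlDl ler_norm].
apply/mem_set; split=> [i|].
  by rewrite mxE -/s divr_ge0 ?(ltW s0) // addr_ge0 // divr_ge0.
under eq_bigr do rewrite mxE -/s.
rewrite -mulr_suml big_split /= -/s sumr_const card_ord -[_ *+ _]mulr_natr.
by rewrite mulfVK ?pnatr_eq0 // divff // gt_eqF.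
Qed.

Lemma ret_id n (v : 'rV[R]_n.+1) : simplex R n v -> ret_fun v = v.
Proof.
move=> [v0 v1]; apply/rowP => i; rewrite mxE.
have -> : \sum_j `|v 0 j| = 1.
  by rewrite -[RHS]v1; apply: eq_bigr => j _; rewrite ger0_norm.
by rewrite subrr normr0 mul0r !addr0 divr1 ger0_norm.
Qed.

Lemma ret_continuous n : continuous (@ret_fun n).
Proof.
have cn i : continuous (fun v : 'rV[R]_n.+1 => `|v 0 i|).
  move=> v; have h := @continuous_coord 'rV[R]_n.+1 n.+1 id i (fun x => cvg_id).
  exact: cvg_norm (h v).
have cs := continuous_bigsum (r := index_enum _) cn.
have c1 : continuous (fun v : 'rV[R]_n.+1 => `|1 - \sum_i `|v 0 i| |).
  move=> v; apply: (@continuous_comp _ R R _ (fun x : R => `|1 - x|)); first exact: cs.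
  by apply: cvg_norm; apply: cvgB; [exact: cvg_cst | exact: cvg_id].
have gen (T : topologicalType) (f g s : T -> R) : continuous f -> continuous g ->
    continuous s -> (forall x, s x + g x != 0) ->
    continuous (fun x => (f x + g x / n.+1%:R) / (s x + g x)).
  move=> cf cg cs' s0 x; apply: cvgM; last by apply: cvgV => //; apply: cvgD; [exact: cs' | exact: cg].
  by apply: cvgD; [exact: cf | apply: cvgM; [exact: cg | exact: cvg_cst]].
apply: continuous_row => j; under eq_fun do rewrite mxE.
apply: gen => // v; rewrite gt_eqF //; apply: (@lt_le_trans _ _ 1); first exact: ltr01.
by rewrite -lerBlDl ler_norm.
Qed.

Definition ret n (v : 'rV[R]_n.+1) : simplex R n := exist _ (ret_fun v) (ret_simplex v).

Lemma continuous_ret n : continuous (@ret n).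
Proof. by apply: continuous_comp_initial; exact: ret_continuous. Qed.

Lemma ret_val n (v : simplex R n) : ret (set_val v) = v.
Proof. by apply/val_inj; rewrite /= ret_id //; exact: set_valP. Qed.

(** The nearest point of [0, 1], written with absolute values so that continuity is immediate. *)
Definition clamp (t : R) : R := (`|t| + 1 - `|t - 1|) / 2.

Lemma clamp_in t : 0 <= clamp t <= 1.
Proof.
by rewrite /clamp; case: (ger0P t) => t0; case: (ger0P (t - 1)) => t1; lra.
Qed.

Lemma clamp_id t : 0 <= t <= 1 -> clamp t = t.
Proof.
by move=> t01; rewrite /clamp ger0_norm ?ler0_norm; lra.
Qed.

Lemma continuous_clamp : continuous clamp.
Proof.
move=> t; apply: cvgM; last exact: cvg_cst.
apply: cvgB; first by apply: cvgD; [apply: cvg_norm; exact: cvg_id | exact: cvg_cst].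
by apply: cvg_norm; apply: cvgB; [exact: cvg_id | exact: cvg_cst].
Qed.

End Continuity.

(** * Singular operators defined by affine chains *)

Section Evaluation.
Variables (R : realType) (K : comNzRingType).
Local Notation ach k d := {freeg 'M[R]_(k, d) / K}.

Lemma rowmul_simplex k d (P : 'M[R]_(k.+1, d)) C (v : simplex R k) :
  cvx C -> rows_in C P -> C (set_val v *m P).
Proof. by move=> cC; apply: cC; exact: set_valP. Qed.

Lemma continuous_asimplex (X : topologicalType) d (g : 'rV[R]_d -> X) k
    (P : 'M[R]_(k.+1, d)) :
  continuous g -> continuous (fun v : simplex R k => g (set_val v *m P)).
Proof.
move=> cg v; apply: (@continuous_comp _ _ _ (fun v : simplex R k => set_val v *m P) g).
  by apply: continuous_mulmx; exact: initial_continuous.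
exact: cg.
Qed.

Definition asimplex (X : topologicalType) d (g : 'rV[R]_d -> X) (cg : continuous g) k
  (P : 'M[R]_(k.+1, d)) : sing R k X := mkcts (@continuous_asimplex _ _ _ k P cg).

Lemma asimplexE (X : topologicalType) d (g : 'rV[R]_d -> X) (cg : continuous g) k
  (P : 'M[R]_(k.+1, d)) v : asimplex cg P v = g (set_val v *m P).
Proof. by []. Qed.

(* [0] when [g] is not continuous. *)
Definition aeval (X : topologicalType) d (g : 'rV[R]_d -> X) k :
    {linear ach k.+1 d -> chain R K k X} :=
  flift (fun P => match pselect (continuous g) with
                  | left cg => << asimplex cg P >>
                  | right _ => 0 : chain R K k X
                  end).

Lemma aevalU (X : topologicalType) d (g : 'rV[R]_d -> X) (cg : continuous g) k
  (P : 'M[R]_(k.+1, d)) : aeval g k << P >> = << asimplex cg P >>.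
Proof.
rewrite fliftU; case: pselect => // cg'; congr << _ >>.
exact/continuousEP.
Qed.

(** The boundary [bdry], rebuilt on the locked [flift]. *)
Definition bd (X : topologicalType) n : {linear chain R K n.+1 X -> chain R K n X} :=
  flift (fun s => bdry R K n X << s >>).

Lemma bdE (X : topologicalType) n c : bd X n c = bdry R K n X c.
Proof. by apply: free_lift_ext => s; rewrite fliftU. Qed.

Lemma bdU (X : topologicalType) n (s : sing R n.+1 X) :
  bd X n << s >> = \sum_(i < n.+2) (-1) ^+ i *: << sing_face i s >>.
Proof. by rewrite bdE; exact: free_liftU. Qed.

Lemma sing_face_asimplex (X : topologicalType) d (g : 'rV[R]_d -> X) (cg : continuous g) k
  (P : 'M[R]_(k.+2, d)) i : sing_face i (asimplex cg P) = asimplex cg (row' i P).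
Proof.
apply/continuousEP => v; rewrite asimplexE /sing_face /= asimplexE; congr g.
rewrite [face _ _ _]/= !mulmx_sum_row (bigD1_ord i) //= mxE unlift_none scale0r add0r.
by apply: eq_bigr => j _; rewrite mxE liftK row_row'.
Qed.

Lemma bd_aeval (X : topologicalType) d (g : 'rV[R]_d -> X) k c :
  bd X k (aeval g k.+1 c) = aeval g k (abd R K k.+1 d c).
Proof.
apply: (@free_lift_ext _ _ _ (bd X k \o aeval g k.+1) (aeval g k \o abd R K k.+1 d)) => P /=.
case: (pselect (continuous g)) => [cg|ncg].
  rewrite aevalU bdU abdU linear_sum; apply: eq_bigr => i _.
  by rewrite linearZ /= (aevalU cg) sing_face_asimplex.
have z l c' : aeval g l c' = 0.
  apply: (@free_lift_ext _ _ _ (aeval g l) \0) => Q /=; rewrite fliftU.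
  by case: pselect.
by rewrite !z linear0.
Qed.

(** The values of [g] matter only on the convex hulls of the vertices. *)
Lemma aeval_local (X : topologicalType) d d' (g : 'rV[R]_d -> X) (g' : 'rV[R]_d' -> X)
    (C : set 'rV[R]_d) (D : 'M[R]_(d, d')) k (c : ach k.+1 d) :
  continuous g -> continuous g' ->
  cvx C -> (forall v, C v -> g v = g' (v *m D)) -> c \in fsupp (@rows_in _ _ C k.+1) ->
  aeval g k c = aeval g' k (avmap K k.+1 (mulmxr D) c).
Proof.
move=> cg cg' cC gg'.
apply: (eq_on_fsupp (F := aeval g k) (G := aeval g' k \o avmap K k.+1 (mulmxr D))).
move=> P PC; rewrite /= avmapU !aevalU; congr << _ >>; apply/continuousEP => v.
rewrite !asimplexE gg'; last exact: rowmul_simplex.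
rewrite -mulmxA; congr (g' (_ *m _)); apply/row_matrixP => i.
by rewrite rowK row_mul.
Qed.

Lemma aeval_in (X : topologicalType) d (g : 'rV[R]_d -> X) (C : set 'rV[R]_d) (A : set X)
    k (c : ach k.+1 d) :
  cvx C -> (forall v, C v -> A (g v)) -> c \in fsupp (@rows_in _ _ C k.+1) ->
  aeval g k c \in chain_in A.
Proof.
move=> cC gA; apply: fsupp_lift => P PC.
rewrite fliftU; case: pselect => [cg|_]; last exact: rpred0.
rewrite fsuppU; apply/asboolP => _ [v _ <-]; rewrite asimplexE; apply: gA.
exact: rowmul_simplex.
Qed.

End Evaluation.

Arguments aeval {R K X d} g k.
Arguments bd {R K X n}.

Section Operators.
Variables (R : realType) (K : comNzRingType).
Local Notation ach k d := {freeg 'M[R]_(k, d) / K}.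

Definition prism d : set 'rV[R]_(d.+1 + 1) :=
  [set v | simplex R d (lsubmx v) /\ 0 <= v 0 (rshift d.+1 0) <= 1].

Lemma prism_cvx d : cvx (@prism d).
Proof.
move=> k w P wS PC; split.
  have -> : lsubmx (w *m P) = w *m lsubmx P.
    by rewrite -{1}[P]hsubmxK mul_mx_row row_mxKl.
  apply: simplex_cvx => // i; have [+ _] := PC i; congr (simplex R d _).
  by apply/rowP => j; rewrite !mxE.
have [w0 w1] := wS; rewrite mxE; apply/andP; split.
  rewrite sumr_ge0 // => i _; rewrite mulr_ge0 //.
  by have [_ /andP[]] := PC i; rewrite mxE.
rewrite -[leRHS]w1; apply: ler_sum => i _; rewrite -[leRHS]mulr1 ler_wpM2l //.
by have [_ /andP[]] := PC i; rewrite mxE.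
Qed.

Section Operator.
Variables (X Y : topologicalType) (h : X * R -> Y).

(** [h] after s x id on the prism, extended to the ambient space by [ret] and [clamp]. *)
Definition hev k (s : sing R k X) (v : 'rV[R]_(k.+1 + 1)) : Y :=
  h (s (ret (lsubmx v)), clamp (v 0 (rshift k.+1 0))).

(* Natural operators on singular chains, given by a chain [tau] in the prism over
   the standard simplex. *)
Definition sop k l (tau : ach l.+1 (k.+1 + 1)) : {linear chain R K k X -> chain R K l Y} :=
  flift (fun s => aeval (hev s) l tau).

(** [h] will be continuous over a subset of [X] only; boundary formulas are restricted to simplices
    for which the evaluation is continuous. *)
Definition admissible k : set (sing R k X) := [set s | continuous (hev s)].

Lemma sopU k l (tau : ach l.+1 (k.+1 + 1)) s : sop tau << s >> = aeval (hev s) l tau.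
Proof. exact: fliftU. Qed.

Lemma bd_sop k l (tau : ach l.+2 (k.+1 + 1)) c :
  bd (sop tau c) = sop (abd R K l.+1 _ tau) c.
Proof.
apply: (@free_lift_ext _ _ _ (@bd R K Y l \o sop tau) (sop (abd R K l.+1 _ tau))) => s.
by rewrite /= !sopU bd_aeval.
Qed.

Lemma sopD k l (tau tau' : ach l.+1 (k.+1 + 1)) c : sop (tau + tau') c = sop tau c + sop tau' c.
Proof.
apply: (@free_lift_ext _ _ _ (sop (tau + tau')) (sop tau \+ sop tau')) => s.
by rewrite /= !sopU linearD.
Qed.

Lemma sopZ k l a (tau : ach l.+1 (k.+1 + 1)) c : sop (a *: tau) c = a *: sop tau c.
Proof.
apply: (@free_lift_ext _ _ _ (sop (a *: tau)) (a \*: sop tau)) => s.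
by rewrite /= !sopU linearZ.
Qed.

Lemma sopB k l (tau tau' : ach l.+1 (k.+1 + 1)) c : sop (tau - tau') c = sop tau c - sop tau' c.
Proof. by rewrite -scaleN1r sopD sopZ scaleN1r. Qed.

Definition xlift d d' (D : 'M[R]_(d, d')) (v : 'rV[R]_(d + 1)) : 'rV[R]_(d' + 1) :=
  v *m block_mx D 0 0 1.

Lemma xliftE d d' (D : 'M[R]_(d, d')) v :
  xlift D v = row_mx (lsubmx v *m D) (rsubmx v).
Proof.
rewrite /xlift -{1}[v]hsubmxK mul_row_block !mulmx0 addr0 add0r.
by congr (row_mx _ _); rewrite mulmx1.
Qed.

(** Compatibility with D x id. Applied to the faces of the model it makes the boundary formula of an
    affine operator pass to singular chains. *)
Definition natural m l (F : forall d, {linear ach m d -> ach l (d + 1)}) : Prop :=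
  forall d d' (D : 'M[R]_(d, d')) c,
    avmap K l (xlift D) (F d c) = F d' (avmap K m (mulmxr D) c).

Lemma face_mulmx k (i : 'I_k.+2) (v : simplex R k) :
  set_val (face_fun i v) = set_val v *m row' i 1%:M.
Proof.
rewrite [LHS]/= mulmx_sum_row; apply/rowP => j; rewrite mxE summxE.
case: unliftP => [l|] ->.
  rewrite (bigD1 l) //= big1 ?addr0; first by rewrite !mxE eqxx mulr1.
  by move=> m ml; rewrite !mxE (inj_eq lift_inj) (negPf ml) mulr0.
by rewrite big1 // => m _; rewrite !mxE eq_sym (negPf (neq_lift _ _)) mulr0.
Qed.

(* Faces of singular simplices become faces of the model. *)
Lemma sop_bd k l (F : forall d, {linear ach k.+1 d -> ach l.+1 (d + 1)}) c :
  natural F -> F k.+1 << 1%:M >> \in fsupp (@rows_in _ _ (@prism k) l.+1) ->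
  c \in fsupp (@admissible k.+1) ->
  (forall s i, @admissible k.+1 s -> admissible (sing_face i s)) ->
  sop (F k.+1 << 1%:M >>) (bd c) =
  sop (F k.+2 (abd R K k.+1 k.+2 << 1%:M >>)) c.
Proof.
move=> nF Fin; set F1 := F _ _ => cadm fadm.
apply: (eq_on_fsupp (F := sop F1 \o @bd R K X k)
  (G := sop (F k.+2 (abd R K k.+1 k.+2 << 1%:M >>))) _ cadm) => s sadm.
rewrite /= sopU bdU abdU !linear_sum; apply: eq_bigr => i _.
rewrite !linearZ /= sopU; congr (_ *: _).
have -> : F k.+2 << row' i 1%:M >> = avmap K l.+1 (xlift (row' i 1%:M)) F1.
  rewrite nF avmapU; congr (F _ << _ >>); apply/row_matrixP => j.
  by rewrite rowK /= -row_mul mul1mx.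
apply: (@aeval_local _ _ _ _ _ _ _ (@prism k)) => //.
- exact: fadm.
- exact: prism_cvx.
move=> v [v1 v2]; rewrite /hev -/(xlift _ v) xliftE row_mxKl row_mxEr.
congr (h (_, clamp _)); last by rewrite mxE.
rewrite /sing_face /=; congr (s _); apply/val_inj.
have rv : set_val (ret (lsubmx v)) = lsubmx v by exact: ret_id.
rewrite [LHS]face_mulmx rv; symmetry; apply: ret_id; apply: simplex_cvx => // j.
rewrite row_row' row1; split=> [m|]; first by rewrite mxE eqxx; case: eqP.
rewrite (bigD1 (lift i j)) //= big1 ?addr0; first by rewrite mxE !eqxx.
by move=> m /negPf ml; rewrite mxE ml andbF.
Qed.

Lemma sop_in k l (tau : ach l.+1 (k.+1 + 1)) (A : set X) (B : set Y) c :
  (forall x t, A x -> 0 <= t <= 1 -> B (h (x, t))) ->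
  tau \in fsupp (@rows_in _ _ (@prism k) l.+1) ->
  c \in chain_in A -> sop tau c \in chain_in B.
Proof.
move=> hAB tin; apply: fsupp_lift => s sA; rewrite sopU.
apply: aeval_in (@prism_cvx k) _ tin => v _; apply: hAB; last exact: clamp_in.
by apply: sA; exists (ret (lsubmx v)).
Qed.
End Operator.

End Operators.
(** * Barycentric subdivision and excision *)

Section SubdivisionHomotopy.
Variables (R : realType) (K : comNzRingType).
Local Notation ach k d := {freeg 'M[R]_(k, d) / K}.

Local Notation family := (forall m d, {linear ach m d -> ach m (d + 1)}).

Lemma avmap_comp k d d' d'' (f : 'rV[R]_d -> 'rV[R]_d') (g : 'rV[R]_d' -> 'rV[R]_d'') c :
  avmap K k g (avmap K k f c) = avmap K k (g \o f) c.
Proof.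
apply: (@free_lift_ext _ _ _ (avmap K k g \o avmap K k f) (avmap K k (g \o f))) => P /=.
by rewrite !avmapU; congr << _ >>; apply/row_matrixP => i; rewrite !rowK.
Qed.

Lemma eq_avmap k d d' (f g : 'rV[R]_d -> 'rV[R]_d') c :
  f =1 g -> avmap K k f c = avmap K k g c.
Proof.
move=> fg; apply: (@free_lift_ext _ _ _ (avmap K k f) (avmap K k g)) => P.
by rewrite !avmapU; congr << _ >>; apply/row_matrixP => i; rewrite !rowK.
Qed.

Definition emb d (t : R) (v : 'rV[R]_d) : 'rV[R]_(d + 1) := row_mx v (const_mx t).

Lemma xlift_emb d d' (D : 'M[R]_(d, d')) t v : xlift D (emb t v) = emb t (v *m D).
Proof. by rewrite xliftE row_mxKl row_mxKr. Qed.

Lemma emb_prism d t (v : 'rV[R]_d.+1) : 0 <= t <= 1 -> simplex R d v -> prism (emb t v).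
Proof. by move=> t01 vS; split; rewrite ?row_mxKl // row_mxEr mxE. Qed.

Definition Aemb t m d : {linear ach m d -> ach m (d + 1)} := avmap K m (@emb d t).
Definition Asub m d : {linear ach m d -> ach m (d + 1)} :=
  avmap K m (@emb d 0) \o asub R K m d.
(** One homotopy serves twice: between [Aemb 0] and [Asub] it gives the subdivision homotopy,
    between [Aemb 1] and [Aemb 0] the prism operator. The apexes lie at height 0, but any points of
    the convex prism that depend naturally on the simplex would serve. *)
Definition Ahom (F G : family) m d :
    {linear ach m d -> ach m.+1 (d + 1)} :=
  ahom (fun m => F m d) (fun m => G m d) (fun k P => emb 0 (bary P)) m.

Lemma Aemb_natural t m : natural (Aemb t m).
Proof.
by move=> d d' D c; rewrite /Aemb !avmap_comp; apply: eq_avmap => v; exact: xlift_emb.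
Qed.

Lemma Asub_natural m : natural (Asub m).
Proof.
move=> d d' D c; rewrite /Asub /= -avmap_asub !avmap_comp.
by apply: eq_avmap => v; exact: xlift_emb.
Qed.

Lemma Ahom_natural F G : (forall m, natural (F m)) -> (forall m, natural (G m)) ->
  forall m, natural (Ahom F G m).
Proof.
move=> nF nG m d d' D c; apply: avmap_ahom => [k P|k c'|k c'].
- by rewrite xlift_emb -[_ *m D]/(mulmxr D _) bary_mulmx.
- exact: nF.
- exact: nG.
Qed.

Lemma abd_Aemb t m d c : abd R K m _ (Aemb t m.+1 d c) = Aemb t m d (abd R K m d c).
Proof. exact: abd_avmap. Qed.

Lemma abd_Asub m d c : abd R K m _ (Asub m.+1 d c) = Asub m d (abd R K m d c).
Proof. by rewrite /Asub /= abd_avmap abd_asub. Qed.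

Definition chainmap (F : family) : Prop :=
  [/\ forall m, natural (F m),
      forall m d c, abd R K m _ (F m.+1 d c) = F m d (abd R K m d c) &
      forall m d (c : ach m d.+1), c \in fsupp (@rows_in _ _ (simplex R d) m) ->
        F m d.+1 c \in fsupp (@rows_in _ _ (@prism R d) m)].

Lemma avmap_in k d d' (f : 'rV[R]_d -> 'rV[R]_d') (C : set 'rV[R]_d) (C' : set 'rV[R]_d') c :
  (forall v, C v -> C' (f v)) -> c \in fsupp (@rows_in _ _ C k) ->
  avmap K k f c \in fsupp (@rows_in _ _ C' k).
Proof.
move=> fC; apply: fsupp_lift => P PC; rewrite avmapU fsuppU.
by apply/asboolP => i; rewrite rowK; exact: fC.
Qed.

Lemma Aemb_chainmap t : 0 <= t <= 1 -> chainmap (Aemb t).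
Proof.
move=> t01; split; [exact: Aemb_natural | exact: abd_Aemb |].
by move=> m d c; apply: avmap_in => v; exact: emb_prism.
Qed.

Lemma Asub_chainmap : chainmap Asub.
Proof.
split; [exact: Asub_natural | exact: abd_Asub |].
move=> m d c cS; apply: avmap_in (asub_in (@simplex_cvx _ _) cS) => v.
by apply: emb_prism; rewrite lexx ler01.
Qed.

Lemma Ahom_in F G m d (c : ach m d.+1) : chainmap F -> chainmap G ->
  c \in fsupp (@rows_in _ _ (simplex R d) m) ->
  Ahom F G m d.+1 c \in fsupp (@rows_in _ _ (@prism R d) m.+1).
Proof.
move=> [_ _ Fin] [_ _ Gin]; apply: ahom_in => [k P PS|k c'|k c'].
- by apply: emb_prism; [rewrite lexx ler01 | apply: bary_in => //; exact: simplex_cvx].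
- exact: Fin.
- exact: Gin.
Qed.

Lemma id_simplex k : (<< 1%:M >> : ach k.+1 k.+1) \in fsupp (@rows_in _ _ (simplex R k) k.+1).
Proof.
rewrite fsuppU; apply/asboolP => j; rewrite row1; split=> [m|].
  by rewrite mxE eqxx; case: eqP.
rewrite (bigD1 j) //= big1 ?addr0; first by rewrite mxE !eqxx.
by move=> m /negPf ml; rewrite mxE ml andbF.
Qed.

Section Operators.
Variables (X Y : topologicalType).
Local Notation ch k := (chain R K k).

(** Read as 0 in degree 0, so that homotopy formulas take one form in all degrees. *)
Definition prebd (H : forall k, {linear ch k X -> ch k.+1 Y}) k : ch k X -> ch k Y :=
  match k with 0 => fun=> 0 | l.+1 => fun c => H l (bd c) end.

Variable h : X * R -> Y.
Definition cop (F : family) k : {linear ch k X -> ch k Y} := sop h (F k.+1 k.+1 << 1%:M >> : ach k.+1 _).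
Definition hop (F G : family) k : {linear ch k X -> ch k.+1 Y} :=
  sop h (Ahom F G k.+1 k.+1 << 1%:M >>).

Lemma bd_cop F k c : chainmap F -> c \in fsupp (@admissible R _ _ h k.+1) ->
  (forall s i, @admissible R _ _ h k.+1 s -> admissible h (sing_face i s)) ->
  bd (cop F k.+1 c) = cop F k (bd c).
Proof.
move=> [Fn Fb Fi] cA fA; rewrite bd_sop (sop_bd (F := F k.+1)) //.
  by congr (sop h _ c); rewrite Fb.
exact/Fi/id_simplex.
Qed.

Lemma bd_hop F G k c : chainmap F -> chainmap G -> (forall d, F 0%N d =1 G 0%N d) ->
  c \in fsupp (@admissible R _ _ h k) ->
  (forall l s i, @admissible R _ _ h l.+1 s -> admissible h (sing_face i s)) ->
  bd (hop F G k c) = cop F k c - cop G k c - prebd (hop F G) c.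
Proof.
move=> cF cG FG0 cA fA; have [Fn Fb Fi] := cF; have [Gn Gb Gi] := cG.
rewrite bd_sop abd_ahom //.
rewrite !sopB; congr (_ - _); case: k c cA => [|k] c cA /=.
  by rewrite /sop; apply: (@free_lift_ext _ _ _ (sop h _) \0) => s /=; rewrite sopU linear0.
rewrite (sop_bd (F := Ahom F G k.+1)) //; last exact: fA.
  exact: Ahom_natural.
by apply: Ahom_in => //; exact: id_simplex.
Qed.
End Operators.

End SubdivisionHomotopy.

HB.lock Definition Sd (R : realType) (K : comNzRingType) (X : topologicalType) k :
  {linear chain R K k X -> chain R K k X} := cop (fst : X * R -> X) (@Asub R K) k.
HB.lock Definition Td (R : realType) (K : comNzRingType) (X : topologicalType) k :
  {linear chain R K k X -> chain R K k.+1 X} :=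
  hop (fst : X * R -> X) (Aemb K 0) (@Asub R K) k.

Section Subdivision.
Variables (R : realType) (K : comNzRingType) (X : topologicalType).
Local Notation ch k := (chain R K k X).
Local Notation fstX := (fst : X * R -> X).

(** Small chains, with [Q] deciding which ranges count as small. *)
Definition csup k (Q : set (set X)) : {pred ch k} := fsupp [set s : sing R k X | Q (range s)].
HB.instance Definition _ k Q := GRing.SubmodClosed.on (@csup k Q).

Definition downclosed (Q : set (set X)) : Prop := forall A B, A `<=` B -> Q B -> Q A.

Definition local_op k l (F : {linear ch k -> ch l}) : Prop :=
  forall s, F << s >> \in chain_in (range s).

Lemma local_op_in k l (F : {linear ch k -> ch l}) Q c : local_op F -> downclosed Q ->
  c \in csup Q -> F c \in csup Q.
Proof.
move=> lF dQ; apply: fsupp_lift => s Qs; apply: fsuppS (lF s) => t ts.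
exact: dQ ts Qs.
Qed.

Lemma continuous_ret_sing k (s : sing R k X) : continuous (s \o @ret R k).
Proof. by move=> v; apply: continuous_comp; [exact: continuous_ret | exact: cts_fun]. Qed.

Lemma continuous_lsubmx m n : continuous (fun v : 'rV[R]_(m + n) => lsubmx v).
Proof.
apply: continuous_row => j; under eq_fun do rewrite mxE.
exact: coord_continuous.
Qed.

Lemma hev_fst_continuous k (s : sing R k X) : continuous (hev fstX s).
Proof.
move=> v; apply: (@continuous_comp _ _ _ (fun v => lsubmx v) (s \o @ret R k)).
  exact: continuous_lsubmx.
exact: continuous_ret_sing.
Qed.

Lemma admissible_fst k (c : ch k) : c \in fsupp (@admissible R _ _ fstX k).
Proof. by apply: fsuppS (fsuppT c) => s _; exact: hev_fst_continuous. Qed.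

Local Notation Sd := (@Sd R K X).
Local Notation Td := (@Td R K X).

Let zero01 : ((0 : R) <= 0) && ((0 : R) <= 1). Proof. by rewrite lexx ler01. Qed.

Lemma bd_Sd k (c : ch k.+1) : bd (Sd k.+1 c) = Sd k (bd c).
Proof.
rewrite Sd.unlock; apply: bd_cop (@Asub_chainmap R K) (admissible_fst c) _ => s i _.
exact: hev_fst_continuous.
Qed.

Lemma cop_fst_sub k tau s : tau \in fsupp (@rows_in _ _ (simplex R k) k.+1) ->
  sop fstX (avmap K k.+1 (@emb R k.+1 0) tau) << s >> = aeval (s \o @ret R k) k tau.
Proof.
move=> tS; rewrite sopU (aeval_local (D := row_mx 1%:M 0) (C := simplex R k)
  (g := s \o @ret R k) (g' := hev fstX s)) //.
- congr (aeval _ _ _); apply: eq_avmap => v /=.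
  by rewrite mul_mx_row mulmx1 mulmx0 /emb; congr row_mx; apply/rowP => i; rewrite !mxE.
- exact: continuous_ret_sing.
- exact: hev_fst_continuous.
- exact: simplex_cvx.
by move=> v _; rewrite /hev /= mul_mx_row mulmx1 row_mxKl.
Qed.

Lemma aeval_id k (s : sing R k X) : aeval (s \o @ret R k) k << 1%:M >> = << s >> :> ch k.
Proof.
rewrite (aevalU _ (@continuous_ret_sing _ s)); congr << _ >>; apply/continuousEP => v.
by rewrite asimplexE mulmx1 /= ret_val.
Qed.

Lemma bd_Td k (c : ch k) : bd (Td k c) = c - Sd k c - prebd Td c.
Proof.
have E : cop fstX (Aemb K 0) k c = c.
  apply: (@free_lift_ext _ _ _ (cop fstX (Aemb K 0) k) idfun) => s.
  by rewrite cop_fst_sub ?aeval_id //; exact: id_simplex.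
rewrite Td.unlock Sd.unlock bd_hop ?E //.
- exact: Aemb_chainmap zero01.
- exact: Asub_chainmap.
- exact: admissible_fst.
by move=> l s i _; exact: hev_fst_continuous.
Qed.

Lemma sop_fst_local k l (tau : {freeg 'M[R]_(l.+1, k.+1 + 1) / K}) :
  tau \in fsupp (@rows_in _ _ (@prism R k) l.+1) -> local_op (sop fstX tau).
Proof.
move=> tin s; apply: (sop_in (A := range s)) => //.
by rewrite fsuppU; apply/asboolP.
Qed.

Lemma Sd_local k : local_op (Sd k).
Proof. by rewrite Sd.unlock; apply: sop_fst_local; have [_ _] := @Asub_chainmap R K; apply; exact: id_simplex. Qed.

Lemma Td_local k : local_op (Td k).
Proof.
rewrite Td.unlock; apply: sop_fst_local; apply: Ahom_in; last exact: id_simplex.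
  exact: Aemb_chainmap zero01.
exact: Asub_chainmap.
Qed.

(** The sum of T Sd^j over j < N, a homotopy between the identity and Sd^N. *)
Fixpoint TdN N k : {linear ch k -> ch k.+1} :=
  if N is N.+1 then Td k \+ (TdN N k \o Sd k) else \0.

Lemma bd_TdN N k (c : ch k) : bd (TdN N k c) = c - iter N (Sd k) c - prebd (TdN N) c.
Proof.
elim: N k c => [|N IH] k c; first by rewrite /= linear0 subrr sub0r; case: k c => [|k] c /=; rewrite oppr0.
rewrite [TdN N.+1 k c]/= linearD /= bd_Td IH.
have -> : iter N (Sd k) (Sd k c) = Sd k (iter N (Sd k) c) by rewrite -iterSr.
have -> : prebd (TdN N.+1) c = prebd Td c + prebd (TdN N) (Sd k c).
  by case: k c => [|k] c; rewrite /= ?addr0 ?bd_Sd.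
zmod.
Qed.

Lemma TdN_local N k : local_op (TdN N k).
Proof.
elim: N => [|N IH] s /=; first exact: rpred0.
rewrite rpredD //; first exact: Td_local.
apply: (local_op_in (Q := fun B => B `<=` range s) IH); last exact: Sd_local.
by move=> A B AB Bs; move=> x /AB /Bs.
Qed.

Lemma bd_in Q k (c : ch k.+1) : downclosed Q -> c \in csup Q -> bd c \in csup Q.
Proof.
move=> dQ; apply: fsupp_lift => s Qs; rewrite bdU; apply: rpred_sum => i _.
apply: rpredZ; rewrite fsuppU; apply/asboolP; apply: dQ Qs => _ [v _ <-].
by exists (face R i v).
Qed.

Lemma iter_Sd_in Q N k (c : ch k) : downclosed Q -> c \in csup Q -> iter N (Sd k) c \in csup Q.
Proof. by move=> dQ cQ; elim: N => //= N; apply: local_op_in => //; exact: Sd_local. Qed.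

(** Reduces the subdivision of singular simplices to that of the model simplex, where diameters are
    measured. *)
Lemma Sd_aeval d (g : 'rV[R]_d -> X) k tau :
  Sd k (aeval g k tau) = aeval g k (asub R K k.+1 d tau).
Proof.
apply: (@free_lift_ext _ _ _ (Sd k \o aeval g k) (aeval g k \o asub R K k.+1 d)) => P.
change (Sd k (aeval g k << P >>) = aeval g k (asub R K k.+1 d << P >>)).
case: (pselect (continuous g)) => cg; last first.
  have z c : aeval g k c = 0 :> ch k.
    by apply: (@free_lift_ext _ _ _ (aeval g k) \0) => Q /=; rewrite fliftU; case: pselect.
  by rewrite !z linear0.
have S1 := asub_in (@simplex_cvx _ _) (id_simplex R K k).
rewrite (aevalU _ cg) Sd.unlock [LHS]cop_fst_sub //.
rewrite (aeval_local (g' := g) (D := P) (C := simplex R k)) //.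
- by rewrite avmap_asub avmapU; congr (aeval g k (asub _ _ _ _ << _ >>)); apply/row_matrixP => i;
    rewrite rowK /= -row_mul mul1mx.
- exact: continuous_ret_sing.
- exact: simplex_cvx.
by move=> v vS; congr (g (_ *m P)); exact: ret_id.
Qed.

Lemma iter_Sd_sing N k (s : sing R k X) :
  iter N (Sd k) << s >> = aeval (s \o @ret R k) k (iter N (asub R K k.+1 k.+1) << 1%:M >>).
Proof. by elim: N => [|N IH] /=; rewrite ?aeval_id // IH Sd_aeval. Qed.

End Subdivision.
Arguments csup {R K X k} Q.
Arguments Sd {R K X k}.
Arguments Td {R K X k}.
Arguments TdN {R K X} N {k}.

(** * Small chains *)

Section SmallChains.
Variables (R : realType) (K : comNzRingType) (X : topologicalType).
Local Notation ch k := (chain R K k X).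

Lemma simplex_compact n : compact (simplex R n : set 'rV[R]_n.+1).
Proof.
apply: (@subclosed_compact _ _ [set v : 'rV[R]_n.+1 | forall i, `[0, 1]%classic (v 0 i)]).
- have -> : (simplex R n : set 'rV[R]_n.+1) =
    \bigcap_(i in setT) ((fun v : 'rV[R]_n.+1 => v 0 i) @^-1` [set x | 0 <= x]) `&`
    (fun v : 'rV[R]_n.+1 => \sum_i v 0 i) @^-1` [set 1].
    by apply/seteqP; split=> v [v0 v1]; split => // i; [move=> _; exact: v0 | exact: v0].
  apply: closedI; first apply: closed_bigI => i _.
    apply: closed_comp; last exact: closed_ge.
    by move=> v _; exact: coord_continuous.
  apply: closed_comp; last exact: closed_eq.
  by move=> v _; apply: continuous_bigsum => i; exact: coord_continuous.
- by apply: (@rV_compact R n.+1 (fun=> `[0, 1]%classic)) => i; exact: segment_compact.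
move=> v [v0 v1] i; rewrite /= in_itv /= v0 -v1 (bigD1 i) //= lerDl.
by rewrite sumr_ge0.
Qed.

Definition nbhd_small (Q : set (set X)) (A : set X) : Prop :=
  forall x, A x -> exists2 U, nbhs x U & Q U.

(** A Lebesgue number for the cover of the simplex by preimages of small neighborhoods. *)
Lemma lebesgue_simplex k (s : sing R k X) Q : downclosed Q -> nbhd_small Q (range s) ->
  exists2 e : R, 0 < e & forall v, simplex R k v ->
    Q ((s \o @ret R k) @` ball v e).
Proof.
move=> dQ sQ.
have := @compact_near_coveringP _ (simplex R k : set 'rV[R]_k.+1).
case=> /(_ (@simplex_compact k)) nc _.
have [|e /= e0 He] := nc R 0^'+ (fun e v => Q ((s \o @ret R k) @` ball v e)).
  move=> v vS; have [|U Us QU] := sQ ((s \o @ret R k) v); first by exists (ret v).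
  have /nbhs_ballP[e /= e0 eU] := @continuous_ret_sing R X k s v U Us.
  exists (ball v (e / 2), [set d | d < e / 2 /\ 0 < d]).
    split; first by apply: nbhsx_ballx; rewrite divr_gt0.
    exists (e / 2); first by rewrite /= divr_gt0.
    by move=> d /=; rewrite sub0r normrN => de d0; split=> //; rewrite -(gtr0_norm d0).
  move=> [w d] [/= vw [de d0]]; apply: dQ QU => _ [u wu <-]; apply: eU.
  rewrite [e]splitr; apply: ball_triangle vw _; apply: le_ball wu; exact: ltW.
exists (e / 2); first by rewrite divr_gt0.
move=> v vS; apply: (He (e / 2)) => //=; last by rewrite divr_gt0.
by rewrite sub0r normrN gtr0_norm ?divr_gt0 // ltr_pdivrMr // ltr_pMr // ltr1n.
Qed.

Lemma Sd_small_sing k (s : sing R k X) Q : downclosed Q -> nbhd_small Q (range s) ->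
  exists N, iter N (@Sd R K X k) << s >> \in csup Q.
Proof.
move=> dQ /(lebesgue_simplex dQ) [e e0 eQ].
(* The factor by which one subdivision shrinks diameters; 2 bounds the diameter of the model
   simplex. *)
pose rho : R := k%:R / k.+1%:R.
have rho0 : 0 <= rho by rewrite divr_ge0.
have [N rN] : exists N, rho ^+ N * 2 < e.
  have rho1 : `|rho| < 1 by rewrite ger0_norm // ltr_pdivrMr // mul1r ltr_nat.
  have /cvgrPdist_lt/(_ (e / 2)) := cvg_expr rho1.
  case; first by rewrite divr_gt0.
  move=> N _ /(_ N (leqnn _)); rewrite sub0r normrN ger0_norm ?exprn_ge0 // => h.
  by exists N; rewrite -ltr_pdivlMr.
exists N; rewrite iter_Sd_sing.
have inS : iter N (asub R K k.+1 k.+1) << 1%:M >> \in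
    fsupp (@rows_in _ _ (simplex R k) k.+1).
  elim: (N) => [|M IH]; first exact: id_simplex.
  by rewrite iterS; apply: asub_in IH; exact: simplex_cvx.
have inD : iter N (asub R K k.+1 k.+1) << 1%:M >> \in
    fsupp (@adiam R k.+1 (rho ^+ N * 2) k.+1).
  elim: (N) => [|M IH]; last first.
    by rewrite iterS exprS -mulrA; apply: asub_diam => //; rewrite mulr_ge0 ?exprn_ge0.
  rewrite fsuppU; apply/asboolP => i j; rewrite expr0 mul1r !row1.
  have n1 l : `|'e_l : 'rV[R]_k.+1| <= 1.
    have [->|/mx_norm_neq0[a]] := eqVneq `|'e_l : 'rV[R]_k.+1| 0; first exact: ler01.
    move=> e1; rewrite [leLHS]e1 mxE; case: (_ && _); rewrite ?normr1 ?normr0 //; exact: ler01.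
  by apply: le_trans (ler_normB _ _) _; rewrite -[2]/(1 + 1) lerD.
move: (fsuppI inS inD); apply: fsupp_lift => P [PS PD].
rewrite (aevalU _ (@continuous_ret_sing _ _ _ s)) fsuppU; apply/asboolP.
apply: dQ (eQ (row 0 P) (PS 0)) => _ [v _ <-]; exists (set_val v *m P) => //.
rewrite -ball_normE /=; apply: le_lt_trans rN.
apply: (@ball_cvx _ _ (row 0 P) _ k); first exact: set_valP.
by move=> i; exact: PD.
Qed.

Lemma Sd_small k (c : ch k) A Q : downclosed Q -> nbhd_small Q A -> c \in chain_in A ->
  exists N0, forall N, (N0 <= N)%N -> iter N Sd c \in csup Q.
Proof.
move=> dQ sQ; apply: (fsupp_ind (P := fun c =>
    exists N0, forall N, (N0 <= N)%N -> iter N Sd c \in csup Q)).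
- by exists 0 => N _; elim: N => [|N IH] /=; rewrite ?rpred0 // (local_op_in _ dQ IH) //; exact: Sd_local.
- move=> a x y [N1 H1] [N2 H2]; exists (maxn N1 N2) => N; rewrite geq_max => /andP[l1 l2].
  have -> : iter N Sd (a *: x + y) = a *: iter N Sd x + iter N Sd y.
    by elim: (N) => //= M ->; rewrite linearP.
  by rewrite rpredD ?rpredZ ?H1 ?H2.
move=> s sA; have [|N0 HN] := @Sd_small_sing k s Q dQ; first by move=> x /sA /sQ.
by exists N0 => N /subnK <-; rewrite iterD iter_Sd_in.
Qed.

(* [bd c] lies in [csup Q]; no condition in degree [0]. *)
Definition bcond k (Q : set (set X)) : ch k -> Prop :=
  if k is l.+1 then fun c => bd c \in csup Q else fun=> True.

(** The chain Sd^N c + T_N bd c is small because T_N is local and [bd c] is small already; it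
    differs from [c] by the boundary of T_N c. *)
Lemma small_split k (c : ch k) A Q : downclosed Q -> nbhd_small Q A ->
  c \in chain_in A -> bcond Q c ->
  exists w t, [/\ c = w + bd t, w \in csup Q & t \in chain_in A].
Proof.
move=> dQ sQ cA cQ; have [N /(_ N (leqnn N)) SN] := Sd_small dQ sQ cA.
exists (iter N Sd c + prebd (@TdN R K X N) c), (TdN N c); split.
- by rewrite bd_TdN; zmod.
- rewrite rpredD //; case: k c cQ {cA SN} => [|k] c /= cQ; first exact: rpred0.
  by apply: local_op_in cQ => //; exact: TdN_local.
apply: (local_op_in (Q := fun B => B `<=` A)) cA; first exact: TdN_local.
by move=> B C BC CA x /BC /CA.
Qed.

End SmallChains.
(** * Homotopy invariance and Mayer-Vietoris *)

Lemma continuous_pair (T X Y : topologicalType) (f : T -> X) (g : T -> Y) :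
  continuous f -> continuous g -> continuous (fun x => (f x, g x)).
Proof. by move=> cf cg x; apply: cvg_pair; [exact: cf | exact: cg]. Qed.

HB.lock Definition prism_op (R : realType) (K : comNzRingType) (X Y : topologicalType)
    (h : X * R -> Y) k : {linear chain R K k X -> chain R K k.+1 Y} :=
  hop h (Aemb K 1) (Aemb K 0) k.

(* [0] on the simplices on which [f] is not continuous. *)
HB.lock Definition fpush (R : realType) (K : comNzRingType) (X Y : topologicalType)
    (f : X -> Y) k : {linear chain R K k X -> chain R K k Y} :=
  flift (fun s : sing R k X => match pselect (continuous (f \o s)) with
    | left cf => << (mkcts cf : sing R k Y) >>
    | right _ => 0 : chain R K k Y
    end).
Arguments fpush {R K X Y} f {k}.

Section PartialPush.
Variables (R : realType) (K : comNzRingType).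
Implicit Types X Y Z : topologicalType.
Local Notation ch k X := (chain R K k X).

Lemma fpushU X Y (f : X -> Y) k (s : sing R k X) (cf : continuous (f \o s)) :
  fpush f << s >> = << (mkcts cf : sing R k Y) >> :> chain R K k Y.
Proof.
rewrite fpush.unlock fliftU; case: pselect => // cf'.
by congr << _ >>; apply/continuousEP.
Qed.

Lemma within_sing X Y (A : set X) (f : X -> Y) k (s : sing R k X) :
  {within A, continuous f} -> range s `<=` A -> continuous (f \o s).
Proof.
move=> cf sA; apply: within_comp cf; first exact: cts_fun.
by move=> v; apply: sA; exists v.
Qed.

Lemma range_face X k (s : sing R k.+1 X) i : range (sing_face i s) `<=` range s.
Proof. by move=> _ [v _ <-]; exists (face R i v). Qed.

Lemma bd_fpush X Y (A : set X) (f : X -> Y) k (c : ch k.+1 X) :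
  {within A, continuous f} -> c \in chain_in A -> bd (fpush f c) = fpush f (bd c).
Proof.
move=> cf; apply: (eq_on_fsupp (F := bd \o fpush f) (G := fpush f \o bd)) => s sA /=.
rewrite (fpushU (within_sing cf sA)) !bdU linear_sum; apply: eq_bigr => i _.
have sAi : range (sing_face i s) `<=` A by move=> x /range_face/sA.
rewrite linearZ /= (fpushU (within_sing cf sAi)); congr (_ *: << _ >>).
exact/continuousEP.
Qed.

Lemma fpush_in X Y (A : set X) (B : set Y) (f : X -> Y) k (c : ch k X) :
  (forall x, A x -> B (f x)) -> c \in chain_in A -> fpush f c \in chain_in B.
Proof.
move=> fAB; apply: fsupp_lift => s sA; rewrite fpush.unlock fliftU.
case: pselect => [cf|_]; last exact: rpred0.
by rewrite fsuppU; apply/asboolP => _ [v _ <-]; apply/fAB/sA; exists v.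
Qed.

Lemma eq_fpush X Y (A : set X) (f g : X -> Y) k (c : ch k X) :
  {within A, continuous f} -> (forall x, A x -> f x = g x) -> c \in chain_in A ->
  fpush f c = fpush g c.
Proof.
move=> cf fg; apply: eq_on_fsupp => s sA.
have E : f \o s = g \o s by apply/funext => v; apply/fg/sA; exists v.
have cs := within_sing cf sA; have cs' : continuous (g \o s) by rewrite -E.
rewrite (fpushU cs) (fpushU cs'); congr << _ >>; apply/continuousEP => v.
exact: (congr1 (@^~ v) E).
Qed.

Lemma fpush_id X k (c : ch k X) : fpush id c = c.
Proof.
apply: (@free_lift_ext _ _ _ (fpush id) idfun) => s.
have cs : continuous (id \o s) by exact: cts_fun.
by rewrite (fpushU cs); congr << _ >>; apply/continuousEP.
Qed.

Lemma fpush_comp X Y Z (A : set X) (B : set Y) (f : X -> Y) (g : Y -> Z) k (c : ch k X) :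
  {within A, continuous f} -> (forall x, A x -> B (f x)) -> {within B, continuous g} ->
  c \in chain_in A -> fpush g (fpush f c) = fpush (g \o f) c.
Proof.
move=> cf fAB cg; apply: (eq_on_fsupp (F := fpush g \o fpush f)) => s sA /=.
have cs := within_sing cf sA; rewrite (fpushU cs).
have rs : range (mkcts cs) `<=` B by move=> _ [v _ <-]; apply/fAB/sA; exists v.
have cgs := within_sing (s := mkcts cs) cg rs.
by rewrite (fpushU cgs) (@fpushU _ _ (g \o f) _ s cgs); congr << _ >>; apply/continuousEP.
Qed.

Lemma push_fpush X Y (f : continuousType X Y) k (c : ch k X) : push R K k f c = fpush f c.
Proof.
apply: (@free_lift_ext _ _ _ (push R K k f) (fpush f)) => s.
have cs : continuous (f \o s) by move=> v; apply: continuous_comp; exact: cts_fun.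
have -> : push R K k f << s >> = << sing_comp f s >> by exact: free_liftU.
by rewrite (fpushU cs); congr << _ >>; apply/continuousEP.
Qed.

Lemma fpushK X Y (A : set X) (B : set Y) (f : X -> Y) (g : Y -> X) k (c : ch k X) :
  {within A, continuous f} -> (forall x, A x -> B (f x)) -> {within B, continuous g} ->
  (forall x, A x -> g (f x) = x) -> c \in chain_in A -> fpush g (fpush f c) = c.
Proof.
move=> cf fAB cg gf cA; rewrite (fpush_comp cf fAB cg cA) -[RHS]fpush_id.
symmetry; apply: eq_fpush cA => [|x /gf //].
by apply: continuous_subspaceT => x; exact: cvg_id.
Qed.

Lemma admissible_face X Y (h : X * R -> Y) k (s : sing R k.+1 X) i :
  admissible h s -> admissible h (sing_face i s).
Proof.
move=> hs; pose g (v : 'rV[R]_(k.+1 + 1)) : 'rV[R]_(k.+2 + 1) :=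
  row_mx (set_val (face_fun i (ret (lsubmx v)))) (rsubmx v).
rewrite /admissible /=; have -> : hev h (sing_face i s) = hev h s \o g.
  apply/funext => v; rewrite /hev /= row_mxKl row_mxEr; congr (h (_, clamp _)); last by rewrite mxE.
  by congr (s _); rewrite ret_val.
move=> v; apply: continuous_comp; last exact: hs.
apply: continuous_row => j {v}; rewrite /g; case: (split_ordP j) => l ->.
  under eq_fun do rewrite row_mxEl.
  have : continuous (fun v : 'rV[R]_(k.+1 + 1) => set_val (face_fun i (ret (lsubmx v)))).
    move=> v; apply: (@continuous_comp _ _ _ (fun v => @ret R k (lsubmx v))
      (fun u => set_val (face_fun i u))).
      apply: (@continuous_comp _ _ _ (fun v => lsubmx v) (@ret R k)).
        exact: continuous_lsubmx.
      exact: continuous_ret.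
    apply: (@continuous_comp _ _ _ (face_fun i) set_val); first exact: continuous_face.
    exact: initial_continuous.
  exact: continuous_coord.
under eq_fun do rewrite row_mxEr mxE.
exact: coord_continuous.
Qed.

Section Homotopy.
Variables (X Y : topologicalType) (A : set X) (h : X * R -> Y).

Local Notation prism_op := (@prism_op R K X Y h).

Lemma prism_op_in (A' : set X) (B : set Y) k (c : ch k X) :
  (forall x t, A' x -> 0 <= t <= 1 -> B (h (x, t))) ->
  c \in chain_in A' -> prism_op k c \in chain_in B.
Proof.
rewrite prism_op.unlock => hB; apply: sop_in hB _; apply: Ahom_in; last exact: id_simplex.
  by apply: Aemb_chainmap; rewrite lexx ler01.
by apply: Aemb_chainmap; rewrite lexx ler01.
Qed.

Hypothesis ch : {within A `*` `[0, 1], continuous h}.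

Lemma homotopy_admissible k (s : sing R k X) : range s `<=` A -> admissible h s.
Proof.
move=> sA; rewrite /admissible /= /hev.
apply: (within_comp (f := fun v : 'rV[R]_(k.+1 + 1) =>
  (s (ret (lsubmx v)), clamp (v 0 (rshift k.+1 0))))) ch.
  have c1 : continuous (fun v : 'rV[R]_(k.+1 + 1) => s (ret (lsubmx v))).
    exact: (@hev_fst_continuous R X k s).
  have c2 : continuous (fun v : 'rV[R]_(k.+1 + 1) => clamp (v 0 (rshift k.+1 0))).
    move=> v; apply: (@continuous_comp _ _ _ (fun v : 'rV_ _ => v 0 _) (@clamp R)).
      exact: coord_continuous.
    exact: continuous_clamp.
  exact: continuous_pair.
move=> v; split => /=; first by apply: sA; exists (ret (lsubmx v)).
by rewrite in_itv /= clamp_in.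
Qed.

Lemma cop_Aemb t k (c : chain R K k X) : 0 <= t <= 1 -> c \in chain_in A ->
  cop h (Aemb K t) k c = fpush (fun x => h (x, t)) c.
Proof.
move=> t01; apply: eq_on_fsupp => s sA; have hs := homotopy_admissible sA.
rewrite sopU avmapU (aevalU _ hs).
have E v : hev h s (set_val v *m \matrix_(i < k.+1) emb t (row i 1%:M)) = h (s v, t).
  have -> : \matrix_(i < k.+1) emb t (row i (1%:M : 'M[R]_k.+1)) = row_mx 1%:M (const_mx t).
    apply/row_matrixP => i; rewrite rowK row_row_mx; congr row_mx.
    by apply/rowP => j; rewrite !mxE.
  rewrite mul_mx_row mulmx1 /hev row_mxKl row_mxEr ret_val; congr (h (_, _)).
  rewrite mxE -(clamp_id t01); congr clamp; rewrite (clamp_id t01) -[RHS]mul1r.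
  have [_ <-] := set_valP v; rewrite mulr_suml; apply: eq_bigr => i _.
  by rewrite mxE.
have cs : continuous ((fun x => h (x, t)) \o s).
  have -> : (fun x => h (x, t)) \o s =
    asimplex (k := k) hs (\matrix_(i < k.+1) emb t (row i 1%:M)).
    by apply/funext => v; rewrite asimplexE E.
  exact: cts_fun.
by rewrite (fpushU cs); congr << _ >>; apply/continuousEP => v; rewrite asimplexE E.
Qed.

Lemma bd_prism_op k (c : chain R K k X) : c \in chain_in A ->
  bd (prism_op k c) =
  fpush (fun x => h (x, 1)) c - fpush (fun x => h (x, 0)) c - prebd prism_op c.
Proof.
move=> cA; rewrite prism_op.unlock -!cop_Aemb ?lexx ?ler01 //.
have tS (t : R) : 0 <= t <= 1 -> chainmap (Aemb K t) by exact: Aemb_chainmap.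
have z0 : ((0 : R) <= 0) && ((0 : R) <= 1) by rewrite lexx ler01.
have z1 : ((0 : R) <= 1) && ((1 : R) <= 1) by rewrite lexx ler01.
apply: bd_hop (tS _ z1) (tS _ z0) _ _ _.
- move=> d x; apply: eq_on_fsupp (fsuppT x) => P _; rewrite !avmapU; congr << _ >>.
  by apply/matrixP => -[].
- by apply: fsuppS cA => s; exact: homotopy_admissible.
exact: admissible_face.
Qed.
End Homotopy.

End PartialPush.

Arguments prism_op {R K X Y} h k.

(** * Relative homology as predicates on chains *)

Section RelativeCycles.
Variables (R : realType) (K : comNzRingType) (X : topologicalType).
Local Notation ch k := (chain R K k X).
Implicit Types A B U : set X.

Definition cyc k B : ch k -> Prop := bcond (subset^~ B).

(** With [cyc B] for relative cycles, this expresses vanishing in the homology of the pair (A, B).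
    Working with chains instead of classes allows free cutting and gluing. *)
Definition nullc k A B (c : ch k) : Prop :=
  exists d, d \in chain_in A /\ c - bd d \in chain_in B.

Lemma subset_downclosed B : downclosed (subset^~ B).
Proof. by move=> C D CD DB x /CD/DB. Qed.

Lemma chain_inS k A B (c : ch k) : A `<=` B -> c \in chain_in A -> c \in chain_in B.
Proof. by move=> AB; apply: fsuppS => s sA x /sA/AB. Qed.

Lemma chain_inT k (c : ch k) : c \in chain_in setT.
Proof. by apply: fsuppS (fsuppT c). Qed.

Lemma chain_in0 k (c : ch k) : c \in chain_in set0 -> c = 0.
Proof.
apply: (fsupp_ind (P := fun c : ch k => c = 0)) => // [a x y -> ->|s sA].
  by rewrite scaler0 addr0.
by case: (sA (s (ret (const_mx 0)))); exists (ret (const_mx 0)).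
Qed.

Lemma chain_inI k A B (c : ch k) :
  c \in chain_in A -> c \in chain_in B -> c \in chain_in (A `&` B).
Proof.
move=> cA cB; apply: fsuppS (fsuppI cA cB) => s [sA sB] x sx.
by split; [exact: sA | exact: sB].
Qed.

Lemma bd_chain_in k A (c : ch k.+1) : c \in chain_in A -> bd c \in chain_in A.
Proof. exact: (bd_in (@subset_downclosed A)). Qed.

Lemma bd_bd k (c : ch k.+2) : bd (bd c) = 0.
Proof.
apply: (@free_lift_ext _ _ _ (@bd R K X k \o @bd R K X k.+1) \0) => s /=.
rewrite -aeval_id !bd_aeval -[RHS](linear0 (aeval (s \o @ret R k.+2) k)).
by congr (aeval _ _ _); exact: (@acycle_abd R K k.+2 k.+3 << 1%:M >>).
Qed.

Lemma bcondP k Q a (c d : ch k) : bcond Q c -> bcond Q d -> bcond Q (a *: c + d).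
Proof. by case: k c d => //= k c d cQ dQ; rewrite linearP /= rpredD ?rpredZ. Qed.

Lemma bcond0 k Q : bcond Q (0 : ch k).
Proof. by case: k => //= k; rewrite linear0 rpred0. Qed.

Lemma bcondZ k Q a (c : ch k) : bcond Q c -> bcond Q (a *: c).
Proof. by move=> cQ; rewrite -[_ *: _]addr0; apply: bcondP => //; exact: bcond0. Qed.

Lemma bcondD k Q (c d : ch k) : bcond Q c -> bcond Q d -> bcond Q (c + d).
Proof. by move=> cQ dQ; rewrite -[c]scale1r; exact: bcondP. Qed.

Lemma bcondB k Q (c d : ch k) : bcond Q c -> bcond Q d -> bcond Q (c - d).
Proof. by move=> cQ dQ; rewrite addrC -scaleN1r; exact: bcondP. Qed.

Lemma bcond_bd k Q (c : ch k.+1) : bcond Q (bd c).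
Proof. by case: k c => //= k c; rewrite bd_bd rpred0. Qed.

Lemma bcond_in k Q (c : ch k) : downclosed Q -> c \in csup Q -> bcond Q c.
Proof. by case: k c => //= k c dQ; exact: bd_in. Qed.

Lemma bcondS k (P Q : set (set X)) (c : ch k) : P `<=` Q -> bcond P c -> bcond Q c.
Proof. by case: k c => //= k c PQ; apply: fsuppS => s; exact: PQ. Qed.

Lemma cyc_in k B (c : ch k) : c \in chain_in B -> cyc B c.
Proof. exact: (bcond_in (@subset_downclosed B)). Qed.

Lemma cycI k A B (c : ch k) : cyc A c -> cyc B c -> cyc (A `&` B) c.
Proof. by case: k c => //= k c; exact: chain_inI. Qed.

Lemma cycS k A B (c : ch k) : A `<=` B -> cyc A c -> cyc B c.
Proof. by move=> AB; apply: bcondS => C CA x /CA/AB. Qed.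

Lemma nullcP k A B a (c d : ch k) : nullc A B c -> nullc A B d -> nullc A B (a *: c + d).
Proof.
move=> [c' [cA cB]] [d' [dA dB]]; exists (a *: c' + d'); split; first by rewrite rpredD ?rpredZ.
by rewrite linearP opprD addrACA -scalerBr rpredD ?rpredZ.
Qed.

Lemma nullc_in k A B (c : ch k) : c \in chain_in B -> nullc A B c.
Proof. by move=> cB; exists 0; rewrite rpred0 linear0 subr0. Qed.

Lemma nullc_bd k A B (d : ch k.+1) : d \in chain_in A -> nullc A B (bd d).
Proof. by move=> dA; exists d; rewrite dA subrr rpred0. Qed.

Lemma nullc0 k A B : nullc A B (0 : ch k).
Proof. by apply: nullc_in; exact: rpred0. Qed.

Lemma nullcZ k A B a (c : ch k) : nullc A B c -> nullc A B (a *: c).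
Proof. by move=> cQ; rewrite -[_ *: _]addr0; apply: nullcP => //; exact: nullc0. Qed.

Lemma nullcD k A B (c d : ch k) : nullc A B c -> nullc A B d -> nullc A B (c + d).
Proof. by move=> cQ dQ; rewrite -[c]scale1r; exact: nullcP. Qed.

Lemma nullcN k A B (c : ch k) : nullc A B c -> nullc A B (- c).
Proof. by rewrite -scaleN1r; exact: nullcZ. Qed.

Lemma nullcB k A B (c d : ch k) : nullc A B c -> nullc A B d -> nullc A B (c - d).
Proof. by move=> cQ /nullcN; exact: nullcD. Qed.

Lemma nullc_sym k A B (c d : ch k) : nullc A B (c - d) -> nullc A B (d - c).
Proof. by move=> /nullcN; rewrite opprB. Qed.

Lemma nullc_trans k A B (c d e : ch k) :
  nullc A B (c - d) -> nullc A B (d - e) -> nullc A B (c - e).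
Proof. by move=> cd /(nullcD cd); rewrite addrA subrK. Qed.

Lemma nullcS k A B A' B' (c : ch k) : A `<=` A' -> B `<=` B' -> nullc A B c -> nullc A' B' c.
Proof.
by move=> AA BB [d [dA dB]]; exists d; rewrite (chain_inS AA dA) (chain_inS BB dB).
Qed.

Lemma nullc_cyc k A B (c : ch k) : nullc A B c -> cyc B c.
Proof.
move=> [d [_ dB]]; rewrite -[c](subrK (bd d)).
by apply: bcondD; [exact: cyc_in | exact: bcond_bd].
Qed.

Section TwoOpens.
Variables U1 U2 : set X.
Hypotheses (oU1 : open U1) (oU2 : open U2).

Definition either : set (set X) := [set S | S `<=` U1 \/ S `<=` U2].

Lemma either_downclosed : downclosed either.
Proof.
by move=> A B AB [BU|BU]; [left | right] => x /AB/BU.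
Qed.

Lemma csup_either k (c : ch k) : c \in csup either ->
  exists c1 c2, [/\ c = c1 + c2, c1 \in chain_in U1 & c2 \in chain_in U2].
Proof. exact: fsupp_split. Qed.

Lemma either_csup k (c1 c2 : ch k) : c1 \in chain_in U1 -> c2 \in chain_in U2 ->
  c1 + c2 \in csup either.
Proof.
move=> c1U c2U; rewrite rpredD //.
  by apply: fsuppS c1U => s; left.
by apply: fsuppS c2U => s; right.
Qed.

Lemma split2 k (v : ch k) : v \in chain_in (U1 `|` U2) -> bcond either v ->
  exists v1 v2 t, [/\ v = v1 + v2 + bd t, v1 \in chain_in U1, v2 \in chain_in U2 &
    t \in chain_in (U1 `|` U2)].
Proof.
move=> vU vb; have [|w [t [-> /csup_either [v1 [v2 [-> h1 h2]]] tU]]] :=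
  small_split either_downclosed _ vU vb; last by exists v1, v2, t.
move=> x [Ux|Ux]; [exists U1 | exists U2]; rewrite /either /=; try exact: open_nbhs_nbhs.
  by left.
by right.
Qed.

(** The chain [d1 - d2] is a cycle modulo [U1]|[U2], and its image under the Mayer-Vietoris
    connecting map is the class of [e]; the image of [w'] is [a2']. So this is the well-definedness
    of the connecting map. *)
Lemma mv_connecting k (d1 d2 w' : ch k.+1) (e a1 a2 a1' a2' : ch k) :
  e = bd d1 + a1 -> e = bd d2 + a2 -> a1 \in chain_in U1 -> a2 \in chain_in U2 ->
  bd w' = a2' - a1' -> a1' \in chain_in U1 -> a2' \in chain_in U2 ->
  nullc setT (U1 `|` U2) (d1 - d2 - w') -> nullc setT (U1 `&` U2) (e - a2').
Proof.
move=> e1 e2 a1U a2U bw a1U' a2U' [u [_ vU]].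
set v := _ - bd u in vU; have bv : bd v = (a2 - a2') - (a1 - a1').
  rewrite /v !linearB /= bd_bd bw; have -> : bd d1 = e - a1 by rewrite e1 addrK.
  by have -> : bd d2 = e - a2 by [rewrite e2 addrK]; zmod.
have [|v1 [v2 [t [vE v1U v2U tU]]]] := split2 vU.
  rewrite /bcond bv addrC; apply: either_csup; rewrite ?rpredB // opprB rpredB //.
have E : a2 - a2' - bd v2 = a1 - a1' + bd v1.
  have : bd v = bd v1 + bd v2 by rewrite vE !linearD /= bd_bd addr0.
  by rewrite bv => /(canRL (subrK _)) ->; zmod.
exists (d2 + v2); split; first exact: chain_inT.
rewrite linearD /= (_ : _ - _ = a2 - a2' - bd v2); last by rewrite {1}e2; zmod.
apply: chain_inI; first by rewrite E rpredD ?rpredB // bd_chain_in.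
by rewrite !rpredB // bd_chain_in.
Qed.

(** Exactness of Mayer-Vietoris at the sum: after cutting the difference of [m1] and [m2], the part
    in [U1] is subtracted from [m1]. *)
Lemma mv_glue k (m1 m2 : ch k) : cyc U1 m1 -> cyc U2 m2 ->
  nullc setT (U1 `|` U2) (m1 - m2) ->
  exists m, [/\ cyc (U1 `&` U2) m, nullc setT U1 (m - m1) & nullc setT U2 (m - m2)].
Proof.
move=> c1 c2 [d [_ vU]]; set v := _ - bd d in vU.
have [|v1 [v2 [t [vE v1U v2U tU]]]] := split2 vU.
  apply: bcondB; last exact: bcond_bd.
  apply: bcondB; last by apply: bcondS c2 => S; right.
  by apply: bcondS c1 => S; left.
have E : m1 - v1 = m2 + v2 + bd (d + t).
  rewrite linearD /=; have := vE; rewrite /v => /(canRL (subrK _)) /(canRL (subrK _)) ->.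
  by zmod.
exists (m1 - v1); split.
- apply: cycI; first by apply: bcondB => //; exact: cyc_in.
  by rewrite E; apply: bcondD; [apply: bcondD => //; exact: cyc_in | exact: bcond_bd].
- by rewrite addrAC subrr sub0r; apply: nullc_in; rewrite rpredN.
rewrite E; have -> : m2 + v2 + bd (d + t) - m2 = bd (d + t) + v2 by zmod.
by apply: nullcD; [apply: nullc_bd; exact: chain_inT | exact: nullc_in].
Qed.

(** Surjectivity of excision: of a small representative only the part in [U1] is kept. *)
Lemma excise k (c : ch k) : c \in chain_in (U1 `|` U2) -> cyc U2 c ->
  exists c', [/\ c' \in chain_in U1, cyc (U1 `&` U2) c' & nullc (U1 `|` U2) U2 (c - c')].
Proof.
move=> cU cc; have [|v1 [v2 [t [vE v1U v2U tU]]]] := split2 cU.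
  by apply: bcondS cc => S; right.
exists v1; split=> //.
  apply: cycI; first exact: cyc_in.
  have -> : v1 = c - v2 - bd t by rewrite vE; zmod.
  by apply: bcondB; [apply: bcondB => //; exact: cyc_in | exact: bcond_bd].
rewrite vE; have -> : v1 + v2 + bd t - v1 = bd t + v2 by zmod.
by apply: nullcD; [exact: nullc_bd | exact: nullc_in].
Qed.

(** The bounding chain is made small, and its part in [U1] still bounds [c] modulo the
    intersection. *)
Lemma excise_inj k (c : ch k) : c \in chain_in U1 -> nullc (U1 `|` U2) U2 c ->
  nullc U1 (U1 `&` U2) c.
Proof.
move=> cU [d [dU vU]].
have [|v1 [v2 [t [vE v1U v2U tU]]]] := split2 dU.
  rewrite /bcond (_ : bd d = c + (bd d - c)); last by zmod.
  by apply: either_csup => //; rewrite -opprB rpredN.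
exists v1; split=> //; apply: chain_inI; first by rewrite rpredB // bd_chain_in.
have -> : c - bd v1 = c - bd d + bd v2 by rewrite vE !linearD /= bd_bd; zmod.
by rewrite rpredD // bd_chain_in.
Qed.

End TwoOpens.
End RelativeCycles.

Lemma homotopy_null (R : realType) (K : comNzRingType) (X Y : topologicalType)
    (A B : set X) (A' B' : set Y) (h : X * R -> Y) k (c : chain R K k X) :
  {within A `*` `[0, 1], continuous h} -> c \in chain_in A -> cyc B c ->
  (forall x t, A x -> 0 <= t <= 1 -> A' (h (x, t))) ->
  (forall x t, B x -> 0 <= t <= 1 -> B' (h (x, t))) ->
  nullc A' B' (fpush (fun x => h (x, 1)) c - fpush (fun x => h (x, 0)) c).
Proof.
move=> ch cA cB hA hB; exists (prism_op h k c); split; first exact: prism_op_in cA.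
rewrite (bd_prism_op ch cA) opprB addrC subrK.
case: k c {cA} cB => [|k] c cB /=; first exact: rpred0.
exact: prism_op_in cB.
Qed.

Lemma cyc_fpush (R : realType) (K : comNzRingType) (X Y : topologicalType) (A B : set X)
    (B' : set Y) (f : X -> Y) k (c : chain R K k X) :
  {within A, continuous f} -> (forall x, A x -> B x -> B' (f x)) -> c \in chain_in A ->
  cyc B c -> cyc B' (fpush f c).
Proof.
move=> cf fB cA /(cycI (cyc_in cA)); case: k c cA => //= k c cA cAB.
by rewrite /cyc /= (bd_fpush cf cA); apply: fpush_in cAB => x [Ax Bx]; exact: fB.
Qed.
(** * Local homology of manifolds *)

(** The boxes considered lie in the open cube (-1, 1)^n, so a coordinate pushed to 1 or -1 has left
    them. *)
HB.lock Definition coord_push (R : realType) (n : nat) (up : bool) (k : nat)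
    (p : 'rV[R]_n * R) : 'rV[R]_n :=
  \row_j (if j == k :> nat then (1 - p.2) * p.1 0 j + p.2 * (if up then 1 else -1) else p.1 0 j).

Lemma coord_pushE (R : realType) (n : nat) (up : bool) (k : nat) (x : 'rV[R]_n) t j :
  coord_push up k (x, t) 0 j = if j == k :> nat then (1 - t) * x 0 j + t * (if up then 1 else -1) else x 0 j.
Proof. by rewrite coord_push.unlock mxE. Qed.

Lemma subrBB (V : zmodType) (x y z t c : V) : x - c - y - (z - c - t) = x - y - (z - t).
Proof. zmod. Qed.

Section Boxes.
Variables (R : realType) (K : comNzRingType) (n : nat).
Local Notation ch k := (chain R K k 'rV[R]_n).
Local Notation V := 'rV[R]_n.

Lemma coord_push_continuous up k : continuous (@coord_push R n up k).
Proof.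
rewrite coord_push.unlock; apply: continuous_row => j; under eq_fun do rewrite mxE.
have c1 : continuous (fun p : V * R => p.1 0 j).
  by apply: continuous_coord => p; exact: cvg_fst.
case: (j == k :> nat) => //.
have c2 : continuous (fun p : V * R => p.2) by move=> p; exact: cvg_snd.
move=> p; apply: cvgD; apply: cvgM; try exact: c1; try exact: c2; try exact: cvg_cst.
by apply: cvgB; [exact: cvg_cst | exact: c2].
Qed.

Lemma coord_push0 up k (x : V) : coord_push up k (x, 0) = x.
Proof.
by apply/rowP => j; rewrite coord_pushE subr0 mul1r mul0r addr0; case: ifP.
Qed.

(** Sweeps a chain along the whole k-th coordinate. This is the suspension isomorphism from cycles
    modulo [outside k] to cycles modulo [outside k.+1] one degree higher. *)
Definition suspend k i : {linear ch i -> ch i.+1} :=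
  prism_op (coord_push true k) i \- prism_op (coord_push false k) i.

Lemma suspendE k i (c : ch i) :
  suspend k i c = prism_op (coord_push true k) i c - prism_op (coord_push false k) i c.
Proof. by []. Qed.

Definition const_sing (X : topologicalType) (x : X) i : sing R i X :=
  mkcts (fun _ => @cvg_cst _ x _ _ _).

(** The k-fold suspension of a point. It does not depend on the box, so a single chain generates for
    all boxes of a chart at once. *)
Fixpoint box_gen k : ch k :=
  if k is k.+1 then suspend k k (box_gen k) else << const_sing (0 : V) 0 >>.

Lemma coord_push_at up k t : continuous (fun x : V => coord_push up k (x, t)).
Proof.
have cp : continuous (fun x : V => (x, t)).
  exact: (@continuous_pair V V R id (fun=> t) (fun x => @cvg_id _ (nbhs x)) (@cst_continuous V R t)).
move=> x; apply: (@continuous_comp _ _ _ (fun x : V => (x, t)) (coord_push up k)).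
  exact: cp.
exact: coord_push_continuous.
Qed.

Lemma bd_push up k i (c : ch i) :
  bd (prism_op (coord_push up k) i c) =
  fpush (fun x => coord_push up k (x, 1)) c - c - prebd (prism_op (coord_push up k)) c.
Proof.
rewrite (bd_prism_op (A := setT)) ?chain_inT //; last first.
  by apply: continuous_subspaceT; exact: coord_push_continuous.
congr (_ - _ - _); rewrite -[RHS]fpush_id; apply: eq_fpush (chain_inT _) => [|x _].
  by apply: continuous_subspaceT; exact: coord_push_at.
exact: coord_push0.
Qed.

Lemma prebd_in (X Y : topologicalType) (H : forall k, {linear chain R K k X -> chain R K k.+1 Y})
    (A : set X) (B : set Y) k (c : chain R K k X) :
  (forall l (c : chain R K l X), c \in chain_in A -> H l c \in chain_in B) -> cyc A c ->
  prebd H c \in chain_in B.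
Proof. by move=> HA; case: k c => [|k] c cA /=; [exact: rpred0 | exact: HA]. Qed.

Lemma conv_lt (c x y t : R) : c < x -> c < y -> 0 <= t <= 1 -> c < (1 - t) * x + t * y.
Proof. by move=> cx cy /andP[t0 t1]; have [|] := ltP t 1; nra. Qed.

Lemma conv_gt (c x y t : R) : x < c -> y < c -> 0 <= t <= 1 -> (1 - t) * x + t * y < c.
Proof. by move=> cx cy /andP[t0 t1]; have [|] := ltP t 1; nra. Qed.

Definition augmentation (X : topologicalType) i : {linear chain R K i X -> K^o} :=
  flift (fun=> 1 : K^o).

Lemma augmentation_bd (X : topologicalType) (c : chain R K 1 X) : augmentation X 0 (bd c) = 0.
Proof.
apply: (@free_lift_ext _ _ _ (augmentation X 0 \o @bd R K X 0) \0) => s /=.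
rewrite bdU big_ord_recl big_ord1 linearD !linearZ /= !fliftU.
by rewrite expr0 expr1 scale1r scaleN1r subrr.
Qed.

Lemma fpush_const (X Y : topologicalType) (y : Y) i (c : chain R K i X) :
  fpush (fun=> y) c = augmentation X i c *: << const_sing y i >>.
Proof.
apply: (fsupp_ind (P := fun c => fpush (fun=> y) c = augmentation X i c *: _) _ _ _ (fsuppT c)).
- by rewrite !linear0 scale0r.
- by move=> r x z ex ez; rewrite !linearP /= ex ez scalerDl scalerA.
move=> s _; have cs : continuous ((fun=> y) \o s) by exact: cst_continuous.
by rewrite (fpushU K cs) fliftU scale1r; congr << _ >>; apply/continuousEP.
Qed.

Lemma bd_const_sing (X : topologicalType) (x : X) i :
  bd << const_sing x i.+1 >> = (odd i)%:R *: << const_sing x i >> :> chain R K i X.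
Proof.
rewrite bdU.
have E j : << sing_face j (const_sing x i.+1) >> = << const_sing x i >> :> chain R K i X.
  by congr << _ >>; apply/continuousEP.
under eq_bigr do rewrite E.
rewrite -scaler_suml; congr (_ *: _); elim: i {E} => [|i IH].
  by rewrite big_ord_recl big_ord1 expr0 expr1 subrr.
by rewrite big_ord_recr /= IH exprS -signr_odd oddS; case: (odd i) => /=; rewrite ?expr0 ?expr1; ring.
Qed.

Section Box.
Variables a b : V.
Hypothesis ab : forall j, a 0 j <= b 0 j.
Hypothesis a1 : forall j, -1 < a 0 j.
Hypothesis b1 : forall j, b 0 j < 1.

(** The complement of a box in the first k coordinates times a linear space; the homology is
    computed by induction on k. *)
Definition outside k : set V :=
  [set x | exists j : 'I_n, (j < k)%N /\ (x 0 j < a 0 j \/ b 0 j < x 0 j)].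
Definition above k : set V := [set x | exists2 j : 'I_n, j = k :> nat & b 0 j < x 0 j].
Definition below k : set V := [set x | exists2 j : 'I_n, j = k :> nat & x 0 j < a 0 j].
Let Up k := outside k `|` above k.
Let Um k := outside k `|` below k.

Lemma outsideS k : outside k.+1 = Up k `|` Um k.
Proof.
apply/seteqP; split=> [x [j []]|x].
  rewrite ltnS leq_eqVlt => /orP[/eqP jk|jk] xj; last by left; left; exists j.
  by case: xj => xj; [right; right; exists j | left; right; exists j].
case=> -[[j [jk xj]]|[j jk xj]]; exists j; rewrite ?ltnS ?jk ?leqnn ?(ltnW jk) //.
all: by split=> //; auto.
Qed.

Lemma outsideI k : Up k `&` Um k = outside k.
Proof.
apply/seteqP; split=> [x|x ox]; last by split; left.
case=> -[//|[j jk xj]] [//|[l lk xl]].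
have jl : j = l by apply/val_inj; rewrite /= jk lk.
by move: xl; rewrite -jl => xl; have := lt_trans xl (le_lt_trans (ab j) xj); rewrite ltxx.
Qed.

Lemma outside_open k : open (outside k).
Proof.
have -> : outside k = \bigcup_(j in [set j : 'I_n | (j < k)%N])
    ((fun x : V => x 0 j) @^-1` [set y | y < a 0 j] `|`
     (fun x : V => x 0 j) @^-1` [set y | b 0 j < y]).
  by apply/seteqP; split=> [x [j [jk xj]]|x [j jk xj]]; exists j.
apply: bigcup_open => j _; apply: openU; apply: open_comp.
- by move=> x _; exact: coord_continuous.
- exact: open_lt.
- by move=> x _; exact: coord_continuous.
- exact: open_gt.
Qed.

Lemma Up_open k : open (Up k).
Proof.
apply: openU; first exact: outside_open.
have -> : above k = \bigcup_(j in [set j : 'I_n | j = k :> nat])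
    ((fun x : V => x 0 j) @^-1` [set y | b 0 j < y]).
  by apply/seteqP; split=> [x [j jk xj]|x [j jk xj]]; exists j.
apply: bigcup_open => j _; apply: open_comp; last exact: open_gt.
by move=> x _; exact: coord_continuous.
Qed.

Lemma Um_open k : open (Um k).
Proof.
apply: openU; first exact: outside_open.
have -> : below k = \bigcup_(j in [set j : 'I_n | j = k :> nat])
    ((fun x : V => x 0 j) @^-1` [set y | y < a 0 j]).
  by apply/seteqP; split=> [x [j jk xj]|x [j jk xj]]; exists j.
apply: bigcup_open => j _; apply: open_comp; last exact: open_lt.
by move=> x _; exact: coord_continuous.
Qed.

Lemma push_outside up k x t : outside k x -> outside k (coord_push up k (x, t)).
Proof. by case=> j [jk xj]; exists j; split=> //; rewrite coord_pushE ltn_eqF. Qed.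

Lemma push_Up k x t : Up k x -> 0 <= t <= 1 -> Up k (coord_push true k (x, t)).
Proof.
move=> [ox _|[j jk xj] t01]; first by left; exact: push_outside.
by right; exists j => //; rewrite coord_pushE jk eqxx; exact: conv_lt.
Qed.

Lemma push_Um k x t : Um k x -> 0 <= t <= 1 -> Um k (coord_push false k (x, t)).
Proof.
move=> [ox _|[j jk xj] t01]; first by left; exact: push_outside.
by right; exists j => //; rewrite coord_pushE jk eqxx; exact: conv_gt.
Qed.

Lemma push_end_Up k i (c : ch i) : (k < n)%N ->
  fpush (fun x => coord_push true k (x, 1)) c \in chain_in (Up k).
Proof.
move=> kn; pose j := Ordinal kn; have jk : j = k :> nat by []; apply: fpush_in (chain_inT _) => x _; right; exists j => //.
by rewrite coord_pushE jk eqxx subrr mul0r add0r mulr1.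
Qed.

Lemma push_end_Um k i (c : ch i) : (k < n)%N ->
  fpush (fun x => coord_push false k (x, 1)) c \in chain_in (Um k).
Proof.
move=> kn; pose j := Ordinal kn; have jk : j = k :> nat by []; apply: fpush_in (chain_inT _) => x _; right; exists j => //.
by rewrite coord_pushE jk eqxx subrr mul0r add0r mul1r.
Qed.

Lemma prism_outside up k i (c : ch i) : c \in chain_in (outside k) ->
  prism_op (coord_push up k) i c \in chain_in (outside k).
Proof. by apply: prism_op_in => x t ox _; exact: push_outside. Qed.

(** [p] and [m] are the traces of the suspension in the upper and lower half; [p] is homologous to
    [c], which allows one to go back. *)
Lemma suspend_cyc k i (c : ch i) : (k < n)%N -> cyc (outside k) c ->
  exists p m, [/\ bd (suspend k i c) = p - m, p \in chain_in (Up k),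
    m \in chain_in (Um k) & nullc setT (outside k) (p - c)].
Proof.
move=> lkn cc.
have oin up := prebd_in (fun l => @prism_outside up k l) cc.
exists (fpush (fun x => coord_push true k (x, 1)) c - prebd (prism_op (coord_push true k)) c).
exists (fpush (fun x => coord_push false k (x, 1)) c - prebd (prism_op (coord_push false k)) c).
split.
- rewrite suspendE linearB (bd_push true) (bd_push false) /=; exact: subrBB.
- by rewrite rpredB ?push_end_Up //; apply: chain_inS (oin true); left.
- by rewrite rpredB ?push_end_Um //; apply: chain_inS (oin false); left.
exists (prism_op (coord_push true k) i c); split; first exact: chain_inT.
rewrite bd_push; move: (prebd _ c) (fpush _ c) => x y.
have -> : y - x - c - (y - c - x) = 0 by zmod.
exact: rpred0.
Qed.

(** A bounding chain of the suspension is cut at the two halves; its upper part shows that [p], and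
    so [c], bounds modulo their intersection. *)
Lemma suspend_inj k i (c : ch i) : (k < n)%N -> cyc (outside k) c ->
  nullc setT (outside k.+1) (suspend k i c) -> nullc setT (outside k) c.
Proof.
move=> lkn cc [d [_ vU]]; have [p [m [bE pU mU pc]]] := suspend_cyc lkn cc.
rewrite outsideS in vU.
have [|v1 [v2 [t [vE v1U v2U _]]]] := split2 (@Up_open k) (@Um_open k) vU.
  by rewrite /bcond linearB /= bd_bd subr0 bE; apply: either_csup; rewrite ?rpredN.
have E : p - bd v1 = m + bd v2.
  have : bd (suspend k i c - bd d) = bd v1 + bd v2 by rewrite vE !linearD /= bd_bd addr0.
  by rewrite linearB /= bd_bd subr0 bE => /(canRL (subrK _)) ->; zmod.
have -> : c = p - (p - c) by zmod.
apply: nullcB pc; exists v1; split; first exact: chain_inT.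
rewrite -outsideI; apply: chain_inI; first by rewrite rpredB // bd_chain_in.
by rewrite E rpredD // bd_chain_in.
Qed.

(** Minus the lower part [v] of the boundary of [z] is a preimage. To compare, [z] is pushed upward:
    the upper part of its boundary stays in [Up], and [v] sweeps out the prism that occurs in
    [suspend]. *)
Lemma suspend_surj k i (z : ch i.+1) : (k < n)%N -> cyc (outside k.+1) z ->
  exists2 x : ch i, cyc (outside k) x & nullc setT (outside k.+1) (z - suspend k i x).
Proof.
move=> kn zc; rewrite /cyc /= outsideS in zc.
have [|u [v [t [bz uU vU]]]] := split2 (@Up_open k) (@Um_open k) zc.
  exact: bcond_bd.
rewrite -outsideS => tU.
exists (- v).
  rewrite -scaleN1r -outsideI; apply: bcondZ; apply: cycI; last exact: cyc_in.
  have -> : v = bd (z - t) - u by rewrite linearB /= bz; zmod.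
  by apply: bcondB; [exact: bcond_bd | exact: cyc_in].
have bz' : bd (z - t) = u + v by rewrite linearB /= bz; zmod.
have := bd_push true k (z - t); rewrite [prebd _ _]/= bz'.
set z' := z - t in bz' *.
have := push_end_Up z' kn; move: (fpush _ z') => p pU bP.
exists (- prism_op (coord_push true k) _ z'); split; first exact: chain_inT.
have z'E : z = z' + t by rewrite /z'; zmod.
rewrite [bd (- _)]linearN bP linearN suspendE z'E [prism_op _ _ (u + v)]linearD /=.
have := @prism_op_in R K V V (coord_push false k) (Um k) (Um k) _ v (@push_Um k) vU.
have := @prism_op_in R K V V (coord_push true k) (Up k) (Up k) _ u (@push_Up k) uU.
move: (prism_op _ _ v) (prism_op _ _ v) (prism_op _ _ u) => x y w wU xU.
rewrite (_ : _ - _ = t + p - w - x) ?outsideS; last by zmod.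
rewrite !(rpredB, rpredD) // -?outsideS //.
- by apply: chain_inS pU; rewrite outsideS; left.
- by apply: chain_inS wU; rewrite outsideS; left.
- by apply: chain_inS xU; rewrite outsideS; right.
Qed.

Lemma outside_deg0 k (z : ch 0) : (0 < k <= n)%N -> nullc setT (outside k) z.
Proof.
case: k => // k /= kn.
have := bd_push true k z; rewrite /= subr0; have := push_end_Up z kn.
move: (fpush _ z) => p pU bP.
exists (- prism_op (coord_push true k) _ z); split; first exact: chain_inT.
rewrite linearN /= bP (_ : _ - _ = p) ?outsideS; last by zmod.
by apply: chain_inS pU; left.
Qed.

Lemma outside0 : outside 0 = set0.
Proof. by apply/seteqP; split=> // x [j []]. Qed.

Lemma gen_cyc k : (k <= n)%N -> cyc (outside k) (box_gen k).
Proof.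
elim: k => [//|k IH] kn; have [p [m [bE pU mU _]]] := suspend_cyc kn (IH (ltnW kn)).
rewrite /cyc /= bE rpredB //.
  by apply: chain_inS pU; rewrite outsideS; left.
by apply: chain_inS mU; rewrite outsideS; right.
Qed.

(** Desuspending down to a point, where the augmentation reads off the coefficient. *)
Lemma gen_free k c : (k <= n)%N -> nullc setT (outside k) (c *: box_gen k) -> c = 0.
Proof.
elim: k => [_|k IH kn]; last first.
  have -> : c *: box_gen k.+1 = suspend k k (c *: box_gen k) by rewrite linearZ.
  move/suspend_inj => h; apply: IH (ltnW kn) (h kn _).
  exact: bcondZ (gen_cyc (ltnW kn)).
rewrite outside0 => -[d [_ /chain_in0 /(congr1 (augmentation V 0))]].
by rewrite linear0 linearB /= augmentation_bd subr0 linearZ /= fliftU [_ *: _]mulr1.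
Qed.

Lemma suspend_null k i (x : ch i) : (k < n)%N -> nullc setT (outside k) x ->
  nullc setT (outside k.+1) (suspend k i x).
Proof.
move=> kn [d [_ xd]]; rewrite -[x](subrK (bd d)) linearD; apply: nullcD.
  apply: nullc_in; rewrite suspendE rpredB //; apply: chain_inS (prism_outside _ xd);
    by rewrite outsideS; left; left.
exists (- suspend k i.+1 d); split; first exact: chain_inT.
rewrite linearN opprK !suspendE linearB (bd_push true) (bd_push false) /=.
have := push_end_Up d kn; have := push_end_Um d kn.
move: (fpush _ d) => y yU; move: (fpush _ d) => w wU.
move: (prism_op _ _ _) => p; move: (prism_op _ _ _) => q.
have -> : p - q + (w - d - p - (y - d - q)) = w - y by zmod.
rewrite outsideS rpredB //; first by apply: chain_inS wU; left.
by apply: chain_inS yU; right.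
Qed.

Lemma contract (A : set V) (p : V) (i : nat) (z : ch i) :
  (forall x t, A x -> 0 <= t <= 1 -> A ((1 - t) *: x + t *: p)) ->
  z \in chain_in A -> cyc set0 z ->
  nullc A set0 (z - augmentation V i z *: << const_sing p i >>).
Proof.
move=> Ap zA zc; pose h (q : V * R) : V := (1 - q.2) *: q.1 + q.2 *: p.
have ch : {within A `*` `[0, 1], continuous h}.
  apply: continuous_subspaceT => q; apply: cvgD; apply: cvgZ.
  - by apply: cvgB; [exact: cvg_cst | exact: cvg_snd].
  - exact: cvg_fst.
  - exact: cvg_snd.
  exact: cvg_cst.
have := @homotopy_null R K V V A set0 A set0 h i z ch zA zc Ap (fun _ _ F _ => F).
have -> : (fun x => h (x, 1)) = fun=> p.
  by apply/funext => x; rewrite /h /= subrr scale0r add0r scale1r.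
have -> : (fun x => h (x, 0)) = id.
  by apply/funext => x; rewrite /h /= subr0 scale1r scale0r addr0.
by rewrite fpush_const fpush_id; exact: nullc_sym.
Qed.

(** The cycle is homologous to a multiple of a constant simplex. In odd degree the constant simplex
    bounds; in even positive degree it is not a cycle, so the multiple is 0. *)
Lemma contract_null (A : set V) (p : V) (i : nat) (z : ch i.+1) :
  (forall x t, A x -> 0 <= t <= 1 -> A ((1 - t) *: x + t *: p)) -> A p ->
  z \in chain_in A -> cyc set0 z -> nullc A set0 z.
Proof.
move=> Ap pA zA zc; rewrite -[z](subrK (augmentation V i.+1 z *: << const_sing p i.+1 >>)).
apply: nullcD; first exact: contract.
have cA k : (<< const_sing p k >> : ch k) \in chain_in A.
  by rewrite fsuppU; apply/asboolP => _ [v _ <-].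
have [oi|ei] := boolP (odd i); last first.
  exists (augmentation V i.+1 z *: << const_sing p i.+2 >>); split; first by apply: rpredZ; exact: cA.
  by rewrite linearZ /= bd_const_sing /= ei scale1r subrr rpred0.
suff -> : augmentation V i.+1 z = 0 by rewrite scale0r; exact: nullc0.
have : bd (fpush (fun=> p) z) = 0.
  rewrite (bd_fpush (A := setT)) ?chain_inT // ?(chain_in0 zc) ?linear0 //.
  by apply: continuous_subspaceT; exact: cst_continuous.
rewrite fpush_const linearZ /= bd_const_sing oi scale1r.
by move/(congr1 (augmentation V i)); rewrite linear0 linearZ /= fliftU [_ *: _]mulr1.
Qed.

Lemma outside_vanish k i (z : ch i) : (k <= n)%N -> i != k -> cyc (outside k) z ->
  nullc setT (outside k) z.
Proof.
elim: k i z => [|k IH] [|i] z kn // ik zc.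
- by rewrite outside0 in zc *; exact: (@contract_null setT 0 _ _ _ _ (chain_inT _)).
- by apply: outside_deg0; rewrite kn.
have [x xc zx] := suspend_surj kn zc.
rewrite -[z](subrK (suspend k i x)); apply: nullcD zx _.
by apply: suspend_null => //; apply: IH => //; exact: ltnW.
Qed.

Lemma outside_gen k (z : ch k) : (k <= n)%N -> cyc (outside k) z ->
  exists c, nullc setT (outside k) (z - c *: box_gen k).
Proof.
elim: k z => [|k IH] z kn zc.
  by exists (augmentation V 0 z); rewrite outside0 in zc *; exact: (@contract setT 0 _ _ _ (chain_inT _)).
have [x xc zx] := suspend_surj kn zc; have [c xg] := IH x (ltnW kn) xc.
exists c; apply: nullc_trans zx _.
by have := suspend_null kn xg; rewrite linearB linearZ.
Qed.

End Box.
End Boxes.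

(** * Induction over the closed subsets of a manifold *)

Section CompactInduction.
Variables (R : realType) (n : nat) (M : topologicalType).
Local Notation V := 'rV[R]_n.

(** Compactness as an induction principle: the sets with [Q] form an ideal, and [F] is the filter of
    properties shared by all sufficiently large members of it. *)
Lemma compact_local (X : topologicalType) (A : set X) (Q : set X -> Prop) :
  compact A -> Q set0 -> (forall B C, Q B -> Q C -> Q (B `|` C)) ->
  (forall B C, B `<=` C -> Q C -> Q B) ->
  (forall x, A x -> exists2 U, nbhs x U & Q U) -> Q A.
Proof.
move=> /compact_near_coveringP cA Q0 QU QS Ql.
pose F : set_system (set X) := [set P | exists2 C, Q C & forall B, C `<=` B -> Q B -> P B].
have FF : Filter F.
  split.
  - by exists set0.
  - move=> P P' [C QC CP] [C' QC' CP']; exists (C `|` C'); first exact: QU.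
    move=> B CB QB; split; first by apply: CP => // x Cx; apply: CB; left.
    by apply: CP' => // x Cx; apply: CB; right.
  by move=> P P' PP [C QC CP]; exists C => // B CB QB; apply/PP/CP.
have [C QC CA] : F [set B | A `<=` B].
  apply: (cA _ F (fun B x => B x)) => x /Ql[U Ux QU'].
  exists (U, [set B | U `<=` B]); last by move=> [y B] [/= Uy UB]; exact: UB.
  by split=> //; exists U.
exact: QS (CA C _ QC) QC.
Qed.

Lemma continuous_addc (T : topologicalType) (f : T -> R) c :
  continuous f -> continuous (fun x => f x + c).
Proof. by move=> cf x; apply: cvgD; [exact: cf | exact: cvg_cst]. Qed.

Lemma continuous_translation (v0 : V) : continuous (fun v : V => v + v0).
Proof.
apply: continuous_row => j; under eq_fun do rewrite mxE.
by apply: continuous_addc; exact: coord_continuous.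
Qed.

(** The inverse [f] is a total function, continuous on the range of [g], so that [fpush] applies to
    it. *)
Definition is_chart (g : V -> M) (f : M -> V) : Prop :=
  [/\ continuous g, open (range g), {within range g, continuous f} & cancel g f].

Lemma chart_nbhs g f y W : is_chart g f -> range g y -> nbhs (f y) W ->
  nbhs y (range g `&` f @^-1` W).
Proof.
move=> [_ og + _] gy fW; rewrite continuous_open_subspace // => /(_ y (mem_set gy) _ fW) h.
apply: filterI; last exact: h.
by apply: open_nbhs_nbhs; split.
Qed.

Definition box (a b : V) : set V := [set x | forall j, a 0 j <= x 0 j <= b 0 j].

Definition inner_box (a b : V) : Prop := forall j, -1 < a 0 j /\ b 0 j < 1.

Hypothesis hM : closed_manifold R n M.

Lemma chart_ex (x : M) : exists g f, is_chart g f /\ g 0 = x.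
Proof.
have [_ _ _ /(_ x)[U [oU Ux] [f [g [cf cg fK gK]]]]] := hM.
pose v0 := f (exist _ x (mem_set Ux)).
pose G v : M := set_val (g (v + v0)).
pose F := valL_ (0 : V) (fun u : U => f u - v0).
have FE u : F (set_val u) = f u - v0.
  exact: (congr1 (@^~ u) (valLK 0 (fun u : U => f u - v0))).
have rG : range G = U.
  apply/seteqP; split=> [_ [v _ <-]|y Uy]; first exact: set_valP.
  exists (f (exist _ y (mem_set Uy)) - v0) => //.
  by rewrite /G subrK fK.
exists G, F; split; last by rewrite /G add0r fK.
split.
- move=> v; apply: (@continuous_comp V U M (fun v => g (v + v0)) set_val); last first.
    exact: initial_continuous.
  apply: (@continuous_comp V V U (fun v => v + v0) g); last exact: cg.
  exact: continuous_translation.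
- by rewrite rG.
- rewrite rG; apply/subspace_valL_continuousP' => u.
  apply: (@continuous_comp U V V f (fun v => v - v0)); first exact: cf.
  exact: continuous_translation.
by move=> v; rewrite /G FE gK addrK.
Qed.

Lemma box_compact a b : compact (box a b).
Proof.
have -> : box a b = [set v : V | forall j, `[a 0 j, b 0 j]%classic (v 0 j)].
  by apply/seteqP; split=> v h j; have := h j; rewrite /= in_itv.
by apply: (@rV_compact R n (fun j => `[a 0 j, b 0 j]%classic)) => j; exact: segment_compact.
Qed.

Lemma chart_box_closed g f a b : is_chart g f -> closed (g @` box a b).
Proof.
move=> [cg _ _ _]; have [_ hs _ _] := hM; apply: compact_closed => //.
apply: continuous_compact; last exact: box_compact.
exact: continuous_subspaceT.
Qed.

Lemma box_nbhd (x : V) (W : set V) : nbhs x W -> (forall j, -1 < x 0 j < 1) ->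
  exists a b, [/\ inner_box a b, nbhs x (box a b), box a b `<=` W & forall j, a 0 j <= b 0 j].
Proof.
move=> /nbhs_ballP[e /= e0 eW] x1.
have [d /= [d0 de dx]] : exists d : R, [/\ 0 < d, d < e & forall j, -1 < x 0 j - d /\ x 0 j + d < 1].
  have : \forall d \near 0^'+, [/\ 0 < d, d < e & forall j, -1 < x 0 j - d /\ x 0 j + d < 1].
    have H : \forall d \near 0^'+, forall j, -1 < x 0 j - d /\ x 0 j + d < 1.
      apply: filter_forall => j; have /andP[x0 x1'] := x1 j.
      have m0 : 0 < Num.min (x 0 j + 1) (1 - x 0 j) by rewrite lt_min; apply/andP; split; lra.
      near=> d; have : d < Num.min (x 0 j + 1) (1 - x 0 j) by near: d; exact: nbhs_right_lt.
      by rewrite lt_min => /andP[? ?]; split; lra.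
    near=> d; split; [near: d; exact: nbhs_right_gt | near: d; exact: nbhs_right_lt | by near: d].
  by move=> /filter_ex.
exists (x - const_mx d), (x + const_mx d).
split.
- by move=> j; rewrite !mxE; exact: dx.
- apply/nbhs_ballP; exists d => // y [_ yx] j; have := yx 0 j.
  by rewrite !mxE -ball_normE /= ltr_distlC => /andP[? ?]; apply/andP; split; lra.
- move=> y hy; apply: eW; split => // i j; rewrite ord1 -ball_normE /= ltr_distlC.
  by have := hy j; rewrite !mxE => /andP[? ?]; apply/andP; split; lra.
by move=> j; rewrite !mxE; lra.
Unshelve. all: by end_near.
Qed.

Definition boxes (g : V -> M) (s : seq (V * V)) : set M :=
  [set y | exists2 p, p \in s & (g @` box p.1 p.2) y].

Variable P : set M -> Prop.
Hypothesis P0 : P set0.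
Hypothesis Pbox : forall g f a b, is_chart g f -> inner_box a b ->
  (forall j, a 0 j <= b 0 j) -> P (g @` box a b).
Hypothesis PU : forall A B, closed A -> closed B -> P A -> P B -> P (A `&` B) -> P (A `|` B).
Hypothesis Plim : forall A, closed A -> (forall W, open W -> A `<=` W ->
  exists A', [/\ closed A', A `<=` A', A' `<=` W & P A']) -> P A.

Lemma boxes_closed g f s : is_chart g f -> closed (boxes g s).
Proof.
move=> gf; elim: s => [|p s IH].
  by rewrite (_ : boxes _ _ = set0); [exact: closed0 | apply/seteqP; split=> // x []].
rewrite (_ : boxes _ _ = g @` box p.1 p.2 `|` boxes g s).
  by apply: closedU => //; exact: chart_box_closed gf.
apply/seteqP; split=> [x [q]|x [xp|[q qs xq]]].
- by rewrite inE => /orP[/eqP -> xp|qs xq]; [left | right; exists q].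
- by exists p => //; rewrite mem_head.
by exists q => //; rewrite inE qs orbT.
Qed.

Let meet (p q : V * V) : V * V :=
  (\row_j Num.max (p.1 0 j) (q.1 0 j), \row_j Num.min (p.2 0 j) (q.2 0 j)).

(** Induction on the number of boxes: a box meets a union of N boxes in a union of N boxes. *)
Lemma boxes_ind g f s : is_chart g f -> (forall p, p \in s -> inner_box p.1 p.2) -> P (boxes g s).
Proof.
move=> gf; have [cg _ _ gK] := gf.
(* Intersections of boxes may be empty; their bounds then fail [a 0 j <= b 0 j]. *)
have Pany a b : inner_box a b -> P (g @` box a b).
  move=> ab; have [le|nle] := pselect (forall j, a 0 j <= b 0 j); first exact: Pbox gf _ _.
  have -> // : g @` box a b = set0.
  apply/seteqP; split=> // y [v bv _]; apply: nle => j.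
  by have /andP[? ?] := bv j; lra.
move: {2}(size s) (leqnn (size s)) => N; elim: N s => [|N IH] [|p s] //= sN sin.
- by rewrite (_ : boxes _ _ = set0) //; apply/seteqP; split=> // x [].
- by rewrite (_ : boxes _ _ = set0) //; apply/seteqP; split=> // x [].
have sin' q : q \in s -> inner_box q.1 q.2 by move=> qs; apply: sin; rewrite inE qs orbT.
rewrite (_ : boxes _ _ = g @` box p.1 p.2 `|` boxes g s); last first.
  apply/seteqP; split=> [x [q]|x [xp|[q qs xq]]].
  - by rewrite inE => /orP[/eqP -> xp|qs xq]; [left | right; exists q].
  - by exists p => //; rewrite mem_head.
  by exists q => //; rewrite inE qs orbT.
apply: PU; [exact: chart_box_closed gf | exact: boxes_closed gf | | exact: IH |].
  by apply: Pany; apply: sin; rewrite mem_head.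
have -> : g @` box p.1 p.2 `&` boxes g s = boxes g (map (meet p) s).
  apply/seteqP; split=> [_ [[v pv <-] [q qs [w qw]]]|x [_ /mapP[q qs ->] [v vm <-]]].
    move/(congr1 f); rewrite !gK => wv; subst w.
    exists (meet p q); first exact: map_f.
    exists v => // j; rewrite !mxE ge_max le_min.
    by have /andP[-> ->] := pv j; have /andP[-> ->] := qw j.
  have vm' j : (p.1 0 j <= v 0 j <= p.2 0 j) && (q.1 0 j <= v 0 j <= q.2 0 j).
    have := vm j; rewrite !mxE ge_max le_min => /andP[/andP[-> ->] /andP[-> ->]] //.
  split; first by exists v => // j; have /andP[] := vm' j.
  by exists q => //; exists v => // j; have /andP[] := vm' j.
apply: IH; first by rewrite size_map.
move=> _ /mapP[q qs ->] j; rewrite !mxE lt_max gt_min.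
by have [|-> ->] := sin p _ j; rewrite ?mem_head.
Qed.

(** Finite unions of boxes come from [PU], closed subsets of the cube of one chart are limits of
    such unions, and every closed set is a finite union of closed sets of this kind. *)
Lemma compact_induction A : closed A -> P A.
Proof.
have [cM hs _ _] := hM.
have cc (B : set M) : closed B -> compact B by move=> cB; exact: subclosed_compact cB cM _.
have chartP (g : V -> M) (f : M -> V) (B : set M) : is_chart g f -> closed B ->
    B `<=` g @` [set v : V | forall j, -1 < v 0 j < 1] -> P B.
  move=> gf cB Bg; have [cg og cf gK] := gf; apply: Plim => // W oW BW.
  pose Q (C : set M) := exists s, [/\ forall p, p \in s -> inner_box p.1 p.2,
    C `<=` boxes g s & boxes g s `<=` W].
  have [||||s [sin Bs sW]] := @compact_local _ B Q (cc _ cB).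
  - by exists [::]; split=> // x [].
  - move=> C C' [s [sin Cs sW]] [s' [sin' Cs' sW']]; exists (s ++ s'); split.
    + by move=> p; rewrite mem_cat => /orP[]; [exact: sin | exact: sin'].
    + move=> x [/Cs|/Cs'] [p ps xp]; exists p; rewrite // mem_cat ps ?orbT //.
    by move=> x [p]; rewrite mem_cat => /orP[ps|ps] xp; [apply: sW | apply: sW']; exists p.
  - by move=> C C' CC [s [sin Cs sW]]; exists s; split=> // x /CC/Cs.
  - move=> _ /[dup] /Bg[v v1 <-] Bv.
    have [|a [b [ab vb abW _]]] := @box_nbhd v (g @^-1` W) _ v1.
      by apply: cg; apply: open_nbhs_nbhs; split=> //; exact: BW.
    exists (g @` box a b).
      have : nbhs (g v) (range g `&` f @^-1` box a b).
        have gv : range g (g v) by exists v.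
        by apply: chart_nbhs; rewrite ?gK.
      by apply: filterS => _ [[w _ <-]] /=; rewrite gK => wb; exists w.
    exists [:: (a, b)]; split.
    + by move=> p; rewrite mem_seq1 => /eqP ->.
    + by move=> x xb; exists (a, b); rewrite ?mem_head.
    by move=> x [p]; rewrite mem_seq1 => /eqP -> [w wb <-]; exact: abW.
  by exists (boxes g s); split=> //; [exact: boxes_closed gf | exact: boxes_ind gf sin].
move=> cA.
(* [N] serves all closed [B] at once, which covers the intersections asked for by [PU]. *)
pose Q (C : set M) := exists N, [/\ closed N, C `<=` N & forall B, closed B -> P (B `&` N)].
have [|||x Ax|N [cN AN /(_ A cA)]] := @compact_local _ A Q (cc _ cA).
- by exists set0; split=> [| |B cB]; [exact: closed0 | | rewrite setI0].
- move=> C C' [N [cN CN PN]] [N' [cN' CN' PN']]; exists (N `|` N'); split; first exact: closedU.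
    by move=> x [/CN|/CN']; [left | right].
  move=> B cB; rewrite setIUr; apply: PU; [exact: closedI | exact: closedI | exact: PN | exact: PN' |].
  rewrite (_ : _ `&` _ = (B `&` N) `&` N'); first by apply: PN'; exact: closedI.
  by apply/seteqP; split=> x; [move=> [[? ?] [? ?]] | move=> [[? ?] ?]].
- by move=> C C' CC [N [cN CN PN]]; exists N; split=> // x /CC/CN.
- have [g [f [gf gx]]] := chart_ex x; have [cg og cf gK] := gf.
  have h1 : ((-1 : R) < - 2^-1) && (- 2^-1 < (2^-1 : R)) && ((2^-1 : R) < 1) by lra.
  exists (g @` box (const_mx (- 2^-1)) (const_mx 2^-1)).
    have gv : range g x by exists 0.
    have b0 : nbhs (f x) (box (const_mx (- 2^-1)) (const_mx 2^-1)).
      rewrite -gx gK; apply/nbhs_ballP; exists (2^-1) => /=; first by rewrite invr_gt0.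
      move=> y [_ yx] j; have := yx 0 j; rewrite !mxE -ball_normE /= sub0r normrN ltr_norml.
      by move=> /andP[? ?]; apply/andP; split; lra.
    by move: (chart_nbhs gf gv b0); apply: filterS => _ [[w _ <-]] /=; rewrite gK => wb; exists w.
  exists (g @` box (const_mx (- 2^-1)) (const_mx 2^-1)); split=> //.
    exact: chart_box_closed gf.
  move=> B cB; apply: (chartP _ _ _ gf).
    by apply: closedI => //; exact: chart_box_closed gf.
  move=> _ [_ [v vb <-]]; exists v => // j; have := vb j; rewrite !mxE => /andP[? ?];
    apply/andP; split; lra.
by rewrite (_ : A `&` N = A) //; apply/seteqP; split=> [x []|x Ax] //; split=> //; exact: AN.
Qed.

End CompactInduction.

(** * Relative homology of a box in a chart *)

Section ChartHomology.
Variables (R : realType) (K : comNzRingType) (n : nat) (M : topologicalType).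
Hypothesis hM : closed_manifold R n M.
Local Notation V := 'rV[R]_n.
Local Notation ch k := (chain R K k M).
Variables (g : V -> M) (f : M -> V) (a b : V).
Hypothesis gf : is_chart g f.
Hypothesis ab : inner_box a b.
Hypothesis le_ab : forall j, a 0 j <= b 0 j.
Let B := g @` box a b.
Let a1 j : -1 < a 0 j. Proof. by have [] := ab j. Qed.
Let b1 j : b 0 j < 1. Proof. by have [] := ab j. Qed.

Lemma outside_box : outside a b n = ~` box a b.
Proof.
apply/seteqP; split=> [v [j [_ vj]] /(_ j) /andP[? ?]|v nv].
  by case: vj => ?; lra.
apply: contrapT => h; apply: nv => j; rewrite leNgt [_ <= b 0 j]leNgt -negb_or.
by apply/negP => /orP vj; apply: h; exists j; rewrite ltn_ord.
Qed.

Lemma complement_open : open (~` B).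
Proof. by apply: closed_openC; exact: chart_box_closed gf. Qed.

(** Excision moves the relative cycle into the range of the chart, where [f] is continuous. *)
Lemma chart_pull i (z : ch i) : cyc (~` B) z ->
  exists z', [/\ z' \in chain_in (range g), nullc setT (~` B) (z - z') &
    cyc (outside a b n) (fpush f z')].
Proof.
move=> zc; have [cg og cf gK] := gf.
have cover : range g `|` ~` B = setT.
  apply/seteqP; split=> // x _; have [[v bv <-]|nb] := pselect (B x); last by right.
  by left; exists v.
have [|z' [z'g z'c zz']] := excise og complement_open _ zc; first by rewrite cover chain_inT.
rewrite cover in zz'; exists z'; split=> //.
rewrite outside_box; apply: cyc_fpush cf _ z'g z'c => x [v _ <-] [_ nb].
by rewrite gK => bv; apply: nb; exists v.
Qed.

Lemma chart_null i (c : chain R K i V) : nullc setT (outside a b n) c ->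
  nullc setT (~` B) (fpush g c).
Proof.
have [cg _ _ gK] := gf; have cg' : {within setT, continuous g} by exact: continuous_subspaceT.
move=> [d [_ cd]]; exists (fpush g d); split; first exact: chain_inT.
rewrite (bd_fpush cg') ?chain_inT // -linearB; apply: fpush_in cd => v.
by rewrite outside_box => nb [w bw /(can_inj gK) wv]; apply: nb; rewrite -wv.
Qed.

Lemma fpush_chartK i (z : ch i) : z \in chain_in (range g) -> fpush g (fpush f z) = z.
Proof.
have [cg _ cf gK] := gf; move=> zg.
apply: (fpushK (A := range g) (B := setT)) => //; first exact: continuous_subspaceT.
by move=> _ [v _ <-]; rewrite gK.
Qed.

Definition chart_gen : ch n := fpush g (box_gen R K n n).

Lemma chart_gen_cyc : cyc (~` B) chart_gen.
Proof.
have [cg _ _ gK] := gf; have cg' : {within setT, continuous g} by exact: continuous_subspaceT.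
apply: (cyc_fpush cg' _ (chain_inT _) (gen_cyc K a1 b1 (leqnn n))) => v _.
by rewrite outside_box => nb [w bw /(can_inj gK) wv]; apply: nb; rewrite -wv.
Qed.

Lemma chart_vanish i (z : ch i) : i != n -> cyc (~` B) z -> nullc setT (~` B) z.
Proof.
move=> ni /chart_pull[z' [z'g zz' zc]].
have := chart_null (outside_vanish le_ab a1 b1 (leqnn n) ni zc); rewrite fpush_chartK // => z'0.
by rewrite -[z](subrK z'); exact: nullcD.
Qed.

Lemma chart_gen_span (z : ch n) : cyc (~` B) z ->
  exists c, nullc setT (~` B) (z - c *: chart_gen).
Proof.
move=> /chart_pull[z' [z'g zz' zc]].
have [c cz] := outside_gen le_ab a1 b1 (leqnn n) zc; exists c.
have := chart_null cz; rewrite linearB linearZ /= fpush_chartK // => h.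
exact: nullc_trans zz' h.
Qed.

Lemma chart_gen_free c : nullc setT (~` B) (c *: chart_gen) -> c = 0.
Proof.
have [cg og cf gK] := gf; have cg' : {within setT, continuous g} by exact: continuous_subspaceT.
have cover : range g `|` ~` B = setT.
  apply/seteqP; split=> // x _; have [[v bv <-]|nb] := pselect (B x); last by right.
  by left; exists v.
have gin : c *: chart_gen \in chain_in (range g).
  by rewrite rpredZ //; apply: fpush_in (chain_inT _) => v _; exists v.
rewrite -cover => /(excise_inj og complement_open gin) [d [dg cd]].
apply: (gen_free le_ab a1 b1 (leqnn n)).
exists (fpush f d); split; first exact: chain_inT.
have -> : c *: box_gen R K n n = fpush f (c *: chart_gen).
  rewrite linearZ /= [fpush f _](fpushK (A := setT) (B := range g)) ?chain_inT //.
rewrite (bd_fpush cf dg) -linearB outside_box; apply: fpush_in cd => x [[v _ <-] nb].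
by rewrite gK => bv; apply: nb; exists v.
Qed.

End ChartHomology.

(** * Homology modulo complements of closed sets, in degrees at least n *)

Section TopHomology.
Variables (R : realType) (K : comNzRingType) (n : nat) (M : topologicalType).
Hypothesis hM : closed_manifold R n M.
Local Notation ch k := (chain R K k M).
Implicit Types A B N : set M.

Lemma closed_compact A : closed A -> compact A.
Proof. by have [cM _ _ _] := hM => cA; exact: subclosed_compact cA cM _. Qed.

Lemma compact_closedM A : compact A -> closed A.
Proof. by have [_ hs _ _] := hM; exact: compact_closed. Qed.

(** Chains have compact support, so a cycle modulo the complement of A is one modulo the complement
    of a neighborhood of A. All passages to limits rest on this. *)
Lemma chain_support k (U : set M) (c : ch k) : c \in chain_in U ->
  exists C, [/\ closed C, C `<=` U & c \in chain_in C].
Proof.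
apply: (fsupp_ind (P := fun c : ch k => exists C, [/\ closed C, C `<=` U & c \in chain_in C])).
- by exists set0; split; [exact: closed0 | | exact: rpred0].
- move=> a x y [C [cC CU xC]] [D [cD DU yD]]; exists (C `|` D); split; first exact: closedU.
    by move=> z [/CU|/DU].
  by rewrite rpredD ?rpredZ //; [apply: chain_inS xC | apply: chain_inS yD] => z; [left|right].
move=> s sU; exists (range s); split=> //; last by rewrite fsuppU; apply/asboolP.
apply: compact_closedM; apply: continuous_compact.
  by apply: continuous_subspaceT; exact: cts_fun.
have -> : [set: simplex R k] = @ret R k @` simplex R k.
  by apply/seteqP; split=> // v _; exists (set_val v); [exact: set_valP | exact: ret_val].
apply: continuous_compact; last exact: simplex_compact.
by apply: continuous_subspaceT; exact: continuous_ret.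
Qed.

Lemma cyc_support k (U : set M) (c : ch k) : cyc U c ->
  exists C, [/\ closed C, C `<=` U & cyc C c].
Proof.
case: k c => [|k] c; first by exists set0; split=> //; exact: closed0.
exact: chain_support.
Qed.

Lemma setCS A B : A `<=` B -> ~` B `<=` ~` A.
Proof. by move=> AB x nB /AB. Qed.

(** The obstruction to combining the two null homologies lies one degree higher, modulo the
    complement of the intersection. *)
Lemma mv_null i A B (z : ch i) : closed A -> closed B ->
  (forall w : ch i.+1, cyc (~` (A `&` B)) w -> nullc setT (~` (A `&` B)) w) ->
  nullc setT (~` A) z -> nullc setT (~` B) z -> nullc setT (~` (A `|` B)) z.
Proof.
move=> cA cB vI [d1 [_ a1]] [d2 [_ a2]].
have := @mv_connecting R K M _ _ (closed_openC cA) (closed_openC cB) i d1 d2 0 z _ _ 0 0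
  _ _ a1 a2.
rewrite -setCI -setCU !subr0 linear0; apply=> //; rewrite ?rpred0 //; try by zmod.
apply: vI; rewrite setCI; change (bd (d1 - d2) \in chain_in (~` A `|` ~` B)).
have -> : bd (d1 - d2) = z - bd d2 - (z - bd d1) by rewrite linearB /=; zmod.
by rewrite rpredB //; [apply: chain_inS a2 | apply: chain_inS a1] => x; [right | left].
Qed.

Lemma top_vanish i A (z : ch i) : closed A -> (n < i)%N -> cyc (~` A) z -> nullc setT (~` A) z.
Proof.
move=> cA ni; move: A cA i z ni.
apply: (compact_induction hM) => [i z _ _|g f a b gf ab le_ab i z ni|A B cA cB PA PB PI i z ni zc|A cA PA i z ni zc].
- by apply: nullc_in; rewrite setC0 chain_inT.
- by apply: (chart_vanish hM gf ab le_ab); rewrite gtn_eqF.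
- have zA : cyc (~` A) z by apply: cycS zc; apply: setCS => x; left.
  have zB : cyc (~` B) z by apply: cycS zc; apply: setCS => x; right.
  by apply: mv_null => //; [move=> w; exact: PI (ltnW _) | exact: PA | exact: PB].
have [C [cC CA zC]] := cyc_support zc.
have [|x Ax Cx|A' [cA' AA' A'C /(_ _ z ni)]] := PA (~` C).
- exact: closed_openC.
- exact: CA Cx Ax.
move=> h; apply: (@nullcS _ _ _ _ setT (~` A')) => //; first exact: setCS.
by apply: h; apply: cycS zC => x Cx /A'C.
Qed.

Lemma local_null A (z : ch n) : closed A ->
  (forall x, A x -> exists N, [/\ nbhs x N, closed N & nullc setT (~` (A `&` N)) z]) ->
  nullc setT (~` A) z.
Proof.
move=> cA lA; pose Q (X : set M) :=
  exists N, [/\ closed N, X `<=` N & nullc setT (~` (A `&` N)) z].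
have [|B C [N [cN BN zN]] [N' [cN' CN zN']]|B C BC [N [cN CN zN]]|x /lA[N [xN cN zN]]|] :=
  @compact_local _ A Q (closed_compact cA).
- exists set0; split=> //; first exact: closed0.
  by rewrite setI0 setC0; apply: nullc_in; exact: chain_inT.
- exists (N `|` N'); split; first exact: closedU.
    by move=> x [/BN|/CN]; [left | right].
  rewrite setIUr; apply: mv_null => //; [exact: closedI | exact: closedI |].
  by move=> w; apply: top_vanish => //; apply: closedI; exact: closedI.
- by exists N; split=> // x /BC/CN.
- by exists N => //; exists N; split.
move=> N [cN AN]; rewrite (_ : A `&` N = A) //.
by apply/seteqP; split=> [x []|x Ax] //; split=> //; exact: AN.
Qed.

Lemma chart_point (g : 'rV[R]_n -> M) : g @` box 0 0 = [set g 0].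
Proof.
apply/seteqP; split=> [_ [v v0 <-]|_ ->] /=; last by exists 0 => // j; rewrite lexx.
congr g; apply/rowP => j; have /andP[? ?] := v0 j; apply/eqP.
by rewrite mxE eq_le; move: (v0 j); rewrite !mxE andbC.
Qed.

Lemma inner_box0 : inner_box (0 : 'rV[R]_n) 0.
Proof. by move=> j; rewrite mxE; split; lra. Qed.

Lemma chart_box_nbhd (x : M) (W : set M) : nbhs x W ->
  exists (g : 'rV[R]_n -> M) (f : M -> 'rV[R]_n) (a b : 'rV[R]_n),
  [/\ is_chart g f, g 0 = x, inner_box a b, forall j, a 0 j <= b 0 j &
      nbhs x (g @` box a b) /\ g @` box a b `<=` W].
Proof.
move=> xW; have [g [f [gf gx]]] := chart_ex hM x; have [cg og cf gK] := gf.
have [||a [b [ab vb abW le_ab]]] := @box_nbhd R n 0 (g @^-1` W).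
- by apply: cg; rewrite gx.
- by move=> j; rewrite mxE; apply/andP; split; lra.
exists g, f, a, b; split=> //; split; last by move=> _ [v /abW ? <-].
have gv : range g x by exists 0.
have fx : f x = 0 by rewrite -gx gK.
have := chart_nbhs gf gv; rewrite fx => /(_ _ vb); apply: filterS => _ [[w _ <-]] /=.
by rewrite gK => wb; exists w.
Qed.

(** Near x the class is a multiple of the generator of a box, and restriction to x is injective on
    these multiples. *)
Lemma point_detect A (z : ch n) : closed A -> cyc (~` A) z ->
  (forall x, A x -> nullc setT (~` [set x]) z) -> nullc setT (~` A) z.
Proof.
move=> cA zc zx; apply: local_null => // x Ax.
have [C [cC CA zC]] := cyc_support zc.
have [|g [f [a [b [gf gx ab le_ab [xB BC]]]]]] := @chart_box_nbhd x (~` C).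
  by apply: open_nbhs_nbhs; split; [exact: closed_openC | move=> /CA].
exists (g @` box a b); split=> //; first exact: chart_box_closed gf.
have zB : cyc (~` (g @` box a b)) z by apply: cycS zC => y Cy /BC.
have [c zg] := chart_gen_span hM gf ab le_ab zB.
suff c0 : c = 0.
  rewrite c0 scale0r subr0 in zg; apply: nullcS zg => //; apply: setCS => y [] //.
have Bx : (g @` box a b) x by exact: nbhs_singleton.
apply: (chart_gen_free hM gf inner_box0 (fun j => lexx _)).
rewrite chart_point gx; have -> : c *: chart_gen K g = z - (z - c *: chart_gen K g) by zmod.
by apply: nullcB; [exact: zx | apply: nullcS zg => //; apply: setCS => _ ->].
Qed.

Variable O : M -> ch n -> Prop.
Hypothesis Oloc : forall x : M, exists (N : set M) nu,
  [/\ nbhs x N, closed N, cyc (~` N) nu & forall y, N y -> O y nu].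
Hypothesis Oeq : forall y nu nu', O y nu -> O y nu' -> nullc setT (~` [set y]) (nu - nu').
Hypothesis Onull : forall y nu nu', O y nu -> nullc setT (~` [set y]) (nu' - nu) -> O y nu'.

(** [O y] prescribes the class at y. Local classes agree at the points of an overlap, hence on the
    overlap by [point_detect], and are glued over a finite cover by [mv_glue]. *)
Lemma glue_top_class : exists2 mu : ch n, cyc set0 mu & forall y, O y mu.
Proof.
pose Q (X : set M) := exists N nu,
  [/\ closed N, X `<=` N, cyc (~` N) nu & forall y, N y -> O y nu].
have [cM _ _ _] := hM.
have [|B C [N [nu [cN BN nuc ON]]] [N' [nu' [cN' CN nuc' ON']]]|B C BC [N [nu [cN CN nuc ON]]]|x _|] :=
  @compact_local _ setT Q cM.
- exists set0, 0; split=> //; first exact: closed0.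
  exact: bcond0.
- have [|mu [muc mu1 mu2]] := mv_glue (closed_openC cN) (closed_openC cN') nuc nuc'.
    rewrite -setCI; apply: point_detect; first exact: closedI.
      apply: bcondB; [apply: cycS nuc | apply: cycS nuc']; apply: setCS => x [] //.
    by move=> x [Nx Nx']; apply: Oeq; [exact: ON | exact: ON'].
  exists (N `|` N'), mu; split; first exact: closedU.
  + by move=> x [/BN|/CN]; [left | right].
  + by rewrite setCU.
  move=> y [Ny|Ny]; [apply: Onull (ON _ Ny) _ | apply: Onull (ON' _ Ny) _].
    by apply: nullcS mu1 => //; apply: setCS => _ ->.
  by apply: nullcS mu2 => //; apply: setCS => _ ->.
- by exists N, nu; split=> // x /BC/CN.
- have [N [nu [xN cN nuc ON]]] := Oloc x; exists N => //; by exists N, nu; split.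
move=> N [mu [_ NT muc ON]]; exists mu; last by move=> y; apply: ON; exact: NT.
by apply: cycS muc => x /(_ (NT x I)).
Qed.

End TopHomology.

(** * Change of coefficients *)

Section CoefficientChange.
Variable K : comNzRingType.

(** Orientations are integral while mu has coefficients in K. The generators are built from cones
    and pushes, all of which commute with [cc]. *)
Definition cc (S : choiceType) : {freeg S / int} -> {freeg S / K} :=
  flift (V := zmodule {freeg S / K}) (fun s => << s >>).

Lemma ccP (S : choiceType) (a : int) (x y : {freeg S / int}) :
  cc (a *: x + y) = a%:~R *: cc x + cc y.
Proof. by rewrite /cc linearP /= scalezrE -scaler_int. Qed.

Lemma ccU (S : choiceType) (s : S) : cc << s >> = << s >>.
Proof. by rewrite /cc fliftU. Qed.

Lemma cc0 (S : choiceType) : cc (0 : {freeg S / int}) = 0.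
Proof. by rewrite /cc linear0. Qed.

Lemma ccD (S : choiceType) (x y : {freeg S / int}) : cc (x + y) = cc x + cc y.
Proof. by rewrite /cc linearD. Qed.

Lemma ccB (S : choiceType) (x y : {freeg S / int}) : cc (x - y) = cc x - cc y.
Proof. by rewrite /cc linearB. Qed.

Lemma ccZ (S : choiceType) (a : int) (x : {freeg S / int}) : cc (a *: x) = a%:~R *: cc x.
Proof. by rewrite -[a *: x]addr0 ccP cc0 addr0. Qed.

Lemma cc_flift (S T : choiceType) (g : S -> {freeg T / int}) (g' : S -> {freeg T / K}) x :
  (forall s, cc (g s) = g' s) -> cc (flift g x) = flift g' (cc x).
Proof.
move=> gg; apply: (fsupp_ind (P := fun x => cc (flift g x) = flift g' (cc x)) _ _ _ (fsuppT x)).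
- by rewrite !(linear0, cc0).
- by move=> a y z ey ez; rewrite linearP !ccP ey ez linearP.
by move=> s _; rewrite ccU !fliftU gg.
Qed.

Lemma cc_sum (S : choiceType) (I : Type) (r : seq I) (F : I -> {freeg S / int}) :
  cc (\sum_(i <- r) F i) = \sum_(i <- r) cc (F i).
Proof. by elim: r => [|i r IH]; rewrite ?big_nil ?cc0 // !big_cons ccD IH. Qed.

Lemma cc_fsupp (S : choiceType) (Q : set S) (x : {freeg S / int}) :
  x \in fsupp Q -> cc x \in fsupp Q.
Proof.
apply: (fsupp_ind (P := fun x => cc x \in fsupp Q)) => [|a y z yQ zQ|s sQ].
- by rewrite cc0 rpred0.
- by rewrite ccP rpredD ?rpredZ.
by rewrite ccU fsuppU; apply/asboolP.
Qed.

Variable R : realType.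

Lemma cc_sign (S : choiceType) n (F : 'I_n -> S) :
  cc (\sum_(i < n) (-1) ^+ i *: << F i >>) = \sum_(i < n) (-1) ^+ i *: << F i >>.
Proof. by rewrite cc_sum; apply: eq_bigr => i _; rewrite ccZ ccU rmorphXn rmorphN1. Qed.

Lemma cc_abd k d c : cc (abd R int k d c) = abd R K k d (cc c).
Proof. by apply: cc_flift => P; exact: cc_sign. Qed.

Lemma cc_cone k d b c : cc (@cone R int k d b c) = cone K k b (cc c).
Proof. by apply: cc_flift => P; rewrite ccU. Qed.

Lemma cc_Aemb t m d c : cc (@Aemb R int t m d c) = Aemb K t m d (cc c).
Proof. by apply: cc_flift => P; rewrite ccU. Qed.

Lemma cc_Ahom m d c :
  cc (Ahom (@Aemb R int 1) (@Aemb R int 0) m d c) = Ahom (Aemb K 1) (Aemb K 0) m d (cc c).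
Proof.
elim: m c => [|m IH] c; first by rewrite /= cc0.
apply: cc_flift => P; rewrite cc_cone !ccB !cc_Aemb ccU; congr (cone _ _ _ (_ - _)).
by rewrite [LHS]IH cc_abd ccU.
Qed.

Lemma cc_aeval (X : topologicalType) d (g : 'rV[R]_d -> X) k c :
  cc (aeval g k c : chain R int k X) = aeval g k (cc c).
Proof. by apply: cc_flift => P; case: pselect => ?; rewrite ?ccU ?cc0. Qed.

Lemma cc_prism_op (X Y : topologicalType) (h : X * R -> Y) k (c : chain R int k X) :
  cc (prism_op h k c) = prism_op h k (cc c).
Proof.
rewrite !prism_op.unlock; apply: cc_flift => s.
by rewrite cc_aeval cc_Ahom ccU.
Qed.

Lemma cc_bd (X : topologicalType) k (c : chain R int k.+1 X) : cc (bd c) = bd (cc c).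
Proof. by apply: cc_flift => s; rewrite -!bdE !bdU; exact: cc_sign. Qed.

Lemma cc_fpush (X Y : topologicalType) (f : X -> Y) k (c : chain R int k X) :
  cc (fpush f c) = fpush f (cc c).
Proof. by rewrite !fpush.unlock; apply: cc_flift => s; case: pselect => ?; rewrite ?ccU ?cc0. Qed.

Lemma cc_box_gen n k : cc (box_gen R int n k) = box_gen R K n k.
Proof.
elim: k => [|k IH]; first exact: ccU.
by rewrite /= ccB !cc_prism_op IH.
Qed.

Lemma cc_chart_gen n (M : topologicalType) (g : 'rV[R]_n -> M) :
  cc (chart_gen int g) = chart_gen K g.
Proof. by rewrite /chart_gen cc_fpush cc_box_gen. Qed.

Lemma cc_nullc (X : topologicalType) (A B : set X) k (c : chain R int k X) :
  nullc A B c -> nullc A B (cc c).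
Proof.
move=> [d [dA cd]]; exists (cc d); split; first exact: cc_fsupp.
by rewrite -cc_bd -ccB; exact: cc_fsupp.
Qed.

Lemma cc_cyc (X : topologicalType) (B : set X) k (c : chain R int k X) :
  cyc B c -> cyc B (cc c).
Proof. by case: k c => //= k c; rewrite /cyc /= -cc_bd; exact: cc_fsupp. Qed.

End CoefficientChange.

(** * Passage between homology classes and cycles *)

Section Classes.
Variables (R : realType) (K : comNzRingType) (X : topologicalType) (A : set X).

Lemma is_cycleE k (c : chain R K k X) : c \in is_cycle A <-> cyc A c.
Proof.
case: k c => [|k] c; first by split.
have -> : (c \in is_cycle A) = (bdry R K k X c \in chain_in A) by rewrite unfold_in.
exact: (@eq_ind _ (bd c) (fun z => z \in chain_in A <-> bd c \in chain_in A)
  (iff_refl _) _ (bdE c)).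
Qed.

Definition hclass k (c : chain R K k X) (h : cyc A c) : homology R K k A :=
  lquot_pi _ (RelCycle ((is_cycleE c).2 h)).

Lemma hclass_eq k (c d : chain R K k X) (hc : cyc A c) (hd : cyc A d) :
  hclass hc = hclass hd <-> nullc setT A (c - d).
Proof.
rewrite lquot_eqP [_ \in @is_bdry _ _ _ _ _]unfold_in; split=> [/asboolP[e /= eA]|[e [_ eA]]].
  by exists e; rewrite chain_inT bdE.
by apply/asboolP; exists e; rewrite /= -bdE.
Qed.

Lemma hclass_ex k (x : homology R K k A) : exists c (h : cyc A c), x = hclass h.
Proof.
rewrite -[x]lquot_reprK; case: (lquot_repr x) => c cP.
exists c, ((is_cycleE c).1 cP); congr (lquot_pi _ _); exact/val_inj.
Qed.

Lemma hclassP k a (c d e : chain R K k X) (hc : cyc A c) (hd : cyc A d) (he : cyc A e) :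
  nullc setT A (e - (a *: c + d)) -> hclass he = a *: hclass hc + hclass hd.
Proof.
move=> /(hclass_eq he (bcondP a hc hd)) ->; rewrite /hclass -linearP.
by congr (lquot_pi _ _); exact/val_inj.
Qed.

Lemma hclassZ k a (c d : chain R K k X) (hc : cyc A c) (hd : cyc A d) :
  hclass hd = a *: hclass hc <-> nullc setT A (d - a *: c).
Proof.
have -> : a *: hclass hc = hclass (bcondZ a hc).
  by rewrite /hclass -linearZ; congr (lquot_pi _ _); exact/val_inj.
exact: hclass_eq.
Qed.

End Classes.

(** * The fundamental cycle *)

Section FundamentalCycle.
Variables (R : realType) (K : fieldType) (n : nat) (M : topologicalType).
Hypotheses (hM : closed_manifold R n M) (oM : field_orientable R K n M).
Local Notation zch := (chain R int n M).

Definition local_generator (y : M) (m : zch) : Prop :=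
  cyc (~` [set y]) m /\
  forall z : zch, cyc (~` [set y]) z -> exists k, nullc setT (~` [set y]) (z - k *: m).

(** Both chains generate the same infinite cyclic group, so the factor is a unit of the integers. *)
Lemma local_generator_chart (g : 'rV[R]_n -> M) f (m : zch) : is_chart g f ->
  local_generator (g 0) m -> exists k l : int, k * l = 1 /\
    nullc setT (~` [set g 0]) (m - k *: chart_gen int g).
Proof.
move=> gf [mc mgen]; rewrite -chart_point in mc mgen *.
have i0 := @inner_box0 R n; have l0 (j : 'I_n) : (0 : 'rV[R]_n) 0 j <= (0 : 'rV[R]_n) 0 j := lexx _.
have [k mk] := chart_gen_span hM gf i0 l0 mc.
have [l el] := mgen _ (chart_gen_cyc int gf i0).
exists k, l; split=> //; apply/eqP; rewrite -subr_eq0; apply/eqP.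
apply: (chart_gen_free hM gf i0 l0).
have -> : (k * l - 1) *: chart_gen int g =
    - (chart_gen int g - l *: m) - l *: (m - k *: chart_gen int g).
  by rewrite scalerBl scale1r scalerBr scalerA [l * k]mulrC; zmod.
by apply: nullcB; [exact: nullcN | exact: nullcZ].
Qed.

Lemma orientation_ex : exists G : M -> zch -> Prop,
  [/\ forall y m, G y m -> local_generator y m,
      forall y m m', G y m -> G y m' -> nullc setT (~` [set y]) (cc K m - cc K m') &
      forall x : M, exists (N : set M) m,
        [/\ nbhs x N, closed N, cyc (~` N) m & forall y, N y -> G y m]].
Proof.
case: oM => [K2|[mu [mugen muloc]]].
  exists local_generator; split=> // [y m m' my my'|x].
    have [g [f [gf gy]]] := chart_ex hM y; rewrite -gy in my my' *.
    have [k [l [kl mk]]] := local_generator_chart gf my.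
    have [k' [l' [kl' mk']]] := local_generator_chart gf my'.
    (* The integral units 1 and -1 coincide in characteristic 2. *)
    have one (i j : int) : i * j = 1 -> i%:~R = 1 :> K.
      have two : 1 + 1 = 0 :> K by move: K2; rewrite inE => /andP[_ /eqP].
      move=> ij; have : i \is a GRing.unit by apply/unitrPr; exists j.
      rewrite unfold_in => /orP[/eqP ->|/eqP ->] //.
      by rewrite rmorphN1; apply/eqP; rewrite eq_sym -subr_eq0 opprK two.
    have h (m1 : zch) (k1 l1 : int) : k1 * l1 = 1 ->
        nullc setT (~` [set g 0]) (m1 - k1 *: chart_gen int g) ->
        nullc setT (~` [set g 0]) (cc K m1 - chart_gen K g).
      by move=> /one e /(cc_nullc K); rewrite ccB ccZ e scale1r cc_chart_gen.
    exact: nullc_trans (h _ _ _ kl mk) (nullc_sym (h _ _ _ kl' mk')).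
  have [g [f [a [b [gf gx ab le_ab [xB _]]]]]] := chart_box_nbhd hM (@filterT _ (nbhs x) _).
  exists (g @` box a b), (chart_gen int g); split=> //.
  - exact: chart_box_closed gf.
  - exact: (chart_gen_cyc int gf ab).
  move=> _ [v vb <-].
  have vab : inner_box v v.
    by move=> j; have [? ?] := ab j; have /andP[? ?] := vb j; split; lra.
  have E : g @` box v v = [set g v].
    apply/seteqP; split=> [_ [w wv <-]|_ ->] /=; last by exists v => // j; rewrite lexx.
    by congr g; apply/rowP => j; apply/eqP; rewrite eq_le andbC; exact: wv.
  rewrite /local_generator -E; split; first exact: (chart_gen_cyc int gf vab).
  by move=> z zc; exact: (chart_gen_span hM gf vab).
exists (fun y m => exists h : cyc (~` [set y]) m, hclass h = mu y); split.
- move=> y m [h hm]; split=> // z zc; have [k] := mugen y (hclass zc).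
  by rewrite -hm => /hclassZ ?; exists k.
- move=> y m m' [h hm] [h' hm']; rewrite -ccB; apply: cc_nullc.
  by apply/(hclass_eq h h'); rewrite hm hm'.
move=> x; have [N xN [nu nuP]] := muloc x.
have [m [mc mE]] := hclass_ex nu.
have [g [f [a [b [gf gx ab le_ab [xB BN]]]]]] := chart_box_nbhd hM xN.
exists (g @` box a b), m; split=> //; first exact: chart_box_closed gf.
  by apply: (cycS _ mc); exact: setCS.
move=> y /BN Ny; have h : cyc (~` [set y]) m by apply: (cycS _ mc); apply: setCS => _ ->.
exists h; rewrite -(nuP y Ny) mE /localize /induced /= induced_pi; congr (lquot_pi _ _).
apply/val_inj => /=; rewrite push_fpush; symmetry; exact: fpush_id.
Qed.

(** At each point mu is the image of an integral generator, thus a unit multiple of the chart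
    generator, and does not vanish over K. *)
Lemma fundamental_cycle : exists2 mu : chain R K n M,
  cyc set0 mu & forall y, ~ nullc setT (~` [set y]) mu.
Proof.
have [G [Ggen Geq Gloc]] := orientation_ex.
pose O (y : M) (nu : chain R K n M) := exists2 m, G y m & nullc setT (~` [set y]) (nu - cc K m).
have [x|y nu nu' [m Gm nm] [m' Gm' nm']|y nu nu' [m Gm nm] nn|mu muc muO] :=
  @glue_top_class R K n M hM O.
- have [N [m [xN cN mc GN]]] := Gloc x; exists N, (cc K m); split=> //; first exact: cc_cyc.
  by move=> y Ny; exists m; [exact: GN | rewrite subrr; exact: nullc0].
- by apply: nullc_trans nm _; apply: nullc_trans (Geq _ _ _ Gm Gm') _; exact: nullc_sym.
- by exists m => //; exact: nullc_trans nn nm.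
exists mu => // y mu0; have [m /Ggen gm mum] := muO y.
have [g [f [gf gy]]] := chart_ex hM y; rewrite -gy in gm mum mu0.
have [k [l [kl mk]]] := local_generator_chart gf gm.
have i0 := @inner_box0 R n; have l0 (j : 'I_n) : (0 : 'rV[R]_n) 0 j <= (0 : 'rV[R]_n) 0 j := lexx _.
have : k%:~R = 0 :> K.
  apply: (chart_gen_free hM gf i0 l0); rewrite chart_point -cc_chart_gen -ccZ.
  have -> : cc K (k *: chart_gen int g) = mu - (mu - cc K m) - cc K (m - k *: chart_gen int g).
    by rewrite ccB; zmod.
  by apply: nullcB; [exact: nullcB | exact: cc_nullc].
by move/(congr1 ( *%R^~ l%:~R)); rewrite -rmorphM kl mul0r => /eqP; rewrite oner_eq0.
Qed.

End FundamentalCycle.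
(** * Cap products and Poincare duality *)

Section CapProduct.
Variables (R : realType) (K : comNzRingType) (X : topologicalType).
Local Notation ch k := (chain R K k X).
Local Notation coch k := ({linear chain R K k X -> K^o}).

Definition vertex_mx (w : nat -> nat) k N : 'M[R]_(k.+1, N.+1) :=
  \matrix_(i < k.+1) delta_mx 0 (inord (w i)).

(** The face of [s] spanned by the vertices w 0, ..., w k. Affine evaluation turns iterated faces
    into compositions of index maps. *)
Definition vop (w : nat -> nat) k N (s : sing R N X) : sing R k X :=
  asimplex (@continuous_ret_sing R X N s) (vertex_mx w k N).

Lemma vop_range w k N (s : sing R N X) : range (vop w k s) `<=` range s.
Proof. by move=> _ [v _ <-]; exists (ret (set_val v *m vertex_mx w k N)). Qed.

Lemma eq_vop w w' k N (s : sing R N X) : (forall i, (i <= k)%N -> w i = w' i) ->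
  vop w k s = vop w' k s.
Proof.
move=> ww; rewrite /vop (_ : vertex_mx w k N = vertex_mx w' k N) //.
by apply/row_matrixP => i; rewrite !rowK ww // -ltnS.
Qed.

Lemma vertex_in w k N : rows_in (simplex R N) (vertex_mx w k N).
Proof.
move=> j; rewrite rowK; split=> [m|]; first by rewrite mxE eqxx; case: eqP.
rewrite (bigD1 (inord (w j))) //= big1 ?addr0; first by rewrite mxE !eqxx.
by move=> m /negPf ml; rewrite mxE ml andbF.
Qed.

Lemma vop_id N (s : sing R N X) : vop id N s = s.
Proof.
apply/continuousEP => v; rewrite asimplexE (_ : vertex_mx id N N = 1%:M).
  by rewrite mulmx1 /= ret_val.
by apply/row_matrixP => i; rewrite rowK row1 inord_val.
Qed.

Lemma face_vop w k N (s : sing R N X) (i : 'I_k.+2) :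
  sing_face i (vop w k.+1 s) = vop (w \o bump i) k s.
Proof.
rewrite sing_face_asimplex /vop (_ : row' i _ = vertex_mx (w \o bump i) k N) //.
by apply/row_matrixP => j; rewrite row_row' !rowK.
Qed.

Lemma vop_face w k N (s : sing R N.+1 X) (j : 'I_N.+2) :
  (forall i, (i <= k)%N -> (w i <= N)%N) ->
  vop w k (sing_face j s) = vop (bump j \o w) k s.
Proof.
move=> wN; apply/continuousEP => v; rewrite !asimplexE /=.
have vS := rowmul_simplex v (@simplex_cvx R N) (@vertex_in w k N).
congr (s _); apply/val_inj; rewrite [LHS]/= -[LHS]/(set_val (face_fun j _)).
rewrite face_mulmx (_ : set_val (ret _) = set_val v *m vertex_mx w k N); last exact: ret_id.
rewrite -mulmxA (_ : vertex_mx w k N *m _ = vertex_mx (bump j \o w) k N.+1).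
  symmetry; apply: ret_id; apply: rowmul_simplex; first exact: simplex_cvx.
  exact: vertex_in.
apply/row_matrixP => i; rewrite row_mul !rowK -rowE row_row' row1; congr (delta_mx 0 _).
have wi : (w i <= N)%N by apply: wN; rewrite -ltnS.
have e1 : nat_of_ord (inord (w i) : 'I_N.+1) = w i by apply: inordK; rewrite ltnS.
have e2 : nat_of_ord (inord (bump j (w i)) : 'I_N.+2) = bump j (w i).
  apply: inordK; rewrite /bump; case: (j <= w i)%N; rewrite ?add1n ?add0n !ltnS //.
  exact: leqW.
apply/val_inj; exact: (etrans (congr1 (bump j) e1) (esym e2)).
Qed.

(** The Alexander-Whitney formula: front r-face into [phi], back q-face kept. *)
Definition cap r (phi : coch r) q N : {linear ch N -> ch q} :=
  flift (fun s : sing R N X => phi << vop id r s >> *: << vop (addn (N - q)) q s >>).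

Lemma capU r (phi : coch r) q N (s : sing R N X) :
  cap phi q N << s >> = phi << vop id r s >> *: << vop (addn (N - q)) q s >>.
Proof. by rewrite /cap fliftU. Qed.

Lemma cap_local r (phi : coch r) q N : local_op (cap phi q N).
Proof.
move=> s; rewrite capU rpredZ // fsuppU; apply/asboolP; exact: vop_range.
Qed.

Lemma capP r a (phi psi chi : coch r) q N (c : ch N) :
  (forall x, chi x = a * phi x + psi x) -> cap chi q N c = a *: cap phi q N c + cap psi q N c.
Proof.
move=> E; apply: (@free_lift_ext _ _ _ (cap chi q N) ((a \*: cap phi q N) \+ cap psi q N)) => s.
by rewrite /= !capU E scalerDl scalerA.
Qed.

Definition delta r (phi : coch r) : coch r.+1 := phi \o @bd R K X r.

(** For j at most r the j-th face changes the front only and cancels against the coboundary; for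
    larger j it changes the back only. The last term of the coboundary supplies the face number 0 of
    the back. *)
Lemma cap_bd r q N (phi : coch r) (c : ch N.+1) : N = (r + q)%N ->
  cap phi q N (bd c) - cap (delta phi) q N.+1 c = (-1) ^+ r *: bd (cap phi q.+1 N.+1 c).
Proof.
move=> NE; apply: (@free_lift_ext _ _ _ ((cap phi q N \o bd) \- cap (delta phi) q N.+1)
  ((-1) ^+ r \*: (bd \o cap phi q.+1 N.+1))) => s.
rewrite [LHS]/= [RHS]/= !capU.
pose t j := (-1) ^+ j *: (phi << vop (bump j) r s >> *: << vop (bump j \o addn r) q s >>) : ch q.
have Nq : (N - q = r)%N by rewrite NE addnK.
have Nq1 : (N.+1 - q.+1 = r)%N by rewrite subSS.
have Nq2 : (N.+1 - q = r.+1)%N by rewrite NE -addSn addnK.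
have -> : cap phi q N (bd << s >>) = \sum_(0 <= j < N.+2) t j.
  rewrite bdU linear_sum big_mkord; apply: eq_bigr => i _; rewrite linearZ /= capU Nq !vop_face //.
    by move=> j jq; rewrite NE leq_add2l.
  by move=> j jr; rewrite (leq_trans jr) // NE leq_addr.
have -> : delta phi << vop id r.+1 s >> *: << vop (addn (N.+1 - q)) q s >> =
    \sum_(0 <= j < r.+2) ((-1) ^+ j *: phi << vop (bump j) r s >>) *: << vop (addn r.+1) q s >>.
  rewrite Nq2 /delta /= bdU linear_sum -scaler_suml big_mkord; congr (_ *: _).
  by apply: eq_bigr => i _; rewrite linearZ /= face_vop.
have -> : @bd R K X q (phi << vop id r s >> *: << vop (addn (N.+1 - q.+1)) q.+1 s >>) =
    (phi << vop id r s >> : K) *: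
      \sum_(0 <= i < q.+2) (-1) ^+ i *: << vop (addn r \o bump i) q s >>.
  rewrite linearZ /= bdU; congr (_ *: _).
  by rewrite big_mkord; apply: eq_bigr => i _; rewrite face_vop Nq1.
have rN : (r.+1 <= N.+2)%N by rewrite NE ltnS leqW // leq_addr.
rewrite (big_cat_nat (leq0n _) rN) /=.
rewrite [X in _ - X]big_nat_recr //=.
have -> : \sum_(0 <= j < r.+1) t j =
    \sum_(0 <= j < r.+1) ((-1) ^+ j *: phi << vop (bump j) r s >>) *: << vop (addn r.+1) q s >>.
  apply: eq_big_nat => j /andP[_ jr]; rewrite /t scalerA; congr (_ *: << _ >>).
  apply: eq_vop => i _ /=; rewrite /bump (leq_trans _ (leq_addr i r)) //.
have -> : \sum_(r.+1 <= j < N.+2) t j =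
    (-1) ^+ r *: \sum_(1 <= i < q.+2) (-1) ^+ i *:
      (phi << vop id r s >> *: << vop (addn r \o bump i) q s >>).
  have Nr : (N.+2 - r)%N = q.+2 by rewrite NE -!addnS addKn.
  rewrite -(add1n r) big_addn Nr scaler_sumr; apply: eq_big_nat => i /andP[i0 _].
  rewrite /t addnC exprD scalerA; congr (_ *: (phi << _ >> *: << _ >>)).
    apply: eq_vop => l lr; rewrite /bump leqNgt (leq_ltn_trans lr) //.
    by rewrite -[X in (X < _)%N]addn0 ltn_add2l.
  by apply: eq_vop => l _ /=; rewrite /bump leq_add2l addnCA.
have b0 : vop (bump r.+1) r s = vop id r s.
  by apply: eq_vop => i ir; rewrite /bump leqNgt ltnS ir.
have b1 : vop (addn r \o bump 0) q s = vop (addn r.+1) q s.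
  by apply: eq_vop => i _; rewrite /= /bump addSn addnS.
rewrite b0 [in RHS]big_ltn // b1 expr0 scale1r !scalerDr [phi _ *: \sum_(_ <= _ < _) _]scaler_sumr.
have -> : ((-1) ^+ r.+1 *: phi << vop id r s >>) *: << vop (addn r.+1) q s >> =
    - ((-1) ^+ r *: (phi << vop id r s >> *: << vop (addn r.+1) q s >>)) :> ch q.
  by rewrite scalerA -scaleNr -mulNr; congr (_ *: _); rewrite exprS mulN1r.
have -> : \sum_(1 <= i < q.+2) phi << vop id r s >> *: ((-1) ^+ i *: << vop (addn r \o bump i) q s >>) =
    \sum_(1 <= i < q.+2) (-1) ^+ i *: (phi << vop id r s >> *: << vop (addn r \o bump i) q s >>) :> ch q.
  by apply: eq_big_nat => i _; rewrite !scalerA [_ * phi _]mulrC.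
move: (\sum_(_ <= _ < _) _) (\sum_(_ <= _ < _) _) => S1 S2; zmod.
Qed.

End CapProduct.

Arguments delta {R K X r} phi.

(** * Germs of cochains *)

Section Germs.
Variables (R : realType) (K : fieldType) (X : topologicalType).
Local Notation ch k := (chain R K k X).
Local Notation coch k := ({linear chain R K k X -> K^o}).
Implicit Types A V : set X.

Definition vanishing k (phi : coch k) : set (set X) :=
  [set S | forall c, c \in chain_in S -> phi c = 0].

(* [phi] represents the zero germ of a cochain along [A]. *)
Definition lz k (phi : coch k) A : Prop := nbhd_small (vanishing phi) A.

Lemma vanishing_down k (phi : coch k) : downclosed (vanishing phi).
Proof. by move=> S T ST Tv c cS; apply: Tv; exact: chain_inS cS. Qed.

Lemma csup_vanishing k (phi : coch k) c : c \in csup (vanishing phi) -> phi c = 0.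
Proof.
move=> cv; apply: (eq_on_fsupp (F := phi) (G := \0) _ cv) => s; apply.
by rewrite fsuppU; apply/asboolP.
Qed.

Lemma lzS k (phi : coch k) A A' : A' `<=` A -> lz phi A -> lz phi A'.
Proof. by move=> AA phA x /AA/phA. Qed.

Lemma lzU k (phi : coch k) A A' : lz phi A -> lz phi A' -> lz phi (A `|` A').
Proof. by move=> h h' x [/h|/h']. Qed.

Lemma lzP k a b (phi psi chi : coch k) A : (forall c, chi c = a * phi c + b * psi c) ->
  lz phi A -> lz psi A -> lz chi A.
Proof.
move=> E h h' x Ax; have [U xU Uv] := h x Ax; have [U' xU' Uv'] := h' x Ax.
exists (U `&` U'); first exact: filterI.
move=> c cU; rewrite E Uv ?Uv' ?mulr0 ?addr0 //; by apply: chain_inS cU => y [].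
Qed.

Lemma lz_delta k (phi : coch k) A : lz phi A -> lz (delta phi) A.
Proof.
move=> h x Ax; have [U xU Uv] := h x Ax; exists U => // c cU.
by rewrite /delta /=; apply: Uv; exact: bd_chain_in.
Qed.

Lemma lz_open k (phi : coch k) A : lz phi A -> exists V, [/\ open V, A `<=` V & lz phi V].
Proof.
move=> h; exists [set x | exists2 U, nbhs x U & vanishing phi U]; split=> //.
rewrite openE => x [U]; rewrite nbhsE => -[W [oW Wx] WU] Uv.
rewrite /interior /= nbhsE; exists W => // y Wy; exists U => //.
by rewrite nbhsE; exists W.
Qed.

(** A primitive has to send [bd c] to [phi c] for small [c]. This is consistent: a small cycle is
    joined by [TdN] to a subdivision on which [phi] vanishes, through small chains on whose
    boundaries [phi] is 0. *)
Lemma cobounding V r (phi : coch r.+1) : open V -> lz (delta phi) V ->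
  (forall z : ch r.+1, z \in chain_in V -> bd z = 0 ->
     exists N0, forall N, (N0 <= N)%N -> phi (iter N Sd z) = 0) ->
  exists psi : coch r, lz (phi \- delta psi) V.
Proof.
move=> oV dV phV; pose Q (S : set X) := S `<=` V /\ vanishing (delta phi) S.
(* The projection to small chains, since [functional_factor] takes linear maps defined on all
   chains. *)
pose p : {linear ch r.+1 -> ch r.+1} := flift (fun s : sing R r.+1 X =>
  if `[< Q (range s) >] then << s >> : ch r.+1 else 0).
have pQ c : p c \in csup Q.
  apply: (fsupp_lift (F := p) (Q := setT)) (fsuppT c) => s _; rewrite fliftU.
  by case: ifPn => [sQ|_]; [rewrite fsuppU | exact: rpred0].
have pid c : c \in csup Q -> p c = c.
  by apply: (eq_on_fsupp (F := p) (G := idfun)) => s sQ; rewrite fliftU asboolT.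
have [|psi psiP] := @functional_factor K _ _ (@bd R K X r \o p) (phi \o p).
  move=> c /= bz; have cV : p c \in chain_in V by apply: fsuppS (pQ c) => s [].
  have [N /(_ N (leqnn N)) zN] := phV _ cV bz.
  have E : p c = bd (TdN N (p c)) + iter N Sd (p c) by rewrite bd_TdN /= bz linear0 subr0 subrK.
  rewrite /= E linearD zN addr0.
  apply: (csup_vanishing (phi := delta phi)); apply: local_op_in; first exact: TdN_local.
    exact: vanishing_down.
  by apply: fsuppS (pQ c) => s [].
exists psi => x Vx; have [U xU Uv] := dV x Vx; exists (U `&` V).
  by apply: filterI => //; exact: open_nbhs_nbhs.
move=> c cU; have cQ : c \in csup Q.
  apply: fsuppS cU => s sUV; split; first by move=> y /sUV [].
  by apply: vanishing_down Uv => y /sUV [].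
by rewrite /= -{2}(pid _ cQ) psiP /= pid // subrr.
Qed.

End Germs.

(** * The duality map *)

Section Duality.
Variables (R : realType) (K : fieldType) (n : nat) (M : topologicalType).
Hypothesis hM : closed_manifold R n M.
Local Notation ch k := (chain R K k M).
Local Notation coch k := ({linear chain R K k M -> K^o}).
Implicit Types A B V : set M.
Variable mu : ch n.
Hypothesis mu_cyc : cyc set0 mu.
Hypothesis mu_point : forall y, ~ nullc setT (~` [set y]) mu.

Lemma bd_mu0 m (c : chain R K m.+1 M) : cyc set0 c -> bd c = 0.
Proof. exact: chain_in0. Qed.

(** mu is subdivided because [delta phi] vanishes only on small simplices near A. *)
Definition capmu r (phi : coch r) q N : ch q := cap phi q n (iter N Sd mu).

(** On such simplices capping with [phi] gives nothing modulo the complement of A: they miss A or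
    [phi] vanishes on their faces. *)
Let Q r (phi : coch r) A : set (set M) := fun S => S `<=` ~` A \/ vanishing phi S.

Lemma Q_down r (phi : coch r) A : downclosed (Q phi A).
Proof.
by move=> S T ST [TA|Tv]; [left=> x /ST/TA | right; exact: vanishing_down Tv].
Qed.

Lemma Q_cap r (phi : coch r) q k A (c : ch k) : c \in csup (Q phi A) ->
  cap phi q k c \in chain_in (~` A).
Proof.
apply: fsupp_lift => s [sA|sv]; first by apply: fsuppS (cap_local phi q s) => t ts x /ts/sA.
rewrite capU sv ?scale0r ?rpred0 //.
by rewrite fsuppU; apply/asboolP; exact: vop_range.
Qed.

Lemma Q_small r (phi : coch r) A k (c : ch k) : closed A -> lz phi A ->
  exists N0, forall N, (N0 <= N)%N -> iter N Sd c \in csup (Q phi A).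
Proof.
move=> cA pA; apply: (Sd_small (A := setT)); [exact: Q_down | | exact: chain_inT].
move=> x _; have [Ax|nA] := pselect (A x); last first.
  by exists (~` A); [apply: open_nbhs_nbhs; split=> //; exact: closed_openC | left].
by have [U xU Uv] := pA x Ax; exists U => //; right.
Qed.

Lemma Sd_mu_cyc N : cyc set0 (iter N Sd mu).
Proof.
case: (n) (mu) (mu_cyc) => //= m c /chain_in0 bc; rewrite /cyc /=.
suff -> : bd (iter N Sd c) = iter N Sd (bd c).
  by rewrite bc; elim: N => [|N IH]; rewrite /= ?rpred0 // ?bd_Sd; apply: local_op_in IH => //;
    [exact: Sd_local | exact: subset_downclosed].
by elim: N => //= N IH; rewrite bd_Sd IH.
Qed.

Lemma bd_capmu r q (phi : coch r) N : n = (r + q).+1 ->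
  bd (capmu phi q.+1 N) = - (-1) ^+ r *: capmu (delta phi) q N.
Proof.
move=> nE; rewrite /capmu; have := Sd_mu_cyc N; move: (iter N Sd mu).
rewrite nE => c /bd_mu0 bc.
have := cap_bd phi c (erefl (r + q)%N); rewrite bc linear0 sub0r => /(congr1 (GRing.scale ((-1) ^+ r))).
by rewrite scalerA -expr2 sqrr_sign scale1r scalerN scaleNr => ->.
Qed.

Lemma capmu_stable r q (phi : coch r) A N N' : n = (r + q)%N ->
  iter N Sd mu \in csup (Q (delta phi) A) -> (N <= N')%N ->
  nullc setT (~` A) (capmu phi q N - capmu phi q N').
Proof.
move=> nE HN NN'; rewrite /capmu -(subnK NN') iterD; move: (N' - N)%N => j; set c := iter N Sd mu in HN *.
have E : bd (TdN j c) = c - iter j Sd c.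
  rewrite bd_TdN; suff -> : prebd (@TdN R K M j) c = 0 by rewrite subr0.
  by have := Sd_mu_cyc N; rewrite -/c; case: (n) c HN => //= m c HN /bd_mu0 ->; rewrite linear0.
rewrite -linearB -E; have := cap_bd phi (TdN j c) nE => /(canRL (subrK _)) ->.
apply: nullcD; first by apply: nullcZ; apply: nullc_bd; exact: chain_inT.
apply: nullc_in; apply: Q_cap.
by apply: local_op_in HN; [exact: TdN_local | exact: Q_down].
Qed.

(** [N0] is common to all A' inside A, as the passage to the limit in [pd_lim] requires. *)
Lemma capmu_shift r q (phi : coch r) A : n = (r + q)%N -> closed A -> lz (delta phi) A ->
  exists N0, forall A' N N', A' `<=` A -> (N0 <= N)%N -> (N <= N')%N ->
    nullc setT (~` A') (capmu phi q N - capmu phi q N').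
Proof.
move=> nE cA dA; have [N0 HN] := Q_small mu cA dA; exists N0 => A' N N' AA NN NN'.
by apply: (nullcS (A := setT) (B := ~` A)); [| exact: setCS | exact: capmu_stable (HN _ NN) NN'].
Qed.

(** y represents the cap product of mu with the germ of [phi] along A; by [capmu_shift] the class is
    eventually independent of N. *)
Definition dual A r (phi : coch r) q (y : ch q) : Prop :=
  exists N0, forall N, (N0 <= N)%N -> nullc setT (~` A) (y - capmu phi q N).

Lemma dualS A A' r (phi : coch r) q (y : ch q) : A' `<=` A -> dual A phi y -> dual A' phi y.
Proof.
move=> AA [N0 HN]; exists N0 => N /HN; apply: nullcS => //; exact: setCS.
Qed.

Lemma dualP A r (phi psi chi : coch r) q (y z w : ch q) a b :
  (forall c, chi c = a * phi c + b * psi c) ->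
  nullc setT (~` A) (w - (a *: y + b *: z)) ->
  dual A phi y -> dual A psi z -> dual A chi w.
Proof.
move=> E wn [N0 H0] [N1 H1]; exists (maxn N0 N1) => N; rewrite geq_max => /andP[/H0 h0 /H1 h1].
have -> : capmu chi q N = a *: capmu phi q N + b *: capmu psi q N.
  have -> : capmu chi q N = a *: capmu phi q N + cap (b \*: psi) q n (iter N Sd mu).
    by apply: capP => c; rewrite E.
  congr (_ + _); have := @capP _ _ _ _ b psi (\0) (b \*: psi) q n (iter N Sd mu) _.
  rewrite (_ : cap \0 q n _ = 0) ?addr0; last first.
    apply: (@free_lift_ext _ _ _ (cap (\0 : coch r) q n) \0) => s.
    by rewrite capU /= scale0r.
  by apply=> c; rewrite /= addr0.
apply: nullc_trans wn _; rewrite opprD addrACA -!scalerBr.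
by apply: nullcD; exact: nullcZ.
Qed.

Lemma dual_lz A r (phi : coch r) q : closed A -> lz phi A -> dual A phi (0 : ch q).
Proof.
move=> cA pA; have [N0 HN] := Q_small mu cA pA; exists N0 => N /HN NQ.
by rewrite sub0r; apply: nullcN; apply: nullc_in; exact: Q_cap.
Qed.

Lemma dual_null A r (phi : coch r) q (y z : ch q) : dual A phi y ->
  nullc setT (~` A) (z - y) -> dual A phi z.
Proof. by move=> [N0 HN] zy; exists N0 => N /HN; exact: nullc_trans. Qed.

Lemma dual_uniq A r (phi : coch r) q (y z : ch q) : dual A phi y -> dual A phi z ->
  nullc setT (~` A) (y - z).
Proof.
move=> [N0 H0] [N1 H1].
have h0 := H0 _ (leq_maxl N0 N1); have h1 := H1 _ (leq_maxr N0 N1).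
exact: nullc_trans h0 (nullc_sym h1).
Qed.

Lemma dual_ex A r (phi : coch r) q : n = (r + q)%N -> closed A -> lz (delta phi) A ->
  exists N, dual A phi (capmu phi q N).
Proof.
move=> nE cA dA; have [N0 HN] := capmu_shift nE cA dA; exists N0, N0 => N NN.
exact: HN.
Qed.

Lemma dual_cyc A r (phi : coch r) q (y : ch q) : n = (r + q)%N -> closed A ->
  lz (delta phi) A -> dual A phi y -> cyc (~` A) y.
Proof.
move=> nE cA dA [N0 H0]; have [N1 H1] := Q_small mu cA dA.
rewrite -[y](subrK (capmu phi q (maxn N0 N1))); apply: bcondD.
  by apply: nullc_cyc; apply: H0; exact: leq_maxl.
case: q nE {H0 y} => // q nE; rewrite /cyc /= bd_capmu ?nE ?addnS // rpredZ //.
by apply: Q_cap; apply: H1; exact: leq_maxr.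
Qed.

Lemma dual_delta A r (psi : coch r) q : n = (r.+1 + q)%N -> dual A (delta psi) (0 : ch q).
Proof.
move=> nE; exists 0 => N _; rewrite sub0r; apply: nullcN.
have := bd_capmu psi N nE => /(congr1 (GRing.scale (- (-1) ^+ r))).
rewrite scalerA mulrNN -expr2 sqrr_sign scale1r => <-.
by apply: nullcZ; apply: nullc_bd; exact: chain_inT.
Qed.

Definition cobounds A r : coch r -> Prop :=
  if r is l.+1 then fun phi => exists psi : coch l, lz (phi \- delta psi) A
  else fun phi => lz phi A.

(** Capping with mu, from cohomology of germs along A to homology modulo the complement of A: first
    injectivity, then surjectivity. *)
Definition pd A : Prop := forall r q, n = (r + q)%N ->
  (forall phi : coch r, lz (delta phi) A -> dual A phi (0 : ch q) -> cobounds A phi) /\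
  (forall y : ch q, cyc (~` A) y -> exists2 phi : coch r, lz (delta phi) A & dual A phi y).

End Duality.

(** * Poincare duality along closed subsets *)

Section PoincareDuality.
Variables (R : realType) (K : fieldType) (n : nat) (M : topologicalType).
Hypothesis hM : closed_manifold R n M.
Local Notation ch k := (chain R K k M).
Local Notation coch k := ({linear chain R K k M -> K^o}).
Implicit Types A B V : set M.
Variable mu : ch n.
Hypothesis mu_cyc : cyc set0 mu.
Hypothesis mu_point : forall y, ~ nullc setT (~` [set y]) mu.
Local Notation capmu := (capmu mu).
Local Notation dual := (dual mu).
Local Notation pd := (pd mu).

Lemma vanishing_sing k (phi : coch k) (S : set M) :
  (forall s : sing R k M, range s `<=` S -> phi << s >> = 0) -> vanishing phi S.
Proof. by move=> h c; apply: (eq_on_fsupp (F := phi) (G := \0)) => s; exact: h. Qed.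

Lemma separate A B : closed A -> closed B -> A `&` B = set0 ->
  exists G1 G2, [/\ open G1, open G2, A `<=` G1, B `<=` G2 & G1 `&` G2 = set0].
Proof.
have [cM hs _ _] := hM; move=> cA cB AB.
by have /(@normal_openP R) := compact_normal hs cM; exact.
Qed.

Lemma shrink A W : closed A -> open W -> A `<=` W ->
  exists G N, [/\ open G, closed N, A `<=` G, G `<=` N & N `<=` W].
Proof.
move=> cA oW AW; have [||G1 [G2 [h1 h2 AO WO G12]]] := @separate A (~` W) cA.
- exact: open_closedC.
- by apply/seteqP; split=> // x [/AW].
exists G1, (~` G2); split=> //; first exact: open_closedC.
  by move=> x Ox1 Ox2; have : (G1 `&` G2) x by []; rewrite G12.
by move=> x nO; apply: contrapT => /WO.
Qed.

(** [V] is a neighborhood of the intersection where the two cochains agree locally. Outside it A and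
    B have disjoint neighborhoods, so [phi1] inside [G1] and [phi2] elsewhere has the right
    germs. *)
Lemma glue_germs k (phi1 phi2 : coch k) A B : closed A -> closed B ->
  lz (phi1 \- phi2) (A `&` B) ->
  exists phi : coch k, lz (phi \- phi1) A /\ lz (phi \- phi2) B.
Proof.
move=> cA cB /lz_open[V [oV ABV lV]].
have [|||G1 [G2 [h1 h2 AO BO G12]]] := @separate (A `\` V) (B `\` V).
- by apply: closedI => //; exact: open_closedC.
- by apply: closedI => //; exact: open_closedC.
- by apply/seteqP; split=> // x [[Ax nV] [Bx _]]; apply: nV; apply: ABV.
pose phi : coch k := flift (fun s : sing R k M =>
  if `[< range s `<=` G1 >] then phi1 << s >> else phi2 << s >>).
have onV x : V x -> exists2 U, nbhs x U & vanishing (phi1 \- phi2) U /\ U `<=` V.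
  move=> Vx; have [U xU Uv] := lV x Vx; exists (U `&` V).
    by apply: filterI => //; exact: open_nbhs_nbhs.
  by split=> [|y []//]; apply: vanishing_down Uv => y [].
have eqU (U : set M) (s : sing R k M) : vanishing (phi1 \- phi2) U -> range s `<=` U ->
    phi1 << s >> = phi2 << s >>.
  move=> Uv sU; apply/eqP; rewrite -subr_eq0; apply/eqP.
  by apply: (Uv << s >>); rewrite fsuppU; apply/asboolP.
exists phi; split=> x Xx; have [Vx|nV] := pselect (V x).
- have [U xU [Uv _]] := onV x Vx; exists U => //; apply: vanishing_sing => s sU.
  by rewrite /= fliftU; case: ifP => _; rewrite ?(eqU U s Uv sU) subrr.
- exists G1; first by apply: open_nbhs_nbhs; split=> //; exact: AO.
  by apply: vanishing_sing => s sO; rewrite /= fliftU asboolT // subrr.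
- have [U xU [Uv _]] := onV x Vx; exists U => //; apply: vanishing_sing => s sU.
  by rewrite /= fliftU; case: ifP => _; rewrite ?(eqU U s Uv sU) subrr.
exists G2; first by apply: open_nbhs_nbhs; split=> //; exact: BO.
apply: vanishing_sing => s sO; rewrite /= fliftU asboolF ?subrr // => sO1.
(* A simplex is nonempty, so it cannot lie in [G1] and in [G2]. *)
pose v : M := s (ret (const_mx 0)); have : (G1 `&` G2) v.
  by split; [apply: sO1 | apply: sO]; exists (ret (const_mx 0)).
by rewrite G12.
Qed.

Lemma capmuP r a (phi psi chi : coch r) q N :
  (forall x, chi x = a * phi x + psi x) -> capmu chi q N = a *: capmu phi q N + capmu psi q N.
Proof. exact: capP. Qed.

Lemma capmuB r (phi psi : coch r) q N :
  capmu (phi \- psi) q N = capmu phi q N - capmu psi q N.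
Proof.
by rewrite addrC -scaleN1r; apply: capmuP => x /=; rewrite mulN1r addrC.
Qed.

Lemma lzB k (phi psi : coch k) A : lz phi A -> lz psi A -> lz (phi \- psi) A.
Proof. by move=> h h'; apply: (lzP (a := 1) (b := -1)) h h' => c /=; rewrite mul1r mulN1r. Qed.

Lemma lzD k (phi psi : coch k) A : lz phi A -> lz psi A -> lz (phi \+ psi) A.
Proof. by move=> h h'; apply: (lzP (a := 1) (b := 1)) h h' => c /=; rewrite !mul1r. Qed.

Lemma lzZ k a (phi : coch k) A : lz phi A -> lz (a \*: phi) A.
Proof.
by move=> h; apply: (lzP (a := a) (b := 0)) (h) (h) => c /=; rewrite mul0r addr0.
Qed.

Lemma eq_lz k (phi psi : coch k) A : phi =1 psi -> lz phi A -> lz psi A.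
Proof.
by move=> e h; apply: (lzP (a := 1) (b := 0)) (h) (h) => c; rewrite mul1r mul0r addr0 e.
Qed.

Lemma eq0_lz k (phi : coch k) A : (forall c, phi c = 0) -> lz phi A.
Proof. by move=> h x _; exists setT => [|c _]; [exact: filterT | exact: h]. Qed.

Lemma dualB A r (phi psi : coch r) q (y z : ch q) :
  dual A phi y -> dual A psi z -> dual A (phi \- psi) (y - z).
Proof.
apply: (dualP (a := 1) (b := -1)) => [c|]; first by rewrite mul1r mulN1r.
by rewrite scale1r scaleN1r subrr; exact: nullc0.
Qed.

Lemma dualZ A r (phi : coch r) q a (y : ch q) :
  dual A phi y -> dual A (a \*: phi) (a *: y).
Proof.
move=> h; apply: (dualP (a := a) (b := 0)) (h) (h) => [c|]; first by rewrite mul0r addr0.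
by rewrite scale0r addr0 subrr; exact: nullc0.
Qed.

Lemma dualD A r (phi psi : coch r) q (y z : ch q) :
  dual A phi y -> dual A psi z -> dual A (phi \+ psi) (y + z).
Proof.
apply: (dualP (a := 1) (b := 1)) => [c|]; first by rewrite !mul1r.
by rewrite !scale1r subrr; exact: nullc0.
Qed.

Lemma dual_eq_lz A r (phi psi : coch r) q (y : ch q) : closed A -> lz (phi \- psi) A ->
  dual A psi y -> dual A phi y.
Proof.
move=> cA h hy; have := dualP (a := 1) (b := 1) (chi := phi) (w := y) _ _ (dual_lz mu q cA h) hy.
apply=> [c|]; first by rewrite /= !mul1r subrK.
by rewrite !scale1r add0r subrr; exact: nullc0.
Qed.

Lemma pd0 : pd set0.
Proof.
move=> r q nE; split=> [phi _ _|y _].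
  by case: r phi nE => [|r] phi nE; [move=> x | exists \0 => x].
exists \0; first by move=> x.
by exists 0%N => N _; apply: nullc_in; rewrite setC0 chain_inT.
Qed.

(** A relative cycle or a null homology involves a compact set off A and so persists for a nearby
    A'; a germ along A is defined near A. *)
Lemma pd_lim A : closed A -> (forall W, open W -> A `<=` W ->
  exists A', [/\ closed A', A `<=` A', A' `<=` W & pd A']) -> pd A.
Proof.
move=> cA lim r q nE; split=> [phi dA [N1 H1]|y yc].
  have [V [oV AV dV]] := lz_open dA.
  have [G [N [oO cN AO ON NV]]] := shrink cA oV AV.
  have [N0 H0] := capmu_shift mu_cyc nE cN (lzS NV dV).
  pose m := maxn N0 N1; have [d [_ dC]] := H1 m (leq_maxr _ _).
  have [C [cC CA dC']] := chain_support hM dC.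
  have [|x Ax|A' [cA' AA' A'W /(_ r q nE)[inj _]]] := lim (G `&` ~` C).
  - by apply: openI => //; exact: closed_openC.
  - by split; [exact: AO | move=> /CA].
  have A'N : A' `<=` N by move=> x /A'W[/ON].
  suff co : cobounds A' phi.
    case: (r) (phi) co => [|l] phi' /= co; first exact: lzS co.
    by case: co => psi /(lzS AA'); exists psi.
  apply: inj; first by apply: lzS dV => x /A'N/NV.
  exists m => N' mN'; have h := H0 A' m N' A'N (leq_maxl _ _) mN'.
  rewrite sub0r; have -> : - capmu phi q N' = (0 - capmu phi q m) + (capmu phi q m - capmu phi q N').
    by rewrite sub0r addKr.
  apply: nullcD h; exists d; split; [exact: chain_inT | apply: chain_inS dC'].
  by move=> x Cx /A'W[].
have [C [cC CA yC]] := cyc_support hM yc.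
have [|x Ax /CA|A' [cA' AA' A'W /(_ r q nE)[_ /(_ y)]]] := lim (~` C) => //.
  exact: closed_openC.
case=> [|phi dp dy]; first by apply: cycS yC => x Cx /A'W.
by exists phi; [exact: lzS dp | exact: dualS dy].
Qed.

(** The five lemma for the Mayer-Vietoris sequences of germs and of relative chains, carried out on
    representatives. The connecting maps correspond up to the sign [sg] from [bd_capmu]. *)
Lemma pd_union A B : closed A -> closed B -> pd A -> pd B -> pd (A `&` B) -> pd (A `|` B).
Proof.
move=> cA cB PA PB PI; have cAB : closed (A `|` B) by exact: closedU.
have cI : closed (A `&` B) by exact: closedI.
have SA : A `<=` A `|` B by move=> x; left.
have SB : B `<=` A `|` B by move=> x; right.
have IA : A `&` B `<=` A by move=> x [].
have IB : A `&` B `<=` B by move=> x [].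
(* Germs that are cohomologous on the intersection are made equal there by a coboundary, which
   alters neither [delta phi2] nor its dual class. *)
have modify r (phi1 phi2 : coch r) : cobounds (A `&` B) (phi1 \- phi2) ->
    exists2 phi2' : coch r, lz (phi1 \- phi2') (A `&` B) &
      delta phi2' =1 delta phi2 /\ forall q, n = (r + q)%N -> forall y : ch q,
        dual B phi2 y -> dual B phi2' y.
  case: r phi1 phi2 => [|r] phi1 phi2 /= co; first by exists phi2.
  have [eta lzE] := co; exists (phi2 \+ delta eta).
    by apply: eq_lz lzE => c /=; zmod.
  split=> [c|q nE y dy]; first by rewrite /= /delta /= bd_bd linear0 addr0.
  by rewrite -[y]addr0; apply: dualD dy _; exact: dual_delta.
move=> r q nE; split=> [phi dphi dual0|y yc]; last first.
  have [_ /(_ y)[|phi1 d1 y1]] := PA r q nE; first by apply: cycS yc; exact: setCS.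
  have [_ /(_ y)[|phi2 d2 y2]] := PB r q nE; first by apply: cycS yc; exact: setCS.
  have [|phi2' lI [dE /(_ q nE y y2) y2']] := modify r phi1 phi2.
    apply: (PI r q nE).1.
      apply: (eq_lz (phi := delta phi1 \- delta phi2)); last by apply: lzB; [exact: lzS d1 | exact: lzS d2].
      by move=> c; rewrite /delta /=.
    by rewrite -[0](subrr y); apply: dualB; [exact: dualS y1 | exact: dualS y2].
  have [phi [lA lB]] := glue_germs cA cB lI.
  have dphi : lz (delta phi) (A `|` B).
    apply: lzU.
      apply: (eq_lz (phi := delta (phi \- phi1) \+ delta phi1)); last by apply: lzD => //; exact: lz_delta.
      by move=> c; rewrite /delta /= subrK.
    apply: (eq_lz (phi := delta (phi \- phi2') \+ delta phi2)); last by apply: lzD => //; exact: lz_delta.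
    by move=> c; have := dE c; rewrite /delta /= => <-; rewrite subrK.
  have [N dy'] := dual_ex mu_cyc nE cAB dphi; set y' := capmu phi q N in dy'.
  have eA : nullc setT (~` A) (y - y').
    by apply: (dual_uniq (phi := phi)); [exact: dual_eq_lz y1 | exact: dualS dy'].
  have eB : nullc setT (~` B) (y - y').
    by apply: (dual_uniq (phi := phi)); [exact: dual_eq_lz y2' | exact: dualS dy'].
  (* y and y' agree modulo both complements; what is left of [y - y'] is the image of a connecting
     map. *)
  move: y' dy' eA eB; clear phi1 d1 y1 phi2 d2 y2 phi2' lI dE y2' lA lB => y' dy' eA eB.
  case: r nE phi dphi dy' => [|r] nE phi dphi dy'.
    exists phi => //; apply: dual_null dy' _; apply: mv_null => // w.
    by apply: (top_vanish hM) => //; rewrite nE.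
  case: eA eB => [d1 [_ a1]] [d2 [_ a2]].
  have nE' : n = (r + q.+1)%N by rewrite nE addSnnS.
  have bw : bd (d1 - d2) = (y - y' - bd d2) - (y - y' - bd d1) by rewrite linearB /=; zmod.
  (* [chi] is dual to [d1 - d2] over the intersection, and [theta], equal to [delta chi] near A and
     to 0 near B, is its connecting image. *)
  have [_ /(_ (d1 - d2))[|chi dchi [N1 H1]]] := PI r q.+1 nE'.
    rewrite /cyc /= bw setCI rpredB //; [apply: chain_inS a2 | apply: chain_inS a1] => x; by [left | right].
  have [|theta [tA tB]] := @glue_germs _ (delta chi) \0 _ _ cA cB.
    by apply: eq_lz dchi => c /=; rewrite subr0.
  have [N2 H2] := Q_small mu cA tA; have [N3 H3] := Q_small mu cB tB.
  pose sg : K := - (-1) ^+ r; have sg2 : sg * sg = 1 by rewrite /sg mulrNN -expr2 sqrr_sign.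
  exists (phi \+ sg \*: theta).
    apply: (eq_lz (phi := delta phi \+ sg \*: delta theta)) => [c|]; first by [].
    apply: lzD => //; apply: lzZ; apply: lzU.
      apply: (eq_lz (phi := delta (theta \- delta chi))); last exact: lz_delta.
      by move=> c; rewrite /delta /= bd_bd linear0 subr0.
    apply: (eq_lz (phi := delta (theta \- \0))); last exact: lz_delta.
    by move=> c; rewrite /delta /= subr0.
  rewrite -[y](subrK y') addrC; apply: dualD => //.
  exists (maxn N1 (maxn N2 N3)) => N4; rewrite !geq_max => /and3P[/H1 h1 /H2 h2 /H3 h3].
  have cap0 : capmu (\0 : coch r.+1) q N4 = 0.
    have -> : capmu (\0 : coch r.+1) q N4 = capmu (\0 \- \0 : coch r.+1) q N4.
      by rewrite [LHS](@capmuP _ 0 \0 (\0 \- \0)) ?scale0r ?add0r // => c /=; rewrite mul0r subr0 addr0.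
    by rewrite capmuB subrr.
  have -> : capmu (sg \*: theta) q N4 = sg *: capmu theta q N4.
    by rewrite (@capmuP _ sg theta \0) ?cap0 ?addr0 // => c /=; rewrite addr0.
  have := @mv_connecting R K M _ _ (closed_openC cA) (closed_openC cB) q d1 d2 (capmu chi q.+1 N4)
    (y - y') (y - y' - bd d1) (y - y' - bd d2) (sg *: capmu (theta \- delta chi) q N4) (sg *: capmu theta q N4).
  rewrite -setCI -setCU; apply=> //; try by zmod.
  - by rewrite bd_capmu // -/sg capmuB scalerBr; zmod.
  - by apply: rpredZ; exact: Q_cap.
  apply: rpredZ; have : capmu (theta \- \0) q N4 \in chain_in (~` B) by exact: Q_cap.
  by rewrite capmuB cap0 subr0.
case: r nE phi dphi dual0 => [|r] nE phi dphi dual0.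
  apply: lzU; [apply: (PA 0 q nE).1 | apply: (PB 0 q nE).1]; by [exact: lzS dphi | exact: dualS dual0].
have nE' : n = (r + q.+1)%N by rewrite nE addSnnS.
(* The difference of the primitives near A and near B is a cocycle on the intersection with a
   possibly nonzero dual class. As [phi] is trivial over the union, this class splits into parts
   dual to [chi1] and [chi2], which correct the primitives. *)
have [psi1 l1] : cobounds A phi by apply: (PA _ q nE).1; [exact: lzS dphi | exact: dualS dual0].
have [psi2 l2] : cobounds B phi by apply: (PB _ q nE).1; [exact: lzS dphi | exact: dualS dual0].
pose sg : K := - (-1) ^+ r; have sg2 : sg * sg = 1 by rewrite /sg mulrNN -expr2 sqrr_sign.
have dpsi : lz (delta (psi1 \- psi2)) (A `&` B).
  apply: (eq_lz (phi := (phi \- delta psi2) \- (phi \- delta psi1))).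
    by move=> c; rewrite /delta /=; zmod.
  by apply: lzB; [exact: lzS l2 | exact: lzS l1].
have [N1 H1] := Q_small mu cA l1; have [N2 H2] := Q_small mu cB l2.
have [N0 H0] := dual0; have [N3 H3] := capmu_shift mu_cyc nE' cI dpsi.
pose N := maxn N0 (maxn N1 (maxn N2 N3)).
have /and4P[NN0 NN1 NN2 NN3] : [&& N0 <= N, N1 <= N, N2 <= N & N3 <= N]%N by rewrite -!geq_max.
have [d [_ dAB]] := H0 N NN0.
pose D psi := sg *: capmu (psi : coch r) q.+1 N.
have bD psi : bd (D psi - - d) = (capmu phi q N + bd d) - capmu (phi \- delta psi) q N.
  by rewrite capmuB linearB linearZ /= bd_capmu // -/sg scalerA sg2 scale1r linearN; zmod.
have dAB' : capmu phi q N + bd d \in chain_in (~` (A `|` B)) by move: dAB; rewrite sub0r -opprD rpredN.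
have [_ /(_ (D psi1 - - d))[|chi1 dchi1 y1]] := PA r q.+1 nE'.
  rewrite /cyc /= bD rpredB //; first by apply: chain_inS dAB'; exact: setCS.
  by apply: Q_cap; exact: H1.
have [_ /(_ (D psi2 - - d))[|chi2 dchi2 y2]] := PB r q.+1 nE'.
  rewrite /cyc /= bD rpredB //; first by apply: chain_inS dAB'; exact: setCS.
  by apply: Q_cap; exact: H2.
pose psi1' : coch r := psi1 \- sg \*: chi1; pose psi2' : coch r := psi2 \- sg \*: chi2.
have l1' : lz (phi \- delta psi1') A.
  apply: (eq_lz (phi := (phi \- delta psi1) \+ sg \*: delta chi1)); last by apply: lzD => //; exact: lzZ.
  by move=> c; rewrite /delta /=; zmod.
have l2' : lz (phi \- delta psi2') B.
  apply: (eq_lz (phi := (phi \- delta psi2) \+ sg \*: delta chi2)); last by apply: lzD => //; exact: lzZ.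
  by move=> c; rewrite /delta /=; zmod.
have [|psi2'' lI [dE _]] := modify r psi1' psi2'.
  apply: (PI r q.+1 nE').1.
    apply: (eq_lz (phi := (phi \- delta psi2') \- (phi \- delta psi1'))).
      by move=> c; rewrite /delta /=; zmod.
    by apply: lzB; [exact: lzS l2' | exact: lzS l1'].
  have e12 : dual (A `&` B) (psi1 \- psi2) (capmu (psi1 \- psi2) q.+1 N).
    by exists N => N' NN'; exact: H3.
  have := dualB e12 (dualZ sg (dualB (dualS IA y1) (dualS IB y2))).
  have -> : capmu (psi1 \- psi2) q.+1 N - sg *: (D psi1 - - d - (D psi2 - - d)) = 0.
    have -> : D psi1 - - d - (D psi2 - - d) = D psi1 - D psi2 by zmod.
    by rewrite capmuB -scalerBr scalerA sg2 scale1r subrr.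
  apply: dual_eq_lz => //; apply: eq0_lz => c /=.
  by rewrite scalerBr; zmod.
have [psi [lA lB]] := glue_germs cA cB lI; exists psi; apply: lzU.
  apply: (eq_lz (phi := (phi \- delta psi1') \- delta (psi \- psi1'))).
    by move=> c; rewrite /delta /=; zmod.
  by apply: lzB => //; exact: lz_delta.
apply: (eq_lz (phi := (phi \- delta psi2') \- delta (psi \- psi2''))).
  move=> c; have := dE c; rewrite /delta /= => e.
  rewrite -[X in _ - X - _]e; zmod.
by apply: lzB => //; exact: lz_delta.
Qed.

(** A slightly larger open cube, with a margin given by a Lebesgue number; it is star-shaped about
    every point of the box. *)
Lemma thick_box (a b : 'rV[R]_n) G : (forall j, a 0 j <= b 0 j) -> open G -> box a b `<=` G ->
  exists V : set 'rV[R]_n, [/\ open V, box a b `<=` V, V `<=` G &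
    forall p x t, box a b p -> V x -> 0 <= t <= 1 -> V ((1 - t) *: x + t *: p)].
Proof.
move=> ab oG bG.
pose Q (C : set 'rV[R]_n) := exists2 e : R, 0 < e & forall v, C v -> ball v e `<=` G.
have [||||e e0 eG] := @compact_local _ (box a b) Q (@box_compact _ _ a b).
- by exists 1 => // v [].
- move=> B C [e e0 eB] [d d0 dC]; exists (Num.min e d); first by rewrite lt_min e0.
  move=> v [/eB|/dC] h w vw; apply: h; apply: le_ball vw; by rewrite ge_min lexx ?orbT.
- by move=> B C BC [e e0 eC]; exists e => // v /BC/eC.
- move=> x /bG Gx; have /nbhs_ballP[e /= e0 eG] : nbhs x G by exact: open_nbhs_nbhs.
  exists (ball x (e / 2)); first by apply: nbhsx_ballx; lra.
  exists (e / 2); first lra.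
  by move=> v xv w vw; apply: eG; rewrite [e]splitr; exact: ball_triangle xv vw.
pose V := [set v : 'rV[R]_n | forall j, a 0 j - e < v 0 j < b 0 j + e].
exists V; split.
- rewrite openE => v Vv.
  apply: (@filter_forall _ _ (fun j (w : 'rV[R]_n) => a 0 j - e < w 0 j < b 0 j + e) (nbhs v)) => j.
  apply: (@coord_continuous R 1 n 0 j v (fun t => a 0 j - e < t < b 0 j + e)).
  have : nbhs (v 0 j) `]a 0 j - e, b 0 j + e[%classic.
    by apply: open_nbhs_nbhs; split; [exact: interval_open | rewrite /= in_itv /= Vv].
  by apply: filterS => t; rewrite /= in_itv.
- by move=> v bv j; have /andP[? ?] := bv j; apply/andP; split; lra.
- move=> v Vv; pose w : 'rV[R]_n := \row_j Num.max (a 0 j) (Num.min (b 0 j) (v 0 j)).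
  have wb : box a b w.
    move=> j; rewrite mxE le_max lexx /= ge_max ab /= ge_min lexx //.
  apply: (eG w wb); split=> // i j; rewrite ord1 -ball_normE /= mxE.
  have /andP[? ?] := Vv j; have := ab j; rewrite ltr_norml.
  by case: (lerP (b 0 j) (v 0 j)) => ?; [case: (lerP (a 0 j) (b 0 j)) | case: (lerP (a 0 j) (v 0 j))] => ? ?;
    apply/andP; split; lra.
move=> p x t bp Vx t01 j; have /andP[? ?] := bp j; have /andP[? ?] := Vx j.
by rewrite !mxE; apply/andP; split; [apply: conv_lt | apply: conv_gt] => //; lra.
Qed.

Lemma Sd_bounding k (phi : coch k) V (w : ch k.+1) : lz (delta phi) V -> w \in chain_in V ->
  exists N0, forall N, (N0 <= N)%N -> phi (iter N Sd (bd w)) = 0.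
Proof.
move=> dV /(Sd_small (@vanishing_down _ _ _ _ (delta phi)) dV)[N0 H0]; exists N0 => N /H0 /csup_vanishing.
suff -> : iter N Sd (bd w) = bd (iter N Sd w) by [].
by elim: N => //= N ->; rewrite bd_Sd.
Qed.

(** The homotopy from a 0-simplex to its subdivisions stays at one point, where [delta phi]
    vanishes. *)
Lemma Sd0_invariant (phi : coch 0) V (z : ch 0) N : lz (delta phi) V -> z \in chain_in V ->
  phi (iter N Sd z) = phi z.
Proof.
move=> dV zV; apply/esym/eqP; rewrite -subr_eq0 -linearB; apply/eqP.
have -> : z - iter N Sd z = bd (TdN N z) by rewrite bd_TdN /= subr0.
apply: (csup_vanishing (phi := delta phi)); apply: local_op_in; first exact: TdN_local.
  exact: vanishing_down.
apply: fsuppS zV => s sV; pose x := s (ret (const_mx 0)).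
have sx : range s `<=` [set x].
  move=> _ [v _ <-]; congr (s _); apply/val_inj/rowP => j /=.
  have [_] := set_valP v; have [_] := set_valP (ret (const_mx 0) : simplex R 0).
  rewrite !big_ord1 (ord1 j) => e1 e2; exact: (etrans e2 (esym e1)).
have [|U xU Uv] := dV x; first by apply: sV; exists (ret (const_mx 0)).
by apply: vanishing_down Uv => y /sx ->; exact: nbhs_singleton.
Qed.

Section Chart.
Variables (g : 'rV[R]_n -> M) (f : M -> 'rV[R]_n) (V : set 'rV[R]_n) (p : 'rV[R]_n).
Hypothesis gf : is_chart g f.
Hypothesis Vp : forall x t, V x -> 0 <= t <= 1 -> V ((1 - t) *: x + t *: p).
Hypothesis pV : V p.

Lemma chart_push_null k (c : chain R K k 'rV[R]_n) : nullc V set0 c -> nullc (g @` V) set0 (fpush g c).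
Proof.
have [cg _ _ _] := gf; move=> [d [dV cd]]; exists (fpush g d).
split; first by apply: fpush_in dV => v; exists v.
rewrite (bd_fpush (A := setT)) ?chain_inT //; last exact: continuous_subspaceT.
by rewrite -linearB (chain_in0 cd) linear0 rpred0.
Qed.

Let f_in k (z : ch k) : z \in chain_in (g @` V) -> cyc set0 z ->
  [/\ fpush g (fpush f z) = z, fpush f z \in chain_in V & cyc set0 (fpush f z)].
Proof.
have [_ _ cf gK] := gf; move=> zV z0.
have zg : z \in chain_in (range g) by apply: chain_inS zV => _ [v _ <-]; exists v.
split; [exact: fpush_chartK | by apply: fpush_in zV => _ [v Vv <-]; rewrite gK |].
by apply: cyc_fpush cf _ zg z0.
Qed.

Lemma chart_contract k (z : ch k.+1) : z \in chain_in (g @` V) -> cyc set0 z -> nullc (g @` V) set0 z.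
Proof.
move=> zV z0; have [zE fV f0] := f_in zV z0.
by rewrite -zE; apply: chart_push_null; exact: (contract_null Vp).
Qed.

Lemma chart_contract0 (z : ch 0) : z \in chain_in (g @` V) ->
  nullc (g @` V) set0 (z - augmentation R K M 0 z *: << const_sing R (g p) 0 >>).
Proof.
have [cg _ _ _] := gf; move=> zV; have [zE fV f0] := f_in zV I.
have := chart_push_null (contract Vp fV f0); rewrite linearB linearZ /= zE.
have cs : continuous (g \o const_sing R p 0) by move=> v; apply: cst_continuous.
have -> : fpush g << const_sing R p 0 >> = << const_sing R (g p) 0 >> :> ch 0.
  by rewrite (fpushU K cs); congr << _ >>; apply/continuousEP => v.
move: (augmentation _ _ _ _ _) => e h; suff -> : augmentation R K M 0 z = e by [].
have [d [_ /chain_in0 /(congr1 (augmentation R K M 0))]] := h.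
rewrite linear0 !linearB /= augmentation_bd subr0 linearZ /= fliftU => /subr0_eq ->.
by rewrite [_ *: _]mulr1.
Qed.

End Chart.

(** On a star-shaped neighborhood cocycles of positive degree bound and those of degree 0 are
    constant. On the homology side one generator remains, mu is a nonzero multiple of it, and the
    augmentation is dual to mu. *)
Lemma pd_box g f (a b : 'rV[R]_n) : is_chart g f -> inner_box a b -> (forall j, a 0 j <= b 0 j) ->
  pd (g @` box a b).
Proof.
move=> gf ab le_ab; have [cg og cf gK] := gf.
have cB : closed (g @` box a b) by exact: (chart_box_closed hM gf).
have ba : box a b a by move=> j; rewrite lexx le_ab.
have dual_aug : dual (g @` box a b) (augmentation R K M 0) mu.
  exists 0%N => N _; rewrite /capmu.
  have -> : cap (augmentation R K M 0) n n (iter N Sd mu) = iter N Sd mu.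
    apply: (@free_lift_ext _ _ _ (cap (augmentation R K M 0) n n) idfun) => s.
    rewrite capU fliftU scale1r /= subnn; congr << _ >>; exact: vop_id.
  have -> : mu - iter N Sd mu = bd (TdN N mu).
    rewrite bd_TdN (_ : prebd _ _ = 0) ?subr0 //.
    by case: (n) (mu) mu_cyc => //= m c /bd_mu0 ->; rewrite linear0.
  by apply: nullc_bd; exact: chain_inT.
have daug A : lz (delta (augmentation R K M 0)) A.
  apply: eq0_lz => c; rewrite /delta /=; exact: augmentation_bd.
move=> r q nE; split=> [phi dphi dual0|y yc]; last first.
  have [qn|qn] := eqVneq q n; last first.
    exists \0; first by apply: eq0_lz => c.
    apply: (dual_null (y := 0)); first by apply: dual_lz => //; exact: eq0_lz.
    by rewrite subr0; exact: (chart_vanish hM gf).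
  have r0 : r = 0%N by move: nE; rewrite qn => /(congr1 (subn^~ n)); rewrite subnn addnK.
  subst q r; have [c yg] := chart_gen_span hM gf ab le_ab yc.
  have mc : cyc (~` (g @` box a b)) mu by exact: cycS mu_cyc.
  have [c' mg] := chart_gen_span hM gf ab le_ab mc.
  have c0 : c' != 0.
    apply/eqP => c0; apply: (mu_point (y := g a)); move: mg; rewrite c0 scale0r subr0.
    by apply: nullcS => //; apply: setCS => _ ->; exists a.
  exists ((c / c') \*: augmentation R K M 0).
    by apply: (eq_lz (phi := (c / c') \*: delta (augmentation R K M 0))) => //; exact: lzZ.
  apply: dual_null (dualZ _ dual_aug) _.
  apply: nullc_trans yg _; have := nullcZ (c / c') (nullc_sym mg).
  by rewrite scalerBr scalerA divfK.
have [G [oG BG dG]] := lz_open dphi.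
have oG' : open (g @^-1` G) by apply: open_comp => // v _; exact: cg.
have [|V [oV bV VG Vstar]] := thick_box le_ab oG'; first by move=> v bv; apply: BG; exists v.
have VG' : g @` V `<=` G by move=> _ [v /VG ? <-].
have oW : open (g @` V).
  rewrite openE => _ [v Vv <-]; have gv : range g (g v) by exists v.
  have : nbhs (f (g v)) V by rewrite gK; exact: open_nbhs_nbhs.
  by move/(chart_nbhs gf gv); apply: filterS => _ [[w _ <-]] /=; rewrite gK; exists w.
have BW : g @` box a b `<=` g @` V by move=> _ [v /bV ? <-]; exists v.
have dW := lzS VG' dG; have Va := bV a ba.
case: r nE phi dphi dual0 dG dW => [|r] nE phi dphi dual0 dG dW; last first.
  have [|psi lpsi] := cobounding oW dW; last by exists psi; exact: lzS lpsi.
  move=> z zW z0; have zc : cyc set0 z by rewrite /cyc /= z0 rpred0.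
  have [d [dV /chain_in0 /eqP]] := chart_contract gf (fun x t => Vstar a x t ba) Va zW zc.
  by rewrite subr_eq0 => /eqP ->; exact: Sd_bounding dV.
rewrite add0n in nE; subst q; set p := << const_sing R (g a) 0 >> : ch 0; set e := phi p.
have lphi : lz (phi \- e \*: augmentation R K M 0) (g @` V).
  move=> x Wx; exists (g @` V); first exact: open_nbhs_nbhs.
  move=> z zW; have pW : p \in chain_in (g @` V).
    by rewrite fsuppU; apply/asboolP => _ [v _ <-]; exists a.
  have [d [dV /chain_in0 /eqP]] := chart_contract0 gf (fun x t => Vstar a x t ba) zW.
  rewrite subr_eq0 => /eqP E.
  have [N /(_ N (leqnn N))] := Sd_bounding dW dV.
  rewrite -E (Sd0_invariant _ dW); last by rewrite rpredB // rpredZ.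
  by rewrite linearB linearZ /= -/p -/e [_ *: _]mulrC.
have lB := lzS BW lphi.
have := dual_uniq dual0 (dual_eq_lz cB lB (dualZ e dual_aug)); rewrite sub0r => /nullcN; rewrite opprK.
have [e0|e0] := eqVneq e 0 => [_|/(nullcZ e^-1)].
  by apply: eq_lz lB => c /=; rewrite e0 scale0r subr0.
rewrite scalerA mulVf // scale1r => h; case: (@mu_point (g a)).
by apply: nullcS h => //; apply: setCS => _ ->; exists a.
Qed.

Theorem poincare_duality A : closed A -> pd A.
Proof.
apply: (compact_induction hM) => [|g f a b|B C|B]; [exact: pd0 | exact: pd_box | exact: pd_union | exact: pd_lim].
Qed.

End PoincareDuality.
(** * Preimages of arcs *)

Section Circle.
Variable R : realType.
Local Notation tau := (pi *+ 2 : R).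

Lemma tau_gt0 : 0 < tau.
Proof. by rewrite pmulrn_rgt0 // pi_gt0. Qed.

Lemma angle_eqP (x y : R) : angle x = angle y <-> exists k : int, x = y + tau * k%:~R.
Proof.
have E : angle x = angle y <-> x - y \in @period R.
  by rewrite (Quotient.idealrBE (@period R)); split=> [xy|/eqP //]; apply/eqP.
split=> [/E/asboolP[k xy]|[k xk]]; first by exists k; rewrite mulrzr -xy addrC subrK.
by apply/E/asboolP; exists k; rewrite xk addrAC subrr add0r mulrzr.
Qed.

Lemma angle_add (x : R) (k : int) : angle (x + tau * k%:~R) = angle x.
Proof. by apply/angle_eqP; exists k. Qed.

Lemma angle_inj (u x y : R) : u <= x < u + tau -> u <= y < u + tau -> angle x = angle y -> x = y.
Proof.
move=> ux uy /angle_eqP[k xy]; have t0 := tau_gt0.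
suff k0 : k = 0 by rewrite xy k0 mulr0 addr0.
have k1 : k%:~R < 1 :> R by have [//|h] := ltP (k%:~R : R) 1; nra.
have k2 : - 1 < k%:~R :> R by have [//|h] := ltP (- 1) (k%:~R : R); nra.
by move: k1 k2; rewrite (ltr_int R k 1) -[- 1]/((-1)%:~R) ltr_int; lia.
Qed.

Lemma angle_ex (u : R) (y : circle R) : exists2 t, u <= t < u + tau & y = angle t.
Proof.
have t0 := tau_gt0; pose z : R := repr y; pose k := Num.floor ((z - u) / tau).
exists (z + tau * (- k)%:~R); last by rewrite angle_add /angle reprK.
have := Num.Theory.floor_itv ((z - u) / tau); rewrite -/k intrD => /andP[h1 h2].
have e : z - u = (z - u) / tau * tau by rewrite divfK ?gt_eqF.
by rewrite mulrNz mulrN; apply/andP; split; nra.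
Qed.

Lemma continuous_angle : continuous (@angle R).
Proof. exact: pi_continuous. Qed.

Lemma angle_open (G : set R) : open G -> open (@angle R @` G).
Proof.
move=> oG.
have -> : open (@angle R @` G) = open (@angle R @^-1` (@angle R @` G)) by [].
have -> : @angle R @^-1` (@angle R @` G) =
    \bigcup_(k : int) ((fun x : R => x + tau * k%:~R) @^-1` G).
  apply/seteqP; split=> [x [y Gy /angle_eqP[k yx]]|x [k _ Gx]].
    by exists k => //=; rewrite -yx.
  by exists (x + tau * k%:~R) => //; rewrite angle_add.
apply: bigcup_open => k _; apply: open_comp => // x _.
by apply: cvgD; [exact: cvg_id | exact: cvg_cst].
Qed.

Section Levels.
Variables (M : topologicalType) (f : M -> circle R).
Hypothesis cf : continuous f.

Definition levels (S : set R) : set M := [set x | exists2 t, S t & f x = angle t].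

Lemma levelsP u S t x : S `<=` [set t | u <= t < u + tau] -> u <= t < u + tau ->
  f x = angle t -> levels S x <-> S t.
Proof.
move=> Su ut fx; split=> [[s Ss fs]|St]; last by exists t.
by rewrite -(angle_inj (Su _ Ss) ut) // -fs.
Qed.

Lemma levelsS S S' : S `<=` S' -> levels S `<=` levels S'.
Proof. by move=> SS x [t /SS St fx]; exists t. Qed.

Lemma levels1 p : levels [set p] = fiber f p.
Proof. by apply/seteqP; split=> [x [t -> fx]|x fx] //; exists p. Qed.

Lemma levels_shift S (k : int) : levels [set t | S (t + tau * k%:~R)] = levels S.
Proof.
apply/seteqP; split=> x [t St fx]; first by exists (t + tau * k%:~R); rewrite ?angle_add.
exists (t + tau * (- k)%:~R); last by rewrite angle_add.
by rewrite /= mulrNz mulrN subrK.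
Qed.

Lemma open_levels S : open S -> open (levels S).
Proof.
move=> oS; rewrite (_ : levels S = f @^-1` (@angle R @` S)).
  by apply: open_comp (angle_open oS) => x _; exact: cf.
by apply/seteqP; split=> [x [t St e]|x [t St e]]; exists t.
Qed.

Definition cci a b : set R := [set t | a <= t <= b].
Definition ooi a b : set R := [set t | a < t < b].

Lemma open_ooi a b : open (levels (ooi a b)).
Proof.
apply: open_levels; rewrite (_ : ooi a b = `]a, b[%classic); first exact: interval_open.
by apply/seteqP; split=> t; rewrite /ooi /= in_itv.
Qed.

Lemma levels_compl u (S : set R) : S `<=` [set t | u <= t < u + tau] ->
  ~` levels S = levels ([set t | u <= t < u + tau] `\` S).
Proof.
move=> Su; apply/seteqP; split=> [x nS|x [t [ut nS] fx]].
  have [t ut fx] := angle_ex u (f x); exists t => //; split=> // St; apply: nS.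
  by exists t.
by move=> /(levelsP Su ut fx).
Qed.

Lemma compl_cci a b : a <= b < a + tau -> ~` levels (cci a b) = levels (ooi b (a + tau)).
Proof.
move=> ab; rewrite (@levels_compl a) => [|t]; last by rewrite /cci /= => ?; lra.
congr levels; apply/seteqP; split=> t; rewrite /cci /ooi /=.
  by move=> [/andP[-> ->]] /negP; rewrite andTb -ltNge => ->.
by move=> /andP[bt ->]; split; [apply/andP; split => //; lra | apply/negP; lra].
Qed.

Lemma compl_fiber p : ~` fiber f p = levels (ooi p (p + tau)).
Proof.
have -> : fiber f p = levels (cci p p).
  by rewrite -levels1; congr levels; apply/seteqP; split=> t; rewrite /cci /= -eq_le; [move=> ->|move=> /eqP].
by apply: compl_cci; rewrite lexx ltrDl tau_gt0.
Qed.

Lemma closed_cci a b : closed (levels (cci a b)).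
Proof.
have [ba|ab] := ltP b a.
  by rewrite (_ : levels _ = set0); [exact: closed0 | apply/seteqP; split=> // x [t /andP[? ?] _]; lra].
have [h|h] := ltP b (a + tau).
  by rewrite -openC compl_cci ?ab //; exact: open_ooi.
rewrite (_ : levels _ = setT); first exact: closedT.
apply/seteqP; split=> // x _; have [t ut fx] := angle_ex a (f x); exists t => //.
by rewrite /cci /=; lra.
Qed.

Lemma closed_fiber p : closed (fiber f p).
Proof. by rewrite -openC compl_fiber; exact: open_ooi. Qed.

(** The level of x in the window [u, u + tau), continuous off the seam u. *)
Definition lev (u : R) (x : M) : R := xget u [set t | u <= t < u + tau /\ f x = angle t].

Lemma levP u x : u <= lev u x < u + tau /\ f x = angle (lev u x).
Proof.
have [t ut fx] := angle_ex u (f x).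
by have := xgetPex u (ex_intro [set t | u <= t < u + tau /\ f x = angle t] t (conj ut fx)).
Qed.

Lemma lev_eq u x t : u <= t < u + tau -> f x = angle t -> lev u x = t.
Proof. by move=> ut fx; have [ul fl] := levP u x; apply: (angle_inj ul ut); rewrite -fl. Qed.

Lemma lev_continuous u x : u < lev u x -> {for x, continuous (lev u)}.
Proof.
move=> ux; have [/andP[_ xu] fx] := levP u x.
move=> /= W /= /nbhs_ballP[e /= e0 eW].
pose a := Num.max u (lev u x - e); pose b := Num.min (u + tau) (lev u x + e).
have xo : nbhs x (levels (ooi a b)).
  apply: open_nbhs_nbhs; split; first exact: open_ooi.
  exists (lev u x) => //; rewrite /ooi /= gt_max lt_min ux xu /=; apply/andP; split; lra.
apply: filterS xo => y [t]; rewrite /ooi /= gt_max lt_min => /andP[/andP[ut h1] /andP[tu h2]] fy.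
rewrite (@lev_eq u y t) ?tu ?andbT ?ltW //.
by apply: eW; rewrite -ball_normE /= ltr_distlC; apply/andP; split; lra.
Qed.

End Levels.
End Circle.

(** * Chains of a subspace *)

Section Restriction.
Variables (R : realType) (K : comNzRingType) (X : topologicalType) (A : set X).
Local Notation ch k := (chain R K k).

Let corestrict_fun k (s : sing R k X) (h : range s `<=` A) (v : simplex R k) : A :=
  exist _ (s v) (mem_set (h _ (ex_intro2 _ _ v I erefl))).

Let corestrict_continuous k (s : sing R k X) (h : range s `<=` A) : continuous (corestrict_fun h).
Proof. by apply: continuous_comp_initial; exact: cts_fun. Qed.

Definition corestrict k : {linear ch k X -> ch k A} :=
  flift (fun s : sing R k X => match pselect (range s `<=` A) with
    | left h => << (mkcts (@corestrict_continuous k s h) : sing R k A) >> | right _ => 0 end).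

Local Notation val_ := (set_val : A -> X).

Lemma continuous_val : continuous val_.
Proof. exact: initial_continuous. Qed.

Let cval : {within setT, continuous val_}.
Proof. by apply: continuous_subspaceT; exact: continuous_val. Qed.

Lemma val_restrict k (c : ch k X) : c \in chain_in A -> fpush val_ (corestrict k c) = c.
Proof.
apply: (eq_on_fsupp (F := fpush val_ \o corestrict k) (G := idfun)) => s sA /=.
rewrite fliftU; case: pselect => // h.
have cs : continuous (val_ \o mkcts (@corestrict_continuous k s h)).
  by move=> v; apply: continuous_comp; [exact: (@corestrict_continuous k s h) | exact: continuous_val].
by rewrite (fpushU K cs); congr << _ >>; apply/continuousEP.
Qed.

Lemma restrict_val k (c : ch k A) : corestrict k (fpush val_ c) = c.
Proof.
apply: (@free_lift_ext _ _ _ (corestrict k \o fpush val_) idfun) => s /=.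
have cs : continuous (val_ \o s).
  by move=> v; apply: continuous_comp; [exact: cts_fun | exact: continuous_val].
rewrite (fpushU K cs) fliftU; case: pselect => [h|nh].
  by congr << _ >>; apply/continuousEP => v; apply/val_inj.
by case: nh => _ [v _ <-]; exact: set_valP.
Qed.

Lemma val_chain_in k (c : ch k A) : fpush val_ c \in chain_in A.
Proof. by apply: fpush_in (chain_inT c) => z _; exact: set_valP. Qed.

Lemma bd_val k (c : ch k.+1 A) : bd (fpush val_ c) = fpush val_ (bd c).
Proof. by rewrite (bd_fpush cval) ?chain_inT. Qed.

Lemma bd_restrict k (c : ch k.+1 X) : c \in chain_in A -> bd (corestrict k.+1 c) = corestrict k (bd c).
Proof.
move=> cA; apply: (can_inj (@restrict_val k)).
by rewrite -bd_val !val_restrict // bd_chain_in.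
Qed.

Lemma restrict_in k (B : set X) (c : ch k X) : c \in chain_in B ->
  corestrict k c \in chain_in (val_ @^-1` B).
Proof.
apply: fsupp_lift => s sB; rewrite fliftU; case: pselect => [h|_]; last exact: rpred0.
rewrite fsuppU; apply/asboolP => _ [v _ <-] /=; apply: sB; by exists v.
Qed.

Lemma restrict_cyc k (B : set X) (c : ch k X) : c \in chain_in A -> cyc B c ->
  cyc (val_ @^-1` B) (corestrict k c).
Proof.
case: k c => //= k c cA; rewrite /cyc /= (bd_restrict cA); exact: restrict_in.
Qed.

End Restriction.
Lemma local_in (R : realType) (K : comNzRingType) (X : topologicalType) k l
    (F : {linear chain R K k X -> chain R K l X}) (A : set X) c :
  local_op F -> c \in chain_in A -> F c \in chain_in A.
Proof. move=> lF cA; exact: (local_op_in lF (@subset_downclosed _ A) cA). Qed.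

(** Excision for a pair of arbitrary subsets: only traces of neighborhoods on A matter, so it
    applies to preimages of closed arcs. *)
Lemma excise_rel (R : realType) (K : comNzRingType) (X : topologicalType) (A B W : set X) k
    (c : chain R K k X) :
  c \in chain_in A -> cyc B c ->
  (forall x, A x -> exists2 U, nbhs x U & U `&` A `<=` B \/ U `&` A `<=` W) ->
  exists c', [/\ c' \in chain_in (A `&` W), cyc B c' & nullc A B (c - c')].
Proof.
move=> cA cB hU; pose Q (S : set X) := S `&` A `<=` B \/ S `&` A `<=` W.
have dQ : downclosed Q.
  by move=> S T ST [h|h]; [left | right] => x [/ST Tx Ax]; apply: h.
have [N /(_ N (leqnn N)) NQ] := Sd_small dQ hU cA.
have NA : iter N Sd c \in chain_in A by exact: (iter_Sd_in N (@subset_downclosed _ A) cA).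
have : iter N Sd c \in fsupp ([set s : sing R k X | range s `<=` B] `|` [set s : sing R k X | range s `<=` A `&` W]).
  apply: fsuppS (fsuppI NQ NA) => s [[h|h] sA]; [left | right] => x sx; first by apply: h; split=> //; exact: sA.
  by split; [exact: sA | apply: h; split=> //; exact: sA].
move=> /fsupp_split[c1 [c2 [E c1B c2A]]].
have h : nullc A B (c - c2).
  have -> : c - c2 = bd (TdN N c) + (prebd (@TdN R K X N) c + c1).
    by rewrite bd_TdN E; move: (prebd _ _) => p; zmod.
  apply: nullcD; first by apply: nullc_bd; apply: local_in cA; exact: TdN_local.
  apply: nullc_in; rewrite rpredD //; apply: prebd_in cB => l d dB.
  by apply: local_in dB; exact: TdN_local.
exists c2; split=> //; have -> : c2 = c - (c - c2) by zmod.
by apply: bcondB => //; exact: nullc_cyc h.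
Qed.

(** * Moving chains along the fibration *)

Section Flow.
Variables (R : realType) (K : comNzRingType) (M : topologicalType) (f : M -> circle R).
Variable B : set (circle R).
Hypotheses (cf : continuous f) (fib : fibration_over R f B).
Local Notation tau := (pi *+ 2 : R).
Local Notation ch k := (chain R K k M).
Local Notation levels := (levels f).

Definition regular a b : Prop := forall t, a <= t <= b -> B (angle t).

Lemma flow a b (g : R -> R) : b < a + tau -> regular a b -> continuous g ->
  (forall t, a <= t <= b -> a <= g t <= b) ->
  exists h : levels (cci a b) * R -> M,
    [/\ {within setT `*` `[0, 1], continuous h}, forall z, h (z, 0) = set_val z &
        forall z s t, a <= s <= b -> f (set_val z) = angle s -> 0 <= t <= 1 ->
          f (h (z, t)) = angle ((1 - t) * s + t * g s)].
Proof.
move=> ab rab cg gab; set Z := levels (cci a b).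
(* Half of the complementary gap is left below a, which keeps [a, b] away from the seam of
   [lev f u]. *)
pose u := a - (a + tau - b) / 2; have ua : u < a by rewrite /u; lra.
have bu : b < u + tau by rewrite /u; lra.
pose s (z : Z) := lev f u (set_val z).
have sP z t : a <= t <= b -> f (set_val z) = angle t -> s z = t.
  by move=> atb; apply: lev_eq; lra.
have sab z : a <= s z <= b by have [t atb ft] := set_valP z; rewrite (sP z t).
have cs : continuous s.
  move=> z; apply: (@continuous_comp _ _ _ (set_val : Z -> M) (lev f u)); first exact: initial_continuous.
  apply: lev_continuous => //; have := sab z; rewrite /s => /andP[h _]; exact: lt_le_trans ua h.
pose k (p : Z * R) : circle R := angle ((1 - p.2) * s p.1 + p.2 * g (s p.1)).
have seg x y t : a <= x <= b -> a <= y <= b -> 0 <= t <= 1 -> a <= (1 - t) * x + t * y <= b.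
  move=> /andP[ax xb] /andP[ay yb] /andP[t0 t1]; apply/andP; split; nra.
have [|||z|h ch [h0 h1]] := @fib Z set_val k.
- exact: initial_continuous.
- apply: continuous_subspaceT => p.
  apply: (@continuous_comp _ _ _ (fun p : Z * R => (1 - p.2) * s p.1 + p.2 * g (s p.1)) (@angle R)); last exact: continuous_angle.
  have c1 : continuous (fun p : Z * R => s p.1).
    by move=> q; apply: continuous_comp; [exact: cvg_fst | exact: cs].
  have c2 : continuous (fun p : Z * R => p.2) by move=> q; exact: cvg_snd.
  have c3 : continuous (fun p : Z * R => g (s p.1)).
    by move=> q; apply: (@continuous_comp _ _ _ (fun p : Z * R => s p.1) g); [exact: c1 | exact: cg].
  apply: cvgD; apply: cvgM; try exact: c1; try exact: c2; try exact: c3.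
  by apply: cvgB; [exact: cvg_cst | exact: c2].
- by move=> z t t01; apply: rab; apply: seg => //; exact: gab.
- have [_ fl] := levP f u (set_val z).
  by rewrite /k /= subr0 mul1r mul0r addr0.
exists h; split=> // z r t arb fr t01; rewrite h1 // /k /=; congr angle.
by rewrite (sP z r).
Qed.

(* The chains are first cut, by excision, into a part in C and a part over [a, b]; the flow then
   moves the second part into C. *)
Lemma compress a b (g : R -> R) (A C : set M) k (x : ch k) :
  b < a + tau -> regular a b -> continuous g -> (forall t, a <= t <= b -> a <= g t <= b) ->
  (forall y, A y -> exists2 U, nbhs y U & U `&` A `<=` C \/ U `&` A `<=` levels (cci a b)) ->
  (forall S, S = A \/ S = C -> forall y z s t, a <= s <= b -> 0 <= t <= 1 ->
     S y -> f y = angle s -> f z = angle ((1 - t) * s + t * g s) -> S z) ->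
  (forall y z s, a <= s <= b -> A y -> f y = angle s -> f z = angle (g s) -> C z) ->
  x \in chain_in A -> cyc C x -> nullc A C x.
Proof.
move=> ab rab cg gab hU stay fin xA xC.
have [c' [c'A c'C xc']] := excise_rel xA xC hU.
have [h [ch h0 h1]] := flow ab rab cg gab; set Z := levels (cci a b) in h ch h0 h1 c'A *.
have c'Z : c' \in chain_in Z by apply: chain_inS c'A => y [].
have c'A' : c' \in chain_in A by apply: chain_inS c'A => y [].
rewrite -[x](subrK c'); apply: nullcD xc' _.
have hS (S : set M) : S = A \/ S = C -> forall (z : Z) t, (set_val @^-1` S) z -> 0 <= t <= 1 -> S (h (z, t)).
  move=> SAC z t Sz t01; have [s sab fs] := set_valP z.
  by apply: (stay S SAC _ _ s t sab t01 Sz fs); exact: h1.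
have cA' : {within (set_val @^-1` A : set Z) `*` `[0, 1], continuous h}.
  by apply: continuous_subspaceW ch => -[z t] [].
have := homotopy_null cA' (restrict_in Z c'A') (restrict_cyc c'Z c'C)
  (hS A (or_introl erefl)) (hS C (or_intror erefl)).
have -> : fpush (fun z => h (z, 0)) (@corestrict R K M Z k c') = c'.
  by rewrite -[RHS](val_restrict c'Z); congr (fpush _ _); apply/funext.
have h1C : fpush (fun z => h (z, 1)) (@corestrict R K M Z k c') \in chain_in C.
  apply: fpush_in (restrict_in Z c'A') => z Az; have [s sab fs] := set_valP z.
  apply: (fin (set_val z) _ s) => //; rewrite (h1 z s 1) ?ler01 ?lexx //.
  by rewrite subrr mul0r add0r mul1r.
move=> e; have -> : c' = fpush (fun z => h (z, 1)) (@corestrict R K M Z k c') -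
  (fpush (fun z => h (z, 1)) (@corestrict R K M Z k c') - c') by zmod.
by apply: nullcB e; exact: nullc_in.
Qed.

End Flow.

(** * Compression of arcs *)

Section Transport.
Variables (R : realType) (K : comNzRingType) (M : topologicalType) (f : M -> circle R).
Variable B : set (circle R).
Hypotheses (cf : continuous f) (fib : fibration_over R f B).
Local Notation tau := (pi *+ 2 : R).
Local Notation ch k := (chain R K k M).
Local Notation regular := (regular B).
Local Notation L a b := (levels f (cci a b)).
Local Notation Lo a b := (levels f (ooi a b)).
Local Notation F p := (fiber f p).

Lemma L_at u a b s x : u <= a -> b < u + tau -> u <= s < u + tau -> f x = angle s ->
  L a b x -> a <= s <= b.
Proof. by move=> ua bu us fx /(levelsP (u := u) _ us fx); apply; rewrite /cci => t /= ?; lra. Qed.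

Lemma LS a b c d : c <= a -> b <= d -> L a b `<=` L c d.
Proof. by move=> ca bd; apply: levelsS => t; rewrite /cci /=; lra. Qed.

Lemma FL a b p : a <= p <= b -> F p `<=` L a b.
Proof. by move=> apb x fx; exists p. Qed.

Lemma F_at u p s x : u <= p < u + tau -> u <= s < u + tau -> f x = angle s -> F p x -> s = p.
Proof. by move=> up us fx fp; apply: (angle_inj us up); rewrite -fx. Qed.

Lemma Lo_nbhd a b s x : a < s < b -> f x = angle s -> nbhs x (Lo a b).
Proof. by move=> asb fx; apply: open_nbhs_nbhs; split; [exact: open_ooi | exists s]. Qed.

Lemma open_setC_fiber p x : ~ F p x -> nbhs x (~` F p).
Proof.
move=> nF; apply: open_nbhs_nbhs; split; last exact: nF.
by apply: closed_openC; exact: closed_fiber.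
Qed.

Lemma continuous_minr (c : R) : continuous (fun t : R => Num.min t c).
Proof. by move=> t; apply: (@continuous_min _ _ id (fun=> c)); [exact: cvg_id | exact: cst_continuous]. Qed.

Lemma continuous_maxr (c : R) : continuous (fun t : R => Num.max t c).
Proof. by move=> t; apply: (@continuous_max _ _ id (fun=> c)); [exact: cvg_id | exact: cst_continuous]. Qed.

(** The flow lowers levels above d to d; the stretch from c to d is the overlap that excision
    needs. *)
Lemma compress_top a b c d k (x : ch k) : a <= c -> c < d -> d <= b -> b < a + tau -> regular c b ->
  x \in chain_in (L a b) -> cyc (L a d) x -> nullc (L a b) (L a d) x.
Proof.
move=> ac cd db ba rcb; apply: (@compress _ _ _ f B cf fib c b (fun t => Num.min t d)) => //.
- lra.
- exact: continuous_minr.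
- by move=> t /andP[ct tb]; rewrite le_min ge_min; apply/andP; split; lra.
- move=> y [s asb fy]; have [cs|sc] := ltP c s.
    exists (Lo c (a + tau)); first by apply: Lo_nbhd fy; move: asb; rewrite /cci /=; lra.
    right=> z [[r cr fz] h]; exists r => //; move: cr; rewrite /ooi /cci /= => cr.
    by have := L_at (u := a) _ _ _ fz h; lra.
  exists (Lo (a - (a + tau - b) / 2) d); first by apply: Lo_nbhd fy; move: asb; rewrite /cci /=; lra.
  left=> z [[r cr fz] h]; exists r => //; move: cr; rewrite /ooi /cci /= => cr.
  by have := L_at (u := a - (a + tau - b) / 2) _ _ _ fz h; lra.
- move=> S SAC y z s t csb t01 Sy fy fz.
  have sc : s <= d -> Num.min s d = s by move=> h; apply/min_idPl.
  have [sd|sd] := leP s d.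
    rewrite sc // in fz; case: SAC => ES; rewrite ES; exists ((1 - t) * s + t * s) => //; rewrite /cci /=; lra.
  case: SAC => ES; rewrite ES in Sy *; last first.
    by have := L_at (u := a) _ _ _ fy Sy; lra.
  exists ((1 - t) * s + t * Num.min s d) => //; rewrite (min_idPr (ltW sd)) /cci /=.
  by move: t01 => /andP[? ?]; apply/andP; split; nra.
move=> y z s csb _ _ fz; exists (Num.min s d) => //; rewrite /cci /= le_min ge_min; lra.
Qed.

Lemma compress_bot a b c d k (x : ch k) : a <= c -> c < d -> d <= b -> b < a + tau -> regular a d ->
  x \in chain_in (L a b) -> cyc (L c b) x -> nullc (L a b) (L c b) x.
Proof.
move=> ac cd db ba rcb; apply: (@compress _ _ _ f B cf fib a d (fun t => Num.max t c)) => //.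
- lra.
- exact: continuous_maxr.
- by move=> t /andP[ct tb]; rewrite le_max ge_max; apply/andP; split; lra.
- pose e := (a + tau - b) / 2; move=> y [s asb fy]; have [sd|ds] := ltP s d.
    exists (Lo (a - e) d); first by apply: Lo_nbhd fy; move: asb; rewrite /e /cci /=; lra.
    right=> z [[r cr fz] h]; exists r => //; move: cr; rewrite /ooi /cci /= => cr.
    by have := L_at (u := a - e) _ _ _ fz h; rewrite /e in cr *; lra.
  exists (Lo c (a + tau)); first by apply: Lo_nbhd fy; move: asb; rewrite /cci /=; lra.
  left=> z [[r cr fz] h]; exists r => //; move: cr; rewrite /ooi /cci /= => cr.
  by have := L_at (u := a) _ _ _ fz h; lra.
- move=> S SAC y z s t csb t01 Sy fy fz.
  have [sd|sd] := leP c s.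
    rewrite (max_idPl sd) in fz; case: SAC => ES; rewrite ES; exists ((1 - t) * s + t * s) => //; rewrite /cci /=; lra.
  case: SAC => ES; rewrite ES in Sy *; last first.
    by have := L_at (u := a) _ _ _ fy Sy; lra.
  exists ((1 - t) * s + t * Num.max s c) => //; rewrite (max_idPr (ltW sd)) /cci /=.
  by move: t01 => /andP[? ?]; apply/andP; split; nra.
move=> y z s csb _ _ fz; exists (Num.max s c) => //; rewrite /cci /= le_max ge_max; lra.
Qed.

(** On one side of F p everything near F p can be pushed to level e, so a chain on one side carries
    no local homology along F p. *)
Lemma half_top p u e k (z : ch k) : p < e -> e <= u -> u < p + tau -> regular p e ->
  z \in chain_in (L p u) -> cyc (~` F p) z -> nullc (L p u) (~` F p) z.
Proof.
move=> pe eu up rpe; apply: (@compress _ _ _ f B cf fib p e (fun=> e)) => //.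
- lra.
- exact: cst_continuous.
- by move=> t _; lra.
- move=> y Ay; have [Fy|nFy] := pselect (F p y); last first.
    by exists (~` F p); [exact: open_setC_fiber | left=> ? []].
  pose d := (p + tau - u) / 2.
  exists (Lo (p - d) e); first by apply: Lo_nbhd Fy; rewrite /d; lra.
  right=> x [[r cr fx] h]; exists r => //; move: cr; rewrite /ooi /cci /= => cr.
  by have := L_at (u := p - d) _ _ _ fx h; rewrite /d in cr *; lra.
- move=> S SAC y x s t psu t01 Sy fy fx.
  have r : p <= (1 - t) * s + t * e <= e by move: t01 psu => /andP[? ?] /andP[? ?]; apply/andP; split; nra.
  case: SAC => ES; rewrite ES in Sy *; first by exists ((1 - t) * s + t * e) => //; rewrite /cci /=; lra.
  move=> Fx; have E := F_at (u := p) _ _ fx Fx.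
  have ps : p < s.
    rewrite lt_neqAle; have /andP[-> _] := psu; rewrite andbT; apply/eqP => ps; apply: Sy.
    by rewrite /fiber /= ps.
  by have : (1 - t) * s + t * e = p by [apply: E; lra]; move: t01 => /andP[? ?]; nra.
move=> y x s psu Ly fy fx Fx; have := F_at (u := p) _ _ fx Fx; lra.
Qed.

Lemma half_bot p u e k (z : ch k) : e < p -> u <= e -> p < u + tau -> regular e p ->
  z \in chain_in (L u p) -> cyc (~` F p) z -> nullc (L u p) (~` F p) z.
Proof.
move=> pe eu up rpe; apply: (@compress _ _ _ f B cf fib e p (fun=> e)) => //.
- lra.
- exact: cst_continuous.
- by move=> t _; lra.
- move=> y Ay; have [Fy|nFy] := pselect (F p y); last first.
    by exists (~` F p); [exact: open_setC_fiber | left=> ? []].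
  pose d := (u + tau - p) / 2.
  exists (Lo e (p + d)); first by apply: Lo_nbhd Fy; rewrite /d; lra.
  right=> x [[r cr fx] h]; exists r => //; move: cr; rewrite /ooi /cci /= => cr.
  by have := L_at (u := u) _ _ _ fx h; rewrite /d in cr *; lra.
- move=> S SAC y x s t psu t01 Sy fy fx.
  have r : e <= (1 - t) * s + t * e <= p by move: t01 psu => /andP[? ?] /andP[? ?]; apply/andP; split; nra.
  case: SAC => ES; rewrite ES in Sy *; first by exists ((1 - t) * s + t * e) => //; rewrite /cci /=; lra.
  move=> Fx; have E := F_at (u := u) _ _ fx Fx.
  have ps : s < p.
    rewrite lt_neqAle; have /andP[_ ->] := psu; rewrite andbT; apply/eqP => ps; apply: Sy.
    by rewrite /fiber /= -ps.
  by have : (1 - t) * s + t * e = p by [apply: E; lra]; move: t01 => /andP[? ?]; nra.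
move=> y x s psu Ly fy fx Fx; have := F_at (u := u) _ _ fx Fx; lra.
Qed.

(** [P] pushes by the end of the flow to level p. It need not fix the chains of F p, but the flow
    preserves F p, so [P] is homotopic to the identity there as well. *)
Lemma fiber_retraction a b p : b < a + tau -> a <= p <= b -> regular a b ->
  exists P : forall k, {linear ch k -> ch k},
    [/\ forall k c, c \in chain_in (L a b) -> P k c \in chain_in (F p),
        forall k c, c \in chain_in (L a b) -> bd (P k.+1 c) = P k (bd c) &
        forall k S x, S = L a b \/ S = F p -> x \in chain_in S -> cyc set0 x ->
          nullc S set0 (x - P k x)].
Proof.
move=> ba apb rab; have [|h [hc h0 h1]] := flow cf fib ba rab (@cst_continuous R R p).
  by [].
set Z := L a b in h hc h0 h1 *.
pose P k : {linear ch k -> ch k} := fpush (fun z => h (z, 1)) \o @corestrict R K M Z k.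
have c1 : {within setT, continuous (fun z : Z => h (z, 1))}.
  apply: continuous_subspaceT; apply: (@within_comp Z (Z * R)%type M (setT `*` `[0, 1]) (fun z => (z, 1)) h _ _ hc).
    exact: (continuous_pair (fun z => @cvg_id _ (nbhs z)) (@cst_continuous Z R 1)).
  by move=> z; split=> //=; rewrite in_itv /= ler01 lexx.
exists P; split=> [k c cZ|k c cZ|k S x SAF xS x0].
- apply: fpush_in (chain_inT _) => z _; have [s sab fs] := set_valP z.
  by rewrite /fiber /= (h1 z s 1) ?ler01 ?lexx // subrr mul0r add0r mul1r.
- by rewrite /P /= (bd_fpush c1) ?chain_inT // bd_restrict.
have xZ : x \in chain_in Z by case: SAF xS => -> //; apply: chain_inS; exact: FL.
have hS (z : Z) t : (set_val @^-1` S) z -> 0 <= t <= 1 -> S (h (z, t)).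
  move=> Sz t01; case: SAF => ES; rewrite ES in Sz *.
    have [s sab fs] := set_valP z; exists ((1 - t) * s + t * p); last exact: h1.
    by move: t01 sab apb => /andP[? ?] /andP[? ?] /andP[? ?]; apply/andP; split; nra.
  by rewrite /fiber /= (h1 z p t) //; congr angle; ring.
have ch' : {within (set_val @^-1` S : set Z) `*` `[0, 1], continuous h}.
  by apply: continuous_subspaceW hc => -[z t] [].
have hS0 (z : Z) t : (set_val @^-1` (set0 : set M)) z -> 0 <= t <= 1 -> set0 (h (z, t)) by [].
have := homotopy_null ch' (restrict_in Z xS) (restrict_cyc xZ x0) hS hS0.
have -> : fpush (fun z => h (z, 0)) (@corestrict R K M Z k x) = x.
  by rewrite -[RHS](val_restrict xZ); congr (fpush _ _); apply/funext.
exact: nullc_sym.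
Qed.

Lemma transport a b p k (x : ch k) : b < a + tau -> a <= p <= b -> regular a b ->
  x \in chain_in (L a b) -> cyc set0 x ->
  exists z, [/\ z \in chain_in (F p), cyc set0 z & nullc (L a b) set0 (x - z)].
Proof.
move=> ba apb rab xL x0; have [P [Pin Pbd Pn]] := fiber_retraction ba apb rab.
exists (P k x); split; [exact: Pin | | by apply: Pn => //; left].
case: k x xL x0 => //= k x xL x0; rewrite /cyc /= Pbd // (chain_in0 x0) linear0 rpred0 //.
Qed.

Lemma fiber_null a b p k (x : ch k) : b < a + tau -> a <= p <= b -> regular a b ->
  x \in chain_in (F p) -> nullc (L a b) set0 x -> nullc (F p) set0 x.
Proof.
move=> ba apb rab xF xn; have [P [Pin Pbd Pn]] := fiber_retraction ba apb rab.
rewrite -[x](subrK (P k x)); apply: nullcD; first by apply: Pn (nullc_cyc xn) => //; right.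
have [d [dL xd]] := xn; exists (P k.+1 d); split; first exact: Pin.
by rewrite Pbd // -linearB (chain_in0 xd) linear0 rpred0.
Qed.

End Transport.
(** * The pairing of regular fibers *)

Section PairSum.
Variables (K : fieldType) (U V W : lmodType K).
Variables (u : {linear U -> W}) (v : {linear V -> W}).
Definition pair_sum (x : U * V) : W := u x.1 + v x.2.
Lemma pair_sum_linear : linear pair_sum.
Proof. by move=> a x y; rewrite /pair_sum !linearP /= scalerDr addrACA. Qed.
HB.instance Definition _ :=
  GRing.isLinear.Build K (U * V)%type W *:%R pair_sum pair_sum_linear.
End PairSum.

Lemma functional_factor2 (K : fieldType) (U V W : lmodType K) (u : {linear U -> W})
    (v : {linear V -> W}) (l : {linear U -> K^o}) (l' : {linear V -> K^o}) :
  (forall x y, u x + v y = 0 -> l x + l' y = 0) ->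
  exists m : {linear W -> K^o}, (forall x, m (u x) = l x) /\ (forall y, m (v y) = l' y).
Proof.
move=> h; have [|m mP] := @functional_factor K _ _ (pair_sum u v) (pair_sum l l').
  by move=> [x y]; exact: h.
exists m; split=> [x|y]; [have := mP (x, 0) | have := mP (0, y)];
  by rewrite /= /pair_sum /= !linear0 ?addr0 ?add0r.
Qed.

(** * Cocycles on open sets *)

Section Cocycles.
Variables (R : realType) (K : fieldType) (X : topologicalType).
Local Notation ch k := (chain R K k X).
Local Notation coch k := ({linear chain R K k X -> K^o}).
Implicit Types A V : set X.

Definition projection k (Q : set (sing R k X)) : {linear ch k -> ch k} :=
  flift (fun s : sing R k X => if `[< Q s >] then << s >> : ch k else 0).

Lemma projection_in k (Q : set (sing R k X)) c : projection Q c \in fsupp Q.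
Proof.
apply: (fsupp_lift (F := projection Q) (Q := setT)) (fsuppT c) => s _; rewrite fliftU.
by case: ifPn => [sQ|_]; [rewrite fsuppU | exact: rpred0].
Qed.

Lemma projection_id k (Q : set (sing R k X)) c : c \in fsupp Q -> projection Q c = c.
Proof. by apply: (eq_on_fsupp (F := projection Q) (G := idfun)) => s sQ; rewrite fliftU asboolT. Qed.

Definition onto_chains k A : {linear ch k -> ch k} := projection [set s : sing R k X | range s `<=` A].

Lemma onto_chains_in k A (c : ch k) : onto_chains k A c \in chain_in A.
Proof. exact: projection_in. Qed.

Lemma onto_chains_id k A (c : ch k) : c \in chain_in A -> onto_chains k A c = c.
Proof. exact: projection_id. Qed.

Definition cocycle_on V k (phi : coch k) : Prop := forall d, d \in chain_in V -> phi (bd d) = 0.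

Lemma cocycle_onS V V' k (phi : coch k) : V' `<=` V -> cocycle_on V phi -> cocycle_on V' phi.
Proof. by move=> VV h d dV; apply: h; exact: chain_inS dV. Qed.

Lemma cocycle_lz V k (phi : coch k) : open V -> cocycle_on V phi -> lz (delta phi) V.
Proof. by move=> oV h x Vx; exists V => //; exact: open_nbhs_nbhs. Qed.

Lemma cocycle_Sd V k (phi : coch k) z N : cocycle_on V phi -> z \in chain_in V -> cyc set0 z ->
  phi (iter N Sd z) = phi z.
Proof.
move=> h zV z0; apply/esym/eqP; rewrite -subr_eq0 -linearB; apply/eqP.
have -> : z - iter N Sd z = bd (TdN N z).
  rewrite bd_TdN (_ : prebd _ z = 0) ?subr0 //; apply: chain_in0.
  by apply: prebd_in z0 => l c c0; apply: local_in c0; exact: TdN_local.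
by apply: h; apply: local_in zV; exact: TdN_local.
Qed.

(** A germ is closed on small chains only. Prescribing [phi] on small chains and 0 on boundaries of
    all chains of V is consistent by subdivision, and yields a cocycle that can be evaluated on
    large cycles. *)
Lemma honest_cocycle V k (phi : coch k) : open V -> lz (delta phi) V ->
  exists Phi : coch k, cocycle_on V Phi /\ lz (Phi \- phi) V.
Proof.
move=> oV dV; pose Q (S : set X) := S `<=` V /\ vanishing (delta phi) S.
pose p := projection [set s : sing R k X | Q (range s)].
have dQ : downclosed Q.
  by move=> S T ST [TV Tv]; split; [move=> x /ST/TV | exact: vanishing_down Tv].
have [x y h|Phi [PhiQ Phibd]] :=
    @functional_factor2 K _ _ _ p (bd \o onto_chains k.+1 V) (phi \o p) \0.
  rewrite /= addr0 in h *.
  have xQ : p x \in csup Q by exact: projection_in.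
  have xE : p x = bd (- onto_chains k.+1 V y) by rewrite linearN; apply/eqP; rewrite -addr_eq0 h.
  have yV : - onto_chains k.+1 V y \in chain_in V by rewrite rpredN onto_chains_in.
  have [N /(_ N (leqnn N)) N0] := Sd_bounding dV yV; rewrite -xE in N0.
  have -> : p x = bd (TdN N (p x)) + iter N Sd (p x).
    rewrite bd_TdN (_ : prebd _ _ = 0) ?subr0 ?subrK //.
    by case: (k) (p x) (- onto_chains k.+1 V y) xE => //= l c d ->; rewrite bd_bd linear0.
  rewrite linearD N0 addr0; apply: (csup_vanishing (phi := delta phi)).
  apply: local_op_in; [exact: TdN_local | exact: vanishing_down | ].
  by apply: fsuppS xQ => s [].
exists Phi; split=> [d dV'|x Vx]; first by rewrite -{1}(onto_chains_id dV') Phibd.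
have [U xU Uv] := dV x Vx; exists (U `&` V); first by apply: filterI => //; exact: open_nbhs_nbhs.
move=> c cU; have cQ : c \in csup Q.
  apply: fsuppS cU => s sUV; split; first by move=> y /sUV [].
  by apply: vanishing_down Uv => y /sUV [].
by rewrite /= -{1}(projection_id cQ) PhiQ /= (projection_id cQ) subrr.
Qed.

End Cocycles.

Section CocycleDuality.
Variables (R : realType) (K : fieldType) (n : nat) (M : topologicalType).
Hypothesis hM : closed_manifold R n M.
Local Notation ch k := (chain R K k M).
Local Notation coch k := ({linear chain R K k M -> K^o}).
Variable mu : ch n.
Hypothesis mu_cyc : cyc set0 mu.
Hypothesis mu_point : forall y, ~ nullc setT (~` [set y]) mu.
Implicit Types A V : set M.

Lemma dual_surj A r q (y : ch q) : n = (r + q)%N -> closed A -> cyc (~` A) y ->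
  exists V (Phi : coch r), [/\ open V, A `<=` V, cocycle_on V Phi & dual mu A Phi y].
Proof.
move=> nE cA yc; have [_ /(_ y yc)[phi dphi dy]] := poincare_duality hM mu_cyc mu_point cA nE.
have [V [oV AV dV]] := lz_open dphi; have [Phi [PV Pl]] := honest_cocycle oV dV.
by exists V, Phi; split=> //; apply: dual_eq_lz dy => //; exact: lzS Pl.
Qed.

(** By duality [Phi] bounds as a germ (or is 0 as a germ in degree 0), and [x] may be replaced by a
    fine subdivision. *)
Lemma dual_inj A V r q (Phi : coch r) (x : ch r) : n = (r + q)%N -> closed A -> open V ->
  A `<=` V -> cocycle_on V Phi -> dual mu A Phi (0 : ch q) -> x \in chain_in A -> cyc set0 x ->
  Phi x = 0.
Proof.
move=> nE cA oV AV PV P0 xA x0.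
have dA : lz (delta Phi) A by apply: lzS AV _; exact: cocycle_lz.
have [/(_ Phi dA P0) co _] := poincare_duality hM mu_cyc mu_point cA nE.
case: r nE Phi x PV P0 xA x0 dA co => [|r] nE Phi x PV P0 xA x0 dA /= co.
  have [N /(_ N (leqnn N)) N0] := Sd_small (@vanishing_down _ _ _ _ Phi) co xA.
  by rewrite -(cocycle_Sd N PV _ x0); [exact: csup_vanishing | exact: chain_inS xA].
have [psi lpsi] := co.
have [N /(_ N (leqnn N)) N0] := Sd_small (@vanishing_down _ _ _ _ (Phi \- delta psi)) lpsi xA.
have := csup_vanishing N0; rewrite /= => /eqP; rewrite subr_eq0 (cocycle_Sd N PV _ x0); last exact: chain_inS xA.
move=> /eqP ->; rewrite /delta /=; suff -> : bd (iter N Sd x) = iter N Sd (bd x).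
  rewrite (chain_in0 x0) (_ : iter N Sd 0 = 0) ?linear0 //.
  by elim: N {N0} => //= N ->; rewrite linear0.
by elim: N {N0} => //= N IH; rewrite bd_Sd IH.
Qed.

(** Cocycles with equal values on cycles differ by a coboundary, by [cobounding], and a coboundary
    has trivial dual class. *)
Lemma dual_ext A V r q (Phi Psi : coch r) (y : ch q) : n = (r + q)%N -> closed A -> open V ->
  A `<=` V -> cocycle_on V Phi -> cocycle_on V Psi ->
  (forall z, z \in chain_in V -> cyc set0 z -> Phi z = Psi z) -> dual mu A Phi y -> dual mu A Psi y.
Proof.
move=> nE cA oV AV PV PV' E; case: r nE Phi Psi PV PV' E => [|r] nE Phi Psi PV PV' E dy.
  apply: dual_eq_lz dy => //; apply: lzS AV _ => x Vx; exists V; first exact: open_nbhs_nbhs.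
  by move=> c cV; rewrite /= E ?subrr.
have [|z zV z0|psi lpsi] := @cobounding R K M V r (Psi \- Phi) oV.
- apply: (eq_lz (phi := delta Psi \- delta Phi)) => //.
  by apply: lzB; exact: cocycle_lz.
- have zc : cyc set0 z by rewrite /cyc /= z0 rpred0.
  by exists 0%N => N _; rewrite /= (cocycle_Sd N PV) // (cocycle_Sd N PV') // E ?subrr.
have d0 : dual mu A (Psi \- Phi) (0 : ch q).
  by apply: (dual_eq_lz cA (lzS AV lpsi)); exact: dual_delta.
have := dualD d0 dy; rewrite add0r; apply: dual_eq_lz => //; apply: eq0_lz => c /=; zmod.
Qed.

End CocycleDuality.
(* [lra] is slow on hypotheses about chains. *)
Ltac clra := repeat match goal with
  | H : is_true (_ \in _) |- _ => clear H
  | H : @eq ?T _ _ |- _ => lazymatch T with chain _ _ _ _ => clear H | set _ => clear H end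
  | H : nullc _ _ _ |- _ => clear H
  | H : cyc _ _ |- _ => clear H
  end; lra.

(** * Suspension across a regular fiber *)

Section FiberPairing.
Variables (R : realType) (K : fieldType) (n : nat) (M : topologicalType) (f : M -> circle R).
Hypothesis hM : closed_manifold R n M.
Variable B : set (circle R).
Hypotheses (cf : continuous f) (fib : fibration_over R f B) (oB : open B).
Local Notation tau := (pi *+ 2 : R).
Local Notation ch k := (chain R K k M).
Local Notation coch k := ({linear chain R K k M -> K^o}).
Local Notation regular := (regular B).
Local Notation L a b := (levels f (cci a b)).
Local Notation Lo a b := (levels f (ooi a b)).
Local Notation F p := (fiber f p).
Variable mu : ch n.
Hypothesis mu_cyc : cyc set0 mu.
Hypothesis mu_point : forall y, ~ nullc setT (~` [set y]) mu.

Lemma regularS a b a' b' : a <= a' -> b' <= b -> regular a b -> regular a' b'.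
Proof. by move=> aa bb h t ?; apply: h; clra. Qed.

Lemma near_regular p c : B (angle p) -> 0 < c -> exists2 e, 0 < e < c & regular (p - e) (p + e).
Proof.
move=> Bp c0; have : nbhs p (@angle R @^-1` B).
  by apply: (@continuous_angle R p); exact: open_nbhs_nbhs.
move=> /nbhs_ballP[d /= d0 dB]; exists (Num.min (d / 2) (c / 2)).
  by rewrite lt_min gt_min; clra.
move=> t pt; apply: dB; rewrite -ball_normE /= ltr_distlC.
have : Num.min (d / 2) (c / 2) <= d / 2 by rewrite ge_min lexx.
by move=> h; apply/andP; split; clra.
Qed.

Lemma near_regular2 p q c : B (angle p) -> B (angle q) -> 0 < c ->
  exists e, [/\ 0 < e < c, regular (p - e) (p + e) & regular (q - e) (q + e)].
Proof.
move=> Bp Bq c0; have [e e0 re] := near_regular Bp c0.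
have [|d d0 rd] := near_regular Bq (c := e); first clra.
by exists d; split=> //; [clra | apply: regularS re; clra].
Qed.

Lemma L_above p a b : p < a -> b < p + tau -> L a b `<=` ~` F p.
Proof.
move=> pa bp x [s asb fx] Fx; have := F_at (u := p) _ _ fx Fx; move: asb; rewrite /cci /=; clra.
Qed.

Lemma L_below p a b : b < p -> p < a + tau -> L a b `<=` ~` F p.
Proof.
move=> bp pa x [s asb fx] Fx; have := F_at (u := a) _ _ fx Fx; move: asb; rewrite /cci /=; clra.
Qed.

Lemma F_LL p : F p `<=` L p p.
Proof. by apply: FL; rewrite lexx. Qed.

(** The complement of V is compact and its points have levels away from p. *)
Lemma tube p V : open V -> F p `<=` V -> exists2 d, 0 < d & L (p - d) (p + d) `<=` V.
Proof.
move=> oV FV; pose Q (C : set M) := exists2 d, 0 < d & forall x, C x -> ~ L (p - d) (p + d) x.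
have [||||y nV|d d0 h] := @compact_local M (~` V) Q.
- apply: (closed_compact hM); exact: open_closedC.
- by exists 1.
- move=> C D [d d0 dC] [e e0 eD]; exists (Num.min d e); first by rewrite lt_min d0.
  have l1 : Num.min d e <= d by rewrite ge_min lexx.
  have l2 : Num.min d e <= e by rewrite ge_min lexx orbT.
  by move=> x [/dC|/eD] h h'; apply: h; apply: LS h'; clra.
- by move=> C D CD [d d0 dD]; exists d => // x /CD/dD.
- have [ps fy] := levP f p y; set s := lev f p y in ps fy; clearbody s.
  have s0 : p < s.
    rewrite lt_neqAle; have /andP[-> _] := ps; rewrite andbT; apply/eqP => e; apply: nV; apply: FV.
    by rewrite /fiber /= e.
  pose d := Num.min (s - p) (p + tau - s) / 2.
  have d1 : d <= (s - p) / 2 by rewrite /d ler_pM2r ?invr_gt0 // ge_min lexx.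
  have d2 : d <= (p + tau - s) / 2 by rewrite /d ler_pM2r ?invr_gt0 // ge_min lexx orbT.
  have d0 : 0 < d by rewrite /d divr_gt0 // lt_min; clra.
  clearbody d; exists (Lo (p + d) (p + tau - d)).
    by apply: (Lo_nbhd cf _ fy); clra.
  exists d => // x [r rr fx] h; move: rr; rewrite /ooi /= => rr.
  by have := L_at (u := p - d) _ _ _ fx h; clra.
by exists d => // x Lx; apply: contrapT => /h.
Qed.

(** y is swept down to level p - e and up to p + e. The result crosses F p with trace y and is a
    cycle modulo the complement of F p. *)
Definition susp e p k (y : ch k) (Y : ch k.+1) : Prop := exists h1 h2 y1 y2,
  [/\ h1 \in chain_in (L (p - e) p) /\ h2 \in chain_in (L p (p + e)),
      y1 \in chain_in (F (p - e)) /\ y2 \in chain_in (F (p + e)),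
      bd h1 = y - y1, bd h2 = y2 - y & Y = h1 + h2].

Definition good e p : Prop := 0 < e < tau / 2 /\ regular (p - e) (p + e).

Lemma good_ex p : B (angle p) -> exists e, good e p.
Proof.
move=> Bp; have [|e e0 re] := @near_regular p (tau / 2) Bp; first by have := tau_gt0 R; clra.
by exists e.
Qed.

Lemma susp_ex e p k (y : ch k) : good e p -> y \in chain_in (F p) -> cyc set0 y ->
  exists Y, susp e p y Y.
Proof.
move=> [e0 re] yF y0.
have yL a b : a <= p <= b -> y \in chain_in (L a b) by move=> ab; apply: chain_inS yF; exact: FL.
have [|||||y1 [y1F _ [h1 [h1L /chain_in0 E1]]]] := @transport R K M f B cf fib (p - e) p (p - e) k y;
  try clra; try (by apply: regularS re; clra); try (by apply: yL; clra); try by [].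
have [|||||y2 [y2F _ [h2 [h2L /chain_in0 E2]]]] := @transport R K M f B cf fib p (p + e) (p + e) k y;
  try clra; try (by apply: regularS re; clra); try (by apply: yL; clra); try by [].
exists (h1 - h2), h1, (- h2), y1, y2; split=> //; first by rewrite rpredN.
  by apply/eqP; rewrite eq_sym -subr_eq0 E1.
have -> : bd (- h2) = - bd h2 by rewrite linearN.
by move/eqP: E2; rewrite subr_eq0 => /eqP <-; rewrite opprB.
Qed.

Lemma susp_lin e p k a (y z : ch k) Y Z : susp e p y Y -> susp e p z Z ->
  susp e p (a *: y + z) (a *: Y + Z).
Proof.
move=> [h1 [h2 [y1 [y2 [[A1 A2] [A3 A4] A5 A6 ->]]]]] [g1 [g2 [z1 [z2 [[B1 B2] [B3 B4] B5 B6 ->]]]]].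
exists (a *: h1 + g1), (a *: h2 + g2), (a *: y1 + z1), (a *: y2 + z2).
split; [by split; rewrite rpredD ?rpredZ | by split; rewrite rpredD ?rpredZ | | |].
- by rewrite linearP /= A5 B5 scalerBr; zmod.
- by rewrite linearP /= A6 B6 scalerBr; zmod.
by rewrite scalerDr; zmod.
Qed.

(** With [w] accounting for the homology of the traces, the difference splits into one chain on each
    side of F p, pushed off by [half_bot] and [half_top]. *)
Lemma susp_uniq e e' p k (y y' : ch k) Y Y' : good e p -> good e' p -> susp e p y Y ->
  susp e' p y' Y' -> nullc (F p) set0 (y - y') -> nullc setT (~` F p) (Y - Y').
Proof.
move=> [e0 re] [e1 re'] [h1 [h2 [y1 [y2 [[A1 A2] [A3 A4] A5 A6 ->]]]]]
  [g1 [g2 [z1 [z2 [[B1 B2] [B3 B4] B5 B6 ->]]]]] [w [wF /chain_in0 /eqP]].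
rewrite subr_eq0 => /eqP E; pose d := Num.max e e'.
have ed : e <= d by rewrite le_max lexx. have ed' : e' <= d by rewrite le_max lexx orbT.
have d0 : 0 < d < tau / 2 by rewrite /d lt_max gt_max; clra.
have -> : h1 + h2 - (g1 + g2) = (h1 - g1 - w) + (h2 - g2 + w) by zmod.
have wL a b : a <= p <= b -> w \in chain_in (L a b) by move=> ab; apply: chain_inS wF; exact: FL.
have LF a b c : a <= b -> b <= c -> forall q k (u : ch k), a <= q <= b -> u \in chain_in (F q) -> u \in chain_in (L a b).
  by move=> ? ? q l u aq; apply: chain_inS; exact: FL.
apply: nullcD; [apply: (nullcS (A := L (p - d) p) (B := ~` F p)) => // | apply: (nullcS (A := L p (p + d)) (B := ~` F p)) => //].
  apply: (@half_bot R K M f B cf fib p (p - d) (p - e)); try clra; first by apply: regularS re; clra.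
    by rewrite !rpredB //; [apply: chain_inS A1 | apply: chain_inS B1 | apply: wL]; try apply: LS; clra.
  rewrite /cyc /= !linearB /= A5 B5 -E (_ : _ - _ = z1 - y1); last by zmod.
  rewrite rpredB //; [apply: chain_inS B3 | apply: chain_inS A3]; move=> x /F_LL; apply: L_below; clra.
apply: (@half_top R K M f B cf fib p (p + d) (p + e)); try clra; first by apply: regularS re; clra.
  by rewrite rpredD ?rpredB //; [apply: chain_inS A2 | apply: chain_inS B2 | apply: wL]; try apply: LS; clra.
have bE : bd (h2 - g2 + w) = y2 - z2 by rewrite linearD linearB /= A6 B6 -E; zmod.
rewrite /cyc /= bE.
rewrite rpredB //; [apply: chain_inS A4 | apply: chain_inS B4]; move=> x /F_LL; apply: L_above; clra.
Qed.

(* Cutting a relative cycle of (M, M - L p q) along the two end fibers: the piece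
   over the open arc bounds the difference of the two traces. *)
Lemma susp_cut e p q k (x y : ch k) X Y Z : p < q -> 0 < e -> p + e < q -> q + e < p - e + tau ->
  susp e p x X -> susp e q y Y -> cyc (~` L p q) Z ->
  nullc setT (~` F p) (Z - X) -> nullc setT (~` F q) (Z - Y) -> nullc (L p q) set0 (x - y).
Proof.
move=> pq e0 eq qe [h1 [h2 [x1 [x2 [[A1 A2] [A3 A4] A5 A6 XE]]]]]
  [g1 [g2 [y1 [y2 [[B1 B2] [B3 B4] B5 B6 YE]]]]] Zc ZX ZY.
have XL : X \in chain_in (L (p - e) (p + e)).
  by rewrite XE rpredD //; [apply: chain_inS A1 | apply: chain_inS A2]; apply: LS; clra.
have YL : Y \in chain_in (L (q - e) (q + e)).
  by rewrite YE rpredD //; [apply: chain_inS B1 | apply: chain_inS B2]; apply: LS; clra.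
have [d [_ aV]] : nullc setT (~` (F p `|` F q)) (Z - X - Y).
  apply: mv_null; try exact: closed_fiber.
  - move=> w _; apply: nullc_in; apply: chain_inS (chain_inT w) => z _ [Fp Fq].
    by have := F_at (u := p) _ _ Fq Fp; clra.
  - by apply: nullcB => //; apply: nullc_in; apply: chain_inS YL; apply: L_above; clra.
  have -> : Z - X - Y = Z - Y - X by zmod.
  by apply: nullcB => //; apply: nullc_in; apply: chain_inS XL; apply: L_below; clra.
set a := _ - bd d in aV; pose U1 := Lo p q; pose U2 := Lo q (p + tau).
have U2E : U2 = ~` L p q by rewrite /U2 compl_cci //; clra.
have aU : a \in chain_in (U1 `|` U2).
  apply: chain_inS aV => z nF; have [ps fz] := levP f p z; set s := lev f p z in ps fz.
  have sp : s != p by apply/eqP => e1; apply: nF; left; rewrite /fiber /= fz e1.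
  have sq : s != q by apply/eqP => e1; apply: nF; right; rewrite /fiber /= fz e1.
  have [sq'|qs] := ltP s q; [left | right]; exists s => //; rewrite /ooi /=.
    by rewrite sq' lt_neqAle eq_sym sp; have /andP[-> _] := ps.
  by rewrite lt_neqAle eq_sym sq qs; have /andP[_ ->] := ps.
have F1 c l (u : ch l) : p < c < q -> u \in chain_in (F c) -> u \in chain_in U1.
  by move=> ?; apply: chain_inS => z fz; exists c.
have F2 c l (u : ch l) : q < c < p + tau -> u \in chain_in (F c) -> u \in chain_in U2.
  by move=> ?; apply: chain_inS => z fz; exists c.
have F2' l (u : ch l) : u \in chain_in (F (p - e)) -> u \in chain_in U2.
  have -> : F (p - e) = F (p - e + tau * 1%:~R) by rewrite /fiber angle_add.
  by apply: F2; rewrite mulr1; clra.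
pose b1 := y1 - x2; pose b2 := bd Z + x1 - y2.
have b1U : b1 \in chain_in U1 by rewrite rpredB //; [apply: F1 B3 | apply: F1 A4]; clra.
have b2U : b2 \in chain_in U2.
  rewrite rpredB ?rpredD //; [by rewrite U2E | exact: F2' | by apply: F2 B4; clra].
have ba : bd a = b1 + b2.
  rewrite /a !linearB /= bd_bd XE YE !linearD /= A5 A6 B5 B6 /b1 /b2; zmod.
have [|v1 [v2 [t [vE v1U v2U tU]]]] := split2 (open_ooi cf p q) (open_ooi cf q (p + tau)) aU.
  by rewrite /bcond ba; exact: either_csup.
have bv : bd v1 - b1 = b2 - bd v2.
  have : bd v1 + bd v2 = b1 + b2 by rewrite -ba vE !linearD /= bd_bd addr0.
  by move=> /(canRL (addrK _)) ->; zmod.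
(* The open arcs [U1] and [U2] are disjoint, so [v1] bounds [b1] exactly. *)
have z0 : bd v1 - b1 \in chain_in set0.
  apply: (chain_inS (A := U1 `&` U2)).
    by rewrite U2E => z [[s ss fz]]; case; exists s => //; move: ss; rewrite /ooi /cci /=; clra.
  apply: chain_inI; first by rewrite rpredB // bd_chain_in.
  by rewrite bv rpredB // bd_chain_in.
exists (- (v1 + h2 + g1)); split.
  rewrite rpredN !rpredD //.
  - by apply: chain_inS v1U; apply: levelsS => s; rewrite /ooi /cci /=; clra.
  - by apply: chain_inS A2; apply: LS; clra.
  by apply: chain_inS B1; apply: LS; clra.
suff -> : x - y - bd (- (v1 + h2 + g1)) = bd v1 - b1 by [].
by rewrite linearN !linearD /= A6 B5 /b1; zmod.
Qed.

(** The suspension has degree above n and vanishes modulo the complement of F p. Cutting against the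
    zero suspension at a nearby fiber shows that [x] bounds. *)
Lemma fiber_vanish p r (x : ch r) : B (angle p) -> (n <= r)%N -> x \in chain_in (F p) ->
  cyc set0 x -> nullc (F p) set0 x.
Proof.
move=> Bp nr xF x0; have tau0 := tau_gt0 R.
have [|e e0 re] := near_regular Bp (c := tau / 6); first clra.
have [|X sX] := @susp_ex (e / 3) p _ x _ xF x0; first by split; [clra | apply: regularS re; clra].
have sY : susp (e / 3) (p + e) (0 : ch r) 0.
  by exists 0, 0, 0, 0; split; rewrite ?linear0 ?subrr ?addr0 //; split; exact: rpred0.
apply: (@fiber_null R K M f B cf fib p (p + e)); try clra; first by apply: regularS re; clra.
  by [].
rewrite -[x]subr0; apply: (@susp_cut (e / 3) p (p + e) r x 0 X 0 0) => //; try clra.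
- by rewrite /cyc /= linear0 rpred0.
- apply: (top_vanish hM); [exact: closed_fiber | by rewrite ltnS |].
  rewrite sub0r.
  have [h1 [h2 [x1 [x2 [_ [A3 A4] A5 A6 ->]]]]] := sX.
  have bE : bd (h1 + h2) = x2 - x1 by rewrite linearD /= A5 A6; zmod.
  rewrite /cyc /= linearN rpredN bE.
  rewrite rpredB //; [apply: chain_inS A4 | apply: chain_inS A3] => z /F_LL.
    by apply: L_above; clra.
  by apply: L_below; clra.
by rewrite subrr; exact: nullc0.
Qed.

End FiberPairing.
(** The exact sequence of the pair (A, C): with no relative homology one degree higher, cycles of C
    that bound in A bound in C. *)
Lemma nullc_restrict (R : realType) (K : comNzRingType) (X : topologicalType) (A C : set X) k
    (x : chain R K k X) :
  (forall d : chain R K k.+1 X, d \in chain_in A -> cyc C d -> nullc A C d) ->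
  x \in chain_in C -> nullc A set0 x -> nullc C set0 x.
Proof.
move=> h xC [d [dA /chain_in0 /eqP]]; rewrite subr_eq0 => /eqP E.
have [|e [eA deC]] := h d dA; first by rewrite /cyc /= -E.
by exists (d - bd e); rewrite deC linearB /= bd_bd subr0 E subrr rpred0.
Qed.

(** * Duality between regular fibers *)

Section FiberDuality.
Variables (R : realType) (K : fieldType) (n : nat) (M : topologicalType) (f : M -> circle R).
Hypothesis hM : closed_manifold R n M.
Variable B : set (circle R).
Hypotheses (cf : continuous f) (fib : fibration_over R f B) (oB : open B).
Local Notation tau := (pi *+ 2 : R).
Local Notation ch k := (chain R K k M).
Local Notation coch k := ({linear chain R K k M -> K^o}).
Local Notation regular := (regular B).
Local Notation good := (good B).
Local Notation susp := (susp f).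
Local Notation L a b := (levels f (cci a b)).
Local Notation Lo a b := (levels f (ooi a b)).
Local Notation F p := (fiber f p).
Variable mu : ch n.
Hypothesis mu_cyc : cyc set0 mu.
Hypothesis mu_point : forall y, ~ nullc setT (~` [set y]) mu.
Variables (r k : nat).
Hypothesis nE : n = (r + k.+1)%N.
Local Notation dual := (dual mu).

(** The value of [Phi] on a cycle of F p is the pairing with y. [Phi] is a cocycle on a whole
    neighborhood, so it is evaluated without subdividing. *)
Definition repr p (y : ch k) (Phi : coch r) : Prop :=
  (exists V, [/\ open V, F p `<=` V & cocycle_on V Phi]) /\
  exists e Y, [/\ good e p, susp e p y Y & dual (F p) Phi Y].

Let closedF p : closed (F p). Proof. exact: closed_fiber. Qed.

Lemma susp_cyc e p l (y : ch l) Y : good e p -> susp e p y Y -> cyc (~` F p) Y.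
Proof.
move=> [e0 re] [h1 [h2 [x1 [x2 [_ [A3 A4] A5 A6 ->]]]]].
have bE : bd (h1 + h2) = x2 - x1 by rewrite linearD /= A5 A6; zmod.
rewrite /cyc /= bE rpredB //; [apply: chain_inS A4 | apply: chain_inS A3] => z /F_LL.
  by apply: L_above; clra.
by apply: L_below; clra.
Qed.

Lemma repr_ex p (y : ch k) : B (angle p) -> y \in chain_in (F p) -> cyc set0 y ->
  exists Phi, repr p y Phi.
Proof.
move=> Bp yF y0; have [e ge] := good_ex oB Bp; have [Y sY] := susp_ex cf fib ge yF y0.
have [V [Phi [oV FV PV dY]]] := dual_surj hM mu_cyc mu_point nE (@closedF p) (susp_cyc ge sY).
by exists Phi; split; [exists V | exists e, Y].
Qed.

Lemma repr_resusp e p (y y' : ch k) Y Phi : repr p y Phi -> good e p -> susp e p y' Y ->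
  nullc (F p) set0 (y' - y) -> dual (F p) Phi Y.
Proof.
move=> [_ [e' [Y' [ge' sY' dY']]]] ge sY yy; apply: dual_null dY' _.
exact: susp_uniq ge ge' sY sY' yy.
Qed.

Lemma repr_uniq p (y y' : ch k) Phi Psi x : repr p y Phi -> repr p y' Psi ->
  nullc (F p) set0 (y - y') -> x \in chain_in (F p) -> cyc set0 x -> Phi x = Psi x.
Proof.
move=> [[V [oV FV PV]] [e [Y [ge sY dY]]]] rP' yy xF x0; have dY' := repr_resusp rP' ge sY yy.
have [[V' [oV' FV' PV']] _] := rP'.
apply/eqP; rewrite -subr_eq0; apply/eqP.
apply: (@dual_inj R K n M hM mu mu_cyc mu_point (F p) (V `&` V') r k.+1 (Phi \- Psi) x) => //.
- exact: openI.
- by move=> z Fz; split; [exact: FV | exact: FV'].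
- by move=> d dV; rewrite /= (PV d) ?(PV' d) ?subrr //; apply: chain_inS dV => z [].
by rewrite -[0](subrr Y); exact: dualB.
Qed.

Lemma repr_lin p a (y z : ch k) Phi Psi : B (angle p) ->
  y \in chain_in (F p) -> cyc set0 y -> z \in chain_in (F p) -> cyc set0 z ->
  repr p y Phi -> repr p z Psi -> repr p (a *: y + z) (a \*: Phi \+ Psi).
Proof.
move=> Bp yF y0 zF z0 ry rz; have [e ge] := good_ex oB Bp.
have [Y sY] := susp_ex cf fib ge yF y0; have [Z sZ] := susp_ex cf fib ge zF z0.
have n0 (w : ch k) : nullc (F p) set0 (w - w) by rewrite subrr; exact: nullc0.
have dY := repr_resusp ry ge sY (n0 y); have dZ := repr_resusp rz ge sZ (n0 z).
have [[V [oV FV PV]] _] := ry; have [[V' [oV' FV' PV']] _] := rz.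
split.
  exists (V `&` V'); split; [exact: openI | by move=> w Fw; split; [exact: FV | exact: FV'] |].
  move=> d dV; rewrite /= (PV d) ?(PV' d) ?scaler0 ?addr0 //; by apply: chain_inS dV => w [].
exists e, (a *: Y + Z); split=> //; first exact: susp_lin.
by apply: dualD => //; exact: dualZ.
Qed.

Lemma repr0 p : B (angle p) -> repr p 0 \0.
Proof.
move=> Bp; have [e ge] := good_ex oB Bp; split.
  by exists setT; split=> //; exact: openT.
exists e, 0; split=> //; last by apply: dual_lz => //; exact: eq0_lz.
by exists 0, 0, 0, 0; split; rewrite ?linear0 ?subrr ?addr0 //; split; exact: rpred0.
Qed.

(** Every cycle of a thin tube is homologous to one of F p, so the values on F p determine the
    cocycle up to a coboundary. *)
Lemma dual_fiber_ext p V1 V2 (Phi Psi : coch r) (Y : ch k.+1) : B (angle p) ->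
  open V1 -> F p `<=` V1 -> cocycle_on V1 Phi -> open V2 -> F p `<=` V2 -> cocycle_on V2 Psi ->
  (forall x, x \in chain_in (F p) -> cyc set0 x -> Phi x = Psi x) ->
  dual (F p) Phi Y -> dual (F p) Psi Y.
Proof.
move=> Bp oV1 FV1 PV1 oV2 FV2 PV2 E.
have oV : open (V1 `&` V2) by exact: openI.
have [|d d0 LV] := tube hM cf oV (p := p); first by move=> z Fz; split; [exact: FV1 | exact: FV2].
have d1 : 0 < Num.min d (tau / 2) by rewrite lt_min d0 divr_gt0 ?tau_gt0.
have [e e0 re] := near_regular oB Bp d1; move: e0; rewrite lt_min => /andP[e0 /andP[ed et]].
have LL a b : p - d <= a -> b <= p + d -> L a b `<=` V1 `&` V2.
  by move=> ? ? z /(LS (c := p - d) (d := p + d)) h; apply: LV; apply: h.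
have LL' : L (p - e) (p + e) `<=` V1 `&` V2 by apply: LL; clra.
have LoL : Lo (p - e) (p + e) `<=` L (p - e) (p + e) by apply: levelsS => t; rewrite /ooi /cci /=; clra.
apply: (@dual_ext R K n M mu mu_cyc (F p) (Lo (p - e) (p + e))) => //.
- exact: open_ooi.
- by move=> z Fz; exists p => //; rewrite /ooi /=; clra.
- by apply: cocycle_onS PV1 => z /LoL/LL' [].
- by apply: cocycle_onS PV2 => z /LoL/LL' [].
move=> z zL z0; have zL' : z \in chain_in (L (p - e) (p + e)) by exact: chain_inS zL.
have [|||||x [xF x0 [w [wL /chain_in0 /eqP]]]] := @transport R K M f B cf fib (p - e) (p + e) p r z; [clra | clra | done | done | done |].
rewrite subr_eq0 => /eqP zx; have -> : z = bd w + x by rewrite -zx subrK.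
have wV : w \in chain_in (V1 `&` V2) by apply: chain_inS wL.
rewrite !linearD (PV1 w) ?(PV2 w) ?add0r ?E //; by apply: chain_inS wV => y [].
Qed.

Section TwoFibers.
Variables p q : R.
Hypotheses (pq : p < q) (qp : q < p + tau) (Bp : B (angle p)) (Bq : B (angle q)).

Let small : exists e, [/\ 0 < e, p + e < q, q + e < p - e + tau, good e p & good e q].
Proof.
have t0 := tau_gt0 R.
have c0 : 0 < Num.min (q - p) (Num.min ((p + tau - q) / 2) (tau / 2)) by rewrite !lt_min !divr_gt0 ?subr_gt0 ?pq.
have [e [/andP[e0 ec] rp rq]] := near_regular2 oB Bp Bq c0.
by move: ec; rewrite !lt_min => /and3P[? ? ?]; exists e; split; try split; try clra.
Qed.

(** The chain [w] between x' and y', prolonged by collars beyond p and q, is a cycle Z modulo the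
    complement of L p q. Its dual cocycle represents x' at p and y' at q, and as a cocycle near L p
    q it has equal values on the homologous cycles x and y. *)
Lemma pairing_eq (x y : ch r) (x' y' : ch k) Phi Psi :
  x \in chain_in (F p) -> cyc set0 x -> y \in chain_in (F q) -> cyc set0 y ->
  x' \in chain_in (F p) -> cyc set0 x' -> y' \in chain_in (F q) -> cyc set0 y' ->
  nullc (L p q) set0 (x - y) -> nullc (L p q) set0 (x' - y') ->
  repr p x' Phi -> repr q y' Psi -> Phi x = Psi y.
Proof.
move=> xF x0 yF y0 x'F x'0 y'F y'0 [d [dL /chain_in0 /subr0_eq xy]] [w [wL /chain_in0 /subr0_eq xy']] rP rQ.
have [e [e0 pe eq gp gq]] := small.
have [X sX] := susp_ex cf fib gp x'F x'0; have [Y sY] := susp_ex cf fib gq y'F y'0.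
have [h1 [h2 [x1 [x2 [[A1 A2] [A3 A4] A5 A6 XE]]]]] := sX.
have [g1 [g2 [y1 [y2 [[B1 B2] [B3 B4] B5 B6 YE]]]]] := sY.
pose Z := h1 - w + g2.
have FV c a b : a <= b -> b < c -> c < a + tau -> F c `<=` ~` L a b.
  by move=> ab bc ca z fz Lz; have := L_at (u := a) _ _ _ fz Lz; clra.
have F1 c a b : c < a -> b < c + tau -> F c `<=` ~` L a b.
  by move=> bc ca z fz Lz; have := L_at (u := c) _ _ _ fz Lz; clra.
have bZ : bd Z = y2 - x1.
  by rewrite /Z linearD linearB /= A5 B6 -xy'; zmod.
have Zc : cyc (~` L p q) Z.
  rewrite /cyc /= bZ rpredB //; [apply: chain_inS B4; apply: FV; clra | apply: chain_inS A3; apply: F1; clra].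
have cL : closed (L p q) by exact: closed_cci.
have [V [Th [oV LV PV dZ]]] := dual_surj hM mu_cyc mu_point nE cL Zc.
have FpL : F p `<=` L p q by apply: FL; clra.
have FqL : F q `<=` L p q by apply: FL; clra.
have rTp : repr p x' Th.
  split; first by exists V; split=> // z /FpL/LV.
  exists e, X; split=> //; apply: dual_null (dualS FpL dZ) _; apply: nullc_sym.
  have -> : Z - X = g2 - w - h2 by rewrite /Z XE; zmod.
  apply: (nullcS (A := L p (q + e)) (B := ~` F p)) => //.
  apply: (@half_top R K M f B cf fib p (q + e) (p + e)); [clra | clra | clra | by apply: regularS gp.2; clra | |].
    by rewrite !rpredB //; [apply: chain_inS B2 | apply: chain_inS wL | apply: chain_inS A2]; apply: LS; clra.
  have bE : bd (g2 - w - h2) = y2 - x2 by rewrite !linearB /= B6 A6 -xy'; zmod.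
  rewrite /cyc /= bE rpredB //; [apply: chain_inS B4 | apply: chain_inS A4] => z /F_LL; apply: L_above; clra.
have rTq : repr q y' Th.
  split; first by exists V; split=> // z /FqL/LV.
  exists e, Y; split=> //; apply: dual_null (dualS FqL dZ) _; apply: nullc_sym.
  have -> : Z - Y = h1 - w - g1 by rewrite /Z YE; zmod.
  apply: (nullcS (A := L (p - e) q) (B := ~` F q)) => //.
  apply: (@half_bot R K M f B cf fib q (p - e) (q - e)); [clra | clra | clra | by apply: regularS gq.2; clra | |].
    by rewrite !rpredB //; [apply: chain_inS A1 | apply: chain_inS wL | apply: chain_inS B1]; apply: LS; clra.
  have bE : bd (h1 - w - g1) = y1 - x1 by rewrite !linearB /= B5 A5 -xy'; zmod.
  rewrite /cyc /= bE rpredB //; [apply: chain_inS B3 | apply: chain_inS A3] => z /F_LL; apply: L_below; clra.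
have n0 c (u : ch k) : nullc (F c) set0 (u - u) by rewrite subrr; exact: nullc0.
rewrite (repr_uniq rP rTp (n0 _ _) xF x0) (repr_uniq rQ rTq (n0 _ _) yF y0).
by apply/eqP; rewrite -subr_eq0 -linearB xy PV //; exact: chain_inS dL.
Qed.

(** The last hypothesis makes it consistent to prescribe [Phi] on F p, [Psi] on F q and 0 on
    boundaries over a slightly longer arc. The dual cycle of the resulting cocycle localizes to the
    suspensions of x' and y', and [susp_cut] applies. *)
Lemma pairing_perp (x' y' : ch k) Phi Psi :
  x' \in chain_in (F p) -> cyc set0 x' -> y' \in chain_in (F q) -> cyc set0 y' ->
  repr p x' Phi -> repr q y' Psi ->
  (forall x y : ch r, x \in chain_in (F p) -> cyc set0 x -> y \in chain_in (F q) -> cyc set0 y ->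
     nullc (L p q) set0 (x - y) -> Phi x = Psi y) ->
  nullc (L p q) set0 (x' - y').
Proof.
move=> x'F x'0 y'F y'0 rP rQ h; have [e [e0 pe eq gp gq]] := small.
have [X sX] := susp_ex cf fib gp x'F x'0; have [Y sY] := susp_ex cf fib gq y'F y'0.
have n0 c (u : ch k) : nullc (F c) set0 (u - u) by rewrite subrr; exact: nullc0.
have dX := repr_resusp rP gp sX (n0 _ _); have dY := repr_resusp rQ gq sY (n0 _ _).
have [[V1 [oV1 FV1 PV1]] _] := rP; have [[V2 [oV2 FV2 PV2]] _] := rQ.
pose G := Lo (p - e) (q + e); have oG : open G by exact: open_ooi.
have GL : G `<=` L (p - e) (q + e) by apply: levelsS => t; rewrite /ooi /cci /=; clra.
have LG : L p q `<=` G by apply: levelsS => t; rewrite /ooi /cci /=; clra.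
have FpL : F p `<=` L p q by apply: FL; clra.
have FqL : F q `<=` L p q by apply: FL; clra.
pose A := F p `|` F q.
have [x d|Th [ThF ThG]] := @functional_factor2 K (ch r * ch r)%type (ch r.+1) (ch r)
    (pair_sum (onto_chains R K r (F p)) (onto_chains R K r (F q))) (bd \o onto_chains R K r.+1 G)
    (pair_sum (Phi \o onto_chains R K r (F p)) (Psi \o onto_chains R K r (F q))) \0.
  rewrite /= /pair_sum /= addr0; set x1 := onto_chains R K r (F p) x.1; set x2 := onto_chains R K r (F q) x.2 => E.
  have x1F : x1 \in chain_in (F p) by exact: onto_chains_in.
  have x2F : x2 \in chain_in (F q) by exact: onto_chains_in.
  set d' := onto_chains R K r.+1 G d in E; have dG : d' \in chain_in G by exact: onto_chains_in.
  have xE : x1 + x2 = - bd d' by apply/eqP; rewrite -addr_eq0 E.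
  (* F p and F q are disjoint, so the boundaries of the two parts vanish separately. *)
  have [x10 x20] : cyc set0 x1 /\ cyc set0 x2.
    have e12 : bcond (subset^~ set0) (x1 + x2) by rewrite xE -linearN; exact: bcond_bd.
    case: (r) x1 x2 x1F x2F {E xE} e12 => [|l] u1 u2 u1F u2F //; rewrite /cyc /bcond linearD => b12.
    have b1 : bd u1 \in chain_in set0.
      apply: (chain_inS (A := F p `&` F q)).
        by move=> z [Fp Fq]; have := F_at (u := p) _ _ Fq Fp; clra.
      apply: chain_inI; first exact: bd_chain_in.
      by rewrite -[bd u1](addrK (bd u2)) rpredB ?bd_chain_in // (chain_in0 b12) rpred0.
    by split=> //; rewrite -[bd u2](addKr (bd u1)) rpredD ?rpredN.
  have x2F' : - x2 \in chain_in (F q) by rewrite rpredN.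
  have x20' : cyc set0 (- x2) by rewrite -scaleN1r; exact: bcondZ.
  apply/eqP; rewrite addr_eq0 -linearN; apply/eqP; apply: h => //.
  have xL : x1 - - x2 \in chain_in (L p q).
    by rewrite rpredB //; [apply: chain_inS x1F | apply: chain_inS x2F'].
  apply: (nullc_restrict (A := L p (q + e))) => //.
    move=> u; apply: (@compress_top R K M f B cf fib p (q + e) (q - e) q); [clra | clra | clra | clra | exact: gq.2].
  apply: (nullc_restrict (A := L (p - e) (q + e))).
  - move=> u; apply: (@compress_bot R K M f B cf fib (p - e) (q + e) p (p + e)); [clra | clra | clra | clra | exact: gp.2].
  - by apply: chain_inS xL; apply: LS; clra.
  exists (- d'); split; first by rewrite rpredN; exact: chain_inS dG.
  by rewrite opprK xE linearN subrr rpred0.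
have Thp x : x \in chain_in (F p) -> Th x = Phi x.
  by move=> xF; have := ThF (x, 0); rewrite /= /pair_sum /= !linear0 !addr0 onto_chains_id.
have Thq x : x \in chain_in (F q) -> Th x = Psi x.
  by move=> xF; have := ThF (0, x); rewrite /= /pair_sum /= !linear0 !add0r onto_chains_id.
have ThV : cocycle_on G Th by move=> d dG; rewrite -(onto_chains_id dG) ThG.
have cL : closed (L p q) by exact: closed_cci.
have lTh : lz (delta Th) (L p q) by apply: lzS LG _; exact: cocycle_lz.
have [N dTh] := dual_ex mu_cyc nE cL lTh.
apply: (susp_cut cf pq e0 pe eq sX sY (dual_cyc mu_cyc nE cL lTh dTh)).
  apply: (dual_uniq (phi := Th)); first exact: dualS dTh.
  by apply: (dual_fiber_ext Bp oV1 FV1 PV1 oG _ ThV _ dX) => [z /FpL/LG|x xF _]; rewrite ?Thp.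
apply: (dual_uniq (phi := Th)); first exact: dualS dTh.
by apply: (dual_fiber_ext Bq oV2 FV2 PV2 oG _ ThV _ dY) => [z /FqL/LG|x xF _]; rewrite ?Thq.
Qed.

End TwoFibers.

(** [pairing_perp] against the zero class on a nearby fiber. *)
Lemma right_nondeg p (y : ch k) Phi : B (angle p) -> y \in chain_in (F p) -> cyc set0 y ->
  repr p y Phi -> (forall x, x \in chain_in (F p) -> cyc set0 x -> Phi x = 0) ->
  nullc (F p) set0 y.
Proof.
move=> Bp yF y0 rP P0; have t0 := tau_gt0 R.
have [||e e0 re] := @near_regular R B oB p (tau / 2); [by [] | clra |].
have Bq : B (angle (p + e)) by apply: re; clra.
apply: (@fiber_null R K M f B cf fib p (p + e)); [clra | clra | by apply: regularS re; clra | by [] |].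
rewrite -[y]subr0; apply: (@pairing_perp p (p + e) _ _ Bp Bq y 0 Phi \0) => //; [clra | clra | | | |].
- exact: rpred0.
- exact: bcond0.
- exact: repr0.
by move=> x z xF x0 _ _ _; exact: P0.
Qed.

End FiberDuality.
(** * Finite generation and transition maps *)

Lemma within_comp2 (T X Y : topologicalType) (A : set T) (C : set X) (f : T -> X) (h : X -> Y) :
  {within A, continuous f} -> (forall x, A x -> C (f x)) -> {within C, continuous h} ->
  {within A, continuous (h \o f)}.
Proof.
move=> /subspace_sigL_continuousP cf fC ch; apply/subspace_sigL_continuousP.
exact: (@within_comp A X Y C (sigL A f) h cf (fun z => fC _ (set_valP z)) ch).
Qed.

Section Retractions.
Variables (R : realType) (X : topologicalType) (A U : set X) (h : X * R -> X).
Hypothesis hU : nbhd_retraction A U h.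

Lemma nbhd_retraction_at t : 0 <= t <= 1 -> {within U, continuous (fun x => h (x, t))}.
Proof.
have [_ ch _ _ _] := hU => t01.
apply: (@within_comp2 X (X * R)%type X U (U `*` `[0, 1]) (fun x => (x, t)) h) => //.
  apply: continuous_subspaceT.
  exact: (continuous_pair (fun x => @cvg_id _ (nbhs x)) (@cst_continuous X R t)).
Qed.

(** The homotopy fixes A, so compactness of [0, 1] gives a neighborhood of A that stays in W
    throughout. *)
Lemma nbhd_retraction_tube (W : set X) : open W -> A `<=` W ->
  exists V, [/\ open V, A `<=` V, V `<=` U & forall x t, V x -> 0 <= t <= 1 -> W (h (x, t))].
Proof.
have [[oU AU] ch h0 h1 hA] := hU => oW AW.
pose good : set X := [set x | exists2 N, nbhs x N & forall y t, N y -> U y -> 0 <= t <= 1 -> W (h (y, t))].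
have Agood x : A x -> good x.
  move=> Ax; pose Q (C : set R) := exists2 N, nbhs x N & forall y t, N y -> U y -> C t -> 0 <= t <= 1 -> W (h (y, t)).
  have [||||t t01|N xN NW] := @compact_local R `[0, 1]%classic Q.
  - exact: segment_compact.
  - by exists setT => //; exact: filterT.
  - move=> C D [N xN NW] [N' xN' NW']; exists (N `&` N'); first exact: filterI.
    by move=> y t [Ny N'y] Uy [Ct|Dt] t01; [exact: NW Ct t01 | exact: NW' Dt t01].
  - by move=> C D CD [N xN NW]; exists N => // y t Ny Uy /CD; exact: NW.
  - have t01' : 0 <= t <= 1 by move: t01; rewrite /= in_itv.
    have UI : (U `*` `[0, 1]%classic) (x, t) by split=> //; exact: AU.
    have xW : nbhs (h (x, t)) W by rewrite hA //; apply: open_nbhs_nbhs; split=> //; exact: AW.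
    have hn : within (U `*` `[0, 1]%classic) (nbhs (x, t)) (h @^-1` W).
      by rewrite (nbhs_subspace_in UI); exact: (ch (x, t) W xW).
    have [[N T] /= [xN tT] NT] := hn.
    exists T => //; exists N => // y s Ny Uy Ts s01.
    apply: (NT (y, s)) => //; split=> //=; by rewrite in_itv.
  by exists N => // y t Ny Uy t01; apply: NW => //; rewrite /= in_itv.
exists (U `&` good^°); split; [exact: openI oU (open_interior _) | | by move=> x [] |].
  move=> x Ax; split; first exact: AU.
  have [N xN NW] := Agood x Ax; move: xN; rewrite nbhsE => -[N' [oN' N'x] N'N].
  rewrite /interior /= nbhsE; exists N' => // y N'y; exists N => //.
  by rewrite nbhsE; exists N'.
by move=> x t [Ux /interior_subset [N xN NW]] t01; apply: NW => //; exact: nbhs_singleton.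
Qed.

Variable K : comNzRingType.

Lemma retract_fpush k (c : chain R K k X) : c \in chain_in A -> fpush (fun x => h (x, 1)) c = c.
Proof.
have [[oU AU] ch h0 h1 hA] := hU => cA; rewrite -[RHS]fpush_id; apply: eq_fpush cA.
  by apply: continuous_subspaceW AU _; apply: nbhd_retraction_at; rewrite ler01 lexx.
by move=> x Ax; rewrite hA // ler01 lexx.
Qed.

Lemma retract_null k (x : chain R K k X) : x \in chain_in A -> nullc U set0 x -> nullc A set0 x.
Proof.
have [[oU AU] ch h0 h1 hA] := hU => xA [d [dU /chain_in0 /subr0_eq xd]].
exists (fpush (fun x => h (x, 1)) d); split; first exact: fpush_in dU.
have cr : {within U, continuous (fun x => h (x, 1))}.
  by apply: nbhd_retraction_at; rewrite ler01 lexx.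
by rewrite (bd_fpush cr dU) -xd retract_fpush // subrr rpred0.
Qed.

End Retractions.

(** * Finite dimension of the homology of fibers *)

Section FiniteHomology.
Variables (R : realType) (K : fieldType) (n : nat) (M : topologicalType).
Hypothesis hM : closed_manifold R n M.
Local Notation ch k := (chain R K k M).
Local Notation coch k := ({linear chain R K k M -> K^o}).
Variable mu : ch n.
Hypothesis mu_cyc : cyc set0 mu.
Hypothesis mu_point : forall y, ~ nullc setT (~` [set y]) mu.

(* For N large, the cap product with Sd^N mu only sees a cochain through its values
   on the finitely many front faces of Sd^N mu. *)
Lemma finite_test A (r q : nat) : n = (r + q)%N -> closed A -> nbhd_deformation_retract R A ->
  exists l : seq (ch r), forall Phi : coch r, cocycle_on A Phi ->
    (forall c, c \in l -> Phi c = 0) -> forall x, x \in chain_in A -> cyc set0 x -> Phi x = 0.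
Proof.
move=> nE cA [U [h hU]]; have [[oU AU] hc h0 h1 hA] := hU.
have cr : {within U, continuous (fun x => h (x, 1))} by apply: (nbhd_retraction_at hU); rewrite ler01 lexx.
have [N HN] : exists N, iter N Sd mu \in csup [set S | S `<=` ~` A \/ S `<=` U].
  have [||N /(_ N (leqnn N)) h2] := @Sd_small R K M n mu setT [set S | S `<=` ~` A \/ S `<=` U] _ _ (chain_inT mu).
  - by move=> S T ST [TA|TU]; [left=> x /ST/TA | right=> x /ST/TU].
  - move=> x _; have [Ax|nA] := pselect (A x).
      by exists U; [apply: open_nbhs_nbhs; split=> //; exact: AU | right].
    by exists (~` A); [apply: open_nbhs_nbhs; split=> //; exact: closed_openC | left].
  by exists N.
set c := iter N Sd mu in HN.
(* The list has to be independent of [Phi]: the retraction turns any cocycle on A into one on U, and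
   the front faces are retracted once for all. *)
pose ret : {linear ch r -> ch r} := fpush (fun x => h (x, 1)) \o onto_chains R K r U.
exists [seq ret << vop id r s >> | s <- dom c] => Phi PA Pl x xA x0.
pose phi : coch r := Phi \o ret.
have phiU : cocycle_on U phi.
  move=> d dU; rewrite /phi /= onto_chains_id ?bd_chain_in // -(bd_fpush cr dU); apply: PA.
  by apply: fpush_in dU.
have <- : phi x = Phi x.
  have xU := chain_inS AU xA.
  by rewrite /phi /= onto_chains_id // (retract_fpush hU).
apply: (@dual_inj R K n M hM mu mu_cyc mu_point A U r q phi) => //.
exists N => N' NN'; have := capmu_stable mu_cyc (q := q) (phi := phi) (A := A) nE _ NN'.
suff -> : capmu mu phi q N = 0.
  apply; apply: fsuppS HN => s [sA|sU]; [by left | right].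
  by move=> d dS; rewrite /delta /=; apply: phiU; exact: chain_inS dS.
rewrite /capmu -/c -[c in cap _ _ _ c]freeg_sumE linear_sum big_seq big1 // => s sc.
have -> : << coeff s c *g s >> = coeff s c *: << s >> :> ch n.
  by apply/eqP/freeg_eqP => z; rewrite coeffZ !coeffU mul1r.
rewrite linearZ /= capU (_ : phi _ = 0) ?scale0r ?scaler0 //.
by apply: Pl; apply: map_f.
Qed.

(** Modulo boundaries in A every cycle is in the span of the list of [finite_test]; otherwise some
    functional would kill the list and the boundaries but not the cycle. *)
Lemma finite_cycles A (r q : nat) : n = (r + q)%N -> closed A -> nbhd_deformation_retract R A ->
  exists N, forall x : 'I_N.+1 -> ch r, (forall i, x i \in chain_in A /\ cyc set0 (x i)) ->
    exists2 a : 'I_N.+1 -> K, (exists i, a i != 0) & nullc A set0 (\sum_i a i *: x i).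
Proof.
move=> nE cA ndr; have [l lP] := finite_test nE cA ndr; pose N := size l.
pose u : {linear {freeg 'I_N / K} -> ch r} := flift (fun i : 'I_N => l`_i).
have span x : x \in chain_in A -> cyc set0 x ->
    exists w, exists2 d, d \in chain_in A & x = u w + bd d.
  move=> xA x0; apply: contrapT => nx.
  pose v : {linear {freeg unit / K} -> ch r} := flift (fun=> x).
  pose e : {linear {freeg unit / K} -> K^o} := flift (fun=> 1 : K^o).
  have ve w : v w = (e w : K) *: x.
    apply: (fsupp_ind (P := fun w => v w = (e w : K) *: x) _ _ _ (fsuppT w)).
    - by rewrite !linear0 scale0r.
    - by move=> a y z ey ez; rewrite !linearP ey ez /= scalerDl scalerA.
    by move=> s _; rewrite !fliftU scale1r.
  have [p d|Phi [PhiU PhiB]] := @functional_factor2 K ({freeg unit / K} * {freeg 'I_N / K})%type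
      (ch r.+1) (ch r) (pair_sum v u) (bd \o onto_chains R K r.+1 A) (pair_sum e \0) \0.
    rewrite /= /pair_sum /= !addr0 => E; apply/eqP/negPn/negP => e0; apply: nx.
    exists (- (e p.1 : K)^-1 *: p.2), (- (e p.1 : K)^-1 *: onto_chains R K r.+1 A d).
      by apply: rpredZ; exact: onto_chains_in.
    rewrite !linearZ /= -scalerDr; move: E; rewrite ve -addrA => /eqP; rewrite addr_eq0 => /eqP E.
    by rewrite -[u _ + _]opprK -E scalerN scaleNr opprK scalerA mulVf ?scale1r.
  have PA : cocycle_on A Phi by move=> d dA; rewrite -(onto_chains_id dA) PhiB.
  have P0 : Phi x = 0.
    apply: (lP Phi PA) => // c /(nthP 0) [i il <-].
    have := PhiU (0, << Ordinal il >>); rewrite /= /pair_sum /= !linear0 add0r fliftU => ->.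
    by rewrite addr0.
  have := PhiU (<< tt >>, 0); rewrite /= /pair_sum /= !linear0 !addr0 !fliftU P0 => /eqP.
  by rewrite eq_sym oner_eq0.
exists N => x xP.
have /choice[w wP] i : exists w, exists2 d, d \in chain_in A & x i = u w + bd d.
  by have [xA x0] := xP i; exact: span.
have /choice[d dP] i : exists d, d \in chain_in A /\ x i = u (w i) + bd d.
  by have [d dA E] := wP i; exists d.
pose Mx : 'M[K]_(N.+1, N) := \matrix_(i, j) coeff j (w i).
have : kermx Mx != 0.
  by rewrite kermx_eq0 /row_free neq_ltn ltnS rank_leq_col.
move=> /rowV0Pn[v /sub_kermxP vM v0].
exists (fun i => v 0 i).
  by apply: contrapT => na; case/eqP: v0; apply/rowP => i; rewrite mxE; apply/eqP/negPn/negP => vi; apply: na; exists i.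
exists (\sum_i v 0 i *: d i); split; first by apply: rpred_sum => i _; apply: rpredZ; exact: (dP i).1.
have -> : \sum_i v 0 i *: x i = u (\sum_i v 0 i *: w i) + bd (\sum_i v 0 i *: d i).
  by rewrite !linear_sum -big_split; apply: eq_bigr => i _; rewrite (dP i).2 scalerDr !linearZ.
rewrite (_ : \sum_i v 0 i *: w i = 0) ?linear0 ?add0r ?subrr ?rpred0 //.
apply/eqP/freeg_eqP => j; rewrite coeff0 raddf_sum /=.
have /rowP/(_ j) := vM; rewrite !mxE => e0; rewrite -[RHS]e0; apply: eq_bigr => i _.
by rewrite coeffZ mxE.
Qed.

End FiniteHomology.
Lemma homotopy_cycle (R : realType) (K : comNzRingType) (Z Y : topologicalType) (S : set Y)
    (h : Z * R -> Y) k (c : chain R K k Z) (g0 g1 : Z -> Y) :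
  {within setT `*` `[0, 1], continuous h} -> cyc set0 c ->
  (forall z t, 0 <= t <= 1 -> S (h (z, t))) ->
  (forall z, h (z, 0) = g0 z) -> (forall z, h (z, 1) = g1 z) ->
  nullc S set0 (fpush g1 c - fpush g0 c).
Proof.
move=> ch c0 hS h0 h1; have := homotopy_null ch (chain_inT c) c0 (fun z t _ => hS z t)
  (fun z t (e : set0 z) _ => match e return set0 (h (z, t)) with end).
have -> : (fun x => h (x, 1)) = g1 by apply/funext.
by have -> : (fun x => h (x, 0)) = g0 by apply/funext.
Qed.

(** * Transition maps and critical levels *)

Section Transitions.
Variables (R : realType) (n : nat) (M : topologicalType) (f : M -> circle R).
Hypothesis hM : closed_manifold R n M.
Variable B : set (circle R).
Hypotheses (cf : continuous f) (fib : fibration_over R f B).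
Local Notation tau := (pi *+ 2 : R).
Local Notation L a b := (levels f (cci a b)).
Local Notation Lo a b := (levels f (ooi a b)).
Local Notation F p := (fiber f p).
Variable K : comNzRingType.

(** From the level where [transition] stops lifting, the retraction homotopy may leave the arc. The
    lift is therefore continued to a level so close to v that the homotopy stays within eps of v. *)
Lemma transition_homologous p u v (phi : F p -> F v) a b eps k (c : chain R K k (F p)) :
  transition u phi -> (forall t, 0 <= t < 1 -> B (angle (u + t * (v - u)))) ->
  a <= u <= b -> 0 < eps -> a <= v - eps -> v + eps <= b -> cyc set0 c ->
  nullc (L a b) set0 (fpush set_val c - fpush (set_val \o phi) c).
Proof.
move=> [s [H [V [h [s01 [cH HP] hV VF phiE]]]]] reg aub e0 ave vbe c0.
have [[oV FV] hc h0 h1 hA] := hV.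
have FW : F v `<=` Lo (v - eps) (v + eps) by move=> x Fx; exists v => //; rewrite /ooi /=; lra.
have [G [oG FG GV GW]] := nbhd_retraction_tube hV (open_ooi cf (v - eps) (v + eps)) FW.
have [d d0 dG] := tube hM cf oG FG.
have sec t : 0 <= t <= 1 -> a <= u + t * (v - u) <= b.
  by move: aub => /andP[? ?] /andP[? ?]; apply/andP; split; nra.
have LS' : Lo (v - eps) (v + eps) `<=` L a b by apply: levelsS => t; rewrite /ooi /cci /=; lra.
have [s' [ss' s'1 s'd]] : exists s', [/\ s < s', s' < 1 & v - d <= u + s' * (v - u) <= v + d].
  pose w := `|v - u| + 1; have w1 : `|v - u| <= w - 1 by rewrite /w addrK.
  have w0 : 1 <= w by rewrite /w lerDr.
  pose r := Num.min ((1 - s) / 2) (d / w).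
  have r0 : 0 < r by rewrite /r lt_min divr_gt0 ?divr_gt0 //; lra.
  have r1 : r <= (1 - s) / 2 by rewrite /r ge_min lexx.
  have r2 : r * w <= d by rewrite -ler_pdivlMr ?(lt_le_trans _ w0) // /r ge_min lexx orbT.
  exists (1 - r); split; [lra | lra |].
  have : `|r * (v - u)| <= d by rewrite normrM (gtr0_norm r0); nra.
  by rewrite ler_norml; lra.
have ts t : 0 <= t <= 1 -> s <= s + t * (s' - s) <= s'.
  by move=> /andP[? ?]; apply/andP; split; nra.
have st t : 0 <= t <= 1 -> 0 <= s * t <= s.
  by move: s01 => /andP[? ?] /andP[? ?]; apply/andP; split; nra.
pose Z := F p; pose Hs (z : Z) := H (set_val z, s).
have cval : continuous (set_val : Z -> M) by exact: initial_continuous.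
have cHs : continuous Hs.
  apply: (@within_comp Z (M * R)%type M (F p `*` `[0, s]) (fun z => (set_val z, s)) H _ _ cH).
    exact: (continuous_pair cval (@cst_continuous Z R s)).
  by move=> z; split; [exact: set_valP | rewrite /= in_itv /=; lra].
pose kk (y : Z * R) : circle R := angle (u + (s + y.2 * (s' - s)) * (v - u)).
have [|||z|Gf cG [G0 G1]] := @fib Z Hs kk => //.
- apply: continuous_subspaceT => y.
  apply: (@continuous_comp _ _ _ (fun y : Z * R => u + (s + y.2 * (s' - s)) * (v - u)) (@angle R)); last exact: continuous_angle.
  apply: cvgD; first exact: cvg_cst.
  apply: cvgM; last exact: cvg_cst.
  apply: cvgD; first exact: cvg_cst.
  by apply: cvgM; [exact: cvg_snd | exact: cvg_cst].
- by move=> z t /ts t01; apply: reg; rewrite /=; lra.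
- have [_ ->] := HP _ (set_valP z); last lra.
  by rewrite /kk /= mul0r addr0.
have GfV z t : 0 <= t <= 1 -> V (Gf (z, t)).
  move=> t01; apply: (VF (s + t * (s' - s))); last exact: G1.
  by have := ts t t01; lra.
have Gf1 z : G (Gf (z, 1)).
  apply: dG; exists (u + s' * (v - u)) => //; rewrite G1 ?ler01 ?lexx // /kk /=.
  by congr angle; ring.
have i01 : ((0 : R) <= 1) && ((1 : R) <= 1) by rewrite ler01 lexx.
(* Four homotopies: along H, along its continuation, along the retracted continuation, which stays
   in F v, and along the retraction homotopy at its end. *)
have e1 : nullc (L a b) set0 (fpush Hs c - fpush set_val c).
  apply: (@homotopy_cycle R K Z M _ (H \o (fun y : Z * R => (set_val y.1, s * y.2)))) => //.
  - apply: (within_comp2 (C := F p `*` `[0, s])) cH.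
      apply: continuous_subspaceT; apply: continuous_pair.
        by move=> y; apply: continuous_comp; [exact: cvg_fst | exact: cval].
      by move=> y; apply: cvgM; [exact: cvg_cst | exact: cvg_snd].
    move=> y [_]; rewrite /= in_itv /= => /andP[y0 y1]; split; first exact: set_valP.
    by rewrite /= in_itv /=; move: s01 => /andP[? ?]; apply/andP; split; nra.
  - move=> z t t01; have [_ h2] := HP _ (set_valP z).
    exists (u + (s * t) * (v - u)); first by apply: sec; have := st t t01; lra.
    by apply: h2; exact: st.
  - by move=> z /=; rewrite mulr0; have [] := HP _ (set_valP z).
  by move=> z /=; rewrite mulr1.
have e2 : nullc (L a b) set0 (fpush (fun z => Gf (z, 1)) c - fpush Hs c).
  apply: (@homotopy_cycle R K Z M _ Gf) => // z t t01.
  exists (u + (s + t * (s' - s)) * (v - u)); last exact: G1.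
  by apply: sec; have := ts t t01; lra.
have e3 : nullc (L a b) set0 (fpush (fun z => h (Gf (z, 1), 1)) c - fpush (fun z => h (Hs z, 1)) c).
  apply: (@homotopy_cycle R K Z M _ ((fun x => h (x, 1)) \o Gf)) => //.
  - apply: (within_comp2 cG) (nbhd_retraction_at hV i01) => -[z t] [_].
    by rewrite /= in_itv /= => t01; exact: GfV.
  - move=> z t t01; apply: LS'; apply: FW; apply: h1; exact: GfV.
  by move=> z /=; rewrite G0.
have e4 : nullc (L a b) set0 (fpush (fun z => h (Gf (z, 1), 1)) c - fpush (fun z => Gf (z, 1)) c).
  apply: (@homotopy_cycle R K Z M _ (h \o (fun y : Z * R => (Gf (y.1, 1), y.2)))) => //.
  - apply: (@within_comp2 (Z * R)%type (M * R)%type M (setT `*` `[0, 1]) (V `*` `[0, 1])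
      (fun y : Z * R => (Gf (y.1, 1), y.2)) h _ _ hc).
      apply: continuous_subspaceT; apply: continuous_pair; last by move=> y; exact: cvg_snd.
      have cG1 : continuous (fun z : Z => Gf (z, 1)).
        apply: (@within_comp Z (Z * R)%type M (setT `*` `[0, 1]) (fun z => (z, 1)) Gf _ _ cG).
          exact: (continuous_pair (fun z => @cvg_id _ (nbhs z)) (@cst_continuous Z R 1)).
        by move=> z; split=> //=; rewrite in_itv.
      by move=> y; apply: (@continuous_comp _ _ _ fst (fun z : Z => Gf (z, 1))); [exact: cvg_fst | exact: cG1].
    by move=> y [_ y1]; split=> //; exact: GfV.
  - by move=> z t t01; apply: LS'; apply: GW.
  by move=> z; rewrite /= h0 //; exact: GfV.
have phiE' : set_val \o phi = fun z => h (Hs z, 1) by apply/funext => z; exact: phiE.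
rewrite phiE'; have := nullcN (nullcD (nullcB e4 e3) (nullcD e1 e2)).
rewrite (_ : - _ = fpush set_val c - fpush (fun z => h (Hs z, 1)) c) //; zmod.
Qed.

Section Triple.
Variables (t v w s : R) (phi : continuousType (F t) (F v)) (psi : continuousType (F s) (F v)).
Hypotheses (tv : t < v) (vw : v < w) (wt : w <= t + tau) (sw : angle s = angle w).
Hypotheses (trphi : transition t phi) (trpsi : transition w psi).
Hypotheses (reg1 : forall x, t <= x < v -> B (angle x)) (reg2 : forall x, v < x <= w -> B (angle x)).
Hypothesis ndr : nbhd_deformation_retract R (F v).

Let q := (v + w) / 2.
Let cpush (A C : set M) (g : continuousType A C) k (c : chain R K k A) :
  fpush (set_val \o g) c = fpush set_val (fpush g c).
Proof.
have cg : {within setT, continuous (g : A -> C)} by apply: continuous_subspaceT; exact: cts_fun.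
have cv : {within setT, continuous (set_val : C -> M)} by apply: continuous_subspaceT; exact: continuous_val.
by rewrite (fpush_comp cg (fun _ _ => Logic.I) cv) ?chain_inT.
Qed.

(* The relation alpha x = beta y is the relation of being homologous across the
   critical level v. *)
Lemma transition_relation k (x : chain R K k (F t)) (y : chain R K k (F s)) (z : chain R K k M) :
  cyc set0 x -> cyc set0 y -> z \in chain_in (F q) ->
  nullc (L q w) set0 (fpush set_val y - z) ->
  nullc setT set0 (fpush phi x - fpush psi y) <-> nullc (L t q) set0 (fpush set_val x - z).
Proof.
move=> x0 y0 zF yz; have tv' := tv; have vw' := vw; have wt' := wt.
have qv : v < q < w by rewrite /q; lra.
pose e := Num.min (v - t) (q - v) / 2.
have e0 : 0 < e by rewrite /e divr_gt0 // lt_min; lra.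
have e1 : e <= (v - t) / 2 by rewrite /e ler_pM2r ?invr_gt0 // ge_min lexx.
have e2 : e <= (q - v) / 2 by rewrite /e ler_pM2r ?invr_gt0 // ge_min lexx orbT.
clearbody e.
have hx : nullc (L t q) set0 (fpush set_val x - fpush set_val (fpush phi x)).
  rewrite -cpush; apply: (transition_homologous (eps := e) trphi) => //; [|lra..].
  by move=> r /andP[r0 r1]; apply: reg1; apply/andP; split; nra.
have hy : nullc (L (v - e) w) set0 (fpush set_val y - fpush set_val (fpush psi y)).
  rewrite -cpush; apply: (transition_homologous (eps := e) trpsi) => //; [|lra..].
  by move=> r /andP[r0 r1]; apply: reg2; apply/andP; split; nra.
have zL a b : a <= q <= b -> z \in chain_in (L a b) by move=> ?; apply: chain_inS zF; exact: FL.
have psiL a b : a <= v <= b -> fpush set_val (fpush psi y) \in chain_in (L a b).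
  by move=> ?; apply: chain_inS (val_chain_in _); exact: FL.
have hz : nullc (L t q) set0 (fpush set_val (fpush psi y) - z).
  apply: (nullcS (A := L (v - e) q) (B := set0)) => //; first by apply: LS; lra.
  apply: (nullc_restrict (A := L (v - e) w)).
  - move=> d; apply: (@compress_top R K M f B cf fib (v - e) w ((v + q) / 2) q); [lra | lra | lra | lra |].
    by move=> r ?; apply: reg2; lra.
  - by rewrite rpredB //; [apply: psiL | apply: zL]; lra.
  apply: nullc_trans (nullc_sym hy) _.
  by apply: nullcS yz => //; apply: LS; lra.
split=> h.
  apply: nullc_trans hx (nullc_trans _ hz).
  have cval : {within setT, continuous (set_val : F v -> M)}.
    by apply: continuous_subspaceT; exact: initial_continuous.
  have [d [_ /chain_in0 /subr0_eq E]] := h.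
  exists (fpush set_val d); split.
    by apply: chain_inS (val_chain_in _); apply: FL; lra.
  by rewrite bd_val -E linearB subrr rpred0.
(* Conversely the null homology over [t, q] is compressed into the neighborhood of F v that retracts
   to F v. *)
have h' : nullc (L t q) set0 (fpush set_val (fpush phi x - fpush psi y)).
  rewrite linearB; apply: nullc_trans (nullc_sym hx) _.
  by apply: nullc_trans h _; exact: nullc_sym.
have [U [hh hU]] := ndr; have [[oU FU] _ _ _ _] := hU.
have [d d0 dU] := tube hM cf oU FU.
pose d' := Num.min d e.
have d'0 : 0 < d' by rewrite lt_min d0.
have d'd : d' <= d by rewrite ge_min lexx.
have d'e : d' <= e by rewrite ge_min lexx orbT.
clearbody d'.
set u := fpush phi x - fpush psi y in h' *.
have uL a b : a <= v <= b -> fpush set_val u \in chain_in (L a b).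
  by move=> ?; apply: chain_inS (val_chain_in _); exact: FL.
have hU' : nullc U set0 (fpush set_val u).
  apply: (nullcS (A := L (v - d') (v + d')) (B := set0)) => //.
    by apply: subset_trans dU; apply: LS; lra.
  apply: (nullc_restrict (A := L (v - d') q)) (uL _ _ _) _; [|lra|].
    move=> c; apply: (@compress_top R K M f B cf fib (v - d') q (v + d' / 2) (v + d')); [lra | lra | lra | lra |].
    by move=> r ?; apply: reg2; lra.
  apply: (nullc_restrict (A := L t q)) (uL _ _ _) _; [|lra|by []].
  move=> c; apply: (@compress_bot R K M f B cf fib t q (v - d') (v - d' / 2)); [lra | lra | lra | lra |].
  by move=> r ?; apply: reg1; lra.
have [c [cF /chain_in0 /subr0_eq uc]] := retract_null hU (val_chain_in _) hU'.
exists (@corestrict R K M (F v) k.+1 c); split; first exact: chain_inT.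
by rewrite bd_restrict // -uc restrict_val subrr rpred0.
Qed.

End Triple.
End Transitions.
(** * Linear algebra of walks and bars *)

Section FiniteDimension.
Variable K : fieldType.
Implicit Types W U : lmodType K.

(** Dimension at most N; homology is only an [lmodType], without a chosen basis. *)
Definition bounded W (N : nat) : Prop := forall v : 'I_N.+1 -> W,
  exists2 a : 'I_N.+1 -> K, (exists i, a i != 0) & \sum_i a i *: v i = 0.

Definition independent W d (e : 'I_d -> W) : Prop :=
  forall a : 'I_d -> K, \sum_i a i *: e i = 0 -> forall i, a i = 0.

Definition spanning W d (e : 'I_d -> W) : Prop :=
  forall x, exists a : 'I_d -> K, x = \sum_i a i *: e i.

Lemma independent_spanning W N (e : 'I_N -> W) : bounded W N -> independent e -> spanning e.
Proof.
move=> bW ie x; pose v i : W := if unlift ord0 i is Some j then e j else x.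
have [a [i ai]] := bW v; rewrite big_ord_recl {1}/v unlift_none.
under eq_bigr do rewrite /v liftK; move=> E.
have a0 : a ord0 != 0.
  apply/eqP => a0; move: E; rewrite a0 scale0r add0r => /ie h; case/eqP: ai.
  by case: (unliftP ord0 i) => [j|] ->; [exact: h | exact: a0].
exists (fun j => - (a ord0)^-1 * a (lift ord0 j)).
under eq_bigr do rewrite -scalerA; rewrite -scaler_sumr scaleNr -scalerN.
by move/eqP: E; rewrite addr_eq0 => /eqP <-; rewrite scalerA mulVf // scale1r.
Qed.

Lemma basis_ex W N : bounded W N ->
  exists d, (d <= N)%N /\ exists e : 'I_d -> W, independent e /\ spanning e.
Proof.
elim: N => [|N IH] bW.
  exists 0%N; split=> //; exists (fun=> 0); split=> [a _ []//|x].
  exists (fun=> 0); rewrite big_ord0; have [a [i ai]] := bW (fun=> x).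
  rewrite big_ord1 => /eqP; rewrite scaler_eq0 => /orP[a0|/eqP //].
  by move: ai; rewrite (ord1 i) a0.
have [[e ie]|nf] := pselect (exists e : 'I_N.+1 -> W, independent e).
  by exists N.+1; split=> //; exists e; split=> //; exact: independent_spanning.
have [|d [dN de]] := IH; last by exists d; split=> //; exact: leqW.
move=> v; apply: contrapT => h; apply: nf; exists v => a a0 i; apply/eqP/negPn/negP => ai.
by apply: h; exists a => //; exists i.
Qed.

Lemma bounded_inj W U (u : {linear W -> U}) N : injective u -> bounded U N -> bounded W N.
Proof.
move=> iu bU v; have [a an a0] := bU (u \o v); exists a => //.
by apply: iu; rewrite linear0 -[RHS]a0 linear_sum; apply: eq_bigr => i _; rewrite linearZ.
Qed.

Definition subspace W (A : set W) : Prop :=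
  A 0 /\ forall a x y, A x -> A y -> A (a *: x + y).

Lemma subspaceZ W (A : set W) a x : subspace A -> A x -> A (a *: x).
Proof. by move=> [A0 AP] Ax; rewrite -[_ *: _]addr0; exact: AP. Qed.

Lemma subspaceB W (A : set W) x y : subspace A -> A x -> A y -> A (x - y).
Proof. by move=> [A0 AP] Ax Ay; rewrite addrC -scaleN1r; exact: AP. Qed.

Lemma subspaceD W (A : set W) x y : subspace A -> A x -> A y -> A (x + y).
Proof. by move=> [A0 AP] Ax Ay; rewrite -[x]scale1r; exact: AP. Qed.

Lemma subspace_sum W (A : set W) (I : Type) (r : seq I) (a : I -> K) (v : I -> W) :
  subspace A -> (forall i, A (v i)) -> A (\sum_(i <- r) a i *: v i).
Proof.
move=> sA Av; elim: r => [|i r IH]; first by rewrite big_nil; exact: sA.1.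
by rewrite big_cons; apply: sA.2.
Qed.

(** [functional_factor] applied to the quotient by A. *)
Lemma functional_kill W U (u : {linear U -> W}) (l : {linear U -> K^o}) (A : set W) :
  subspace A -> (forall x, A (u x) -> l x = 0) ->
  exists m : {linear W -> K^o}, (forall x, m (u x) = l x) /\ forall y, A y -> m y = 0.
Proof.
move=> [A0 AP] h; pose Ap : {pred W} := fun x => `[< A x >].
have cA : submod_closed Ap.
  split; first exact/asboolP.
  by move=> a x y /asboolP Ax /asboolP Ay; apply/asboolP; exact: AP.
have pi0 y : lquot_pi cA y = 0 <-> A y.
  have E : 0 = lquot_pi cA 0 by rewrite linear0.
  by rewrite E lquot_eqP subr0; split=> /asboolP.
have [|m mP] := @functional_factor K U (lquot cA) (lquot_pi cA \o u) l.
  by move=> x /pi0; exact: h.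
exists (m \o lquot_pi cA); split=> [x|y Ay]; first exact: mP.
by rewrite /= (pi0 y).2 // linear0.
Qed.

Lemma functional_separate W (A : set W) x : subspace A -> ~ A x ->
  exists m : {linear W -> K^o}, m x = 1 /\ forall y, A y -> m y = 0.
Proof.
move=> sA nx; pose u : {linear {freeg unit / K} -> W} := flift (fun=> x).
pose e : {linear {freeg unit / K} -> K^o} := flift (fun=> 1 : K^o).
have ue w : u w = (e w : K) *: x.
  apply: (fsupp_ind (P := fun w => u w = (e w : K) *: x) _ _ _ (fsuppT w)).
  - by rewrite !linear0 scale0r.
  - by move=> a y z ey ez; rewrite !linearP ey ez /= scalerDl scalerA.
  by move=> s _; rewrite !fliftU scale1r.
have [w Aw|m [mu mA]] := @functional_kill W _ u e A sA.
  apply/eqP/negPn/negP => e0; apply: nx; rewrite -[x]scale1r -(mulVf e0) -scalerA -ue.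
  exact: subspaceZ.
by exists m; split=> //; have := mu << tt >>; rewrite !fliftU.
Qed.

(** The dimension of A modulo C through representatives, which avoids forming a quotient. *)
Definition gr_dim W (A C : set W) (c : nat) : Prop := exists e : 'I_c -> W,
  [/\ forall i, A (e i),
      forall x, A x -> exists a : 'I_c -> K, C (x - \sum_i a i *: e i) &
      forall a : 'I_c -> K, C (\sum_i a i *: e i) -> forall i, a i = 0].

Lemma gr_dim0 W (A C : set W) : C 0 -> A `<=` C -> gr_dim A C 0.
Proof.
move=> C0 AC; exists (fun=> 0); split=> [[]//|x Ax|a _ []//].
by exists (fun=> 0); rewrite big_ord0 subr0; exact: AC.
Qed.

Lemma gr_dim_iso W U (A C : set W) (A' C' : set U) (u : {linear W -> U}) c : bijective u ->
  (forall x, A x <-> A' (u x)) -> (forall x, C x <-> C' (u x)) ->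
  gr_dim A C c -> gr_dim A' C' c.
Proof.
move=> [g ug gu] AA CC [e [eA es ei]]; exists (u \o e); split.
- by move=> i; apply/AA.
- move=> y Ay; have [|a ha] := es (g y); first by apply/AA; rewrite gu.
  exists a; move/CC: ha; rewrite linearB linear_sum gu; congr (C' (_ - _)).
  by apply: eq_bigr => i _; rewrite linearZ.
move=> a ha; apply: ei; apply/CC; rewrite linear_sum; congr (C' _): ha.
by apply: eq_bigr => i _; rewrite linearZ.
Qed.

Lemma gr_dim_prod W U (A C : set W) (A' C' : set U) c c' :
  gr_dim A C c -> gr_dim A' C' c' -> A 0 -> A' 0 ->
  gr_dim [set x : W * U | A x.1 /\ A' x.2] [set x : W * U | C x.1 /\ C' x.2] (c + c').
Proof.
move=> [e [eA es ei]] [e' [eA' es' ei']] A0 A'0.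
pose E (i : 'I_(c + c')) : W * U := match fintype.split i with inl j => (e j, 0) | inr j => (0, e' j) end.
have ES (a : 'I_(c + c') -> K) : \sum_i a i *: E i =
    (\sum_i a (lshift c' i) *: e i, \sum_i a (rshift c i) *: e' i).
  rewrite big_split_ord /=.
  under eq_bigr => i _ do rewrite /E (unsplitK (inl i)).
  under [X in _ + X]eq_bigr => i _ do rewrite /E (unsplitK (inr i)).
  have fstE (I : finType) (F : I -> W * U) : (\sum_i F i).1 = \sum_i (F i).1.
    by elim/big_rec2: _ => // i y z _ <-.
  have sndE (I : finType) (F : I -> W * U) : (\sum_i F i).2 = \sum_i (F i).2.
    by elim/big_rec2: _ => // i y z _ <-.
  apply/pair_equal_spec; rewrite /= !fstE !sndE /=; split.
    by rewrite [X in _ + X]big1 ?addr0 // => i _; rewrite scaler0.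
  by rewrite [X in X + _]big1 ?add0r // => i _; rewrite scaler0.
exists E; split.
- by move=> i; rewrite /E; case: (fintype.split i) => j /=; split=> //.
- move=> [x y] [/= /es[a ha] /es'[a' ha']].
  exists (fun i => match fintype.split i with inl j => a j | inr j => a' j end); rewrite ES.
  split=> /=; [move: ha | move: ha']; congr (_ (_ - _)); apply: eq_bigr => i _.
    by rewrite (unsplitK (inl i)).
  by rewrite (unsplitK (inr i)).
move=> a; rewrite ES => -[/= /ei h /ei' h'] i.
by case: (split_ordP i) => j ->; [exact: h | exact: h'].
Qed.

Lemma kernel_bound c c' (P : 'M[K]_(c, c')) :
  (forall a : 'I_c -> K, (forall j, \sum_i a i * P i j = 0) -> forall i, a i = 0) -> (c <= c')%N.
Proof.
move=> h; suff : row_free P by move=> /eqP <-; exact: rank_leq_col.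
rewrite -kermx_eq0; apply/rowV0P => v /sub_kermxP vP; apply/rowP => i.
rewrite mxE; apply: (h (fun i => v 0 i)) => j.
by have /rowP/(_ j) := vP; rewrite !mxE.
Qed.

Section Pairing.
Variables (W W' : lmodType K) (b : W -> W' -> K).
Hypothesis bl : forall a x y z, b (a *: x + y) z = a * b x z + b y z.
Hypothesis br : forall a x y z, b x (a *: y + z) = a * b x y + b x z.

Lemma pairing0l z : b 0 z = 0.
Proof. by have := bl 1 0 0 z; rewrite scaler0 addr0 mul1r -{1}[b 0 z]addr0 => /addrI. Qed.

Lemma pairing0r x : b x 0 = 0.
Proof. by have := br 1 x 0 0; rewrite scaler0 addr0 mul1r -{1}[b x 0]addr0 => /addrI. Qed.

Lemma pairing_suml c (a : 'I_c -> K) (e : 'I_c -> W) z :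
  b (\sum_i a i *: e i) z = \sum_i a i * b (e i) z.
Proof.
elim: c a e => [|c IH] a e; first by rewrite !big_ord0 pairing0l.
by rewrite !big_ord_recl bl IH.
Qed.

Lemma pairing_sumr c (a : 'I_c -> K) (e : 'I_c -> W') x :
  b x (\sum_i a i *: e i) = \sum_i a i * b x (e i).
Proof.
elim: c a e => [|c IH] a e; first by rewrite !big_ord0 pairing0r.
by rewrite !big_ord_recl br IH.
Qed.

(** The pairing induced on A modulo C and A' modulo C' has no kernel on either side, so neither the
    matrix of its values on representatives nor the transpose has one. *)
Lemma gr_dim_pairing (A C : set W) (A' C' : set W') c c' : subspace A -> subspace A' ->
  (forall x x', C x -> A' x' -> b x x' = 0) -> (forall x x', A x -> C' x' -> b x x' = 0) ->
  (forall x, A x -> (forall x', A' x' -> b x x' = 0) -> C x) ->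
  (forall x', A' x' -> (forall x, A x -> b x x' = 0) -> C' x') ->
  gr_dim A C c -> gr_dim A' C' c' -> c = c'.
Proof.
move=> sA sA' h1 h2 h3 h4 [e [eA es ei]] [e' [eA' es' ei']].
apply/eqP; rewrite eqn_leq; apply/andP; split.
  apply: (@kernel_bound _ _ (\matrix_(i, j) b (e i) (e' j))) => a a0; apply: ei; apply: h3.
    exact: subspace_sum.
  move=> x' /es'[a' ha']; set y := \sum_i a' i *: e' i in ha'.
  have -> : x' = 1 *: (x' - y) + y by rewrite scale1r subrK.
  rewrite br mul1r (h2 _ _ _ ha') ?add0r; last exact: subspace_sum.
  rewrite pairing_sumr big1 // => j _; rewrite pairing_suml.
  by have := a0 j; under eq_bigr do rewrite mxE; move=> ->; rewrite mulr0.
apply: (@kernel_bound _ _ (\matrix_(i, j) b (e j) (e' i))) => a a0; apply: ei'; apply: h4.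
  exact: subspace_sum.
move=> x /es[a' ha']; set y := \sum_i a' i *: e i in ha'.
have -> : x = 1 *: (x - y) + y by rewrite scale1r subrK.
rewrite bl mul1r (h1 _ _ ha') ?add0r; last exact: subspace_sum.
rewrite pairing_suml big1 // => j _; rewrite pairing_sumr.
by have := a0 j; under eq_bigr do rewrite mxE; move=> ->; rewrite mulr0.
Qed.

End Pairing.

(** Each pairing is nondegenerate in its second argument. Together they bound each dimension by the
    other, and then [b] is perfect. *)
Lemma pairing_functional (W W' : lmodType K) (b : W -> W' -> K) (b' : W' -> W -> K) N N' :
  (forall a x y z, b (a *: x + y) z = a * b x z + b y z) ->
  (forall a x y z, b x (a *: y + z) = a * b x y + b x z) ->
  (forall a x y z, b' (a *: x + y) z = a * b' x z + b' y z) ->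
  (forall a x y z, b' x (a *: y + z) = a * b' x y + b' x z) ->
  bounded W N -> bounded W' N' ->
  (forall x', (forall x, b x x' = 0) -> x' = 0) -> (forall x, (forall x', b' x' x = 0) -> x = 0) ->
  forall g : {linear W -> K^o}, exists x', forall x, g x = b x x'.
Proof.
move=> bl br bl' br' /basis_ex[d [_ [e [ie se]]]] /basis_ex[d' [_ [e' [ie' se']]]] nd nd' g.
pose P := \matrix_(i, j) b (e j) (e' i) : 'M[K]_(d', d).
have P0 (a : 'I_d' -> K) : (forall j, \sum_i a i * P i j = 0) -> forall i, a i = 0.
  move=> h; apply: ie'; apply: nd => x; have [c ->] := se x.
  rewrite (@pairing_suml W W' b bl) big1 // => j _; rewrite (@pairing_sumr W W' b br).
  by have := h j; under eq_bigr do rewrite mxE; move=> ->; rewrite mulr0.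
have dd' : (d' <= d)%N := kernel_bound P0.
have dd : (d <= d')%N.
  apply: (@kernel_bound _ _ (\matrix_(i, j) b' (e' j) (e i))) => a h; apply: ie; apply: nd' => x.
  have [c ->] := se' x; rewrite (@pairing_suml W' W b' bl') big1 // => j _; rewrite (@pairing_sumr W' W b' br').
  by have := h j; under eq_bigr do rewrite mxE; move=> ->; rewrite mulr0.
have full : row_full P.
  have : row_free P.
    rewrite -kermx_eq0; apply/rowV0P => v /sub_kermxP vP; apply/rowP => i.
    by rewrite mxE; apply: (P0 (fun i => v 0 i)) => j; have /rowP/(_ j) := vP; rewrite !mxE.
  by rewrite /row_free /row_full => /eqP ->; rewrite eqn_leq dd dd'.
have /submxP[c cE] := submx_full (\row_j (g (e j) : K)) full.
exists (\sum_i c 0 i *: e' i) => x; have [a ->] := se x.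
rewrite linear_sum (@pairing_suml W W' b bl); apply: eq_bigr => j _.
rewrite linearZ /= (@pairing_sumr W W' b br); congr (_ * _).
have /rowP/(_ j) := cE; rewrite !mxE => ->; apply: eq_bigr => i _; by rewrite mxE.
Qed.

End FiniteDimension.

(** * Walks along the relations *)

Section Walks.
Variables (K : fieldType) (m : nat).
Implicit Types (V W : grep K m) (I : barcode).

(* [walk true] is the domain of the l-fold composite of the relations alpha x = beta y, [walk false]
   its kernel. *)
Fixpoint walk V (b : bool) (l : nat) (i : 'I_m) {struct l} : set (odd_space V i) :=
  match l with
  | 0 => fun x => if b then True else x = 0
  | l'.+1 => fun x => exists y, alpha V i x = beta V i y /\ walk b l' y
  end.
Arguments walk : clear implicits.

Lemma walk_subspace V b l i : subspace (walk V b l i).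
Proof.
elim: l i => [|l IH] i.
  by case: b; split=> //= a x y -> ->; rewrite scaler0 addr0.
split=> [|a x y [x' [ex wx]] [y' [ey wy]]].
  by exists 0; rewrite !linear0; split=> //; case: (IH (ordS i)).
by exists (a *: x' + y'); rewrite !linearP ex ey; split=> //; case: (IH (ordS i)) => _; apply.
Qed.

(* coA / coC has one dimension for each bar [u+1, b) with b - (u+1) <= q, and ocA / ocC one for each
   bar (u+1, b]. *)
Definition coA V q u : set (odd_space V (ordS u)) := walk V false q (ordS u).
Definition coC V q u : set (odd_space V (ordS u)) :=
  fun x => walk V false q (ordS u) x /\ exists y, alpha V u y = beta V u x.
Definition ocA V (u : 'I_m) : set (odd_space V (ordS u)) := fun x => beta V u x = 0.
Definition ocC V q u : set (odd_space V (ordS u)) :=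
  fun x => beta V u x = 0 /\ walk V true q (ordS u) x.
Arguments coA : clear implicits.
Arguments coC : clear implicits.
Arguments ocA : clear implicits.
Arguments ocC : clear implicits.

Definition co_dim V q u c := gr_dim (coA V q u) (coC V q u) c.
Definition oc_dim V q u c := gr_dim (ocA V u) (ocC V q u) c.

Lemma walk_iso_homo V W (p : forall i, {linear odd_space V i -> odd_space W i})
    (q : forall i, {linear even_space V i -> even_space W i}) b l i x :
  (forall i x, q i (alpha V i x) = alpha W i (p i x)) ->
  (forall i x, q i (beta V i x) = beta W i (p (ordS i) x)) ->
  walk V b l i x -> walk W b l i (p i x).
Proof.
move=> qa qb; elim: l i x => [|l IH] i x /=; first by case: b => // ->; rewrite linear0.
move=> [y [exy wy]]; exists (p (ordS i) y); split; last exact: IH.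
by rewrite -qa -qb exy.
Qed.


Lemma linear_inverse (A B : lmodType K) (u : {linear A -> B}) : bijective u ->
  {v : {linear B -> A} | cancel u v /\ cancel v u}.
Proof.
move=> bu; apply: cid; case: bu => v uv vu.
have lv : linear v by move=> a x y; apply: (can_inj uv); rewrite linearP !vu.
pose Lv := GRing.isLinear.Build K B A *:%R v lv.
by exists (HB.pack_for {linear B -> A} v Lv).
Qed.

Lemma grep_iso_sym V W : grep_iso V W -> grep_iso W V.
Proof.
move=> [p [q [bp bq qa qb]]].
exists (fun i => sval (linear_inverse (bp i))), (fun i => sval (linear_inverse (bq i))).
split=> i; try move=> x.
- by case: (linear_inverse (bp i)) => v [pv vp]; exists (p i).
- by case: (linear_inverse (bq i)) => v [pv vp]; exists (q i).
- case: (linear_inverse (bq i)) => v [qv vq]; case: (linear_inverse (bp i)) => w [pw wp] /=.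
  by apply: (can_inj qv); rewrite vq qa wp.
case: (linear_inverse (bq i)) => v [qv vq]; case: (linear_inverse (bp (ordS i))) => w [pw wp] /=.
by apply: (can_inj qv); rewrite vq qb wp.
Qed.

Lemma dims_iso_homo V W (p : forall i, {linear odd_space V i -> odd_space W i})
    (q : forall i, {linear even_space V i -> even_space W i}) l u c c' :
  (forall i, bijective (p i)) -> (forall i, bijective (q i)) ->
  (forall i x, q i (alpha V i x) = alpha W i (p i x)) ->
  (forall i x, q i (beta V i x) = beta W i (p (ordS i) x)) ->
  (co_dim V l u c -> co_dim W l u c) /\ (oc_dim V l u c' -> oc_dim W l u c').
Proof.
move=> bp bq qa qb.
have walkE b n i x : walk V b n i x <-> walk W b n i (p i x).
  split; first exact: walk_iso_homo qa qb.
  pose p' i := sval (linear_inverse (bp i)); pose q' i := sval (linear_inverse (bq i)).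
  have pK j : cancel (p' j) (p j) by rewrite /p'; case: linear_inverse => ? [].
  have pK' j : cancel (p j) (p' j) by rewrite /p'; case: linear_inverse => ? [].
  have qK j : cancel (q j) (q' j) by rewrite /q'; case: linear_inverse => ? [].
  rewrite -{2}(pK' i x); apply: (@walk_iso_homo _ _ p' q') => j y.
    by apply: (can_inj (pK' j)) || (rewrite -{1}(pK j y) -qa qK).
  by rewrite -{1}(pK _ y) -qb qK.
have betaE x : beta V u x = 0 <-> beta W u (p (ordS u) x) = 0.
  rewrite -qb; split=> [-> | h]; first by rewrite linear0.
  by apply: (bij_inj (bq u)); rewrite h linear0.
split; apply: (gr_dim_iso (u := p (ordS u))) => // x; try exact: walkE.
  rewrite /coC -walkE; split=> -[wx [y e]]; split=> //.
    by exists (p u y); rewrite -qa -qb e.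
  have [p' _ pK] := bp u; exists (p' y); apply: (bij_inj (bq u)).
  by rewrite qa pK e qb.
by rewrite /ocC -walkE betaE.
Qed.

Lemma dims_iso V W l u c c' : grep_iso V W ->
  (co_dim V l u c -> co_dim W l u c) /\ (oc_dim V l u c' -> oc_dim W l u c').
Proof. by move=> [p [q [bp bq qa qb]]]; exact: dims_iso_homo qa qb. Qed.

Lemma walk_sum V W b l i x :
  walk (grep_sum V W) b l i x <-> walk V b l i x.1 /\ walk W b l i x.2.
Proof.
elim: l i x => [|l IH] i [x y].
  by case: b => /=; split=> // [[-> ->] | [-> ->]].
rewrite /=; split=> [[[x' y'] [[ex ey] /IH[wx wy]]] | [[x' [ex wx]] [y' [ey wy]]]].
  by split; [exists x' | exists y'].
by exists (x', y'); rewrite IH /pair_map /= ex ey.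
Qed.

Lemma co_dim_sum V W l u c c' :
  co_dim V l u c -> co_dim W l u c' -> co_dim (grep_sum V W) l u (c + c').
Proof.
move=> dV dW; have := gr_dim_prod dV dW (walk_subspace V false l _).1 (walk_subspace W false l _).1.
rewrite /co_dim; congr gr_dim; apply/seteqP; split=> -[x y] /=.
- by rewrite /coA walk_sum.
- by rewrite /coA walk_sum.
- rewrite /coC walk_sum /= => -[[wx [x' ex]] [wy [y' ey]]]; split=> //.
  by exists (x', y'); rewrite /pair_map /= ex ey.
rewrite /coC walk_sum => -[[/= wx wy] [[x' y'] [ex ey]]].
by split; split=> //; [exists x' | exists y'].
Qed.

Lemma oc_dim_sum V W l u c c' :
  oc_dim V l u c -> oc_dim W l u c' -> oc_dim (grep_sum V W) l u (c + c').
Proof.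
move=> dV dW; have := gr_dim_prod dV dW (linear0 _) (linear0 _).
rewrite /oc_dim; congr gr_dim; apply/seteqP; split=> -[x y] /=.
- by rewrite /ocA /= /pair_map /= => -[-> ->].
- by rewrite /ocA /= /pair_map /= => -[-> ->].
- by rewrite /ocC walk_sum /= /pair_map /= => -[[-> wx] [-> wy]].
by rewrite /ocC walk_sum /= /pair_map /= => -[[-> ->] [wx wy]].
Qed.

Lemma co_dim_grep0 l u : co_dim (grep0 K m) l u 0.
Proof.
apply: gr_dim0; first by split; [exact: (walk_subspace _ _ _ _).1 | exists 0; rewrite !linear0].
by move=> x wx; split=> //; exists x.
Qed.

Lemma oc_dim_grep0 l u : oc_dim (grep0 K m) l u 0.
Proof.
apply: gr_dim0; first by split; [exact: linear0 | exact: (walk_subspace _ _ _ _).1].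
by move=> x; rewrite /ocA /= => x0; split=> //; rewrite x0; exact: (walk_subspace _ _ _ _).1.
Qed.

(** All maps of a Jordan block are bijective: nothing lies outside the image of [alpha], and
    likewise nothing nonzero in the kernel of [beta]. *)
Lemma co_dim_jordan J l u : co_dim (jordan_grep m J) l u 0.
Proof.
apply: gr_dim0; first by split; [exact: (walk_subspace _ _ _ _).1 | exists 0; rewrite !linear0].
move=> x wx; split=> //=; case: eqP => _; last by exists x; rewrite id_lfunE.
by have [g gK Kg] := jmap_auto J; exists (g x); rewrite Kg.
Qed.

Lemma oc_dim_jordan J l u : oc_dim (jordan_grep m J) l u 0.
Proof.
apply: gr_dim0; first by split; [exact: linear0 | exact: (walk_subspace _ _ _ _).1].
by move=> x; rewrite /ocA /= => x0; split=> //; rewrite x0; exact: (walk_subspace _ _ _ _).1.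
Qed.

End Walks.
Arguments walk [K m] V b l i _.
Arguments coA [K m] V q u _.
Arguments coC [K m] V q u _.
Arguments ocA [K m] V u _.
Arguments ocC [K m] V q u _.

(** * Walks in a bar code *)

Section BarWalks.
Variables (K : fieldType) (m : nat) (I : barcode).
Hypothesis vI : valid_barcode m I.
Local Notation V := (bar_grep K m I).
Local Notation in_bar r p := (bar_supp I p && (p == r %[mod m.*2]))%N.
Local Notation oddi i := ((nat_of_ord i).*2.+1).
Local Notation eveni i := ((nat_of_ord i).*2.+2).

(** The basis vector e_p as a total function of p, 0 outside the support; [bco] is its
    coordinate. *)
Definition bvec (r p : nat) : bar_space K m I r :=
  if (insub p : option (bar_index m I r)) is Some s then << s >> else 0.

Definition bco (r p : nat) : {linear bar_space K m I r -> K^o} :=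
  free_lift (fun s : bar_index m I r => (val s == p)%:R : K^o).

Lemma bcoU r p (s : bar_index m I r) : bco r p << s >> = (val s == p)%:R.
Proof. exact: free_liftU. Qed.

Lemma bco_out r p x : ~~ in_bar r p -> bco r p x = 0.
Proof.
move=> np; apply: (eq_on_fsupp (F := bco r p) (G := \0)%R) (fsuppT x) => s _.
by rewrite bcoU; case: eqP => // sp; case/negP: np; rewrite -sp; exact: (valP s).
Qed.

Lemma bco_vec r p q : bco r p (bvec r q) = (in_bar r p && (p == q))%:R.
Proof.
rewrite /bvec; case: insubP => [s sb sq|nq].
  by rewrite bcoU -sq eq_sym; case: eqP => [->|]; rewrite ?andbF // andbT (valP s).
by rewrite linear0; case: (eqVneq p q) => [->|]; rewrite ?andbF // (negbTE nq).
Qed.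

Lemma bco_ext r x y : (forall p, in_bar r p -> bco r p x = bco r p y) -> x = y.
Proof.
move=> h; apply/eqP/freeg_eqP => s.
have E z : coeff s z = bco r (val s) z.
  apply: (fsupp_ind (P := fun z => coeff s z = bco r (val s) z) _ _ _ (fsuppT z)).
  - by rewrite linear0 coeff0.
  - by move=> a c d hc hd; rewrite coeffD coeffZ linearP hc hd.
  by move=> t _; rewrite bcoU coeffU mul1r val_eqE.
by rewrite !E; apply: h; exact: (valP s).
Qed.

Lemma bar_map_vec g r r' p : in_bar r p -> bar_map K m I g r r' (bvec r p) = bvec r' (g p).
Proof. by move=> pb; rewrite {1}/bvec insubT; exact: free_liftU. Qed.

Lemma bco_map g r r' p p' x : in_bar r' p' -> (forall s, bar_supp I s -> (g s == p') = (s == p)) ->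
  bco r' p' (bar_map K m I g r r' x) = bco r p x.
Proof.
move=> pb gp; apply: (eq_on_fsupp (F := bco r' p' \o bar_map K m I g r r') (G := bco r p)) (fsuppT x) => s _.
rewrite bcoU -gp; last by case/andP: (valP s).
rewrite -[LHS]/(bco r' p' (bar_map K m I g r r' << s >>)).
have -> : bar_map K m I g r r' << s >> = if insub (g (val s)) is Some t then << t >> else 0 :=
  free_liftU _ _.
case: insubP => [t _ <-|ns]; first exact: bcoU.
by rewrite linear0; case: eqP => // gs; case/negP: ns; rewrite gs.
Qed.

Lemma vI' : [/\ (0 < lend I)%N, (lend I <= m)%N, (lend I <= rend I)%N &
  ~~ (lclosed I && rclosed I) -> (lend I < rend I)%N].
Proof.
by move: vI; rewrite /valid_barcode => /andP[/andP[-> ->]]; case: ifP => //= _ h; split=> //; exact: ltnW.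
Qed.

Lemma modSS a b : (a.+1 == b.+1 %[mod m.*2]) = (a == b %[mod m.*2])%N.
Proof. by rewrite -(addn1 a) -(addn1 b) eqn_modDr. Qed.

Lemma mod_ordS (i : 'I_m) : oddi (ordS i) = (nat_of_ord i).*2.+3 %[mod m.*2].
Proof.
apply/eqP; rewrite modSS /= -(doubleS i) -!muln2 muln_modl modn_mod.
by [].
Qed.

Lemma in_barS (i : 'I_m) p : (p.+2 == oddi (ordS i) %[mod m.*2])%N = (p == oddi i %[mod m.*2])%N.
Proof. by rewrite mod_ordS !modSS. Qed.

Lemma in_bar_odd (i : 'I_m) p : (p == oddi i %[mod m.*2])%N -> odd p.
Proof.
move=> /eqP pE; have m2 : (2 %| m.*2)%N by rewrite -muln2 dvdn_mull.
by rewrite -[odd p]oddb -modn2 -(modn_dvdm p m2) pE modn_dvdm // modn2 /= odd_double.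
Qed.

(** Both [lend I] and [u.+1] lie between 1 and m, where residues modulo m are distinct. *)
Lemma lend_mod (u : 'I_m) : ((lend I).*2 == eveni u %[mod m.*2])%N = (lend I == u.+1).
Proof.
have [l0 lm _ _] := vI'; apply/eqP/eqP => [|->]; last by rewrite doubleS.
have um := ltn_ord u; rewrite -doubleS -!muln2 -!muln_modl => /eqP.
rewrite eqn_pmul2r // => /eqP.
have [lE|lm'] := eqVneq (lend I) m.
  rewrite lE modnn; have [uE _|um'] := eqVneq (u : nat).+1 m; first by rewrite uE.
  by rewrite modn_small // ltn_neqAle um' um.
rewrite modn_small; last by rewrite ltn_neqAle lm' lm.
have [uE|um'] := eqVneq (u : nat).+1 m; first by rewrite {1}uE modnn => l00; move: l0; rewrite l00.
by rewrite modn_small // ltn_neqAle um' um.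
Qed.

Lemma bco_alpha i p x : in_bar (eveni i) p.+1 -> bco (eveni i) p.+1 (alpha V i x) = bco (oddi i) p x.
Proof. by move=> pb; apply: bco_map. Qed.

Lemma bco_beta i p x : in_bar (eveni i) p -> bco (eveni i) p (beta V i x) = bco (oddi (ordS i)) p.+1 x.
Proof.
move=> pb; apply: bco_map => // s /andP[sl _]; have [l0 _ _ _] := vI'.
by case: s sl => [|s] //; rewrite leqn0 addn_eq0 double_eq0; case: (lend I) l0.
Qed.

(** When q steps force the coordinate at p to vanish. At a closed right end a walk is stuck, at an
    open one it continues as 0: a closed end excludes reaching 0, and excludes long walks; an open
    end only delays reaching 0. *)
Definition walk_cond (b : bool) q p := if b then rclosed I && ((rend I).*2 < p + q.*2)%N
  else rclosed I || (p + q.*2 <= (rend I).*2)%N.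

Lemma walk_bco0 b q (i : 'I_m) (x : odd_space V i) p : in_bar (oddi i) p -> walk_cond b q p ->
  walk V b q i x -> bco (oddi i) p x = 0.
Proof.
elim: q i x p => [|q IH] i x p pb pc.
  case: b pc => /=; rewrite /walk_cond; last by move=> _ ->; rewrite linear0.
  by move: pb => /andP[/andP[_ pr] _] /andP[_]; lia.
move=> [y [xy wy]]; have podd := in_bar_odd (andP pb).2.
have pb1 : in_bar (eveni i) p.+1.
  rewrite modSS (andP pb).2 andbT; move: pb => /andP[]; clear IH wy => pb _; move: pb pc podd.
  rewrite /bar_supp /walk_cond; case: b; case: (lclosed I); case: (rclosed I) => /=; lia.
rewrite -bco_alpha // xy bco_beta //.
have [pb2|] := boolP (in_bar (oddi (ordS i)) p.+2); last exact: bco_out.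
apply: (IH _ y) => //; clear IH wy; move: pc; rewrite /walk_cond !doubleS.
by case: b; case: (rclosed I) => //=; lia.
Qed.

Lemma walk_vec b q (i : 'I_m) p : in_bar (oddi i) p -> ~~ walk_cond b q p ->
  walk V b q i (bvec (oddi i) p).
Proof.
elim: q i p => [|q IH] i p pb pc.
  case: b pc => //=; rewrite /walk_cond negb_or -ltnNge => /andP[_].
  by move: pb => /andP[/andP[_ pr] _]; lia.
have podd := in_bar_odd (andP pb).2.
have [pb2|npb2] := boolP (in_bar (oddi (ordS i)) p.+2).
  exists (bvec (oddi (ordS i)) p.+2); split; first by rewrite /= !bar_map_vec.
  apply: IH => //; apply: contra pc; rewrite /walk_cond !doubleS; clear pb pb2 podd.
  by case: b; case: (rclosed I) => //=; lia.
exists 0; split; last exact: (walk_subspace _ _ _ _).1.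
rewrite linear0 /= bar_map_vec // /bvec; case: insubP => // s sb _.
exfalso; move: npb2 sb pb pc; rewrite in_barS => npb2 /andP[sb _] /andP[sp sm].
move: npb2; rewrite sm andbT; clear IH; move: sb sp podd.
rewrite /bar_supp /walk_cond; case: b; case: (lclosed I); case: (rclosed I) => /=; lia.
Qed.

(** Lowering the indices by 2 gives the preimage; this fails only at a closed left end, where [beta]
    hits a vector that [alpha] misses. *)
Lemma lower_beta (u : 'I_m) (x : odd_space V (ordS u)) :
  (lclosed I -> lend I = u.+1 -> bco (oddi (ordS u)) (lend I).*2.+1 x = 0) ->
  exists y, alpha V u y = beta V u x.
Proof.
move=> h; exists (bar_map K m I (subn^~ 2) (oddi (ordS u)) (oddi u) x).
apply: bco_ext => -[|p] pb.
  by have [l0 _ _ _] := vI'; case/andP: pb => /andP[]; rewrite leqn0 addn_eq0 double_eq0; case: (lend I) l0.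
rewrite bco_alpha // bco_beta //; have [pb0|npb0] := boolP (in_bar (oddi u) p).
  apply: bco_map => // s /andP[sl _]; have [l0 _ _ _] := vI'; clear -l0 sl.
  by case: s sl => [|[|s]]; rewrite ?subn2 //=; lia.
rewrite bco_out //; move: npb0 pb; rewrite modSS => npb0 /andP[sp pm].
move: npb0; rewrite pm andbT => npb0.
have lp : lclosed I && (p.+1 == (lend I).*2).
  have podd := in_bar_odd pm; move: npb0 sp podd; rewrite /bar_supp.
  by case: (lclosed I); case: (rclosed I) => /=; lia.
case/andP: lp => lc /eqP lp; rewrite lp h //.
by apply/eqP; rewrite -lend_mod -lp modSS.
Qed.

Lemma lower_beta0 (u : 'I_m) (x : odd_space V (ordS u)) y :
  lclosed I -> lend I = u.+1 -> alpha V u y = beta V u x -> bco (oddi (ordS u)) (lend I).*2.+1 x = 0.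
Proof.
move=> lc lu yx; have [l0 _ lr lr'] := vI'.
have pb : in_bar (eveni u) (lend I).*2.
  rewrite lend_mod lu eqxx andbT /bar_supp -lu; move: lr lr'; rewrite lc; clear.
  by case: (rclosed I) => /=; lia.
rewrite -bco_beta // -yx -(prednK (_ : 0 < (lend I).*2)%N) ?double_gt0 //.
rewrite bco_alpha ?prednK ?double_gt0 // bco_out // /bar_supp lc /=.
by clear -l0; apply/negP; lia.
Qed.

Definition co_bar q u := [&& lclosed I, ~~ rclosed I, lend I == u.+1 & (rend I <= lend I + q)%N].
Definition oc_bar q u := [&& ~~ lclosed I, rclosed I, lend I == u.+1 & (rend I <= lend I + q)%N].

Lemma lend_odd_mod (u : 'I_m) : ((lend I).*2.+1 == oddi (ordS u) %[mod m.*2])%N = (lend I == u.+1).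
Proof. by rewrite mod_ordS modSS lend_mod. Qed.

Lemma sum1E (W : lmodType K) (a : 'I_1 -> K) (e : 'I_1 -> W) : \sum_i a i *: e i = a ord0 *: e ord0.
Proof. exact: big_ord1. Qed.

Lemma co_dim_bar q (u : 'I_m) : co_dim V q u (co_bar q u).
Proof.
have [l0 _ lr lr'] := vI'; pose p := (lend I).*2.+1; pose r1 := oddi (ordS u).
have [/and4P[lc rc /eqP lu rq]|nco] := boolP (co_bar q u).
  have pb : in_bar r1 p.
    rewrite lend_odd_mod lu eqxx andbT /bar_supp; move: lr'; rewrite lc (negbTE rc) /= /p lu; lia.
  have we : walk V false q (ordS u) (bvec r1 p).
    apply: walk_vec => //; rewrite /walk_cond (negbTE rc) /= /p -ltnNge; lia.
  exists (fun=> bvec r1 p); split=> // [x wx|a]; last first.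
    rewrite sum1E => -[_ [y /lower_beta0 h]] i; have := h lc lu.
    rewrite linearZ /= bco_vec pb eqxx /= [_ *: _]mulr1 => a0.
    by rewrite (ord1 i).
  exists (fun=> bco r1 p x); rewrite sum1E.
  have wy : walk V false q (ordS u) (x - (bco r1 p x : K) *: bvec r1 p).
    exact: subspaceB (walk_subspace _ _ _ _) wx (subspaceZ _ (walk_subspace _ _ _ _) we).
  split=> //; apply: lower_beta => _ _.
  by rewrite linearB linearZ /= bco_vec pb eqxx /= [_ *: _]mulr1 subrr.
apply: gr_dim0; first by split; [exact: (walk_subspace _ _ _ _).1 | exists 0; rewrite !linear0].
move=> x wx; split=> //; apply: lower_beta => lc lu.
have [pb|] := boolP (in_bar r1 p); last exact: bco_out.
apply: walk_bco0 pb _ wx; move: nco; rewrite /co_bar /walk_cond lc lu eqxx /= negb_and negbK.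
by rewrite /p lu; case: (rclosed I) => //=; lia.
Qed.

Lemma oc_dim_bar q (u : 'I_m) : oc_dim V q u (oc_bar q u).
Proof.
have [l0 _ lr lr'] := vI'; pose p := (lend I).*2.+1; pose r1 := oddi (ordS u).
(* The kernel of [beta] is spanned by the first vector of a bar with open left end. *)
have xE (x : odd_space V (ordS u)) : beta V u x = 0 ->
    x = if ~~ lclosed I && (lend I == u.+1) then (bco r1 p x : K) *: bvec r1 p else 0.
  move=> x0; apply: bco_ext => t tb.
  have [tp|ntp] := boolP [&& t == p, ~~ lclosed I & lend I == u.+1].
    case/and3P: tp tb => /eqP -> -> -> /= tb.
    by rewrite linearZ /= bco_vec tb eqxx /= [_ *: _]mulr1.
  have todd := in_bar_odd (andP tb).2; case: t tb todd ntp => // t tb todd ntp.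
  rewrite [RHS](_ : _ = 0).
    have [tb'|ntb'] := boolP (in_bar (eveni u) t); first by rewrite -bco_beta // x0 linear0.
    move: tb ntb'; rewrite mod_ordS modSS => /andP[ts tm]; rewrite tm andbT => nts.
    have /andP[nl /eqP tl] : ~~ lclosed I && (t == (lend I).*2).
      by move: ts nts todd; rewrite /bar_supp; case: (lclosed I); case: (rclosed I) => /=; lia.
    by case/negP: ntp; rewrite tl eqxx nl /= -lend_mod -tl.
  case: ifP => [/andP[nl lu]|_]; last by rewrite linear0.
  by move: ntp; rewrite nl lu !andbT => /negbTE ntp; rewrite linearZ /= bco_vec ntp andbF [_ *: _]mulr0.
have pbE : ~~ lclosed I -> lend I = u.+1 -> in_bar r1 p.
  move=> nl lu; rewrite lend_odd_mod lu eqxx andbT /bar_supp nl; move: lr'; rewrite (negbTE nl) /= /p lu.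
  by case: (rclosed I) => /=; lia.
have [/and4P[nl rc /eqP lu rq]|noc] := boolP (oc_bar q u).
  have pb := pbE nl lu; exists (fun=> bvec r1 p); split=> [_|x x0|a].
  - rewrite /ocA /= bar_map_vec // /bvec; case: insubP => // s /andP[sb _] _; exfalso.
    by move: sb; rewrite /bar_supp nl /p /=; lia.
  - exists (fun=> bco r1 p x); rewrite sum1E {1}(xE x x0) nl lu eqxx /= subrr.
    by split; [rewrite linear0 | exact: (walk_subspace _ _ _ _).1].
  rewrite sum1E => -[_ /(walk_bco0 pb) h] i; rewrite (ord1 i).
  have : walk_cond true q p by rewrite /walk_cond rc /p; lia.
  by move/h; rewrite linearZ /= bco_vec pb eqxx /= [_ *: _]mulr1.
apply: gr_dim0; first by split; [exact: linear0 | exact: (walk_subspace _ _ _ _).1].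
move=> x x0; split=> //; rewrite (xE x x0); case: ifP => [/andP[nl /eqP lu]|_]; last exact: (walk_subspace _ _ _ _).1.
apply: subspaceZ; first exact: walk_subspace.
apply: walk_vec; first exact: pbE.
move: noc; rewrite /oc_bar /walk_cond nl lu eqxx /= negb_and.
by rewrite /p lu; case: (rclosed I) => //=; lia.
Qed.

End BarWalks.

Lemma dims_decomposition (K : fieldType) m (V : grep K m) bars q (u : 'I_m) : decomposition V bars ->
  co_dim V q u (count (fun I => co_bar I q u) bars) /\ oc_dim V q u (count (fun I => oc_bar I q u) bars).
Proof.
move=> [/allP vb [js VW]].
have [h1 h2] := dims_iso q u (count (fun I => co_bar I q u) bars) (count (fun I => oc_bar I q u) bars)
  (grep_iso_sym VW).
suff [d1 d2] : co_dim (foldr (@grep_sum K m) (grep0 K m) (map (bar_grep K m) bars ++ map (jordan_grep m) js))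
    q u (count (fun I => co_bar I q u) bars) /\
  oc_dim (foldr (@grep_sum K m) (grep0 K m) (map (bar_grep K m) bars ++ map (jordan_grep m) js))
    q u (count (fun I => oc_bar I q u) bars) by split; [exact: h1 | exact: h2].
clear h1 h2 VW; elim: bars vb => [|I bars IH] vb /=.
  elim: js => [|J js [IH1 IH2]] /=; first by split; [exact: co_dim_grep0 | exact: oc_dim_grep0].
  by split; [exact: co_dim_sum (co_dim_jordan _ _ _) IH1 | exact: oc_dim_sum (oc_dim_jordan _ _ _) IH2].
have [|IH1 IH2] := IH; first by move=> J Jb; apply: vb; rewrite inE Jb orbT.
have vI : valid_barcode m I by apply: vb; rewrite inE eqxx.
by split; [exact: co_dim_sum (co_dim_bar K vI q u) IH1 | exact: oc_dim_sum (oc_dim_bar K vI q u) IH2].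
Qed.
(** * Existence of bar code decompositions *)

Section Duality.
Variables (K : fieldType) (m : nat) (V V' : grep K m).
Variable b : forall i, odd_space V i -> odd_space V' i -> K.
Hypothesis bl : forall i a x y z, b (i := i) (a *: x + y) z = a * b x z + b y z.
Hypothesis br : forall i a x y z, b (i := i) x (a *: y + z) = a * b x y + b x z.
Hypothesis rep : forall i (g : {linear odd_space V i -> K^o}), exists x', forall x, g x = b x x'.
Hypothesis adj : forall i x y x' y', alpha V i x = beta V i y -> alpha V' i x' = beta V' i y' ->
  b x x' = b y y'.
Hypothesis perp : forall i x' y', (forall x y, alpha V i x = beta V i y -> b x x' = b y y') ->
  alpha V' i x' = beta V' i y'.

Let b0l i (z : odd_space V' i) : b 0 z = 0.
Proof. exact: (pairing0l (bl (i := i))). Qed.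

Let b0r i (x : odd_space V i) : b x 0 = 0.
Proof. exact: (pairing0r (br (i := i))). Qed.

Let walk_adj q i x x' : walk V false q i x -> walk V' true q i x' -> b x x' = 0.
Proof.
elim: q i x x' => [|q IH] i x x' /=; first by move=> -> _; rewrite b0l.
by move=> [y [xy wy]] [y' [xy' wy']]; rewrite (adj xy xy'); exact: IH.
Qed.

(** Pairing with x' descends along [alpha] to a functional that kills [beta] of the shorter walks;
    pulled back by [beta] it is represented by some y', and [perp] makes x' and y' related. *)
Let walk_perp q i x' : (forall x, walk V false q i x -> b x x' = 0) -> walk V' true q i x'.
Proof.
elim: q i x' => [|q IH] i x' h //=.
pose fb : odd_space V i -> K^o := fun x => b x x'.
have lb : linear fb by move=> a x y; rewrite /fb bl.
pose Lb := GRing.isLinear.Build K (odd_space V i) K^o *:%R fb lb.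
pose g : {linear odd_space V i -> K^o} := HB.pack_for {linear odd_space V i -> K^o} fb Lb.
pose A : set (even_space V i) := fun z => exists2 y, walk V false q (ordS i) y & z = beta V i y.
have sW := walk_subspace V false q (ordS i).
have sA : subspace A.
  split; first by exists 0; [exact: sW.1 | rewrite linear0].
  by move=> a _ _ [y wy ->] [y' wy' ->]; exists (a *: y + y'); [exact: sW.2 | rewrite linearP].
have [|mu [mug muA]] := functional_kill (u := alpha V i) (l := g) sA.
  by move=> x [y wy xy]; apply: h; exists y.
have [y' y'P] := rep (mu \o beta V i); exists y'; split.
  by apply: perp => x y xy; rewrite -y'P /= -xy mug.
by apply: IH => y wy; rewrite -y'P /=; apply: muA; exists y.
Qed.

(** Annihilators exchange the image condition in [coC] with the kernel of [beta], and the kernel of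
    the q-step relation with its domain. *)
Lemma grep_duality q u c c' : co_dim V q u c -> oc_dim V' q u c' -> c = c'.
Proof.
apply: (gr_dim_pairing (bl (i := ordS u)) (br (i := ordS u))).
- exact: walk_subspace.
- split=> [|a x y]; first exact: linear0.
  by rewrite /ocA linearP => -> ->; rewrite scaler0 addr0.
- move=> x x' [_ [y yx]] x'0; rewrite -(adj yx (_ : alpha V' u 0 = _)) ?b0r //.
  by rewrite linear0.
- by move=> x x' wx [_]; exact: walk_adj.
- move=> x wx h; split=> //; apply: contrapT => nx.
  pose A : set (even_space V u) := fun z => exists y, alpha V u y = z.
  have sA : subspace A.
    split; first by exists 0; rewrite linear0.
    by move=> a _ _ [y <-] [y' <-]; exists (a *: y + y'); rewrite linearP.
  have [mu [mu1 muA]] := functional_separate sA nx.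
  have [x' x'P] := rep (mu \o beta V u).
  have : b x x' = 0.
    apply: h; rewrite /ocA -[RHS](linear0 (alpha V' u)); apply/esym; apply: perp => y z yz.
    by rewrite b0r -x'P /= -yz muA //; exists y.
  by rewrite -x'P /= mu1 => /eqP; rewrite oner_eq0.
move=> x' x'0 h; split=> //; exact: walk_perp.
Qed.

End Duality.

(** * Routes around the cyclic quiver *)

Section Vertices.
Variables (K : fieldType) (m : nat).
Implicit Types V W : grep K m.

Definition vertex := (bool * 'I_m)%type.
Implicit Types c : vertex.

Definition next c : vertex := if c.1 then (false, c.2) else (true, ordS c.2).
Definition space V c : lmodType K := if c.1 then odd_space V c.2 else even_space V c.2.
(** [beta] is read backwards, so that all relations point the same way around the circle. *)
Definition rel V c : space V c -> space V (next c) -> Prop :=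
  match c with
  | (true, i) => fun x y => y = alpha V i x
  | (false, i) => fun x y => x = beta V i y
  end.
Arguments rel : clear implicits.

(** The index r of the space V_r, from 1 to 2m. *)
Definition pos c := (c.2.*2.+1 + ~~ c.1)%N.

Lemma next_inj : injective next.
Proof.
have oS (i j : 'I_m) : ordS i = ordS j -> i = j by exact: (can_inj (@ordSK m)).
by move=> [[] i] [[] j] //=; [case=> -> | case=> ij; congr pair; apply: oS; exact: val_inj].
Qed.

Lemma pos_next c : pos (next c) = (pos c).+1 %[mod m.*2].
Proof. by case: c => -[] i; rewrite /pos /= ?addn0 ?addn1 // mod_ordS. Qed.

Lemma pos_iter j c : pos (iter j next c) = (pos c + j)%N %[mod m.*2].
Proof.
elim: j => [|j IH]; first by rewrite addn0.
by rewrite iterS pos_next addnS -addn1 -modnDml IH modnDml addn1.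
Qed.

Lemma pos_inj c c' : pos c = pos c' %[mod m.*2] -> c = c'.
Proof.
have h d : (0 < pos d <= m.*2)%N by case: d => d i; rewrite /pos /=; have := ltn_ord i; case: d; lia.
move=> E; suff : pos c = pos c'.
  move: c c' {E} => [[] i] [[] j]; rewrite /pos /= => ij; first [congr pair; apply: val_inj => /= | exfalso]; clear -ij; lia.
have [cm|cm] := eqVneq (pos c) m.*2; have [cm'|cm'] := eqVneq (pos c') m.*2; first by rewrite cm.
- by move: E; rewrite cm modnn modn_small; have := h c'; lia.
- by move: E; rewrite cm' modnn modn_small; have := h c; lia.
by move: E; rewrite !modn_small //; have := h c; have := h c'; lia.
Qed.

Lemma iter_next_period j c : iter (m.*2 * j) next c = c.
Proof. by apply: pos_inj; rewrite pos_iter -modnDmr modnMr addn0. Qed.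

(** As [walk], but in single steps and from either kind of vertex. *)
Fixpoint route V (b : bool) l c {struct l} : set (space V c) :=
  match l with
  | 0 => fun x => if b then True else x = 0
  | l'.+1 => fun x => exists y, rel V c x y /\ route b l' y
  end.
Arguments route : clear implicits.

Lemma rel_linear V c a x y x' y' : rel V c x y -> rel V c x' y' -> rel V c (a *: x + x') (a *: y + y').
Proof. by case: c x y x' y' => -[] i x y x' y' /= -> ->; rewrite linearP. Qed.

Lemma rel0 V c : rel V c 0 0.
Proof. by case: c => -[] i /=; rewrite linear0. Qed.

Lemma route_subspace V b l c : subspace (route V b l c).
Proof.
elim: l c => [|l IH] c.
  by case: b; split=> //= a x y -> ->; rewrite scaler0 addr0.
split=> [|a x y [x' [ex wx]] [y' [ey wy]]].
  by exists 0; split; [exact: rel0 | case: (IH (next c))].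
by exists (a *: x' + y'); split; [exact: rel_linear | case: (IH (next c)) => _; apply].
Qed.

Lemma rel_functional V c (xi : {linear space V c -> K^o}) (P : set (space V (next c))) : subspace P ->
  (forall x y, rel V c x y -> P y -> xi x = 0) ->
  exists xi' : {linear space V (next c) -> K^o},
    (forall x y, rel V c x y -> xi x = xi' y) /\ forall y, P y -> xi' y = 0.
Proof.
case: c xi P => -[] i xi P sP h; last first.
  by exists (xi \o beta V i); split=> [x y ->//|y Py]; exact: (h _ y).
have [x Px|mu [mux muP]] := functional_kill (u := alpha V i) (l := xi) sP; first exact: (h x _ erefl).
by exists mu; split=> // x y ->; rewrite mux.
Qed.

(** The family [z] changed to [x] at c; the types vary with the vertex, hence the transport along
    [e]. *)
Definition single (T : vertex -> Type) (z : forall c, T c) c (x : T c) c' : T c' :=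
  match c =P c' with ReflectT e => eq_rect c T x c' e | ReflectF _ => z c' end.

Lemma singleE T z c (x : T c) : single z x c = x.
Proof. by rewrite /single; case: eqP => // e; rewrite (eq_axiomK e). Qed.

Lemma single_ne T z c (x : T c) c' : c != c' -> single z x c' = z c'.
Proof. by rewrite /single; case: eqP. Qed.

Definition vectors V := forall c, space V c.
Definition functionals V := forall c, {linear space V c -> K^o}.

Definition vsingle V c (x : space V c) : vectors V := single (T := fun c => space V c) (fun=> 0) x.
Definition fsingle V c (x : {linear space V c -> K^o}) : functionals V :=
  single (T := fun c => {linear space V c -> K^o}) (fun=> \0%R) x.

(** A long route visits a vertex several times, so the time j and the vertex d are kept apart: [Y j]
    is a family over all vertices, supported at the vertex reached at time j. *)
Lemma vector_thread V b l c x : route V b l c x -> exists Y : nat -> vectors V,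
  [/\ Y 0%N = vsingle x, forall j d, (j < l)%N -> rel V d (Y j d) (Y j.+1 (next d)),
      b = false -> forall d, Y l d = 0 & forall j d, iter j next c != d -> Y j d = 0].
Proof.
elim: l c x => [|l IH] c x.
  move=> wx; exists (fun j => if j is 0 then vsingle x else fun=> 0); split=> //.
    move=> b0 d; move: wx; rewrite b0 /= => ->; have [<-|cd] := eqVneq c d; first exact: singleE.
    exact: single_ne.
  by move=> [|j] d //= cd; exact: single_ne.
move=> [y [xy /IH[Y [Y0 YS Yl Yn]]]].
exists (fun j => if j is j'.+1 then Y j' else vsingle x); split=> //.
- move=> [|j] d jl; last exact: YS.
  rewrite Y0; have [<-|cd] := eqVneq c d; first by rewrite /vsingle !singleE.
  by rewrite /vsingle !single_ne ?(inj_eq next_inj) //; exact: rel0.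
move=> [|j] d cd; first exact: single_ne.
by apply: Yn; rewrite -iterSr.
Qed.

(** Dually, a functional that kills the starting points of routes is carried along by
    [rel_functional], keeping track of the routes that remain. *)
Lemma functional_thread V b e l c (xi : {linear space V c -> K^o}) :
  (forall x, route V b (l + e) c x -> xi x = 0) -> exists X : nat -> functionals V,
  [/\ X 0%N = fsingle xi,
      forall j d x y, (j < l)%N -> rel V d x y -> X j d x = X j.+1 (next d) y,
      forall d z, route V b e d z -> X l d z = 0 &
      forall j d, iter j next c != d -> forall z, X j d z = 0].
Proof.
elim: l c xi => [|l IH] c xi h.
  exists (fun j => if j is 0 then fsingle xi else fun=> \0%R); split=> //.
    move=> d z; have [cd|cd] := eqVneq c d; first by move: z; rewrite -cd => z; rewrite /fsingle singleE; exact: h.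
    by rewrite /fsingle single_ne.
  by move=> [|j] d //= cd z; rewrite /fsingle single_ne.
have [|xi' [xi'E /IH[X [X0 XS Xl Xn]]]] := rel_functional (xi := xi) (route_subspace V b (l + e) (next c)).
  by move=> x y xy wy; apply: h; exists y.
exists (fun j => if j is j'.+1 then X j' else fsingle xi); split=> //.
- move=> [|j] d x y jl xy; last exact: XS.
  rewrite X0; move: x y xy; have [<-|cd] := eqVneq c d => x y xy; first by rewrite /fsingle !singleE; exact: xi'E.
  by rewrite /fsingle !single_ne ?(inj_eq next_inj).
move=> [|j] d cd z; first by rewrite /= /fsingle single_ne.
by apply: Xn; rewrite -iterSr.
Qed.

Lemma route_vectors V b l (Y : nat -> vectors V) c :
  (forall j d, (j < l)%N -> rel V d (Y j d) (Y j.+1 (next d))) -> (b = false -> forall d, Y l d = 0) ->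
  route V b l c (Y 0%N c).
Proof.
elim: l Y c => [|l IH] Y c YS Yl /=; first by case: b Yl => // Yl; exact: Yl.
exists (Y 1%N (next c)); split; first exact: YS.
by apply: (IH (fun j => Y j.+1)) => // j d jl; exact: YS.
Qed.

End Vertices.
Arguments rel [K m] V c _ _.
Arguments route [K m] V b l c _.

(** * Finding a bar inside a representation *)

Section Threads.
Variables (K : fieldType) (m : nat) (V : grep K m) (N : vertex m -> nat).
Hypothesis bN : forall c, bounded (space V c) (N c).

(* The vectors at [next c] with which a bar may begin; left_dead spans those with which
   none does. *)
Definition left_open c : set (space V (next c)) :=
  match c with (true, i) => setT | (false, i) => fun x => beta V i x = 0 end.
Definition left_dead c : set (space V (next c)) :=
  match c with (true, i) => fun x => exists v, x = alpha V i v | (false, i) => fun x => x = 0 end.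
Arguments left_open : clear implicits.
Arguments left_dead : clear implicits.

Lemma subspace_mem_sum (W : lmodType K) (A : set W) (I : finType) (p : pred I) (v : I -> W) :
  subspace A -> (forall i, p i -> A (v i)) -> A (\sum_(i | p i) v i).
Proof. by move=> sA Av; apply: big_ind => //; [exact: sA.1 | move=> x y; exact: subspaceD]. Qed.

Lemma left_dead_subspace c : subspace (left_dead c).
Proof.
case: c => -[] i /=; split=> [|a x y].
- by exists 0; rewrite linear0.
- by move=> [v ->] [w ->]; exists (a *: v + w); rewrite linearP.
- by [].
by move=> -> ->; rewrite scaler0 addr0.
Qed.

Lemma left_open_subspace c : subspace (left_open c).
Proof.
case: c => -[] i /=; split=> [|a x y] //; first by rewrite linear0.
by move=> x0 y0; rewrite linearP x0 y0 scaler0 addr0.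
Qed.

Lemma left_dead_open c x : left_dead c x -> left_open c x.
Proof. by case: c x => -[] i x //= ->; rewrite linear0. Qed.

Lemma rel_sum c I (a : I -> K) x y (r : seq I) : (forall j, a j != 0 -> rel V c (x j) (y j)) ->
  rel V c (\sum_(j <- r) a j *: x j) (\sum_(j <- r) a j *: y j).
Proof.
move=> h; elim: r => [|j r IH]; first by rewrite !big_nil; exact: rel0.
rewrite !big_cons; have [->|aj] := eqVneq (a j) 0; first by rewrite !scale0r !add0r.
exact: rel_linear (h j aj) IH.
Qed.

Lemma rel0_left i d (x : space V (next (false, i))) : left_open (false, i) x ->
  rel V d 0 (vsingle x (next d)).
Proof.
move=> Lx; have [e|ne] := eqVneq (false, i) d; last first.
  by rewrite /vsingle single_ne ?(inj_eq (@next_inj m)) //; exact: rel0.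
by rewrite -e /vsingle singleE /= Lx.
Qed.

Local Notation P := (m.*2).

Lemma loop_dependence c (x : space V c) : route V true (P * N c) c x ->
  exists (Y : nat -> vectors V) (a : 'I_(N c).+1 -> K), [/\ Y 0%N = vsingle x,
    forall j d, (j < P * N c)%N -> rel V d (Y j d) (Y j.+1 (next d)),
    forall j d, iter j (@next m) c != d -> Y j d = 0,
    exists i, a i != 0 & forall d, \sum_j a j *: Y (P * j)%N d = 0].
Proof.
move=> wx; have [Y [Y0 YS _ Yn]] := vector_thread wx.
have [a ai aY] := bN (fun j : 'I_(N c).+1 => Y (P * j)%N c).
exists Y, a; split=> // d; have [<- //|ne] := eqVneq c d.
by rewrite big1 // => j _; rewrite Yn ?scaler0 // iter_next_period.
Qed.

(* The returns of a long route to its starting point are linearly dependent; a suitable shifted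
   combination of the route ends at 0. *)
Lemma loop_dead c (x : space V (next c)) : left_open c x -> route V true (P * N (next c)) (next c) x ->
  (forall l z, left_open c z -> route V false l (next c) z -> left_dead c z) -> left_dead c x.
Proof.
have P0 : (0 < P)%N by rewrite double_gt0; case: (m) c.2 => [[]|].
have YP n (j k : nat) (jN : 'I_n.+1) : (k < P * jN -> j <= k -> j < P * n)%N.
  by move=> kj jk; apply: leq_ltn_trans jk _; apply: leq_trans kj _; rewrite leq_mul2l -ltnS ltn_ord orbT.
case: c x => -[] i x Lx wx H; have [Y [a [Y0 YS Yn [i0 ai0] aY]]] := loop_dependence wx.
  (* Closed left end: J is the first return in the dependency. The later returns, shifted back by P
     J steps, combine to a route to 0 that starts at x plus a vector in the image of [alpha]. *)
  case: (@arg_minnP _ i0 (fun j => a j != 0) (fun j => val j) ai0) => J aJ Jmin.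
  pose W (k : nat) : vectors V := fun d => \sum_(j : 'I_(N (next (true, i))).+1)
    (if (J <= j)%N then (a J)^-1 * a j else 0) *: Y (k + (P * j - P * J))%N d.
  have W0 : route V false (P * J) (false, i) (W 0%N (false, i)).
    apply: route_vectors => [k d kJ|_ d].
      apply: rel_sum => j; case: ifP => [Jj _|_]; last by rewrite eqxx.
      apply: YS; have PJj : (P * J <= P * j)%N by rewrite leq_mul2l Jj orbT.
      have PjN : (P * j <= P * N (false, i))%N by rewrite leq_mul2l -ltnS ltn_ord orbT.
      by apply: leq_trans PjN; rewrite -[X in (_ < X)%N](subnKC PJj) ltn_add2r.
    transitivity ((a J)^-1 *: \sum_j a j *: Y (P * j)%N d); last by rewrite aY scaler0.
    rewrite scaler_sumr; apply: eq_bigr => j _; rewrite scalerA.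
    case: ifP => Jj; first by rewrite subnKC // leq_pmul2l.
    have -> : a j = 0 by apply/eqP/negPn/negP => /Jmin; rewrite Jj.
    by rewrite mulr0 !scale0r.
  have /= {}H := H _ _ Logic.I W0; have sD := left_dead_subspace (true, i).
  have Wx : left_dead (true, i) (W 0%N (false, i) - x).
    rewrite /W (bigD1 J) //= leqnn mulVf // scale1r subnn Y0 /vsingle singleE addrAC subrr add0r.
    apply: (subspace_mem_sum sD) => j jJ.
    case: ifP => Jj; last by rewrite scale0r; exact: sD.1.
    apply: subspaceZ => //; have : (0 < P * j - P * J)%N.
      by rewrite subn_gt0 ltn_pmul2l // ltn_neqAle Jj andbT eq_sym.
    have : (P * j - P * J <= P * N (false, i))%N.
      by apply: leq_trans (leq_subr _ _) _; rewrite leq_mul2l -ltnS ltn_ord orbT.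
    rewrite add0n; case: (_ - _)%N => // k kN _; exists (Y k (true, i)); exact: (YS k (true, i)).
  have -> : x = W 0%N (false, i) - (W 0%N (false, i) - x) by zmod.
  exact: (subspaceB sD H Wx).
(* Open left end: J is the last return. Earlier returns are delayed and preceded by zeros, which is
   possible because [beta] kills x; the route then starts at x itself. *)
case: (@arg_maxnP _ i0 (fun j => a j != 0) (fun j => val j) ai0) => J aJ Jmax.
pose W (k : nat) : vectors V := fun d => \sum_(j : 'I_(N (next (false, i))).+1)
  ((a J)^-1 * a j) *: (if (P * J <= k + P * j)%N then Y (k + P * j - P * J)%N d else 0).
have aj0 j : a j != 0 -> (P * j <= P * J)%N by move=> /Jmax; rewrite /= leq_mul2l => jJ; apply/orP; right.
have W0 : route V false (P * J) (next (false, i)) (W 0%N (next (false, i))).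
  apply: route_vectors => [k d kJ|_ d].
    apply: rel_sum => j; rewrite mulf_eq0 negb_or => /andP[_ /aj0 jJ].
    have [kj|kj] := leqP (P * J) (k + P * j).
      rewrite leqW // addSn subSn //; apply: YS; apply: (YP _ _ k J) => //.
      by lia.
    case: ifP => kj'; last exact: rel0.
    have -> : (k.+1 + P * j - P * J = 0)%N by lia.
    by rewrite Y0; exact: rel0_left.
  transitivity ((a J)^-1 *: \sum_j a j *: Y (P * j)%N d); last by rewrite aY scaler0.
  rewrite scaler_sumr; apply: eq_bigr => j _; rewrite scalerA.
  by rewrite leq_addr addKn.
suff WE : W 0%N (next (false, i)) = x by apply: (H _ _ Lx); rewrite -{2}WE; exact: W0.
rewrite /W (bigD1 J) //= add0n leqnn mulVf // scale1r subnn Y0 /vsingle singleE big1 ?addr0 // => j jJ.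
case: ifP => Jj; last by rewrite scaler0.
have -> : a j = 0; last by rewrite mulr0 scale0r.
apply/eqP/negPn/negP => /aj0 jJ'; case/negP: jJ; rewrite -val_eqE /=.
by move: Jj jJ'; rewrite add0n !leq_pmul2l // => Jj jJ'; rewrite eqn_leq Jj jJ'.
Qed.

(** If neither the routes of length l nor those reaching 0 in l steps jumped modulo dead vectors, x
    would have a long route up to dead vectors and be dead by [loop_dead]. A jump fixes the length
    of the bar and the type [b] of its right end. *)
Lemma left_split c (x : space V (next c)) : left_open c x -> ~ left_dead c x ->
  exists b l z, [/\ left_open c z, route V b (l + ~~ b) (next c) z &
    ~ exists r t, [/\ left_dead c r, route V b (l + b) (next c) t & z = r + t]].
Proof.
move=> Lx nx; apply: contrapT => nex; apply: nx.
have h b l z : left_open c z -> route V b (l + ~~ b) (next c) z ->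
    exists r t, [/\ left_dead c r, route V b (l + b) (next c) t & z = r + t].
  by move=> Lz wz; apply: contrapT => nz; apply: nex; exists b, l, z.
have sD := left_dead_subspace c; have sO := left_open_subspace c.
have T l : exists r t, [/\ left_dead c r, left_open c t, route V true l (next c) t & x = r + t].
  elim: l => [|l [r [t [Dr Ot wt xE]]]]; first by exists 0, x; split; rewrite ?add0r //; exact: sD.1.
  have [|r' [t' [Dr' wt' tE]]] := h true l t Ot; first by rewrite addn0.
  exists (r + r'), t'; split; [exact: subspaceD | | by rewrite addn1 in wt' | by rewrite xE tE addrA].
  have -> : t' = t - r' by rewrite tE addrC addKr.
  by apply: subspaceB => //; exact: left_dead_open.
have F l z : left_open c z -> route V false l (next c) z -> left_dead c z.
  elim: l z => [|l IH] z Oz wz; first by rewrite wz; exact: sD.1.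
  have [|r [t [Dr wt zE]]] := h false l z Oz; first by rewrite addn1.
  rewrite zE; apply: subspaceD => //; apply: IH; last by rewrite addn0 in wt.
  have -> : t = z - r by rewrite zE addrC addKr.
  by apply: subspaceB => //; exact: left_dead_open.
have [r [t [Dr Ot wt ->]]] := T (P * N (next c))%N.
by apply: subspaceD => //; apply: loop_dead.
Qed.

(* A bar of l + 1 vertices starting at [next c], mapped to V by Y and split off by X. *)
Record bar_thread c (b : bool) l (Y : nat -> vectors V) (X : nat -> functionals V) : Prop := BarThread {
  thread_rel : forall j d, (j < l)%N -> rel V d (Y j d) (Y j.+1 (next d));
  thread_supp : forall j d, iter j (@next m) (next c) != d -> Y j d = 0;
  thread_first : forall i, beta V i (Y 0%N (true, ordS i)) = 0;
  thread_last : forall i, alpha V i (Y l (true, i)) = 0;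
  cothread_rel : forall j d x y, (j < l)%N -> rel V d x y -> X j d x = X j.+1 (next d) y;
  cothread_supp : forall j d, iter j (@next m) (next c) != d -> forall z, X j d z = 0;
  cothread_first : forall i v, X 0%N (false, i) (alpha V i v) = 0;
  cothread_last : forall i u, X l (false, i) (beta V i u) = 0;
  thread_unit : X 0%N (next c) (Y 0%N (next c)) = 1;
  thread_parity : (iter l (@next m) (next c)).1 = ~~ b
}.

(** The route of z gives the vectors. A functional equal to 1 on z that kills the dead vectors and
    the routes beyond the jump is carried along and gives the functionals. *)
Lemma bar_thread_ex c (x : space V (next c)) : left_open c x -> ~ left_dead c x ->
  exists b l Y X, bar_thread c b l Y X.
Proof.
move=> Lx nx; have [b [l [z [Oz wz nz]]]] := left_split Lx nx.
pose A := fun y => exists r t, [/\ left_dead c r, route V b (l + b) (next c) t & y = r + t].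
have sD := left_dead_subspace c; have sR := route_subspace V b (l + b) (next c).
have sA : subspace A.
  split; first by exists 0, 0; split; [exact: sD.1 | exact: sR.1 | rewrite addr0].
  move=> a _ _ [r [t [Dr wt ->]]] [r' [t' [Dr' wt' ->]]].
  exists (a *: r + r'), (a *: t + t'); split; [exact: sD.2 | exact: sR.2 | by rewrite scalerDr addrACA].
have [xi [xiz xiA]] := functional_separate sA nz.
have xiD r : left_dead c r -> xi r = 0.
  by move=> Dr; apply: xiA; exists r, 0; split=> //; [exact: sR.1 | rewrite addr0].
have [|X [X0 XS Xl Xn]] := functional_thread (l := l) (xi := xi) (b := b) (e := b).
  by move=> y wy; apply: xiA; exists 0, y; split=> //; [exact: sD.1 | rewrite add0r].
have [Y [Y0 YS Yl Yn]] := vector_thread wz.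
have lD : (l <= l + ~~ b)%N by exact: leq_addr.
(* The wrong parity contradicts the jump: a route ending at an odd vertex extends by [alpha], and
   one that reaches 0 from an even vertex was [beta 0] there already. *)
have par : (iter l (@next m) (next c)).1 = ~~ b.
  case E : (iter l (@next m) (next c)) => [oc i] /=; case: b wz nz X0 XS Xl Xn Y0 YS Yl Yn lD A sR sA xiA => wz nz X0 XS Xl Xn Y0 YS Yl Yn lD A sR sA xiA; case: oc E => // E; exfalso; apply: nz; exists 0, z; split; try exact: sD.1; rewrite ?add0r //.
    have -> : z = Y 0%N (next c) by rewrite Y0 /vsingle singleE.
    pose Y' (k : nat) : vectors V := if (k <= l)%N then Y k else
      vsingle (c := (false, i)) (alpha V i (Y l (true, i)) : space V (false, i)).
    have -> : Y 0%N = Y' 0%N by [].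
    apply: route_vectors => // k d; rewrite addn1 ltnS => kl; rewrite /Y' kl.
    have [kl'|kl'] := leqP k.+1 l; first by apply: YS; exact: leq_trans lD.
    have {kl'} -> : k = l by apply/eqP; rewrite eqn_leq kl -ltnS.
    have [<-|ne] := eqVneq (true, i) d; first exact: singleE.
    rewrite Yn ?E // /vsingle single_ne; first exact: rel0.
    by rewrite (_ : (false, i) = next (true, i)) // (inj_eq (@next_inj m)).
  have -> : z = Y 0%N (next c) by rewrite Y0 /vsingle singleE.
  rewrite addn0; apply: route_vectors => [k d kl|_ d]; first by apply: YS; exact: leq_trans lD.
  have [<-|ne] := eqVneq (false, i) d; last by apply: Yn; rewrite E.
  have := YS l (false, i); rewrite addn1 ltnSn => /(_ isT) /= ->.
  by have := Yl erefl (next (false, i)); rewrite addn1 => ->; rewrite linear0.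
have Y1 i : alpha V i (Y l (true, i)) = 0.
  have [cl|ne] := eqVneq (iter l (@next m) (next c)) (true, i); last by rewrite Yn // linear0.
  move: par (YS l (true, i)) (Yl); rewrite cl /=; case: (b) => //= _; rewrite addn1 => YSl Yl'.
  by have := YSl (ltnSn l); rewrite Yl'.
exists b, l, Y, X; split=> //.
- by move=> j d jl; apply: YS; exact: leq_trans lD.
- move=> i; have [e|ne] := eqVneq (next c) (true, ordS i); last by rewrite Y0 /vsingle single_ne // linear0.
  rewrite Y0; case: c x Lx nx z Oz {wz nz A sD sR sA xi xiz xiA xiD X X0 XS Xl Xn Y Y0 YS Yl Yn par Y1} e => -[] i' x Lx nx z Oz //=.
  move=> /(congr1 snd) /= /(can_inj (@ordSK m)) e; move: z Oz; rewrite e => z Oz;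
  by have -> : vsingle z (true, ordS i) = z := singleE _ _.
- move=> i v; rewrite X0; have [e|ne] := eqVneq (next c) (false, i); last by rewrite /fsingle single_ne.
  move: xi xiD e {x Lx nx z Oz wz nz A sD sR sA xiz xiA X X0 XS Xl Xn Y Y0 YS Yl Yn par Y1}.
  case: c => -[] i' //= xi xiD /(congr1 snd) /= e; move: xi xiD; rewrite e => xi xiD.
  have -> : fsingle xi (false, i) = xi := singleE _ _.
  by apply: xiD; exists v.
- move=> i u; have [e|ne] := eqVneq (iter l (@next m) (next c)) (false, i); last exact: Xn.
  apply: Xl; move: par; rewrite e /=; case: (b) => // _; by exists u.
by rewrite X0 Y0 /fsingle /vsingle !singleE.
Qed.

End Threads.

(** * Kernels as complements *)

Section Kernel.
Variables (K : fieldType) (A B : lmodType K) (u : {linear A -> B}).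

Definition ker_pred : {pred A} := fun x => u x == 0.
Lemma ker_pred_closed : submod_closed ker_pred.
Proof.
split=> [|a x y /eqP x0 /eqP y0]; first by rewrite unfold_in linear0.
by rewrite unfold_in linearP x0 y0 scaler0 addr0.
Qed.
HB.instance Definition _ := GRing.isSubmodClosed.Build K A ker_pred ker_pred_closed.

Record kernel := Kernel { kernel_val : A; kernelP : kernel_val \in ker_pred }.
HB.instance Definition _ := [isSub for kernel_val].
HB.instance Definition _ := [Choice of kernel by <:].
HB.instance Definition _ := [SubChoice_isSubLmodule of kernel by <:].

Lemma kernel0 (k : kernel) : u (val k) = 0.
Proof. exact/eqP/kernelP. Qed.

Lemma bounded_kernel N : bounded A N -> bounded kernel N.
Proof. exact: (bounded_inj (u := \val : {linear kernel -> A})) val_inj. Qed.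

(** x is added to a list of vectors of the kernel; applying [u] to a dependency shows that x has
    coefficient 0. *)
Lemma bounded_kernel_pred N x : u x != 0 -> bounded A N -> (0 < N)%N /\ bounded kernel N.-1.
Proof.
move=> ux bA; case: N bA => [|N] bA.
  have [a [i ai]] := bA (fun=> x); rewrite big_ord1 => /eqP; rewrite scaler_eq0 => /orP[a0|x0].
    by move: ai; rewrite (ord1 i) a0.
  by move: ux; rewrite (eqP x0) linear0 eqxx.
split=> // v; pose w i := if unlift ord0 i is Some j then val (v j) else x.
have [a [i ai]] := bA w; rewrite big_ord_recl {1}/w unlift_none.
under eq_bigr do rewrite /w liftK; move=> E.
have a0 : a ord0 = 0.
  have := congr1 u E; rewrite linearD linearZ linear_sum linear0 /= big1 ?addr0.
    by move/eqP; rewrite scaler_eq0 (negbTE ux) orbF => /eqP.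
  by move=> j _; rewrite linearZ /= kernel0 scaler0.
exists (fun j => a (lift ord0 j)).
  by case: (unliftP ord0 i) ai => [j -> aj|->]; [exists j | rewrite a0 eqxx].
apply: val_inj; transitivity (\sum_i a (lift ord0 i) *: val (v i)).
  exact: (linear_sum (\val : {linear kernel -> A})).
by rewrite -[RHS]E a0 scale0r add0r.
Qed.

Variables (s : {linear B -> A}).

Definition kernel_sum (x : B * kernel) : A := s x.1 + val x.2.
Lemma kernel_sum_linear : linear kernel_sum.
Proof. by move=> a x y; rewrite /kernel_sum /= linearP scalerDr addrACA. Qed.
HB.instance Definition _ := GRing.isLinear.Build K (B * kernel)%type A *:%R kernel_sum kernel_sum_linear.

Lemma kernel_sum_bij : bijective (u \o s) -> bijective kernel_sum.
Proof.
move=> [g gK Kg].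
have kP x : x - s (g (u x)) \in ker_pred 
  by rewrite unfold_in linearB (_ : u (s _) = u x) ?subrr //; exact: Kg.
exists (fun x => (g (u x), Kernel (kP x))) => [[z k]|x]; rewrite /kernel_sum /=; last by rewrite addrC subrK.
have E : g (u (s z + val k)) = z by rewrite linearD kernel0 addr0; exact: gK.
by congr pair => //; apply: val_inj; rewrite /= [g _]E addrC addKr.
Qed.

End Kernel.

Section KernelMap.
Variables (K : fieldType) (A B A' B' : lmodType K) (u : {linear A -> B}) (u' : {linear A' -> B'}).
Variables (f : {linear A -> A'}) (fP : forall x, u x = 0 -> u' (f x) = 0).

Definition kernel_map (k : kernel u) : kernel u' := Kernel (introT eqP (fP (kernel0 k))).
Lemma kernel_map_linear : linear kernel_map.
Proof. by move=> a x y; apply: val_inj; rewrite /= linearP. Qed.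
HB.instance Definition _ := GRing.isLinear.Build K (kernel u) (kernel u') *:%R kernel_map kernel_map_linear.
End KernelMap.

Section Dimension.
Variable K : fieldType.
Implicit Types W U : lmodType K.

Lemma independent_le_spanning W c d (v : 'I_c -> W) (e : 'I_d -> W) :
  independent v -> spanning e -> (c <= d)%N.
Proof.
move=> iv se; have /choice[a aP] i : exists a : 'I_d -> K, v i = \sum_j a j *: e j by exact: se.
apply: (@kernel_bound _ _ _ (\matrix_(i, j) a i j)) => b b0; apply: iv.
under eq_bigr do rewrite aP scaler_sumr; rewrite exchange_big big1 //= => j _.
under eq_bigr do rewrite scalerA; rewrite -scaler_suml -[RHS](scale0r (e j)); congr (_ *: _).
by rewrite -[RHS](b0 j); apply: eq_bigr => i' _; rewrite mxE.
Qed.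

Lemma spanning_bounded W d (e : 'I_d -> W) : spanning e -> bounded W d.
Proof.
move=> se v; apply: contrapT => h; have : (d.+1 <= d)%N; last by rewrite ltnn.
apply: (independent_le_spanning (v := v)) se => a a0 i; apply/eqP/negPn/negP => ai.
by apply: h; exists a => //; exists i.
Qed.

Lemma inj_surj_bij (S T : Type) (f : S -> T) : injective f -> (forall y, exists x, f x = y) -> bijective f.
Proof. by move=> fi fs; have [g gP] := choice fs; exists g => // x; exact: fi. Qed.

Lemma independent_inj W U d (e : 'I_d -> W) (f : {linear W -> U}) :
  independent e -> injective f -> independent (f \o e).
Proof.
move=> ie fi a a0; apply: ie; apply: fi; rewrite linear0 -[RHS]a0 linear_sum.
by apply: eq_bigr => i _; rewrite linearZ.
Qed.

Lemma independent_lift W U d (e : 'I_d -> W) (f : {linear W -> U}) :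
  independent (f \o e) -> independent e.
Proof.
move=> ie a a0; apply: ie; rewrite -[RHS](linear0 f) -a0 linear_sum.
by apply: eq_bigr => i _; rewrite linearZ.
Qed.

Lemma inj_surj W U d (e : 'I_d -> W) (e' : 'I_d -> U) (f : {linear W -> U}) :
  independent e -> spanning e' -> injective f -> bijective f.
Proof.
move=> ie se' fi; apply: inj_surj_bij => // y.
have [a ->] := independent_spanning (spanning_bounded se') (independent_inj ie fi) y.
by exists (\sum_i a i *: e i); rewrite linear_sum; apply: eq_bigr => i _; rewrite linearZ.
Qed.

Lemma surj_inj W U d (e : 'I_d -> W) (e' : 'I_d -> U) (f : {linear W -> U}) :
  spanning e -> independent e' -> (forall y, exists x, f x = y) -> bijective f.
Proof.
move=> se ie' fs; have [w wP] := choice (fun i => fs (e' i)).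
have iw : independent (f \o w) by move=> a; under eq_bigr do rewrite /= wP; exact: ie'.
have sw := independent_spanning (spanning_bounded se) (independent_lift iw).
apply: inj_surj_bij => // x y xy; apply/eqP; rewrite -subr_eq0; apply/eqP.
have [a aE] := sw (x - y); rewrite aE big1 // => i _; rewrite iw ?scale0r //.
transitivity (f (x - y)); last by rewrite linearB xy subrr.
by rewrite aE linear_sum; apply: eq_bigr => j _; rewrite linearZ.
Qed.

Lemma injective_bij W N (f : {linear W -> W}) : bounded W N -> injective f -> bijective f.
Proof. by move=> bW fi; have [d [_ [e [ie se]]]] := basis_ex bW; exact: inj_surj ie se fi. Qed.

End Dimension.

Lemma pred_bounds a q e : (q < e)%N -> (e <= q + a)%N -> (q <= e.-1 <= q + a)%N.
Proof. lia. Qed.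

Lemma sub_bounds a q e : (q <= e)%N -> (e.+1 <= q + a)%N -> (e - q < a)%N.
Proof. lia. Qed.

Lemma sub_pred a q e : (q < e)%N -> (e <= q + a)%N -> (e - q = (e.-1 - q).+1)%N /\ (e.-1 - q < a)%N.
Proof. lia. Qed.

Lemma sub_last a q e : (e <= q + a)%N -> (q + a < e.+1)%N -> (e - q)%N = a.
Proof. lia. Qed.

(** * Splitting off a bar *)

Section BarSplit.
Variables (K : fieldType) (m : nat) (V : grep K m) (N : vertex m -> nat).
Hypothesis bN : forall c, bounded (space V c) (N c).
Variables (c : vertex m) (b : bool) (l : nat) (Y : nat -> vectors V) (X : nat -> functionals V).
Hypothesis bt : bar_thread c b l Y X.

Let t_rel j d : (j < l)%N -> rel V d (Y j d) (Y j.+1 (next d)).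
Proof. by case: bt => h *; exact: h. Qed.

Let c_rel j d x y : (j < l)%N -> rel V d x y -> X j d x = X j.+1 (next d) y.
Proof. by case: bt => _ _ _ _ h *; exact: h. Qed.

(** The first index of the bar on the line that covers the circle; the last is [s0 + l], which is
    odd exactly at an open right end. *)
Let s0 := (c.2.+1.*2 + ~~ c.1)%N.
Let I := Bar c.1 c.2.+1 b (s0 + l + ~~ b)./2.
Let ipos (d : vertex m) := if d.1 then d.2.*2.+1 else d.2.*2.+2.
Let B d := bar_space K m I (ipos d).
Local Notation in_bar r p := (bar_supp I p && (p == r %[mod m.*2]))%N.

Let iposE d : ipos d = pos d.
Proof. by case: d => -[] i; rewrite /ipos /pos /= ?addn0 ?addn1. Qed.

Let s0_pos : s0 = pos (next c) %[mod m.*2].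
Proof. by rewrite pos_next /s0 /pos; case: c => -[] i /=; rewrite ?addn0 ?addn1. Qed.

Let pos_vertex j : (s0 + j = pos (iter j (@next m) (next c)) %[mod m.*2])%N.
Proof. by rewrite pos_iter -modnDml s0_pos modnDml. Qed.

Let odd_s0l : odd (s0 + l) = ~~ b.
Proof.
have m2 : (2 %| m.*2)%N by rewrite -muln2 dvdn_mull.
rewrite -(thread_parity bt) -[LHS]oddb -modn2 -(modn_dvdm _ m2) pos_vertex modn_dvdm // modn2 oddb.
by case: (iter _ _ _) => -[] i; rewrite /pos /= ?addn0 ?addn1 /= odd_double.
Qed.

Let suppE s : bar_supp I s = (s0 <= s <= s0 + l)%N.
Proof.
have e : ((rend I).*2 = s0 + l + ~~ b)%N.
  by rewrite /= -[RHS]odd_double_half oddD odd_s0l; case: (b).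
by rewrite /bar_supp e /= leq_add2r.
Qed.

Let vI : valid_barcode m I.
Proof.
have e : ((rend I).*2 = s0 + l + ~~ b)%N.
  by rewrite /= -[RHS]odd_double_half oddD odd_s0l; case: (b).
rewrite /valid_barcode [lend I]/= ltn_ord /=; move: e; rewrite [rend I]/= /s0; move: (_./2) => r.
by case: (c.1); case: (b) => /=; lia.
Qed.

Let alphaB i : {linear B (true, i) -> B (false, i)} := alpha (bar_grep K m I) i.
Let betaB i : {linear B (true, ordS i) -> B (false, i)} := beta (bar_grep K m I) i.

Definition thread_emb d : {linear B d -> space V d} :=
  free_lift (fun s : bar_index m I (ipos d) => Y (val s - s0) d).

Definition thread_term d (j : nat) (v : space V d) : B d := X j d v *: bvec K m I (ipos d) (s0 + j).
Definition thread_fun d v : B d := \sum_(j < l.+1) thread_term j v.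
Lemma thread_fun_linear d : linear (@thread_fun d).
Proof.
move=> a x y; rewrite /thread_fun scaler_sumr -big_split; apply: eq_bigr => j _.
by rewrite /thread_term linearP scalerDl scalerA.
Qed.
HB.instance Definition _ d := GRing.isLinear.Build K (space V d) (B d) *:%R
  (@thread_fun d) (@thread_fun_linear d).
Definition thread_proj d : {linear space V d -> B d} := @thread_fun d.

Lemma thread_emb_vec d p : (s0 <= p <= s0 + l)%N -> thread_emb d (bvec K m I (ipos d) p) = Y (p - s0) d.
Proof.
move=> pb; rewrite /bvec; case: insubP => [s _ sp|]; first by rewrite -sp; exact: free_liftU.
rewrite suppE pb linear0 /= => np; rewrite (thread_supp bt) //.
apply: contra np => /eqP <-; rewrite iposE -pos_vertex subnKC //.
by case/andP: pb.
Qed.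

Lemma bvec_out r p : ~~ (s0 <= p <= s0 + l)%N -> bvec K m I r p = 0.
Proof. by move=> np; rewrite /bvec; case: insubP => // s; rewrite suppE (negbTE np). Qed.

Lemma thread_emb_alpha i z : thread_emb (false, i) (alphaB i z) = alpha V i (thread_emb (true, i) z).
Proof.
apply: (eq_on_fsupp (F := thread_emb (false, i) \o alphaB i)
  (G := alpha V i \o thread_emb (true, i))) (fsuppT z) => s _.
have sb := valP s; have /andP[] := sb; rewrite suppE => /andP[s1 s2] sm.
rewrite -[LHS]/(thread_emb (false, i) (alphaB i << s >>)) -[RHS]/(alpha V i (thread_emb (true, i) << s >>)).
have -> : << s >> = bvec K m I (ipos (true, i)) (val s).
  by rewrite /bvec insubT //=; congr (<< _ >>); apply: val_inj.
have -> : alphaB i (bvec K m I (ipos (true, i)) (val s)) = bvec K m I (ipos (false, i)) (succn (val s)) :=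
  bar_map_vec K succn _ sb.
rewrite (@thread_emb_vec (true, i)) ?s1 //.
have [sl|sl] := leqP (val s).+1 (s0 + l).
  rewrite (@thread_emb_vec (false, i)) ?sl ?leqW // subSn //.
  by apply: (@t_rel _ (true, i)); exact: sub_bounds.
rewrite (bvec_out (ipos (false, i))) ?linear0; last by rewrite [(_ <= s0 + l)%N]leqNgt sl andbF.
rewrite (sub_last s2 sl).
by rewrite (thread_last bt).
Qed.

Lemma thread_emb_beta i z :
  thread_emb (false, i) (betaB i z) = beta V i (thread_emb (true, ordS i) z).
Proof.
apply: (eq_on_fsupp (F := thread_emb (false, i) \o betaB i)
  (G := beta V i \o thread_emb (true, ordS i))) (fsuppT z) => s _.
have sb := valP s; have /andP[] := sb; rewrite suppE => /andP[s1 s2] sm.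
rewrite -[LHS]/(thread_emb (false, i) (betaB i << s >>)) -[RHS]/(beta V i (thread_emb (true, ordS i) << s >>)).
have -> : << s >> = bvec K m I (ipos (true, ordS i)) (val s).
  by rewrite /bvec insubT //=; congr (<< _ >>); apply: val_inj.
have -> : betaB i (bvec K m I (ipos (true, ordS i)) (val s)) = bvec K m I (ipos (false, i)) (predn (val s)) :=
  bar_map_vec K predn _ sb.
rewrite (@thread_emb_vec (true, ordS i)) ?s1 //.
have s00 : (0 < s0)%N by rewrite /s0 doubleS.
have [sl|sl] := leqP (val s) s0.
  have -> : val s = s0 by lia.
  rewrite (bvec_out (ipos (false, i))) ?linear0; last by rewrite negb_and -ltnNge prednK // leqnn.
  by rewrite subnn (thread_first bt).
rewrite (@thread_emb_vec (false, i)) ?pred_bounds //.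
have [-> sl'] := sub_pred sl s2.
exact: (@t_rel _ (false, i)).
Qed.

Let term_map d d' g (j : nat) v : (forall s, in_bar (ipos d) s -> bar_map K m I g (ipos d) (ipos d') (bvec K m I (ipos d) s)
    = bvec K m I (ipos d') (g s)) -> (j <= l)%N ->
  bar_map K m I g (ipos d) (ipos d') (@thread_term d j v) = X j d v *: bvec K m I (ipos d') (g (s0 + j)).
Proof.
move=> h jl; rewrite /thread_term linearZ /=; have [pb|np] := boolP (in_bar (ipos d) (s0 + j)); first by rewrite h.
rewrite (cothread_supp bt) ?scale0r //; apply: contra np => /eqP <-.
by rewrite suppE leq_addr leq_add2l jl iposE pos_vertex eqxx.
Qed.

Lemma thread_proj_alpha i v : thread_proj (false, i) (alpha V i v) = alphaB i (thread_proj (true, i) v).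
Proof.
rewrite /thread_proj /= /thread_fun (linear_sum (alphaB i)).
under [RHS]eq_bigr => j _ do
  rewrite [alphaB i _](@term_map (true, i) (false, i) succn j v (@bar_map_vec K m I succn _ _)) -1?ltnS ?ltn_ord //.
rewrite big_ord_recl [RHS]big_ord_recr /= /thread_term (cothread_first bt) scale0r add0r.
rewrite [X in _ = _ + X](_ : _ = 0) ?addr0; last by rewrite bvec_out ?scaler0 // negb_and -!ltnNge ltnSn orbT.
apply: eq_bigr => j _; rewrite /= /bump /= add1n addnS; congr (_ *: _).
by apply/esym; exact: (@c_rel j (true, i)).
Qed.

Lemma thread_proj_beta i v :
  thread_proj (false, i) (beta V i v) = betaB i (thread_proj (true, ordS i) v).
Proof.
have s00 : (0 < s0)%N by rewrite /s0 doubleS.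
rewrite /thread_proj /= /thread_fun (linear_sum (betaB i)).
under [RHS]eq_bigr => j _ do
  rewrite [betaB i _](@term_map (true, ordS i) (false, i) predn j v (@bar_map_vec K m I predn _ _)) -1?ltnS ?ltn_ord //.
rewrite big_ord_recr [RHS]big_ord_recl /= /thread_term (cothread_last bt) scale0r addr0.
have b0 r : bvec K m I r (s0 + 0).-1 = 0.
  by rewrite addn0 bvec_out // negb_and -ltnNge prednK // leqnn.
rewrite [X in _ = X + _](_ : _ = 0) ?add0r; last first.
  by rewrite -[RHS](scaler0 _ (X 0%N (true, ordS i) v)); congr (_ *: _); exact: b0.
apply: eq_bigr => j _; rewrite /= /bump /= add1n addnS /=; congr (_ *: _).
by exact: (@c_rel j (false, i)).
Qed.

Let pairs_shift j j' d : (j < l)%N -> (j' < l)%N -> X j.+1 (next d) (Y j'.+1 (next d)) = X j d (Y j' d).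
Proof. by move=> jl j'l; apply/esym; apply: c_rel => //; exact: t_rel. Qed.

Let pair_diag j : (j <= l)%N -> X j (iter j (@next m) (next c)) (Y j (iter j (@next m) (next c))) = 1.
Proof.
elim: j => [|j IH] jl; first exact: (thread_unit bt).
by rewrite iterS pairs_shift // IH // ltnW.
Qed.

Let pair_first j d : c.1 = false -> (0 < j <= l)%N -> X j d (Y 0%N d) = 0.
Proof.
case: j => // j c0 /= jl; case: d => -[] i; last first.
  by rewrite (thread_supp bt) ?linear0 //= /next c0.
rewrite -(ord_predK i) -(@c_rel j (false, ord_pred i) 0) ?linear0 //=.
by rewrite (thread_first bt).
Qed.

Let copair_first j d : c.1 = true -> (0 < j <= l)%N -> X 0%N d (Y j d) = 0.
Proof.
case: j => // j c1 /= jl; case: d => -[] i.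
  by rewrite (cothread_supp bt) //= /next c1.
by rewrite (@t_rel j (true, i) jl) (cothread_first bt).
Qed.

Let pair_lower j j' d : c.1 = false -> (j' < j <= l)%N -> X j d (Y j' d) = 0.
Proof.
move=> c0; elim: j' j d => [|j' IH] [|j] d // /andP[jj jl]; first exact: pair_first.
have [d' <-] : exists d', next d' = d.
  by case: d => -[] i; [exists (false, ord_pred i); rewrite /next /= ord_predK | exists (true, i)].
by rewrite pairs_shift ?IH //; lia.
Qed.

Let pair_upper j j' d : c.1 = true -> (j < j' <= l)%N -> X j d (Y j' d) = 0.
Proof.
move=> c1; elim: j j' d => [|j IH] [|j'] d // /andP[jj jl]; first exact: copair_first.
have [d' <-] : exists d', next d' = d.
  by case: d => -[] i; [exists (false, ord_pred i); rewrite /next /= ord_predK | exists (true, i)].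
by rewrite pairs_shift ?IH //; lia.
Qed.

(** A long bar passes a vertex several times, so several functionals meet several vectors there. The
    matrix of their values is triangular with 1 on the diagonal, upper or lower according to the
    left end. *)
Lemma thread_proj_emb_inj d : injective (thread_proj d \o thread_emb d).
Proof.
suff h z : thread_proj d (thread_emb d z) = 0 -> z = 0.
  move=> z z' /= zz; apply/eqP; rewrite -subr_eq0; apply/eqP/h.
  by rewrite !linearB; apply/eqP; rewrite subr_eq0; apply/eqP.
move=> z0; pose zc j : K := bco K m I (ipos d) (s0 + j) z.
have embE w : thread_emb d w = \sum_(j < l.+1) (bco K m I (ipos d) (s0 + j) w : K) *: Y j d.
  apply: (fsupp_ind (P := fun w => thread_emb d w = \sum_(j < l.+1) (bco K m I (ipos d) (s0 + j) w : K) *: Y j d)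
    _ _ _ (fsuppT w)).
  - by rewrite linear0 big1 // => j _; rewrite linear0 scale0r.
  - move=> a u v hu hv; rewrite linearP hu hv scaler_sumr -big_split; apply: eq_bigr => j _.
    by rewrite linearP scalerDl scalerA.
  move=> s _; have /andP[] := valP s; rewrite suppE => /andP[s1 s2] sm.
  have sl : (val s - s0 < l.+1)%N by rewrite ltnS leq_subLR.
  have -> : thread_emb d << s >> = Y (val s - s0) d by exact: free_liftU.
  rewrite (bigD1 (Ordinal sl)) //= bcoU subnKC // eqxx scale1r big1 ?addr0 // => j jn.
  rewrite bcoU; case: eqP => [e|_]; last by rewrite scale0r.
  by case/negP: jn; apply/eqP/val_inj => /=; rewrite e addKn.
have zc_out j : ~~ (s0 + j == ipos d %[mod m.*2])%N -> zc j = 0.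
  by move=> nj; apply: bco_out; rewrite (negbTE nj) andbF.
have row j : (j <= l)%N -> (s0 + j == ipos d %[mod m.*2])%N -> \sum_(j' < l.+1) zc j' * X j d (Y j' d) = 0.
  move=> jl jm; have := congr1 (bco K m I (ipos d) (s0 + j)) z0; rewrite linear0 => h; rewrite -[RHS]h {h}.
  rewrite [X in _ = _ X]/= /thread_fun (linear_sum (bco K m I (ipos d) (s0 + j))).
  rewrite [RHS](bigD1 (Ordinal (jl : j < l.+1)%N)) //= [X in _ = _ + X]big1 ?addr0 => [|j' j'n].
    rewrite /thread_term linearZ /= bco_vec suppE leq_addr leq_add2l jl jm eqxx /= [_ *: _]mulr1.
    by rewrite embE linear_sum; apply: eq_bigr => j' _; rewrite linearZ.
  rewrite /thread_term linearZ /= bco_vec eqn_add2l; case: (eqVneq j j') => [e|_]; last by rewrite andbF [_ *: _]mulr0.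
  by case/negP: j'n; apply/eqP/val_inj; rewrite /= e.
have diag j : (j <= l)%N -> (s0 + j == ipos d %[mod m.*2])%N -> X j d (Y j d) = 1.
  move=> jl /eqP jm; have -> : d = iter j (@next m) (next c); last exact: pair_diag.
  by apply: pos_inj; rewrite -pos_vertex jm iposE.
suff zc0 j : (j <= l)%N -> zc j = 0.
  apply: (@bco_ext K m I (ipos d)) => p /andP[]; rewrite suppE => /andP[p1 p2] _; rewrite linear0.
  by rewrite -(subnKC p1); apply: zc0; lia.
have step k : (k <= l)%N -> (forall j', (j' <= l)%N -> j' != k -> zc j' * X k d (Y j' d) = 0) -> zc k = 0.
  move=> kl h; have [km|/zc_out //] := boolP (s0 + k == ipos d %[mod m.*2])%N.
  have := row k kl km; rewrite (bigD1 (Ordinal (kl : k < l.+1)%N)) //= big1 ?addr0 ?diag ?mulr1 // => j' j'n.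
  by apply: h; [rewrite -ltnS | move: j'n; apply: contra => /eqP e; apply/eqP/val_inj].
(* Ascending induction for a closed left end, descending for an open one. *)
case c1 : c.1.
  have [n nE] : exists n, (l - j <= n)%N by exists (l - j)%N.
  clear nE n; elim/ltn_ind: j => j IH jl; apply: step => // j' j'l j'j.
  have [lt|le] := ltnP j' j; first by rewrite IH ?mul0r.
  by rewrite pair_upper ?mulr0 // j'l andbT ltn_neqAle eq_sym j'j.
move: {2}(l - j)%N (leqnn (l - j)) => n; elim: n j => [|n IH] j jn jl; apply: step => // j' j'l j'j.
  by rewrite pair_lower ?mulr0 // jl andbT; lia.
have [lt|le] := ltnP j j'; first by rewrite IH ?mul0r //; lia.
by rewrite pair_lower ?mulr0 // jl andbT ltn_neqAle j'j.
Qed.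

(** In finite dimension the composite of embedding and projection is bijective, so V is the bar plus
    the kernel of the projection. The bound drops at [next c], where the bar begins. *)
Lemma bar_split : exists J W, [/\ valid_barcode m J, grep_iso V (grep_sum (bar_grep K m J) W) &
  exists2 N' : vertex m -> nat, (forall d, bounded (space W d) (N' d)) & (forall d, N' d <= N d)%N /\ (N' (next c) < N (next c))%N].
Proof.
have bij d : bijective (thread_proj d \o thread_emb d).
  have inj : injective (thread_emb d) by move=> x y xy; apply: (@thread_proj_emb_inj d); rewrite /= xy.
  have bB : bounded (B d) (N d) := bounded_inj inj (@bN d).
  exact: (@injective_bij K (B d) (N d) (thread_proj d \o thread_emb d) bB (@thread_proj_emb_inj d)).
have kA i x : thread_proj (true, i) x = 0 -> thread_proj (false, i) (alpha V i x) = 0.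
  by move=> x0; rewrite thread_proj_alpha x0 linear0.
have kB i x : thread_proj (true, ordS i) x = 0 -> thread_proj (false, i) (beta V i x) = 0.
  by move=> x0; rewrite thread_proj_beta x0 linear0.
pose W := @GRep K m (fun i => kernel (thread_proj (true, i))) (fun i => kernel (thread_proj (false, i)))
  (fun i => kernel_map (kA i)) (fun i => kernel_map (kB i)).
exists I, W; split=> //.
  apply: grep_iso_sym; exists (fun i => kernel_sum (u := thread_proj (true, i)) (thread_emb (true, i))),
    (fun i => kernel_sum (u := thread_proj (false, i)) (thread_emb (false, i))).
  split=> [i|i|i [z k]|i [z k]].
  - exact: (kernel_sum_bij (bij (true, i))).
  - exact: (kernel_sum_bij (bij (false, i))).
  - by rewrite /kernel_sum /= linearD -thread_emb_alpha.
  by rewrite /kernel_sum /= linearD -thread_emb_beta.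
have ux : thread_proj (next c) (Y 0%N (next c)) != 0.
  apply/eqP => p0; have := thread_unit bt.
  have zE : thread_emb (next c) (bvec K m I (ipos (next c)) s0) = Y 0%N (next c).
    by rewrite thread_emb_vec ?leqnn ?leq_addr // subnn.
  rewrite -zE (_ : bvec _ _ _ _ _ = 0) ?linear0; first by move/eqP; rewrite eq_sym oner_eq0.
  by apply: (@thread_proj_emb_inj (next c)); rewrite /= zE p0 !linear0.
pose N' d := if d == next c then (N d).-1 else N d.
have bk d : bounded (kernel (thread_proj d)) (N' d).
  rewrite /N'; case: eqP => [->|_]; first exact: (bounded_kernel_pred ux (@bN _)).2.
  exact: (bounded_kernel (@bN d)).
exists N'; first by move=> [[] i]; [exact: (bk (true, i)) | exact: (bk (false, i))].
split=> [d|]; rewrite /N'; first by case: ifP => // _; exact: leq_pred.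
by rewrite eqxx ltn_predL; exact: (bounded_kernel_pred ux (@bN _)).1.
Qed.

End BarSplit.

(** * Isomorphisms and Jordan blocks *)

Section GrepIso.
Variables (K : fieldType) (m : nat).
Implicit Types V W : grep K m.

Definition linear_of (A B : lmodType K) (f : A -> B) (lf : linear f) : {linear A -> B} :=
  HB.pack_for {linear A -> B} f (GRing.isLinear.Build K A B *:%R f lf).

Lemma grep_iso_trans V W U : grep_iso V W -> grep_iso W U -> grep_iso V U.
Proof.
move=> [p [q [bp bq qa qb]]] [p' [q' [bp' bq' qa' qb']]].
exists (fun i => p' i \o p i), (fun i => q' i \o q i); split=> i; try move=> x.
- exact: bij_comp (bp' i) (bp i).
- exact: bij_comp (bq' i) (bq i).
- by rewrite /= qa qa'.
by rewrite /= qb qb'.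
Qed.

Lemma grep_sum_iso V V' W W' : grep_iso V V' -> grep_iso W W' -> grep_iso (grep_sum V W) (grep_sum V' W').
Proof.
move=> [p [q [bp bq qa qb]]] [p' [q' [bp' bq' qa' qb']]].
have bm (A B C D : lmodType K) (u : {linear A -> B}) (w : {linear C -> D}) :
    bijective u -> bijective w -> bijective (pair_map u w).
  move=> [u' uK Ku] [w' wK Kw]; exists (fun x => (u' x.1, w' x.2)) => -[x y].
    by rewrite /pair_map /= uK wK.
  by rewrite /pair_map /= Ku Kw.
exists (fun i => pair_map (p i) (p' i)), (fun i => pair_map (q i) (q' i)).
split=> i; [exact: bm | exact: bm | case=> x y | case=> x y].
  by rewrite /= /pair_map /= qa qa'.
by rewrite /= /pair_map /= qb qb'.
Qed.

Lemma grep_sumA V W U : grep_iso (grep_sum (grep_sum V W) U) (grep_sum V (grep_sum W U)).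
Proof.
have la (A B C : lmodType K) : linear (fun x : A * B * C => (x.1.1, (x.1.2, x.2))) by [].
have ba (A B C : lmodType K) : bijective (linear_of (la A B C)).
  by exists (fun x => (x.1, x.2.1, x.2.2)) => [[[x y] z]|[x [y z]]].
exists (fun i => linear_of (la _ _ _)), (fun i => linear_of (la _ _ _)); split=> i; [exact: ba | exact: ba | | ].
  by case=> [[x y] z].
by case=> [[x y] z].
Qed.

Lemma rV0_eq (x y : 'rV[K]_0) : x = y.
Proof. by apply/rowP => -[]. Qed.

Lemma grep_sum0l V : grep_iso (grep_sum (grep0 K m) V) V.
Proof.
have l2 (A : lmodType K) : linear (fun x : 'rV[K]_0 * A => x.2) by [].
have b2 (A : lmodType K) : bijective (linear_of (l2 A)).
  by exists (pair 0) => [[x y]|y] //=; congr pair; exact: rV0_eq.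
by exists (fun i => linear_of (l2 _)), (fun i => linear_of (l2 _)); split=> i; [exact: b2 | exact: b2 | case | case].
Qed.

Lemma grep_sum0r V : grep_iso V (grep_sum V (grep0 K m)).
Proof.
have l2 (A : lmodType K) : linear (fun x : A => (x, 0 : 'rV[K]_0)).
  by move=> a x y; congr pair; exact: rV0_eq.
have b2 (A : lmodType K) : bijective (linear_of (l2 A)).
  by exists fst => [y|[x y]] //=; congr pair; exact: rV0_eq.
by exists (fun i => linear_of (l2 _)), (fun i => linear_of (l2 _)); split=> i; [exact: b2 | exact: b2 | |] => x; congr pair; exact: rV0_eq.
Qed.

Lemma grep_iso_refl V : grep_iso V V.
Proof. by exists (fun i => idfun), (fun i => idfun); split=> i //; exists idfun. Qed.

Local Notation bigsum := (foldr (@grep_sum K m) (grep0 K m)).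

Lemma bigsum_cat s1 s2 : grep_iso (grep_sum (bigsum s1) (bigsum s2)) (bigsum (s1 ++ s2)).
Proof.
elim: s1 => [|V s1 IH] /=; first exact: grep_sum0l.
apply: grep_iso_trans (grep_sumA _ _ _) _.
by apply: grep_sum_iso IH; exact: grep_iso_refl.
Qed.

(** [jordan_grep] for an arbitrary endomorphism, so that it can be split by induction on the
    dimension. *)
Definition loop_grep (W : vectType K) (T : 'End(W)) : grep K m :=
  @GRep K m (fun=> W) (fun=> W) (fun i : 'I_m => if val i == 0 then T else \1%VF) (fun=> idfun).

Lemma lfun_inj_bij (W : vectType K) (T : 'End(W)) : injective T -> bijective T.
Proof.
move=> iT; apply: inj_surj_bij => // y; have k0 : lker T == 0%VS by apply/lker0P.
by exists (T^-1%VF y); rewrite lker0_lfunVK.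
Qed.

Lemma loop_split (W : vectType K) (T : 'End(W)) (U U' : {vspace W}) : bijective T ->
  (T @: U <= U)%VS -> (T @: U' <= U')%VS -> (U + U')%VS = fullv -> (U :&: U')%VS = 0%VS ->
  exists (S : 'End(subvs_of U)) (S' : 'End(subvs_of U')), [/\ bijective S, bijective S' &
    grep_iso (loop_grep T) (grep_sum (loop_grep S) (loop_grep S'))].
Proof.
move=> bT TU TU' UU' UI.
have restr (D : {vspace W}) : (T @: D <= D)%VS ->
    exists2 S : 'End(subvs_of D), bijective S & forall x, vsval (S x) = T (vsval x).
  move=> TD; exists (linfun (vsproj D \o T \o vsval)); last first.
    by move=> x; rewrite lfunE /= vsprojK // (subvP TD) // memv_img // subvsP.
  apply: lfun_inj_bij => x y /(congr1 vsval).
  by rewrite !lfunE /= !vsprojK ?(subvP TD) ?memv_img ?subvsP // => /(bij_inj bT) /val_inj.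
have [S bS SE] := restr U TU; have [S' bS' SE'] := restr U' TU'.
exists S, S'; split=> //; apply: grep_iso_sym.
have ls : linear (fun x : subvs_of U * subvs_of U' => vsval x.1 + vsval x.2).
  move=> a [x1 x2] [y1 y2]; rewrite -[LHS]/(vsval (a *: x1 + y1) + vsval (a *: x2 + y2)).
  by rewrite !linearP scalerDr addrACA.
have bs : bijective (linear_of ls).
  apply: inj_surj_bij => [x y /eqP|w]; last first.
    have : w \in (U + U')%VS by rewrite UU' memvf.
    by case/memv_addP => u uU [v vU ->]; exists (vsproj U u, vsproj U' v); rewrite /= !vsprojK.
  rewrite -subr_eq0 => /eqP; rewrite -linearB /= => xy.
  have x1 : vsval (x - y).1 = - vsval (x - y).2 by apply/eqP; rewrite -addr_eq0 xy.
  have : vsval (x - y).1 \in (U :&: U')%VS by rewrite memv_cap subvsP x1 memvN subvsP.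
  rewrite UI memv0 => /eqP x10; move: x1; rewrite x10 => /eqP; rewrite eq_sym oppr_eq0 => /eqP x20.
  apply/eqP; rewrite -subr_eq0; apply/eqP; rewrite [x - y]surjective_pairing.
  by congr pair; apply: val_inj.
exists (fun i => linear_of ls), (fun i => linear_of ls); split=> i; [exact: bs | exact: bs | | by []].
move=> [x y] /=; rewrite /pair_map /=; case: eqP => _; last by rewrite !id_lfunE.
by rewrite SE SE' linearD.
Qed.

Lemma loop_decomposition n (W : vectType K) (T : 'End(W)) : bijective T -> (\dim {:W} <= n)%N ->
  exists js : seq (jordan K), grep_iso (loop_grep T) (bigsum (map (jordan_grep m) js)).
Proof.
elim: n W T => [|n IH] W T bT dW.
  move: dW; rewrite leqn0 dimv_eq0 => /eqP W0; exists [::] => /=.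
  have W0' (x : W) : x = 0 by have := memvf x; rewrite W0 memv0 => /eqP.
  have b0 : bijective (\0%R : {linear W -> 'rV[K]_0}).
    by exists (fun=> 0) => x; [rewrite [RHS]W0' | exact: rV0_eq].
  by exists (fun=> \0%R), (fun=> \0%R); split=> i //= x; exact: rV0_eq.
have [indec|ndec] := pselect (indecomposable_pair T).
  by exists [:: Jordan bT indec]; exact: grep_sum0r.
have [W0|W0] := eqVneq (fullv : {vspace W}) 0%VS.
  by apply: IH => //; rewrite W0 dimv0.
have [U [U' [TU TU' UU' UI [U0 U0']]]] : exists U U' : {vspace W}, [/\ (T @: U <= U)%VS, (T @: U' <= U')%VS,
    (U + U')%VS = fullv, (U :&: U')%VS = 0%VS & U <> 0%VS /\ U' <> 0%VS].
  apply: contrapT => h; apply: ndec; split=> // U U' TU TU' UU' UI.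
  apply: contrapT => /not_orP[U0 U0']; apply: h; by exists U, U'.
have [S [S' [bS bS' iso]]] := loop_split bT TU TU' UU' UI.
have dUU : (\dim U + \dim U' = \dim {:W})%N by rewrite -UU' dimv_disjoint_sum.
have dU : (0 < \dim U)%N by rewrite lt0n dimv_eq0; apply/eqP.
have dU' : (0 < \dim U')%N by rewrite lt0n dimv_eq0; apply/eqP.
have sub (D : {vspace W}) : \dim {: subvs_of D} = \dim D by rewrite dimvf /dim.
have [|js iso1] := IH _ _ bS; first by rewrite sub; lia.
have [|js' iso2] := IH _ _ bS'; first by rewrite sub; lia.
exists (js ++ js'); rewrite map_cat; apply: grep_iso_trans iso _.
exact: grep_iso_trans (grep_sum_iso iso1 iso2) (bigsum_cat _ _).
Qed.

End GrepIso.

(** * Representations by isomorphisms *)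

Section BijectiveGrep.
Variables (K : fieldType) (m : nat) (V : grep K m).
Hypothesis bA : forall i, bijective (alpha V i).
Hypothesis bB : forall i, bijective (beta V i).

Lemma rel_iso (W : lmodType K) c (g : {linear space V c -> W}) : bijective g ->
  exists2 g' : {linear space V (next c) -> W}, bijective g' & forall x y, rel V c x y -> g x = g' y.
Proof.
case: c g => -[] i g bg; last first.
  by exists (g \o beta V i); [exact: bij_comp bg (bB i) | move=> x y ->].
have [a [aK Ka]] := linear_inverse (bA i).
exists (g \o a) => [|x y -> /=]; last by rewrite aK.
by apply: (bij_comp bg); exists (alpha V i).
Qed.

(** From the even space at [i0] all spaces are identified with W along the circle; the monodromy is
    left over at the last map, [alpha] at [i0]. *)
Lemma bijective_loop (i0 : 'I_m) (W : vectType K) (g0 : {linear even_space V i0 -> W}) : val i0 = 0%N ->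
  bijective g0 -> exists2 T : 'End(W), bijective T & grep_iso V (loop_grep m T).
Proof.
move=> i00 bg0; pose c0 : vertex m := (false, i0); pose v j : vertex m := iter j (@next m) c0.
have m0 : (0 < m)%N by case: (m) i0 {i00 g0 bg0 c0 v} => [[]|].
have vneq j k : (j < k < m.*2)%N -> v j != v k.
  move=> /andP[jk km]; apply/eqP => /(congr1 (@pos m)) e; have := congr1 (modn^~ m.*2) e.
  rewrite /= !pos_iter => /eqP; rewrite eqn_modDl !modn_small //; last exact: ltn_trans jk km.
  by move/eqP => jk'; move: jk; rewrite jk' ltnn.
(* One vertex at a time; the 2m vertices are distinct, so earlier values are kept. *)
have GP k : (k <= m.*2.-1)%N -> exists G : forall c, {linear space V c -> W},
    (forall j, (j <= k)%N -> bijective (G (v j))) /\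
    (forall j x y, (j < k)%N -> rel V (v j) x y -> G (v j) x = G (v j.+1) y).
  elim: k => [|k IH] km.
    exists (single (T := fun c => {linear space V c -> W}) (fun=> \0%R) (g0 : {linear space V c0 -> W})).
    by split=> // j; rewrite leqn0 => /eqP ->; rewrite singleE.
  have [|G [bG GE]] := IH; first exact: ltnW.
  have [g bg gE] := rel_iso (bG k (leqnn k)).
  pose G' : forall c, {linear space V c -> W} :=
    single (T := fun c => {linear space V c -> W}) (c := v k.+1) G (g : {linear space V (v k.+1) -> W}).
  have Gk : G' (v k.+1) = g by exact: singleE.
  have Gj j : (j <= k)%N -> G' (v j) = G (v j).
    by move=> jk; apply: single_ne; rewrite eq_sym vneq // ltnS jk; lia.
  exists G'; split=> [j|j x y]; rewrite leq_eqVlt.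
    by case/orP => [/eqP ->|jk]; [rewrite Gk | rewrite Gj //; exact: bG].
  case/orP => [/eqP [jE]|jk]; last by rewrite !Gj //; [exact: GE | exact: ltnW].
  by move: x y; rewrite jE Gk Gj //; exact: gE.
have [G [bG GE]] := GP _ (leqnn m.*2.-1).
have vE c : c != (true, i0) -> exists2 j, (j < m.*2.-1)%N & c = v j.
  move=> cn; have pc : (1 < pos c <= m.*2)%N.
    case: c cn => -[] i cn; rewrite /pos /=; have := ltn_ord i; last by lia.
    have : val i != 0%N by apply: contra cn => /eqP i1; apply/eqP; congr pair; apply: val_inj; rewrite i1 i00.
    by rewrite /=; lia.
  exists (pos c - 2)%N; first by lia.
  have p0 : pos c0 = 2%N by rewrite /pos /= [nat_of_ord i0]i00.
  apply: pos_inj; rewrite pos_iter p0 subnKC //; clear -pc; lia.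
have vl : v m.*2.-1 = (true, i0).
  apply: pos_inj; rewrite pos_iter /pos /= i00 /=.
  have -> : (0.*2 + 1 + ~~ false + m.*2.-1 = m.*2 + 1)%N by lia.
  by rewrite modnDl.
have bG' c : bijective (G c).
  have [->|cn] := eqVneq c (true, i0); first by rewrite -vl; exact: bG.
  by have [j jm ->] := vE c cn; apply: bG; exact: ltnW.
have GE' c x y : c != (true, i0) -> rel V c x y -> G c x = G (next c) y.
  by move=> cn; have [j jm cE] := vE c cn; move: x y; rewrite cE => x y; exact: GE.
have [h [hK Kh]] := linear_inverse (bG' (true, i0)).
pose T : 'End(W) := linfun (G (false, i0) \o alpha V i0 \o h).
have bT : bijective T.
  apply: (@eq_bij _ _ (G (false, i0) \o alpha V i0 \o h)) => [|x]; last by rewrite lfunE.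
  apply: bij_comp; first exact: bij_comp (bG' (false, i0)) (bA i0).
  by exists (G (true, i0)).
exists T => //; exists (fun i => G (true, i)), (fun i => G (false, i)).
split=> [i|i|i x|i x]; [exact: (bG' (true, i)) | exact: (bG' (false, i)) | | exact: (GE' (false, i))].
rewrite /=; case: eqP => i1; last first.
  rewrite id_lfunE; apply/esym; apply: (GE' (true, i)) => //.
  by apply/eqP => -[e]; apply: i1; rewrite e.
have ii : i = i0 by apply: val_inj; exact: etrans i1 (esym i00).
move: x; rewrite ii => x.
by rewrite lfunE /= hK.
Qed.

End BijectiveGrep.

(** Bars are split off while some vector begins one. Afterwards every [beta] is injective and every
    [alpha] surjective, so dimensions do not increase around the circle; hence they are constant and
    all maps are bijective. *)
Lemma decomposition_ex (K : fieldType) m (V : grep K m) (N : vertex m -> nat) :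
  (forall c, bounded (space V c) (N c)) -> exists bars, decomposition V bars.
Proof.
have [n nN] : exists n, (\sum_c N c <= n)%N by exists (\sum_c N c)%N.
elim/ltn_ind: n V N nN => n IH V N nN bN.
have [[c [x [Lx nx]]]|nex] := pselect (exists c x, left_open (V := V) (c := c) x /\ ~ left_dead x).
  have [b [l [Y [X bt]]]] := bar_thread_ex bN Lx nx.
  have [J [W [vJ iso [N' bW [NN' Nc]]]]] := bar_split bN bt.
  have sN : (\sum_d N' d < \sum_d N d)%N.
    rewrite (bigD1 (next c)) //= [X in (_ < X)%N](bigD1 (next c)) //= -addSn; apply: leq_add => //.
    exact: leq_sum.
  have [bars [vb [js isoW]]] := IH _ (leq_trans sN nN) W N' (leqnn _) bW.
  exists (J :: bars); split; first by rewrite /= vJ.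
  exists js => /=; apply: grep_iso_trans iso _.
  by apply: grep_sum_iso isoW; exact: grep_iso_refl.
have LD c x : left_open (V := V) (c := c) x -> left_dead x.
  by move=> Lx; apply: contrapT => nx; apply: nex; exists c, x.
have iB i : injective (beta V i).
  move=> x y xy; apply/eqP; rewrite -subr_eq0; apply/eqP; apply: (LD (false, i)).
  by rewrite /= linearB xy subrr.
have sA i y : exists x, alpha V i x = y.
  by have [x xy] := LD (true, i) y Logic.I; exists x.
exists [::]; split=> //=.
clear n nN IH nex LD; case: m V N bN iB sA => [|m] V N bN iB sA.
  exists [::]; exists (fun=> \0%R), (fun=> \0%R); by split; case.
have /choice[d dP] c : exists d, exists e : 'I_d -> space V c, independent e /\ spanning e.
  by have [d [_ de]] := basis_ex (bN c); exists d.
have d1 i : (d (true, ordS i) <= d (false, i))%N.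
  have [e [ie se]] := dP (true, ordS i); have [e' [ie' se']] := dP (false, i).
  exact: independent_le_spanning (independent_inj ie (iB i)) se'.
have d2 i : (d (false, i) <= d (true, i))%N.
  have [e [ie se]] := dP (true, i); have [e' [ie' se']] := dP (false, i).
  have [w wP] := choice (fun j => sA i (e' j)).
  have iw : independent (alpha V i \o w) by move=> a; under eq_bigr do rewrite /= wP; exact: ie'.
  exact: independent_le_spanning (independent_lift iw) se.
have dE i : d (true, ordS i) = d (true, i).
  have sumE : (\sum_i d (true, ordS i) = \sum_i d (true, i))%N.
    by rewrite [RHS](reindex_inj (can_inj (@ordSK m.+1))).
  have [_ /esym] := leqif_sum (fun i (_ : xpredT i) => leqif_eq (leq_trans (d1 i) (d2 i))).
  by rewrite sumE eqxx => /forallP/(_ i) /eqP.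
have dB i : bijective (beta V i).
  have [e [ie se]] := dP (true, ordS i); have [e' [ie' se']] := dP (false, i).
  have E : d (true, ordS i) = d (false, i) by apply/eqP; rewrite eqn_leq d1 dE d2.
  by move: e ie se; rewrite E => e ie se; exact: inj_surj ie se' (iB i).
have dA i : bijective (alpha V i).
  have [e [ie se]] := dP (true, i); have [e' [ie' se']] := dP (false, i).
  have E : d (true, i) = d (false, i) by apply/eqP; rewrite eqn_leq d2 -dE d1.
  by move: e ie se; rewrite E => e ie se; exact: surj_inj se ie' (sA i).
have [e [ie se]] := dP (false, ord0).
have le : linear (fun a : 'rV[K]_(d (false, ord0)) => \sum_j a 0 j *: e j).
  move=> a x y; rewrite scaler_sumr -big_split; apply: eq_bigr => j _.
  by rewrite !mxE scalerDl scalerA.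
have be : bijective (linear_of le).
  apply: inj_surj_bij => [x y /eqP|y].
    rewrite -subr_eq0 -linearB => /eqP /= h; apply/rowP => j; apply/eqP; rewrite -subr_eq0.
    by have := ie _ h j; rewrite !mxE => ->.
  have [a ->] := se y; exists (\row_j a j); apply: eq_bigr => j _; by rewrite mxE.
have [g [gK Kg]] := linear_inverse be.
have bg : bijective g by exists (linear_of le).
have [T bT iso] := bijective_loop dA dB (i0 := ord0) erefl bg.
have [js isoT] := loop_decomposition m.+1 bT (leqnn _).
by exists js; exact: grep_iso_trans iso isoT.
Qed.
(** * The representations of a tame map *)

Section SubspaceClasses.
Variables (R : realType) (K : fieldType) (X : topologicalType) (A : set X) (k : nat).
Local Notation H := (homology R K k (set0 : set A)).
Implicit Types (x y : H) (c d : chain R K k A).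

Lemma null_val c d : nullc A set0 (fpush set_val c - fpush set_val d : chain R K k X) <->
  nullc setT set0 (c - d).
Proof.
rewrite -linearB; split=> -[e [eA /chain_in0/subr0_eq E]].
  exists (corestrict R K A k.+1 e); rewrite chain_inT; split=> //.
  by rewrite (bd_restrict eA) -E restrict_val subrr rpred0.
exists (fpush set_val e); rewrite val_chain_in; split=> //.
by rewrite bd_val -E subrr rpred0.
Qed.

Definition crep x : chain R K k A := sval (cid (hclass_ex x)).

Lemma crep_cyc x : cyc set0 (crep x).
Proof. by rewrite /crep; case: cid => c [h]. Qed.

Lemma crepE x : hclass (crep_cyc x) = x.
Proof.
have [h e] := svalP (cid (hclass_ex x)); rewrite [RHS]e; apply/hclass_eq.
by rewrite /crep subrr; exact: nullc0.
Qed.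

(** A chosen cycle, seen in the ambient space, where the geometric lemmas apply; it is linear in x
    only up to boundaries in A. *)
Definition mrep x : chain R K k X := fpush set_val (crep x).

Lemma mrep_in x : mrep x \in chain_in A.
Proof. exact: val_chain_in. Qed.

Lemma mrep_cyc x : cyc set0 (mrep x).
Proof.
apply: (cyc_fpush (A := setT) (B := set0)) (crep_cyc x) => //; last exact: chain_inT.
by apply: continuous_subspaceT; exact: continuous_val.
Qed.

Lemma mrep_eq x y : nullc A set0 (mrep x - mrep y) -> x = y.
Proof. by move=> /null_val h; rewrite -(crepE x) -(crepE y); apply/hclass_eq. Qed.

Lemma mrep0 : nullc A set0 (mrep 0).
Proof.
rewrite -[mrep 0]subr0 -(linear0 (fpush (set_val : A -> X))); apply/null_val; rewrite -[X in _ - X](scale0r (crep 0)).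
by apply/(hclassZ 0 (crep_cyc 0) (crep_cyc 0)); rewrite scale0r crepE.
Qed.

Lemma mrep_eq0 x : nullc A set0 (mrep x) -> x = 0.
Proof. by move=> h; apply: mrep_eq; apply: nullcB => //; exact: mrep0. Qed.

Lemma mrepP a x y : nullc A set0 (mrep (a *: x + y) - (a *: mrep x + mrep y)).
Proof.
rewrite /mrep -linearP; apply/null_val.
apply/(hclass_eq (crep_cyc _) (bcondP a (crep_cyc x) (crep_cyc y))).
rewrite crepE (hclassP (crep_cyc x) (crep_cyc y) (a := a)) ?crepE //.
by rewrite subrr; exact: nullc0.
Qed.

Lemma mrep_ex (z : chain R K k X) : z \in chain_in A -> cyc set0 z ->
  exists x, nullc A set0 (z - mrep x).
Proof.
move=> zA z0; have c0 : cyc set0 (corestrict R K A k z) := restrict_cyc zA z0.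
exists (hclass c0); rewrite -{1}(val_restrict zA); apply/null_val.
by apply/(hclass_eq c0 (crep_cyc _)); rewrite crepE.
Qed.

Lemma mrep_sum N (a : 'I_N -> K) (v : 'I_N -> H) :
  nullc A set0 (mrep (\sum_i a i *: v i) - \sum_i a i *: mrep (v i)).
Proof.
elim: N a v => [|N IH] a v; first by rewrite !big_ord0 subr0; exact: mrep0.
rewrite !big_ord_recl; apply: nullc_trans (mrepP _ _ _) _.
have := IH (fun i => a (lift ord0 i)) (fun i => v (lift ord0 i)).
by congr (nullc _ _ _); zmod.
Qed.

Lemma bounded_homology N : (forall x : 'I_N.+1 -> chain R K k X, (forall i, x i \in chain_in A /\ cyc set0 (x i)) ->
    exists2 a : 'I_N.+1 -> K, (exists i, a i != 0) & nullc A set0 (\sum_i a i *: x i)) ->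
  bounded H N.
Proof.
move=> h v; have [|a ai an] := h (fun i => mrep (v i)).
  by move=> i; split; [exact: mrep_in | exact: mrep_cyc].
exists a => //; apply: mrep_eq0; rewrite -[mrep _](subrK (\sum_i a i *: mrep (v i))).
by apply: nullcD an; exact: mrep_sum.
Qed.

End SubspaceClasses.

Lemma induced_eq (R : realType) (K : fieldType) (X Y Z : topologicalType) (k : nat)
    (phi : continuousType X Z) (psi : continuousType Y Z)
    (x : homology R K k (set0 : set X)) (y : homology R K k (set0 : set Y))
    (c : chain R K k X) (d : chain R K k Y) (hc : cyc set0 c) (hd : cyc set0 d) :
  hclass hc = x -> hclass hd = y ->
  (Defs.induced R K k set0 set0 phi (fun _ => id) x = Defs.induced R K k set0 set0 psi (fun _ => id) y <->
   nullc (setT : set Z) set0 (fpush phi c - fpush psi d)).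
Proof.
move=> <- <-; rewrite /hclass /Defs.induced /= !induced_pi lquot_eqP [_ \in @is_bdry _ _ _ _ _]unfold_in.
rewrite -!push_fpush; split=> [/asboolP[e /= eA]|[e [_ eA]]].
  by exists e; rewrite chain_inT bdE.
by apply/asboolP; exists e; rewrite /= -bdE.
Qed.

(** * Critical and regular angles *)

Section CriticalData.
Variables (R : realType) (K : fieldType) (n : nat) (M : topologicalType) (f : M -> circle R).
Variable D : critical_data f.
Local Notation tau := (pi *+ 2 : R).
Local Notation m := (size (crit_angles D)).
Local Notation cr i := ((crit_angles D)`_i).
Local Notation rg i := ((reg_angles D)`_i).

Definition regular_values : set (circle R) := ~` [set angle x | x in [set` crit_angles D]].

Lemma crit_nth_ge0 i : (i < m)%N -> 0 < cr i <= tau.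
Proof.
move=> im; rewrite (allP (crit_le D)) ?mem_nth // andbT.
have := order_path_min lt_trans (crit_sorted D); move/allP; apply; exact: mem_nth.
Qed.

Lemma crit_nth_lt i j : (i < j)%N -> (j < m)%N -> cr i < cr j.
Proof.
move=> ij jm; have := path_sorted (crit_sorted D) => sc.
by apply: (sorted_ltn_nth lt_trans 0 sc); rewrite ?inE // (ltn_trans ij jm).
Qed.

Lemma open_regular_values : open regular_values.
Proof.
rewrite /regular_values; elim: (crit_angles D) => [|x s IH].
  rewrite (_ : ~` _ = setT); first exact: openT.
  by apply/seteqP; split=> // y _ [z]; rewrite /= in_nil.
rewrite (_ : ~` _ = (@angle R @` `]x, (x + tau)[%classic) `&` ~` [set (@angle R x) | x in [set` s]]).
  by apply: openI IH; apply: angle_open; exact: itv_open.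
apply/seteqP; split=> y.
  move=> ny; split; last by move=> [z zs zy]; apply: ny; exists z => //; rewrite /= inE (zs : z \in s) orbT.
  have [z /andP[xz zx] zy] := angle_ex x y; exists z => //=; rewrite in_itv /= zx andbT lt_neqAle xz andbT.
  apply/eqP => xz'; apply: ny; exists x; first by rewrite /= inE eqxx.
  by rewrite zy -xz'.
move=> [[z /=]]; rewrite in_itv /= => /andP[xz zx] zy ny [w /=].
rewrite inE => /orP[/eqP -> xy|ws wy]; last by apply: ny; exists w.
have xE : z = x.
  apply: (@angle_inj R x); [by rewrite ltW | | by rewrite zy xy].
  by rewrite lexx ltrDl tau_gt0.
by move: xz; rewrite xE ltxx.
Qed.

Lemma crit_gap i x : (i < m)%N -> (0 :: crit_angles D)`_i < x < cr i -> regular_values (angle x).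
Proof.
move=> im /andP[ix xi] [y /(nthP 0)[j jm <-] E].
have [i0 i1] := andP (crit_nth_ge0 im); have [j0 j1] := andP (crit_nth_ge0 jm).
have x0 : 0 < x.
  apply: le_lt_trans ix; case: (i) im {i0 i1 xi} => //= i' im.
  by apply/ltW; have /andP[] := crit_nth_ge0 (ltnW im).
have xj : x = cr j.
  have [h|h] := leP (cr j) x.
    by apply: (@angle_inj R (cr j)); [lra | lra | ].
  by apply: (@angle_inj R x); [lra | lra | ].
have [ij|ji] := leqP i j.
  move: ij; rewrite leq_eqVlt => /orP[/eqP ij|ij]; first by move: xi; rewrite xj -ij ltxx.
  by have := crit_nth_lt ij jm; lra.
case: i im ix xi ji {i0 i1} => //= i im ix xi; rewrite ltnS leq_eqVlt => /orP[/eqP ji|ji].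
  by move: ix; rewrite xj ji ltxx.
by have := crit_nth_lt ji (ltnW im); lra.
Qed.

Lemma crit_gap_last x : (0 < m)%N -> cr m.-1 < x < cr 0%N + tau -> regular_values (angle x).
Proof.
move=> m0 /andP[lx x0] [y /(nthP 0)[j jm <-] E].
have jl : cr j <= cr m.-1.
  have : (j <= m.-1)%N by rewrite -ltnS prednK.
  rewrite leq_eqVlt => /orP[/eqP -> //|jl]; apply/ltW/crit_nth_lt => //.
  by rewrite prednK.
have j0 : cr 0%N <= cr j.
  by case: (j) jm {jl E} => // j' jm; apply/ltW/crit_nth_lt.
have h : x = cr j by apply: (@angle_inj R (cr j)); [lra | lra | ].
by lra.
Qed.

Variable i : 'I_m.
Let w : R := periodic_nth (reg_angles D) i.+2.

Lemma reg_lt_crit : rg i < cr i.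
Proof. by have /andP[] := reg_crit (ltn_ord i). Qed.

Lemma reg_regular x : rg i <= x < cr i -> regular_values (angle x).
Proof.
by have /andP[h1 h2] := reg_crit (ltn_ord i) => /andP[x1 x2]; apply: (crit_gap (ltn_ord i)); lra.
Qed.

Lemma next_angle : angle (rg (ordS i)) = angle w.
Proof. by rewrite /w /periodic_nth size_reg /= [X in _ * X]pmulrn angle_add. Qed.

Let wE : (i.+1 < m)%N /\ w = rg i.+1 \/ i.+1 = m /\ w = rg 0%N + tau.
Proof.
rewrite /w /periodic_nth size_reg /=; have := ltn_ord i; rewrite leq_eqVlt => /orP[/eqP im|im].
  by right; rewrite im modnn divnn (leq_ltn_trans _ (ltn_ord i)) // mulr1.
by left; rewrite modn_small // divn_small // mulr0 addr0.
Qed.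

Lemma next_bounds : cr i < w <= rg i + tau.
Proof.
have [i0 i1] := andP (crit_nth_ge0 (ltn_ord i)); have m0 : (0 < m)%N by exact: leq_trans (ltn_ord i).
have /andP[/= r0 r1] := reg_crit m0.
have ri : 0 < rg i.
  have /andP[h _] := reg_crit (ltn_ord i); apply: le_lt_trans h.
  by case: (nat_of_ord i) (ltn_ord i) => //= i' im; apply/ltW; have /andP[] := crit_nth_ge0 (ltnW im).
have rr : rg 0%N <= rg i.
  case E : (nat_of_ord i) => [//|i']; have im := ltn_ord i; rewrite E in im.
  have /andP[h _] := reg_crit im; apply/ltW; apply: lt_trans h.
  have : cr 0%N <= cr i' by case: (i') im => // j jm; apply/ltW/crit_nth_lt => //; exact: ltnW.
  by move=> /=; lra.
case: wE => [[im ->]|[im ->]]; last by lra.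
have /andP[/= h1 h2] := reg_crit im; have /andP[_ h3] := crit_nth_ge0 im; lra.
Qed.

Lemma next_regular x : cr i < x <= w -> regular_values (angle x).
Proof.
move=> /andP[x1 x2]; case: wE => -[im wE'].
  by have /andP[/= h1 h2] := reg_crit im; apply: (crit_gap im) => /=; rewrite wE' in x2; lra.
have m0 : (0 < m)%N by exact: leq_trans (ltn_ord i).
have /andP[/= r0 r1] := reg_crit m0; apply: crit_gap_last => //; rewrite wE' in x2.
by rewrite -im /=; lra.
Qed.

End CriticalData.

(** * The pairing on the representations *)

Section FiberPairing.
Variables (R : realType) (K : fieldType) (n : nat) (M : topologicalType) (f : M -> circle R).
Hypotheses (hM : closed_manifold R n M) (f_tame : tame R f).
Variable D : critical_data f.
Variable mu : chain R K n M.
Hypothesis mu_cyc : cyc set0 mu.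
Hypothesis mu_point : forall y, ~ nullc setT (~` [set y]) mu.
Local Notation tau := (pi *+ 2 : R).
Local Notation m := (size (crit_angles D)).
Local Notation cr i := ((crit_angles D)`_i).
Local Notation rg i := ((reg_angles D)`_i).
Local Notation L a b := (levels f (cci a b)).
Local Notation F p := (fiber f p).
Local Notation B := (regular_values D).
Local Notation G k := (fiber_grep K D k).
Local Notation repr := (repr f B mu).
Let cf : continuous f. Proof. by case: f_tame => -[]. Qed.
Let fib : fibration_over R f B. Proof. exact: crit_fibration. Qed.
Let oB : open B. Proof. exact: open_regular_values. Qed.
Let ndr p : nbhd_deformation_retract R (F p). Proof. by case: f_tame => _ _ h _; exact: h. Qed.
Let Bt (i : 'I_m) : B (angle (rg i)).
Proof. by apply: (@reg_regular _ _ _ D i); rewrite lexx reg_lt_crit. Qed.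

Lemma fiber_bounded r q : n = (r + q)%N -> exists N : vertex m -> nat,
  forall c, bounded (space (G r) c) (N c).
Proof.
move=> nE; have /choice[N bN] c : exists N, bounded (space (G r) c) N; last by exists N => c; exact: bN.
case: c => -[] i.
  have [N h] := finite_cycles hM mu_cyc mu_point nE (closed_fiber cf (p := rg i)) (ndr (rg i)).
  by exists N; exact: bounded_homology.
have [N h] := finite_cycles hM mu_cyc mu_point nE (closed_fiber cf (p := cr i)) (ndr (cr i)).
by exists N; exact: bounded_homology.
Qed.

Lemma odd_space_vanish r : (n <= r)%N -> forall i (x : odd_space (G r) i), x = 0.
Proof.
move=> nr i x; apply: mrep_eq0.
exact: (fiber_vanish hM cf fib oB (@Bt i) nr (mrep_in x) (mrep_cyc x)).
Qed.

(** The fibers are equal, but the collars are given by real levels and have to be shifted by a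
    multiple of the period. *)
Lemma repr_angle r k p p' (y : chain R K k M) (Phi : {linear chain R K r M -> K^o}) :
  angle p = angle p' -> repr p y Phi -> repr p' y Phi.
Proof.
move=> pp [[V [oV FV PV]] [e [Y [[e0 re] sY dY]]]].
have Fpp : F p = F p' by rewrite /fiber pp.
have [j pj] := (angle_eqP _ _).1 pp.
have Lsh a b a' b' : a = a' + tau * j%:~R -> b = b' + tau * j%:~R -> L a b = L a' b'.
  move=> -> ->; rewrite -(@levels_shift R M f (cci (a' + tau * j%:~R) (b' + tau * j%:~R)) j); congr levels.
  by apply/seteqP; split=> t; rewrite /cci /= !lerD2r.
have Fsh a : F (p + a) = F (p' + a) by rewrite /fiber pj addrAC angle_add.
have pje : p - e = p' - e + tau * j%:~R by rewrite pj addrAC.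
have pje' : p + e = p' + e + tau * j%:~R by rewrite pj addrAC.
split; first by exists V; rewrite -Fpp.
exists e, Y; split; last by rewrite -Fpp.
  split=> // t tb; rewrite -(@angle_add R t j); apply: re.
  by rewrite pj; lra.
by move: sY; rewrite /susp !Fsh (Lsh _ _ _ _ pj pje') (Lsh _ _ _ _ pje pj).
Qed.

Lemma repr_null r k p (y : chain R K k M) (Phi : {linear chain R K r M -> K^o}) x x' :
  repr p y Phi -> nullc (F p) set0 (x - x') -> Phi x = Phi x'.
Proof.
move=> [[V [oV FV PV]] _] [e [eF /chain_in0/subr0_eq E]].
apply/eqP; rewrite -subr_eq0 -linearB E PV //; exact: chain_inS eF.
Qed.

Section Degrees.
Variables (r k : nat).
Hypothesis nE : n = (r + k.+1)%N.

Definition dual_cochain (i : 'I_m) (y : odd_space (G k) i) : {linear chain R K r M -> K^o} :=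
  sval (cid (repr_ex hM cf fib oB mu_cyc mu_point nE (@Bt i) (mrep_in y) (mrep_cyc y))).

Lemma dual_cochainP (i : 'I_m) (y : odd_space (G k) i) : repr (rg i) (mrep y) (@dual_cochain i y).
Proof. exact: svalP (cid (repr_ex hM cf fib oB mu_cyc mu_point nE (@Bt i) (mrep_in y) (mrep_cyc y))). Qed.

Definition fiber_pairing i (x : odd_space (G r) i) (y : odd_space (G k) i) : K :=
  dual_cochain y (mrep x).

Lemma fiber_pairingl (i : 'I_m) a x y z :
  @fiber_pairing i (a *: x + y) z = a * fiber_pairing x z + fiber_pairing y z.
Proof.
rewrite /fiber_pairing (repr_null (dual_cochainP z) (mrepP a x y)).
exact: linearP.
Qed.

Lemma fiber_pairingr (i : 'I_m) a x y z :
  @fiber_pairing i x (a *: y + z) = a * fiber_pairing x y + fiber_pairing x z.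
Proof.
have ryz := repr_lin cf fib oB a (@Bt i) (mrep_in y) (mrep_cyc y) (mrep_in z) (mrep_cyc z)
  (dual_cochainP y) (dual_cochainP z).
exact: (repr_uniq hM cf fib mu_cyc mu_point nE (dual_cochainP (a *: y + z)) ryz (mrepP a y z) (mrep_in x)
  (mrep_cyc x)).
Qed.

Lemma fiber_pairing_nondeg (i : 'I_m) y : (forall x, @fiber_pairing i x y = 0) -> y = 0.
Proof.
move=> h; apply: mrep_eq0.
apply: (right_nondeg hM cf fib oB mu_cyc nE (@Bt i) (mrep_in y) (mrep_cyc y) (dual_cochainP y)) => z zF z0.
by have [x zx] := mrep_ex zF z0; rewrite (repr_null (dual_cochainP y) zx); exact: h.
Qed.

End Degrees.

Let w (i : 'I_m) := periodic_nth (reg_angles D) i.+2.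
(** An intermediate regular level. For m = 1 the arc from [rg i] to [w i] is a full period, while
    the lemmas on arcs require less. *)
Let q (i : 'I_m) := (cr i + w i) / 2.

Let bounds (i : 'I_m) : [/\ rg i < cr i, cr i < q i, q i < w i & w i <= rg i + tau].
Proof. by have h := reg_lt_crit i; have := next_bounds i; rewrite -/(w i) /q => h2; split; lra. Qed.

Lemma relation_level i k (x : odd_space (G k) i) (y : odd_space (G k) (ordS i)) (z : chain R K k M) :
  z \in chain_in (F (q i)) -> nullc (L (q i) (w i)) set0 (mrep y - z) ->
  (alpha (G k) i x = beta (G k) i y <-> nullc (L (rg i) (q i)) set0 (mrep x - z)).
Proof.
move=> zF yz; have [b1 b2 b3 b4] := bounds i.
apply: (iff_trans (induced_eq (amap i) (bmap i) (crepE x) (crepE y))).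
apply: (transition_relation hM cf fib b1 (lt_trans b2 b3) b4 (amapP i) (bmapP i) _ _ (ndr (cr i))
  (crep_cyc x) (crep_cyc y) zF yz) => t ht; [exact: reg_regular ht | exact: next_regular ht].
Qed.

Lemma next_transport i k (y : odd_space (G k) (ordS i)) : exists z : chain R K k M,
  [/\ z \in chain_in (F (q i)), cyc set0 z & nullc (L (q i) (w i)) set0 (mrep y - z)].
Proof.
have [b1 b2 b3 b4] := bounds i; have t0 := tau_gt0 R.
apply: (transport cf fib _ _ _ _ (mrep_cyc y)); [lra | lra | |].
  by move=> t ht; apply: (@next_regular _ _ _ D i); rewrite -/(w i); lra.
apply: chain_inS (mrep_in y) => x; rewrite /fiber /= (next_angle i) => fx.
by exists (w i) => //; rewrite /cci /=; lra.
Qed.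

Lemma next_class i k (z : chain R K k M) : z \in chain_in (F (q i)) -> cyc set0 z ->
  exists y : odd_space (G k) (ordS i), nullc (L (q i) (w i)) set0 (mrep y - z).
Proof.
move=> zF z0; have [b1 b2 b3 b4] := bounds i; have t0 := tau_gt0 R.
have zL : z \in chain_in (L (q i) (w i)).
  by apply: chain_inS zF => x fx; exists (q i) => //; rewrite /cci /=; lra.
have [|||u [uF u0 zu]] := transport cf fib (p := w i) _ _ _ zL z0; [lra | lra | |].
  by move=> t ht; apply: (@next_regular _ _ _ D i); rewrite -/(w i); lra.
have uF' : u \in chain_in (F (rg (ordS i))) by rewrite /fiber (next_angle i).
have [y uy] := mrep_ex uF' u0; exists y; apply: nullc_sym; apply: nullc_trans zu _.
apply: nullcS uy => // x; rewrite /fiber /= (next_angle i) => fx.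
by exists (w i) => //; rewrite /cci /=; lra.
Qed.

Section Adjoint.
Variables (r k : nat).
Hypothesis nE : n = (r + k.+1)%N.

(** [pairing_eq] is used twice, over the arc from [rg i] to [q i] across the critical level and over
    the regular arc from [q i] to [w i]. *)
Lemma fiber_pairing_adj i x y x' y' : alpha (G r) i x = beta (G r) i y ->
  alpha (G k) i x' = beta (G k) i y' -> fiber_pairing nE x x' = fiber_pairing nE y y'.
Proof.
have [z [zF z0 yz]] := next_transport y; have [z' [z'F z'0 yz']] := next_transport y'.
move=> /(relation_level x zF yz) xz /(relation_level x' z'F yz') xz'.
have [b1 b2 b3 b4] := bounds i; have t0 := tau_gt0 R.
have Bq : B (angle (q i)) by apply: (@next_regular _ _ _ D i); rewrite -/(w i); lra.
have Bw : B (angle (w i)) by apply: (@next_regular _ _ _ D i); rewrite -/(w i); lra.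
have [Chi ChiP] := repr_ex hM cf fib oB mu_cyc mu_point nE Bq z'F z'0.
have Fw : F (w i) = F (rg (ordS i)) by rewrite /fiber (next_angle i).
rewrite /fiber_pairing; transitivity (Chi z).
  apply: (pairing_eq hM cf fib oB mu_cyc mu_point nE _ _ (@Bt i) Bq (mrep_in x) (mrep_cyc x) zF z0
    (mrep_in x') (mrep_cyc x') z'F z'0 xz xz' (dual_cochainP nE x') ChiP); lra.
apply: (pairing_eq hM cf fib oB mu_cyc mu_point nE _ _ Bq Bw zF z0 _ (mrep_cyc y) z'F z'0
    _ (mrep_cyc y') (nullc_sym yz) (nullc_sym yz') ChiP (repr_angle (next_angle i) (dual_cochainP nE y'))); rewrite ?Fw; try exact: mrep_in; lra.
Qed.

(** By transport over the regular arc the hypothesis becomes orthogonality between [rg i] and [q i],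
    where [pairing_perp] applies. *)
Lemma fiber_pairing_perp i x' y' : (forall x y, alpha (G r) i x = beta (G r) i y ->
    fiber_pairing nE x x' = fiber_pairing nE y y') ->
  alpha (G k) i x' = beta (G k) i y'.
Proof.
move=> h; have [z' [z'F z'0 yz']] := next_transport y'; apply/(relation_level x' z'F yz').
have [b1 b2 b3 b4] := bounds i; have t0 := tau_gt0 R.
have Bq : B (angle (q i)) by apply: (@next_regular _ _ _ D i); rewrite -/(w i); lra.
have Bw : B (angle (w i)) by apply: (@next_regular _ _ _ D i); rewrite -/(w i); lra.
have [Chi ChiP] := repr_ex hM cf fib oB mu_cyc mu_point nE Bq z'F z'0.
have Fw : F (w i) = F (rg (ordS i)) by rewrite /fiber (next_angle i).
apply: (pairing_perp hM cf fib oB mu_cyc nE _ _ (@Bt i) Bq (mrep_in x') (mrep_cyc x') z'F z'0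
  (dual_cochainP nE x') ChiP); [lra | lra |].
move=> u v uF u0 vF v0 uv; have [x ux] := mrep_ex uF u0; have [y vy] := next_class vF v0.
have xv : nullc (L (rg i) (q i)) set0 (mrep x - v).
  apply: nullc_trans uv; apply: nullc_sym; apply: nullcS ux => // t Ft.
  by exists (rg i) => //; rewrite /cci /=; lra.
rewrite (repr_null (dual_cochainP nE x') ux); transitivity (fiber_pairing nE y y').
  by apply: h; apply/(relation_level x vF vy).
apply/esym; apply: (pairing_eq hM cf fib oB mu_cyc mu_point nE _ _ Bq Bw vF v0 _ (mrep_cyc y) z'F z'0
    _ (mrep_cyc y') (nullc_sym vy) (nullc_sym yz') ChiP (repr_angle (next_angle i) (dual_cochainP nE y'))); rewrite ?Fw; try exact: mrep_in; lra.
Qed.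

End Adjoint.

Lemma fiber_bar_duality r k (nE : n = (r + k.+1)%N) u l c c' :
  co_dim (G r) l u c -> oc_dim (G k) l u c' -> c = c'.
Proof.
have nE' : n = (k + r.+1)%N by rewrite nE addnC addSnnS.
have [N bN] := fiber_bounded nE; have [N' bN'] := fiber_bounded nE'.
apply: (grep_duality (fiber_pairingl nE) (fiber_pairingr nE)).
- move=> i g; apply: (pairing_functional (@fiber_pairingl _ _ nE i) (@fiber_pairingr _ _ nE i)
    (@fiber_pairingl _ _ nE' i) (@fiber_pairingr _ _ nE' i) (bN (true, i)) (bN' (true, i))).
    exact: fiber_pairing_nondeg.
  exact: fiber_pairing_nondeg.
- exact: fiber_pairing_adj.
exact: fiber_pairing_perp.
Qed.

End FiberPairing.
(** * Symmetry of the configurations *)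

Lemma barcodesP (K : fieldType) m (V : grep K m) :
  (exists bars, decomposition V bars) -> decomposition V (barcodes V).
Proof. by move=> h; exact: (xgetPex [::] h). Qed.

Lemma barcodes_valid (K : fieldType) m (V : grep K m) : all (valid_barcode m) (barcodes V).
Proof.
have [h|nh] := pselect (exists bars, decomposition V bars); first by case: (barcodesP h).
by rewrite /barcodes xgetPN // => bars hb; apply: nh; exists bars.
Qed.

Lemma gr_dim_trivial (K : fieldType) (W : lmodType K) (A C : set W) c :
  (forall x : W, x = 0) -> C 0 -> gr_dim A C c -> c = 0%N.
Proof.
move=> W0 C0 [e [_ _ ei]]; case: c e ei => // c e ei.
have := ei (fun=> 1); rewrite [\sum_i _]W0 => /(_ C0 ord0) /eqP.
by rewrite oner_eq0.
Qed.

Section MixedBars.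
Variable m : nat.
Implicit Types (J : barcode) (s : seq barcode).

Definition mixed J := lclosed J != rclosed J.
Definition flip J := Bar (~~ lclosed J) (lend J) (~~ rclosed J) (rend J).

Lemma flipK : involutive flip.
Proof. by case=> a i b j; rewrite /flip /= !negbK. Qed.

Lemma barcode_eqE J J' : (J == J') =
  [&& lclosed J == lclosed J', lend J == lend J', rclosed J == rclosed J' & rend J == rend J'].
Proof.
apply/eqP/and4P => [->|[/eqP h1 /eqP h2 /eqP h3 /eqP h4]] //.
by case: J J' h1 h2 h3 h4 => a i b j [a' i' b' j'] /= -> -> -> ->.
Qed.

Lemma count_predU_disjoint (T : Type) (p p1 p2 : pred T) (s : seq T) :
  (forall x, p x = p1 x || p2 x) -> (forall x, ~~ (p1 x && p2 x)) -> (count p s = count p1 s + count p2 s)%N.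
Proof.
move=> pE p12; rewrite (eq_count pE) -count_predUI [X in (_ + X)%N]( _ : _ = 0%N) ?addn0 //.
by rewrite -(count_pred0 s); apply: eq_count => x; apply/negbTE; exact: p12.
Qed.

Lemma count_co_bar s q (u : 'I_m) : count (fun J => co_bar J q.+1 u) s =
  (count (fun J => co_bar J q u) s + count_mem (Bar true u.+1 false (u.+1 + q.+1)) s)%N.
Proof.
apply: count_predU_disjoint => -[a i b j]; rewrite /= ?barcode_eqE /co_bar /=.
  by case: a; case: b; case: eqP => //= ->; lia.
by case: a; case: b; case: eqP => //= ->; lia.
Qed.

Lemma count_oc_bar s q (u : 'I_m) : count (fun J => oc_bar J q.+1 u) s =
  (count (fun J => oc_bar J q u) s + count_mem (Bar false u.+1 true (u.+1 + q.+1)) s)%N.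
Proof.
apply: count_predU_disjoint => -[a i b j]; rewrite /= ?barcode_eqE /oc_bar /=.
  by case: a; case: b; case: eqP => //= ->; lia.
by case: a; case: b; case: eqP => //= ->; lia.
Qed.

Lemma count_invalid s J : all (valid_barcode m) s -> ~~ valid_barcode m J -> count_mem J s = 0%N.
Proof.
by move=> /allP vs vJ; apply/count_memPn; apply: contra vJ; exact: vs.
Qed.

(** The multiplicity of a single bar is the difference of the counts for two consecutive q. *)
Lemma perm_flip s s' : all (valid_barcode m) s -> all (valid_barcode m) s' ->
  (forall q (u : 'I_m), count (fun J => co_bar J q u) s = count (fun J => oc_bar J q u) s') ->
  (forall q (u : 'I_m), count (fun J => oc_bar J q u) s = count (fun J => co_bar J q u) s') ->
  perm_eq (map flip (seq.filter mixed s)) (seq.filter mixed s').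
Proof.
move=> vs vs' co oc; apply/allP => J _; apply/eqP.
rewrite count_map !count_filter.
have fE J' : (flip J' == J) = (J' == flip J) by rewrite -{1}(flipK J) (inj_eq (can_inj flipK)).
have mixE (J0 : barcode) t : count (predI (pred1 J0) mixed) t = if mixed J0 then count_mem J0 t else 0%N.
  case: ifP => mJ; last first.
    by rewrite -(count_pred0 t); apply: eq_count => x /=; case: eqP => // ->.
  by apply: eq_count => x /=; case: eqP => // ->.
rewrite [LHS](@eq_count _ _ (predI (pred1 (flip J)) mixed)); last by move=> x; rewrite /= fE.
rewrite !mixE (_ : mixed (flip J) = mixed J); last by case: J {fE} => -[] i [] j.
case: ifP => // mJ.
have vE : valid_barcode m (flip J) = valid_barcode m J.
  by move: mJ; case: J {fE} => -[] i [] j //.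
have [vJ|nvJ] := boolP (valid_barcode m J); last by rewrite !count_invalid ?vE.
move: mJ vJ; case: J {fE vE} => a i b j /=; rewrite /mixed /valid_barcode /flip /= => ab.
have -> : b = ~~ a by move: ab; case: (a); case: (b).
rewrite andbN => /andP[/andP[i0 im] ij].
have [u uE] : exists u : 'I_m, u.+1 = i.
  have i1 : (i.-1 < m)%N by rewrite prednK.
  by exists (Ordinal i1); rewrite /= prednK.
have jE : j = (u.+1 + (j - i).-1.+1)%N by rewrite uE prednK ?subn_gt0 // subnKC // ltnW.
rewrite -uE jE; case: (a) => /=.
  by have := oc (j - i).-1.+1 u; rewrite count_co_bar count_oc_bar oc => /addnI.
by have := co (j - i).-1.+1 u; rewrite count_co_bar count_oc_bar co => /addnI.
Qed.

End MixedBars.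

Section TorusSwap.
Variable R : realType.
Local Notation tau := (pi *+ 2 : R).

Lemma tpoint_eqP (a b c d : R) :
  tpoint a b = tpoint c d <-> exists k : int, a = c + tau *~ k /\ b = d + tau *~ k.
Proof.
split.
  move=> /eqP; rewrite /tpoint -Quotient.idealrBE => /asboolP[k hk]; exists k.
  have h1 : a - c = tau *~ k := congr1 fst hk.
  have h2 : b - d = tau *~ k := congr1 snd hk.
  by rewrite -{1}h1 -h2 ![_ + (_ - _)]addrC !subrK.
move=> [k [-> ->]]; apply/eqP; rewrite /tpoint -Quotient.idealrBE; apply/asboolP; exists k.
by congr pair; rewrite /= addrC addKr.
Qed.

Lemma tpoint_repr (p : torus R) : tpoint (generic_quotient.repr p).1 (generic_quotient.repr p).2 = p.
Proof. by rewrite /tpoint -surjective_pairing reprK. Qed.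

Definition tswap (p : torus R) : torus R := tpoint (generic_quotient.repr p).2 (generic_quotient.repr p).1.

Lemma tswapE (a b : R) : tswap (tpoint a b) = tpoint b a.
Proof.
have [k [h1 h2]] := (tpoint_eqP _ _ _ _).1 (tpoint_repr (tpoint a b)).
by apply/tpoint_eqP; exists k.
Qed.

Lemma tswapK : involutive tswap.
Proof. by move=> p; rewrite -{1}(tpoint_repr p) !tswapE tpoint_repr. Qed.

(** Another representative has the same difference and a half sum shifted by a multiple of the
    period. *)
Lemma to_planeE (a b : R) : to_plane (tpoint a b) =
  Complex (expR ((a - b) / 2) * cos ((a + b) / 2)) (expR ((a - b) / 2) * sin ((a + b) / 2)).
Proof.
have := tpoint_repr (tpoint a b); rewrite /to_plane; case: (generic_quotient.repr _) => c d /tpoint_eqP[k [/= -> ->]].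
have -> : (a + tau *~ k - (b + tau *~ k)) / 2 = (a - b) / 2 by congr (_ / 2); zmod.
have -> : (a + tau *~ k + (b + tau *~ k)) / 2 = (a + b) / 2 + tau *~ k.
  by rewrite addrACA -mulr2n mulrDl -[(_ *~ _) *+ 2]mulr_natr mulfK // pnatr_eq0.
have pk (x : R) : cos (x + tau *~ k) = cos x /\ sin (x + tau *~ k) = sin x.
  case: k => k; first by split; [exact: (periodicn (@cosD2pi R)) | exact: (periodicn (@sinD2pi R))].
  rewrite NegzE mulrNz; set t := _ *~ _.
  by split; rewrite -[in RHS](subrK t x); apply/esym; [exact: (periodicn (@cosD2pi R)) | exact: (periodicn (@sinD2pi R))].
by have [-> ->] := pk ((a + b) / 2).
Qed.

(** Exchanging the coordinates inverts the modulus and keeps the argument. *)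
Lemma to_plane_swap (p : torus R) : to_plane (tswap p) = inversion (to_plane p).
Proof.
rewrite -(tpoint_repr p) tswapE !to_planeE; set c := (generic_quotient.repr p).1; set d := (generic_quotient.repr p).2.
have -> : (d - c) / 2 = - ((c - d) / 2) by rewrite -mulNr opprB.
rewrite expRN (addrC d) /inversion; set e := expR _; set C := cos _; set S := sin _.
have e0 : e != 0 by rewrite gt_eqF // expR_gt0.
have CS : C ^+ 2 + S ^+ 2 = 1 by exact: cos2Dsin2.
have zz : Complex (e^-1 * C) (e^-1 * S) * (Complex (e * C) (e * S))^* = 1.
  rewrite -[(_)^*]/(conjc (Complex (e * C) (e * S))); apply/eqP; rewrite eq_complex /=.
  have -> : e^-1 * C * (e * C) - e^-1 * S * (- (e * S)) = C ^+ 2 + S ^+ 2 by field.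
  have -> : e^-1 * C * (- (e * S)) + e^-1 * S * (e * C) = 0 by field.
  by rewrite CS !eqxx.
have z0 : (Complex (e * C) (e * S))^* != 0.
  by apply/eqP => z0; move: zz; rewrite z0 mulr0 => /eqP; rewrite eq_sym oner_eq0.
by apply: (mulIf z0); rewrite mulVf.
Qed.

Lemma inversionK : involutive (@inversion R).
Proof.
move=> z; rewrite /inversion; have -> : ((z^*)^-1)^* = ((z^*)^*)^-1 by exact: fmorphV.
have -> : (z^*)^* = z by exact: conjCK.
exact: invrK.
Qed.

End TorusSwap.

Section Symmetry.
Variables (R : realType) (K : fieldType) (n : nat) (M : topologicalType) (f : M -> circle R).
Hypotheses (hM : closed_manifold R n M) (oM : field_orientable R K n M) (f_tame : tame R f).
Variable D : critical_data f.
Local Notation bars r := (barcodes (fiber_grep K D r)).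

Lemma bars_dual r k : n = (r + k.+1)%N -> forall q (u : 'I_(size (crit_angles D))),
  count (fun J => co_bar J q u) (bars r) = count (fun J => oc_bar J q u) (bars k).
Proof.
move=> nE q u; have nE' : n = (k + r.+1)%N by rewrite nE addnC addSnnS.
have [mu mu_cyc mu_point] := fundamental_cycle hM oM.
have [N bN] := fiber_bounded hM f_tame D mu_cyc mu_point nE.
have [N' bN'] := fiber_bounded hM f_tame D mu_cyc mu_point nE'.
have [dco _] := dims_decomposition q u (barcodesP (decomposition_ex bN)).
have [_ doc] := dims_decomposition q u (barcodesP (decomposition_ex bN')).
exact: (fiber_bar_duality hM f_tame mu_cyc mu_point nE dco doc).
Qed.

Lemma bars_vanish r : (n <= r)%N -> forall q (u : 'I_(size (crit_angles D))),
  count (fun J => co_bar J q u) (bars r) = 0%N /\ count (fun J => oc_bar J q u) (bars r) = 0%N.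
Proof.
move=> nr q u; 
have V0 i (x : odd_space (fiber_grep K D r) i) : x = 0 := odd_space_vanish hM f_tame nr x.
have [h|nh] := pselect (exists bs, decomposition (fiber_grep K D r) bs); last first.
  by rewrite /barcodes xgetPN // => bs hb; apply: nh; exists bs.
have [dco doc] := dims_decomposition q u (barcodesP h); split.
  apply: (gr_dim_trivial _ _ dco); first exact: V0.
  by split; [exact: (walk_subspace _ _ _ _).1 | exists 0; rewrite !linear0].
apply: (gr_dim_trivial _ _ doc); first exact: V0.
by split; [exact: linear0 | exact: (walk_subspace _ _ _ _).1].
Qed.

(** Within 0 <= r < n this is [bars_dual] in both degrees. Otherwise one degree is negative and the
    other at least n, where regular fibers have no homology, so both sides are empty. *)
Lemma mixed_points_swap (r : int) :
  perm_eq (map (@tswap R) (mixed_points K D r)) (mixed_points K D (n%:Z - 1 - r)).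
Proof.
have bpE J : mixed J -> bar_point D (flip J) = tswap (bar_point D J).
  by case: J => a i b j; rewrite /mixed /bar_point /=; case: a; case: b => //= _; rewrite tswapE.
have main s s' : perm_eq (map flip (seq.filter mixed s)) (seq.filter mixed s') ->
    perm_eq (map (@tswap R) [seq bar_point D J | J <- s & lclosed J != rclosed J])
      [seq bar_point D J | J <- s' & lclosed J != rclosed J].
  move=> h; have := perm_map (bar_point D) h; rewrite -!map_comp; congr perm_eq.
  by apply/eq_in_map => J; rewrite mem_filter => /andP[mJ _]; exact: bpE.
have v0 : all (valid_barcode (size (crit_angles D))) [::] by [].
rewrite /mixed_points; apply: main; case: r => r.
  have [nr|rn] := leqP n r.
    have -> : barcodes_of K D (n%:Z - 1 - Posz r) = [::].
      by case E : (n%:Z - 1 - Posz r) => [j|j] //; exfalso; clear -E nr; lia.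
    apply: perm_flip => // [|q u|q u]; [exact: barcodes_valid | exact: (bars_vanish nr q u).1 | exact: (bars_vanish nr q u).2].
  have -> : n%:Z - 1 - Posz r = Posz (n - r.+1) by lia.
  have nE : n = (r + (n - r.+1).+1)%N by lia.
  have nE' : n = (n - r.+1 + r.+1)%N by lia.
  apply: perm_flip => [||q u|q u]; [exact: barcodes_valid | exact: barcodes_valid | exact: bars_dual |].
  by apply/esym; exact: bars_dual.
have -> : n%:Z - 1 - Negz r = Posz (n + r) by lia.
have nr : (n <= n + r)%N by lia.
apply: perm_flip => // [|q u|q u]; [exact: barcodes_valid | |].
  by rewrite (bars_vanish nr q u).2.
by rewrite (bars_vanish nr q u).1.
Qed.

End Symmetry.
Theorem theorem1p6 (R : realType) (K : fieldType) (n : nat)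
    (M : topologicalType) (f : M -> circle R)
    (M_closed : closed_manifold R n M) (M_orientable : field_orientable R K n M)
    (f_tame : tame R f) (D : critical_data f) :
  (forall (r : int) (a b : R), ~ torus_diagonal (tpoint a b) ->
     Cm K D r (tpoint a b) = Cm K D (n%:Z - 1 - r) (tpoint b a)) /\
  (forall (r : int) (z : R[i]), z != 0 -> `|z| != 1 ->
     Cm_plane K D r z = Cm_plane K D (n%:Z - 1 - r) (inversion z)).
Proof.
have perm r := mixed_points_swap M_closed M_orientable f_tame D r.
split=> [r a b _|r z _ _]; rewrite /Cm /Cm_plane; apply/esym.
  rewrite -(permP (perm r) (pred1 (tpoint b a))) count_map; apply: eq_count => p.
  by rewrite /= -(tswapE a b) (inj_eq (can_inj (@tswapK R))).
have := permP (perm_map (@to_plane R) (perm r)) (pred1 (inversion z)); rewrite /= => <-.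
rewrite -map_comp !count_map; apply: eq_count => p.
by rewrite /= to_plane_swap (inj_eq (can_inj (@inversionK R))).
Qed.
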